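(* Let $s>1/2$ and $r_1,r_2>3$. Let $\beta_1,\beta_2$ be integrable kernels on $\mathbb{R}$ with $0\le\widehat{\beta_i}(\xi)\le C_i(1+\xi^2)^{-r_i/2}$ for all $\xi\in\mathbb{R}$ and some constants $C_i>0$, such that $\widehat{\beta_i}$ has only isolated zeros ($i=1,2$). Let $g_1,g_2\in C^\infty(\mathbb{R}^2)$ be real valued with $g_1(0)=g_2(0)=0$ and $g_i=\partial G/\partial u_i$ ($i=1,2$) for a function $G:\mathbb{R}^2\to\mathbb{R}$. Let $\varphi_i,\psi_i\in H^s$, $P_i\psi_i\in L^2$ ($i=1,2$) and $G(\varphi_1,\varphi_2)\in L^1$. If there is some $k>0$ so that $$G(a,b)\ge -k(a^2+b^2)\qquad\text{for all }a,b\in\mathbb{R},$$ then the Cauchy problem $$u_{1tt}=(\beta_1*(u_1+g_1(u_1,u_2)))_{xx},\qquad u_{2tt}=(\beta_2*(u_2+g_2(u_1,u_2)))_{xx},\qquad x\in\mathbb{R},\ t>0,$$ $$u_i(x,0)=\varphi_i(x),\qquad u_{it}(x,0)=\psi_i(x)\qquad(i=1,2)$$ has a global solution with $u_1$ and $u_2$ in $C^2([0,\infty),H^s)$.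
   Context: $H^s=H^s(\mathbb{R})$ is the $L^2$-based Sobolev space of real-valued functions with norm $\|u\|_s^2=\int_{\mathbb{R}}(1+\xi^2)^s|\hat u(\xi)|^2\,d\xi$, where $\hat v(\xi)=\int_{\mathbb{R}}e^{-i\xi x}v(x)\,dx$; $*$ is convolution in $x$; subscripts $x,t$ denote partial derivatives. For $i=1,2$, $P_i$ is the (possibly unbounded) operator $P_iw=\mathcal{F}^{-1}\big(|\xi|^{-1}(\widehat{\beta_i}(\xi))^{-1/2}\hat w(\xi)\big)$, where $\mathcal{F}^{-1}$ is the inverse Fourier transform; $P_iw\in L^2$ means that $|\xi|^{-1}(\widehat{\beta_i}(\xi))^{-1/2}\hat w(\xi)$ is in $L^2$. *)

(* Defs.v *)
From HB Require Import structures.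
From mathcomp Require Import all_boot all_order all_algebra.
From mathcomp Require Import all_classical all_reals all_analysis.
From mathcomp.real_closed Require Import complex.

Set Implicit Arguments.
Unset Strict Implicit.
Unset Printing Implicit Defensive.

Import Order.TTheory GRing.Theory Num.Theory.
Import numFieldNormedType.Exports.

Local Open Scope classical_set_scope.
Local Open Scope ring_scope.
Local Open Scope complex_scope.

Section FourierTransform.
Context {R : realType}.
Local Notation mu := (@lebesgue_measure R).

Definition cintegral (D : set R) (f : R -> R[i]) : R[i] :=
  (\int[mu]_(x in D) complex.Re (f x)) +i* (\int[mu]_(x in D) complex.Im (f x)).

Definition expi (theta : R) : R[i] := cos theta +i* sin theta.

Definition fourier_on (D : set R) (v : R -> R) (xi : R) : R[i] :=
  cintegral D (fun x => expi (- (xi * x)) * (v x)%:C).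

(* Meaningful for v integrable; see [fourierL2] for square-integrable v. *)
Definition fourier (v : R -> R) : R -> R[i] := fourier_on setT v.

(* L^2(R) and L^2(R; C) are treated as sets of functions; equality of their
   elements is almost-everywhere equality. *)
Definition L2 : set (R -> R) := [set u | u \in Lfun mu 2%:E].

Definition normsq (z : R[i]) : R := complex.Re z ^+ 2 + complex.Im z ^+ 2.

Definition L2C : set (R -> R[i]) :=
  [set w | [/\ measurable_fun setT ((fun xi => complex.Re (w xi))),
               measurable_fun setT ((fun xi => complex.Im (w xi))) &
               (\int[mu]_xi (normsq (w xi))%:E < +oo)%E]].

(* The Fourier transform of a square-integrable function is the L^2-limit of
   the integrals of e^{-i xi x} u(x) over [-n, n]. *)
Definition is_fourierL2 (u : R -> R) (w : R -> R[i]) : Prop :=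
  [/\ L2 u, L2C w &
      (\int[mu]_xi (normsq (fourier_on `[- n%:R, n%:R] u xi - w xi))%:E)%E
        @[n --> \oo] --> 0%E].

Definition fourierL2 (u : R -> R) : R -> R[i] :=
  xget (fun=> 0) [set w | is_fourierL2 u w].

End FourierTransform.

Section Sobolev.
Context {R : realType}.
Local Notation mu := (@lebesgue_measure R).

Definition sobolev_norm (s : R) (u : R -> R) : \bar R :=
  ((\int[mu]_xi (((1 + xi ^+ 2) `^ s) * normsq (fourierL2 u xi))%:E)
     `^ (2^-1))%E.

(* H^s for s >= 0, where H^s is a subspace of L^2.  The first conjunct says
   that u is in L^2 and that [fourierL2 u] is not the default value. *)
Definition Hs (s : R) : set (R -> R) :=
  [set u | is_fourierL2 u (fourierL2 u) /\ (sobolev_norm s u < +oo)%E].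

(* A curve in H^s is a function u of t and x, u t being the state at time t.
   Only its values at t >= 0 matter; at t = 0 limits are one-sided. *)
Definition continuous_Hs (s : R) (u : R -> R -> R) : Prop :=
  (forall t, 0 <= t -> Hs s (u t)) /\
  (forall t, 0 <= t ->
     sobolev_norm s (fun x => u t' x - u t x)
       @[t' --> within [set t' | 0 <= t'] (nbhs t)] --> 0%E).

Definition is_derive_Hs (s : R) (u v : R -> R -> R) : Prop :=
  forall t, 0 <= t ->
    sobolev_norm s (fun x => h^-1 * (u (t + h) x - u t x) - v t x)
      @[h --> within [set h | 0 <= t + h] 0^'] --> 0%E.

(* u is in C^2([0, oo), H^s), with u_t = v and u_tt = a. *)
Definition C2_Hs (s : R) (u v a : R -> R -> R) : Prop :=
  [/\ continuous_Hs s u, continuous_Hs s v, continuous_Hs s a,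
      is_derive_Hs s u v & is_derive_Hs s v a].

End Sobolev.

Section WaveSystem.
Context {R : realType}.
Local Notation mu := (@lebesgue_measure R).

Definition isolated_zeros (f : R -> R[i]) : Prop :=
  forall xi0, f xi0 = 0 -> \forall xi \near xi0^', f xi != 0.

Fixpoint Ck (k : nat) (f : R * R -> R) : Prop :=
  if k is k'.+1 then
    [/\ continuous f,
        forall p, derivable f p (1, 0) /\ derivable f p (0, 1),
        Ck k' (fun p => 'D_(1, 0) f p) & Ck k' (fun p => 'D_(0, 1) f p)]
  else continuous f.

Definition Csmooth (f : R * R -> R) : Prop := forall k, Ck k f.

Definition convolution (beta w : R -> R) (x : R) : R :=
  \int[mu]_y (beta y * w (x - y)).

(* The symbol |xi|^-1 (hat beta)^(-1/2) of P, times hat w.  It is meant for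
   hat beta real and nonnegative, whence the real part; its value on the zeros
   of hat beta and at xi = 0 is irrelevant when these zeros are isolated. *)
Definition P_symbol (beta w : R -> R) (xi : R) : R[i] :=
  (`|xi|^-1 * (complex.Re (fourier beta xi)) `^ (- 2^-1))%:C * fourierL2 w xi.

Definition P_in_L2 (beta w : R -> R) : Prop := L2C (P_symbol beta w).

Definition derivable2 (f : R -> R) : Prop :=
  forall x, derivable f x 1 /\ derivable (derive1 f) x 1.

(* u_tt = (beta * w)_xx for t > 0, where [a] is u_tt. *)
Definition nonlocal_wave_eq (beta : R -> R) (w a : R -> R -> R) : Prop :=
  forall t, 0 < t ->
    derivable2 (convolution beta (w t)) /\
    {ae mu, forall x, a t x = derive1n 2 (convolution beta (w t)) x}.

(* (u1, u2) solves the Cauchy problem globally in time, with both components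
   in C^2([0, oo), H^s). *)
Definition global_solution (s : R) (beta1 beta2 : R -> R)
    (g1 g2 : R * R -> R) (phi1 phi2 psi1 psi2 : R -> R)
    (u1 u2 : R -> R -> R) : Prop :=
  exists v1 v2 a1 a2 : R -> R -> R,
    [/\ C2_Hs s u1 v1 a1 /\ C2_Hs s u2 v2 a2,
        nonlocal_wave_eq beta1 (fun t x => u1 t x + g1 (u1 t x, u2 t x)) a1,
        nonlocal_wave_eq beta2 (fun t x => u2 t x + g2 (u1 t x, u2 t x)) a2,
        {ae mu, forall x, u1 0 x = phi1 x} /\
        {ae mu, forall x, u2 0 x = phi2 x} &
        {ae mu, forall x, v1 0 x = psi1 x} /\
        {ae mu, forall x, v2 0 x = psi2 x}].

End WaveSystem.

(* Main.v *)
Require Import Defs.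
From HB Require Import structures.
From mathcomp Require Import all_boot all_order all_algebra.
From mathcomp Require Import all_classical all_reals all_analysis.
From mathcomp.real_closed Require Import complex.
From mathcomp Require Import measurable_realfun ring lra.

(** Write [B_i] for the Fourier multiplier with symbol |xi| (hat beta_i)^(1/2).
    Since (beta_i * w)_xx = - B_i^2 w, the system is u_itt = - B_i^2 w_i with
    w_i = u_i + g_i(u_1, u_2).  In the unknowns q_i defined by
    u_i = phi_i + B_i q_i it becomes q_itt = - B_i w_i, a first order equation
    for (q_1, q_2, p_1, p_2) with p_i = q_it and u_it = B_i p_i.  The condition
    P_i psi_i in L^2 says that psi_i = B_i p_i(0) for a square-integrable
    p_i(0) ([psi_lift]).

    Because r_i > 3, the symbol of B_i is square-integrable and O of
    (1 + xi^2)^(-1/4) ([wave_symb_symb]).  Hence B_i maps L^2 boundedly to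
    bounded continuous functions ([Bop_bd]), so composition with g_i is locally
    Lipschitz in (q_1, q_2) however fast g_i grows ([force_lip]), and the
    equation is an ordinary differential equation in L^2 whose only obstruction
    to global existence is blow-up of the norm ([global_ode]).

    Blow-up is excluded by the energy: the sum of |p_1|^2 + |p_2|^2 +
    |u_1|^2 + |u_2|^2 and twice the integral of G(u_1, u_2) is constant
    ([energy_const]).  The lower bound on G gives
    |p|^2 <= A + C |u|^2 <= A' + C' |q|^2, and since q_t = p, Gronwall's lemma
    bounds q and p on every bounded time interval ([apriori], [wave_ode]).

    It remains to see that the solution, so far a curve in L^2 that is bounded
    in the sup norm, lies in C^2([0, oo), H^s).  The operator B_i^2 gains one
    derivative, and composition with a smooth map sends functions bounded in
    the sup norm and in H^j to functions bounded in H^j ([comp_boundedP]); so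
    regularity climbs from H^j to H^(j+1) as long as the initial data allow it
    ([bootstrap]).  With m the integer part of s, w_i is then bounded in H^m
    and continuous in L^2, hence continuous in H^(s-1) by interpolation
    ([force_contH]), and - B_i^2 w_i is continuous in H^s ([Hs_solution]).

    The transform used throughout is the Hartley transform, with kernel
    cas = cos + sin.  It carries the same information as the Fourier transform
    ([fourier_hart1], [fourierL2P]) but is real and its own inverse.  Its
    inversion formula regularized by exp(-e |xi|) is convolution with the
    Poisson kernel ([hart1_abel]); this gives Plancherel's theorem
    ([plancherel_L1L2]) and the formula for beta * w at every point
    ([conv_spectrum]). *)

Set Implicit Arguments.
Unset Strict Implicit.
Unset Printing Implicit Defensive.

Import Order.TTheory GRing.Theory Num.Theory.
Import numFieldNormedType.Exports.

Local Open Scope classical_set_scope.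
Local Open Scope ring_scope.

(** * Real induction and differential inequalities *)

Section RealInduction.
Context {R : realType}.
Implicit Types (a b t e h : R) (P : R -> Prop) (y theta : R -> R).

(** The supremum of the points up to which the property holds throughout is
    such a point because the property passes to left limits, and it is [b]
    because the property extends to the right. *)
Lemma real_induction a b P : a <= b -> P a ->
  (forall t, a <= t < b -> (forall s, a <= s <= t -> P s) ->
     exists2 d, 0 < d & forall s, t < s < t + d -> s <= b -> P s) ->
  (forall t, a < t <= b -> (forall s, a <= s < t -> P s) -> P t) ->
  forall t, a <= t <= b -> P t.
Proof.
move=> ab Pa Hr Hl.
pose S := [set t | a <= t <= b /\ forall s, a <= s <= t -> P s].
have Sa : S a.
  by split; [rewrite lexx|move=> s /andP[h1 h2]; have -> : s = a by apply/le_anti/andP].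
have ubS : ubound S b by move=> t [] /andP[].
have hS : has_sup S by split; [exists a|exists b].
set c := sup S.
have ac : a <= c by apply: ub_le_sup => //; exists b.
have cb : c <= b by apply: ge_sup => //; exists a.
have Plt s : a <= s < c -> P s.
  move=> /andP[as_ sc].
  have e0 : 0 < c - s by rewrite subr_gt0.
  have [t [_ St] ct] := sup_adherent e0 hS.
  apply: St; rewrite as_ /= ltW //.
  by move: ct; rewrite -/c opprB addrC subrK.
have Pc : P c.
  have [<-//|nac] := eqVneq a c.
  by apply: Hl => //; rewrite cb andbT lt_neqAle nac ac.
have Pcl s : a <= s <= c -> P s.
  move=> /andP[as_]; rewrite le_eqVlt => /orP[/eqP->//|sc]; apply: Plt.
  by rewrite as_.
have [<-//|ncb] := eqVneq c b.
have cltb : c < b by rewrite lt_neqAle ncb cb.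
have [d d0 Hd] := Hr c (introT andP (conj ac cltb)) Pcl.
pose c' := Num.min (c + d / 2) b.
have cc' : c < c'.
  by rewrite /c' lt_min cltb andbT ltrDl divr_gt0.
have c'b : c' <= b by rewrite /c' ge_min lexx orbT.
have c'd : c' < c + d.
  by apply: (@le_lt_trans _ _ (c + d / 2)); [rewrite /c' ge_min lexx|lra].
have Sc' : S c'.
  split; first by rewrite c'b (le_trans ac (ltW cc')).
  move=> s /andP[as_ sc'].
  have [sc|cs] := leP s c; first by apply: Pcl; rewrite as_.
  apply: Hd; last exact: le_trans c'b.
  by rewrite cs /= (le_lt_trans sc').
have : c' <= c by apply: ub_le_sup => //; exists b.
by rewrite leNgt cc'.
Qed.

(** A function whose upper right Dini derivative is at most 0 and that does
    not jump up from the left is nonincreasing. These one-sided conditions,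
    rather than differentiability, are what piecewise linear approximations
    and norms of curves satisfy. *)
Lemma dini_le a b theta : a <= b ->
  (forall t, a <= t < b -> forall e, 0 < e -> exists2 d, 0 < d &
     forall h, 0 < h < d -> t + h <= b -> theta (t + h) <= theta t + e * h) ->
  (forall t, a < t <= b -> forall e, 0 < e -> exists2 d, 0 < d &
     forall s, a <= s -> t - d < s < t -> theta t <= theta s + e) ->
  theta b <= theta a.
Proof.
move=> ab Hr Hl; apply/ler_addgt0Pr => e e0.
pose e1 := e / (b - a + 1).
have e10 : 0 < e1 by apply: divr_gt0 => //; lra.
have H : forall t, a <= t <= b -> theta t <= theta a + e1 * (t - a).
  apply: real_induction => //.
  - by rewrite subrr mulr0 addr0.
  - move=> t tab Pt; have [d d0 Hd] := Hr t tab _ e10.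
    exists d => // s /andP[ts std] sb.
    have -> : s = t + (s - t) by ring.
    apply: le_trans (Hd _ _ _) _; [by apply/andP; split; lra|lra|].
    have : theta t <= theta a + e1 * (t - a).
      by apply: Pt; case/andP: tab => -> _; rewrite lexx.
    lra.
  - move=> t tab Pt; apply/ler_addgt0Pr => e2 e20.
    have [d d0 Hd] := Hl t tab _ e20.
    case/andP: tab => at_ tb.
    pose s := Num.max a (t - d / 2).
    have st : s < t by rewrite /s gt_max at_ /=; lra.
    have as_ : a <= s by rewrite /s le_max lexx.
    have ds : t - d < s by rewrite /s lt_max; apply/orP; right; lra.
    have h1 : theta t <= theta s + e2 by apply: Hd => //; rewrite ds.
    have h2 : theta s <= theta a + e1 * (s - a) by apply: Pt; rewrite as_.
    have h3 : e1 * (s - a) <= e1 * (t - a) by apply: ler_wpM2l; lra.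
    lra.
apply: le_trans (H b _) _; first by rewrite ab lexx.
rewrite lerD2l /e1 -mulrA ger_pMr // mulrC ler_pdivrMr; lra.
Qed.

(** The function exp(- L t) (y t + K / L) satisfies the hypotheses of
    [dini_le], because 1 + L h <= exp(L h). *)
Lemma gronwall b L K y : 0 <= b -> 0 < L -> 0 <= K ->
  (forall t, 0 <= t <= b -> 0 <= y t) ->
  (forall t, 0 <= t < b -> forall e, 0 < e -> exists2 d, 0 < d &
     forall h, 0 < h < d -> t + h <= b ->
     y (t + h) <= y t + h * (L * y t + K) + e * h) ->
  (forall t, 0 < t <= b -> forall e, 0 < e -> exists2 d, 0 < d &
     forall s, 0 <= s -> t - d < s < t -> y t <= y s + e) ->
  y b <= (y 0 + K / L) * expR (L * b).
Proof.
move=> b0 L0 K0 y0 Hr Hl.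
have c0 : 0 <= K / L by rewrite divr_ge0 // ltW.
have LK : L * (K / L) = K by rewrite mulrC divfK // gt_eqF.
set c := K / L in c0 LK *.
(* The integrating factor turns the hypothesis into monotonicity of z. *)
pose z t := expR (- (L * t)) * (y t + c).
suff : z b <= z 0.
  rewrite /z mulr0 oppr0 expR0 mul1r expRN mulrC ler_pdivrMr ?expR_gt0 //.
  by move=> h; apply: le_trans h; rewrite lerDl.
apply: dini_le => //.
- move=> t tb e e0; have [d d0 Hd] := Hr t tb e e0.
  exists d => // h hd thb; have := Hd h hd thb.
  have yt : 0 <= y t + c.
    by case/andP: tb => t0 tb; rewrite addr_ge0 // y0 // t0 ltW.
  move=> H1.
  have h0 : 0 < h by case/andP: hd.
  have t0 : 0 <= t by case/andP: tb.
  have E : expR (- (L * t)) = expR (- (L * (t + h))) * expR (L * h).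
    by rewrite -expRD; congr expR; ring.
  have E1 : expR (- (L * (t + h))) <= 1.
    by rewrite -expR0 ler_expR oppr_le0 mulr_ge0 ?ltW // ltr_wpDl.
  have E0 : 0 < expR (- (L * (t + h))) by exact: expR_gt0.
  rewrite /z [in leRHS]E.
  have H2 : (1 + L * h) * (y t + c) <= expR (L * h) * (y t + c).
    by apply: ler_wpM2r => //; exact: expR_ge1Dx.
  have H3 : y (t + h) + c <= expR (L * h) * (y t + c) + e * h.
    rewrite -LK in H1; nra.
  have H4 : expR (- (L * (t + h))) * (e * h) <= e * h.
    by rewrite ger_pMl // mulr_gt0.
  have H5 := ler_wpM2l (ltW E0) H3.
  move: H5; rewrite (mulrDr _ (expR (L * h) * _)) !mulrA => H5; rewrite mulrA in H4; lra.
- move=> t tb e e0; have [d d0 Hd] := Hl t tb e e0.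
  exists d => // s s0 sd; have H1 := Hd s s0 sd.
  case/andP: tb => t0 tb; case/andP: sd => _ st.
  have ys : 0 <= y s + c by rewrite addr_ge0 // y0 // s0 /= ltW // (lt_le_trans st).
  have E1 : expR (- (L * t)) <= 1.
    by rewrite -expR0 ler_expR oppr_le0 mulr_ge0 ?ltW.
  have E2 : expR (- (L * t)) <= expR (- (L * s)).
    by rewrite ler_expR lerN2 ler_pM2l // ltW.
  have E0 : 0 < expR (- (L * t)) by exact: expR_gt0.
  rewrite /z.
  have : expR (- (L * t)) * (y t + c) <= expR (- (L * t)) * (y s + c + e).
    by rewrite ler_pM2l //; lra.
  have := ler_wpM2r ys E2; have := ler_wpM2r (ltW e0) E1.
  rewrite mul1r !mulrDr; lra.
Qed.

End RealInduction.

Ltac vring := apply/funext => ?; rewrite !(addrfctE, opprfctE, scalrfctE);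
  rewrite /GRing.scale /=; ring.

(** * Ordinary differential equations in complete seminormed spaces *)

Section SeminormedODE.
Context {R : realType} {X : Type}.
Local Notation V := (X -> R).

(** Spaces of functions modulo equality almost everywhere are handled as sets
    of functions with a seminorm: limits are then unique only up to seminorm
    0, which is all that the existence theory needs. *)
Record seminorm_on (D : set V) (N : V -> R) : Prop := SeminormOn {
  sn0 : D 0;
  snL : forall a u v, D u -> D v -> D (a *: u + v);
  sn_ge0 : forall u, D u -> 0 <= N u;
  snD : forall u v, D u -> D v -> N (u + v) <= N u + N v;
  snZ : forall a u, D u -> N (a *: u) = `|a| * N u }.

Definition seq_complete (D : set V) (N : V -> R) : Prop :=
  forall f : nat -> V, (forall n, D (f n)) ->
  (forall e : R, 0 < e -> exists n0 : nat, forall m n : nat,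
     (n0 <= m)%N -> (n0 <= n)%N -> N (f m - f n) <= e) ->
  exists2 l, D l & forall e : R, 0 < e -> exists n0 : nat, forall n : nat,
     (n0 <= n)%N -> N (f n - l) <= e.

(** The derivative along [I], one-sided at the end points of [I]. *)
Definition has_deriv (N : V -> R) (I : set R) (U W : R -> V) : Prop :=
  forall t, I t -> forall e, 0 < e -> exists2 d, 0 < d &
  forall h, `|h| < d -> I (t + h) -> N (U (t + h) - U t - h *: W t) <= e * `|h|.

Lemma has_deriv_restr (N : V -> R) (I J : set R) (U W : R -> V) :
  I `<=` J -> has_deriv N J U W -> has_deriv N I U W.
Proof.
move=> IJ hd t It e e0; have [d d0 h1] := hd t (IJ _ It) e e0; exists d => // h hh Ih.
by apply: h1 => //; exact: IJ.
Qed.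

Variables (D : set V) (N : V -> R).
Hypothesis SN : seminorm_on D N.

Lemma snDD u v : D u -> D v -> D (u + v).
Proof. by move=> Du Dv; rewrite -[u]scale1r; exact: (snL SN). Qed.

Lemma snDZ a u : D u -> D (a *: u).
Proof. by move=> Du; rewrite -[_ *: _]addr0; apply: (snL SN) => //; exact: (sn0 SN). Qed.

Lemma snDN u : D u -> D (- u).
Proof. by move=> Du; rewrite -scaleN1r; exact: snDZ. Qed.

Lemma snDB u v : D u -> D v -> D (u - v).
Proof. by move=> Du Dv; apply: snDD => //; exact: snDN. Qed.

Lemma snN u : D u -> N (- u) = N u.
Proof. by move=> Du; rewrite -scaleN1r (snZ SN) // normrN1 mul1r. Qed.

Lemma snN0 : N 0 = 0.
Proof. by rewrite -(scale0r 0) (snZ SN) ?normr0 ?mul0r //; exact: (sn0 SN). Qed.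

Lemma snBC u v : D u -> D v -> N (u - v) = N (v - u).
Proof. by move=> Du Dv; rewrite -snN ?opprB //; exact: snDB. Qed.

Lemma snT u v w : D u -> D v -> D w -> N (u - w) <= N (u - v) + N (v - w).
Proof.
move=> Du Dv Dw; have -> : u - w = (u - v) + (v - w) by rewrite addrA subrK.
by apply: (snD SN); exact: snDB.
Qed.

Lemma snB_le u v : D u -> D v -> N u <= N v + N (u - v).
Proof.
move=> Du Dv; have {1}-> : u = v + (u - v) by rewrite addrC subrK.
by apply: (snD SN) => //; exact: snDB.
Qed.

(** The difference of N (f tau - f s) and C (tau - s) decreases, by [dini_le]. *)
Lemma mean_value_le (s t C : R) (f : R -> V) : s <= t ->
  (forall tau, s <= tau <= t -> D (f tau)) ->
  (forall tau, s <= tau < t -> forall e, 0 < e -> exists2 d, 0 < d &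
     forall h, 0 < h < d -> tau + h <= t ->
     N (f (tau + h) - f tau) <= (C + e) * h) ->
  (forall tau, s < tau <= t -> forall e, 0 < e -> exists2 d, 0 < d &
     forall sg, s <= sg -> tau - d < sg < tau -> N (f tau - f sg) <= e) ->
  N (f t - f s) <= C * (t - s).
Proof.
move=> st Df Hr Hl.
have Ds : D (f s) by apply: Df; rewrite lexx.
suff : N (f t - f s) - C * (t - s) <= N (f s - f s) - C * (s - s).
  by rewrite !subrr mulr0 snN0; lra.
apply: (dini_le (theta := fun tau => N (f tau - f s) - C * (tau - s)) st).
- move=> tau taust e e0; have [d d0 Hd] := Hr _ taust _ e0.
  exists d => // h hd ht; have H := Hd h hd ht.
  case/andP: taust => h1 h2; case/andP: hd => h3 h4.
  have D1 : D (f (tau + h)) by apply: Df; apply/andP; split; lra.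
  have D2 : D (f tau) by apply: Df; apply/andP; split; lra.
  have := snT D1 D2 Ds; lra.
- move=> tau taust e e0.
  have e20 : 0 < e / 2 by lra.
  have [d d0 Hd] := Hl _ taust _ e20.
  exists (Num.min d (e / 2 / (`|C| + 1))).
    by rewrite lt_min d0 /= divr_gt0 // ltr_wpDl.
  move=> sg ssg /andP[h1 h2]; case/andP: taust => h3 h4.
  have H : N (f tau - f sg) <= e / 2.
    apply: Hd => //; rewrite h2 andbT; apply: le_lt_trans h1.
    by rewrite lerB // ge_min lexx.
  have D1 : D (f sg) by apply: Df; apply/andP; split; lra.
  have D2 : D (f tau) by apply: Df; apply/andP; split; lra.
  have := snT D2 D1 Ds.
  have h5 : tau - sg < e / 2 / (`|C| + 1).
    have : Num.min d (e / 2 / (`|C| + 1)) <= e / 2 / (`|C| + 1).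
      by rewrite ge_min lexx orbT.
    lra.
  have C1 : 0 < `|C| + 1 by rewrite ltr_wpDl.
  rewrite ltr_pdivlMr // in h5.
  have h6 : - C * (tau - sg) <= (`|C| + 1) * (tau - sg).
    by apply: ler_wpM2r; [lra|have := ler_norm (- C); rewrite normrN; lra].
  lra.
Qed.

Lemma has_deriv_cont (I : set R) (U W : R -> V) t :
  has_deriv N I U W -> I t -> (forall s, I s -> D (U s)) -> D (W t) ->
  forall e, 0 < e -> exists2 d, 0 < d &
  forall s, I s -> `|s - t| < d -> N (U s - U t) <= e.
Proof.
move=> H It DU DW e e0; have [d d0 Hd] := H t It 1 ltr01.
pose K := 1 + N (W t).
have K0 : 0 < K by rewrite ltr_pwDl // (sn_ge0 SN).
exists (Num.min d (e / K)); first by rewrite lt_min d0 divr_gt0.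
move=> s Is; rewrite lt_min => /andP[sd se].
have := Hd _ sd; rewrite addrC subrK => /(_ Is) H1.
have D1 := DU s Is; have D2 := DU t It.
have -> : U s - U t = (U s - U t - (s - t) *: W t) + (s - t) *: W t by rewrite subrK.
apply: le_trans (snD SN _ _) _; [by apply: snDB; [exact: snDB|exact: snDZ]|exact: snDZ|].
rewrite (snZ SN) //; move: se; rewrite ltr_pdivlMr // /K; lra.
Qed.

Lemma deriv_mean_value (s t C : R) (f w : R -> V) : s <= t ->
  (forall tau, s <= tau <= t -> D (f tau)) ->
  (forall tau, s <= tau <= t -> D (w tau)) ->
  has_deriv N `[s, t] f w ->
  (forall tau, s <= tau <= t -> N (w tau) <= C) ->
  N (f t - f s) <= C * (t - s).
Proof.
move=> st Df Dw H HC; apply: mean_value_le => //.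
- move=> tau taust e e0.
  have It : `[s, t]%classic tau by rewrite /= in_itv /=; case/andP: taust => -> /ltW.
  have taust' : s <= tau <= t by case/andP: taust => -> /ltW.
  have [d d0 Hd] := H tau It e e0.
  exists d => // h /andP[h0 hd] ht.
  have Ih : s <= tau + h <= t by case/andP: taust => *; apply/andP; split; lra.
  have H1 : N (f (tau + h) - f tau - h *: w tau) <= e * h.
    by rewrite -[X in _ <= _ * X]gtr0_norm //; apply: Hd; rewrite ?gtr0_norm //= in_itv.
  have D1 := Df _ Ih; have D2 := Df _ taust'; have D3 := Dw _ taust'.
  have -> : f (tau + h) - f tau = (f (tau + h) - f tau - h *: w tau) + h *: w tau.
    by rewrite subrK.
  apply: le_trans (snD SN _ _) _; [by apply: snDB; [exact: snDB|exact: snDZ]|exact: snDZ|].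
  rewrite (snZ SN) // gtr0_norm //; have := HC _ taust'; nra.
- move=> tau taust e e0.
  have taust' : s <= tau <= t by case/andP: taust => /ltW ->.
  have It : `[s, t]%classic tau by rewrite /= in_itv.
  have [|d d0 Hd] := has_deriv_cont H It _ (Dw _ taust') e0.
    by move=> r; rewrite /= in_itv /=; exact: Df.
  exists d => // sg ssg /andP[h1 h2]; case/andP: taust' => h3 h4.
  have Isg : s <= sg <= t by apply/andP; split; lra.
  rewrite snBC; [|by apply: Df; rewrite h3|exact: Df].
  by apply: Hd; [rewrite /= in_itv|rewrite ltr0_norm; lra].
Qed.

Lemma truncn_cell (x : R) (k : nat) : k%:R <= x < k.+1%:R -> Num.truncn x = k.
Proof. by move=> h; apply/eqP; rewrite truncn_eq //; case/andP: h => h _; apply: le_trans h. Qed.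

Section Euler.
Variables (Phi : R -> V -> V) (U0 : V) (L K : R -> R).
Hypothesis DU0 : D U0.
Hypothesis comp : seq_complete D N.
Hypothesis DPhi : forall t U, 0 <= t -> D U -> D (Phi t U).
Hypothesis L0 : forall T, 0 < L T.
Hypothesis K0 : forall T, 0 <= K T.
Hypothesis Phi_bd : forall T t U, 0 <= t <= T -> D U -> N (Phi t U) <= K T.
Hypothesis Phi_lip : forall T t t' U U', 0 <= t <= T -> 0 <= t' <= T ->
  D U -> D U' -> N (Phi t U - Phi t' U') <= L T * (N (U - U') + `|t - t'|).

Let dl (n : nat) : R := n.+1%:R^-1.
Let dl0 n : 0 < dl n. Proof. by rewrite invr_gt0. Qed.

Fixpoint euler_node (n k : nat) : V :=
  if k is k'.+1 then euler_node n k' + dl n *: Phi (k'%:R * dl n) (euler_node n k')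
  else U0.

(** The piecewise linear interpolation of the Euler nodes of step 1 / (n + 1). *)
Definition euler (n : nat) (t : R) : V :=
  let k := Num.truncn (t / dl n) in
  euler_node n k + (t - k%:R * dl n) *: Phi (k%:R * dl n) (euler_node n k).

Let kdl0 k n : 0 <= k%:R * dl n.
Proof. by rewrite mulr_ge0 // ltW. Qed.

Lemma D_euler_node n k : D (euler_node n k).
Proof.
elim: k => //= k IH; apply: snDD => //; apply: snDZ; exact: DPhi.
Qed.

Lemma D_euler n t : D (euler n t).
Proof.
by apply: snDD; [exact: D_euler_node|apply: snDZ; apply: DPhi => //; exact: D_euler_node].
Qed.

Lemma euler_cell n k t : k%:R * dl n <= t <= k.+1%:R * dl n ->
  euler n t = euler_node n k + (t - k%:R * dl n) *: Phi (k%:R * dl n) (euler_node n k).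
Proof.
move=> /andP[h1 h2]; rewrite /euler.
move: h2; rewrite le_eqVlt => /orP[/eqP->|h2].
  rewrite mulfK ?gt_eqF // (_ : Num.truncn _ = k.+1); last exact: natrK.
  rewrite subrr scale0r addr0 /= -natr1 mulrDl mul1r.
  by rewrite addrAC subrr add0r.
have -> : Num.truncn (t / dl n) = k; last by [].
by apply: truncn_cell; rewrite ler_pdivlMr // h1 ltr_pdivrMr.
Qed.

Lemma cell_right n t : 0 <= t ->
  exists k : nat, k%:R * dl n <= t < k.+1%:R * dl n.
Proof.
move=> t0; exists (Num.truncn (t / dl n)).
have h : 0 <= t / dl n by rewrite divr_ge0 // ltW.
by have /andP[h1 h2] := truncn_itv h; rewrite -ler_pdivlMr // h1 -ltr_pdivrMr.
Qed.

Lemma cell_left n t : 0 < t ->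
  exists k : nat, k%:R * dl n < t <= k.+1%:R * dl n.
Proof.
move=> t0; have [k /andP[h1 h2]] := cell_right n (ltW t0).
move: h1; rewrite le_eqVlt => /orP[/eqP h|h1]; last by exists k; rewrite h1 ltW.
case: k h h2 => [h|k h h2]; first by move: t0; rewrite -h mul0r ltxx.
by exists k; rewrite -h lexx andbT ltr_pM2r // ltr_nat.
Qed.

Lemma euler_cellB n k s t : k%:R * dl n <= s <= k.+1%:R * dl n ->
  k%:R * dl n <= t <= k.+1%:R * dl n ->
  euler n t - euler n s = (t - s) *: Phi (k%:R * dl n) (euler_node n k).
Proof.
move=> hs ht; rewrite (euler_cell hs) (euler_cell ht).
rewrite opprD addrACA subrr add0r -scalerBl; congr (_ *: _); ring.
Qed.

(** How far the slope of the polygon of index n can be from the vector field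
    along it: on a cell, time and state together move by at most K + 1 times
    the step. *)
Definition euler_err T n : R := L T * (K T + 1) * dl n.

Lemma euler_right T n t : 0 <= t < T -> exists2 d, 0 < d &
  forall h, 0 < h < d -> t + h <= T ->
   N (euler n (t + h) - euler n t - h *: Phi t (euler n t)) <= euler_err T n * h /\
   N (euler n (t + h) - euler n t) <= K T * h.
Proof.
move=> /andP[t0 tT]; have [k /andP[h1 h2]] := cell_right n t0.
exists (k.+1%:R * dl n - t); first by rewrite subr_gt0.
move=> h /andP[h0 hd] thT.
have c1 : k%:R * dl n <= t <= k.+1%:R * dl n by rewrite h1 ltW.
have c2 : k%:R * dl n <= t + h <= k.+1%:R * dl n by apply/andP; split; lra.
have Dk := D_euler_node n k.
have kT : 0 <= k%:R * dl n <= T by rewrite kdl0 /=; lra.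
have DP : D (Phi (k%:R * dl n) (euler_node n k)) by exact: DPhi.
have DPt : D (Phi t (euler n t)) by apply: DPhi => //; exact: D_euler.
rewrite (euler_cellB c1 c2).
have -> : t + h - t = h by ring.
split; last by rewrite (snZ SN) // gtr0_norm // mulrC; apply: ler_wpM2r; [exact: ltW|exact: (Phi_bd kT)].
rewrite -scalerBr (snZ SN); last exact: snDB.
rewrite gtr0_norm // mulrC; apply: ler_wpM2r; first exact: ltW.
apply: le_trans (@Phi_lip T _ _ _ _ kT _ Dk (D_euler n t)) _.
  by rewrite t0 ltW.
rewrite /euler_err -mulrA; apply: ler_wpM2l; first exact: ltW.
rewrite (euler_cell c1) opprD addrA subrr add0r snN; last exact: snDZ.
rewrite (snZ SN) //.
have tk : 0 <= t - k%:R * dl n <= dl n.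
  by move: h2; rewrite -natr1 mulrDl mul1r => h2; apply/andP; split; lra.
case/andP: tk => tk0 tk1.
rewrite (distrC (k%:R * dl n) t) !ger0_norm //.
have := Phi_bd kT Dk; have := sn_ge0 SN DP; have := K0 T; nra.
Qed.

Lemma euler_left T n t : 0 < t <= T -> forall e, 0 < e -> exists2 d, 0 < d &
  forall s, 0 <= s -> t - d < s < t -> N (euler n t - euler n s) <= e.
Proof.
move=> /andP[t0 tT] e e0; have [k /andP[h1 h2]] := cell_left n t0.
have K1 : 0 < K T + 1 by have := K0 T; lra.
exists (Num.min (t - k%:R * dl n) (e / (K T + 1))).
  by rewrite lt_min subr_gt0 h1 divr_gt0.
move=> s s0 /andP[].
have [m1 m2] : Num.min (t - k%:R * dl n) (e / (K T + 1)) <= t - k%:R * dl n /\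
       Num.min (t - k%:R * dl n) (e / (K T + 1)) <= e / (K T + 1).
  by split; rewrite ge_min lexx ?orbT.
move=> h3 h4.
have Dk := D_euler_node n k.
have kT : 0 <= k%:R * dl n <= T by rewrite kdl0 /=; lra.
rewrite (@euler_cellB _ k); [|by apply/andP; split; lra|by apply/andP; split; lra].
rewrite (snZ SN); last exact: DPhi.
rewrite gtr0_norm; last lra.
have h5 : t - s < e / (K T + 1) by lra.
rewrite ltr_pdivlMr // in h5.
have := Phi_bd kT Dk; nra.
Qed.

Lemma euler_lip T n s t : 0 <= s -> s <= t -> t <= T ->
  N (euler n t - euler n s) <= K T * (t - s).
Proof.
move=> s0 st tT; apply: mean_value_le => //.
- by move=> tau _; exact: D_euler.
- move=> tau /andP[h1 h2] e e0.
  have [|d d0 Hd] := @euler_right T n tau; first by apply/andP; split; lra.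
  exists d => // h hd ht; have [_ H] := Hd h hd (le_trans ht tT).
  by apply: le_trans H _; case/andP: hd => h0 _; rewrite ler_pM2r // lerDl ltW.
- move=> tau /andP[h1 h2] e e0.
  have [|d d0 Hd] := @euler_left T n tau _ _ e0; first by apply/andP; split; lra.
  by exists d => // sg ssg; apply: Hd; lra.
Qed.

(** The slope at s controls the polygon on all of [s, t], with an error that
    is quadratic in t - s up to a term tending to 0 with the step; this is
    what survives in the limit and makes the limit differentiable. *)
Lemma euler_deriv T n s t : 0 <= s -> s <= t -> t <= T ->
  N (euler n t - euler n s - (t - s) *: Phi s (euler n s)) <=
  (euler_err T n + L T * (K T + 1) * (t - s)) * (t - s).
Proof.
move=> s0 st tT.
have DP : D (Phi s (euler n s)) by apply: DPhi => //; exact: D_euler.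
pose f tau := euler n tau - tau *: Phi s (euler n s).
have -> : euler n t - euler n s - (t - s) *: Phi s (euler n s) = f t - f s.
  by rewrite /f; vring.
apply: mean_value_le => //.
- by move=> tau _; apply: snDB; [exact: D_euler|exact: snDZ].
- move=> tau /andP[h1 h2] e e0.
  have [|d d0 Hd] := @euler_right T n tau; first by apply/andP; split; lra.
  exists d => // h hd ht; have [H _] := Hd h hd (le_trans ht tT).
  have h0 : 0 < h by case/andP: hd.
  have Dt : D (Phi tau (euler n tau)) by apply: DPhi; [lra|exact: D_euler].
  have -> : f (tau + h) - f tau =
     (euler n (tau + h) - euler n tau - h *: Phi tau (euler n tau)) +
     h *: (Phi tau (euler n tau) - Phi s (euler n s)).
    by rewrite /f; vring.
  apply: le_trans (snD SN _ _) _.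
  + by apply: snDB; [apply: snDB; exact: D_euler|exact: snDZ].
  + by apply: snDZ; exact: snDB.
  rewrite (snZ SN); last exact: snDB.
  rewrite gtr0_norm //.
  have H2 : N (Phi tau (euler n tau) - Phi s (euler n s)) <= L T * (K T + 1) * (t - s).
    apply: le_trans (@Phi_lip T _ _ _ _ _ _ (D_euler n tau) (D_euler n s)) _.
    - by apply/andP; split; lra.
    - by apply/andP; split; lra.
    rewrite -mulrA; apply: ler_wpM2l; first exact: ltW.
    rewrite ger0_norm; last lra.
    have H3 : N (euler n tau - euler n s) <= K T * (tau - s) by apply: euler_lip; lra.
    have := K0 T; nra.
  have := ler_wpM2l (ltW h0) H2; nra.
- move=> tau /andP[h1 h2] e e0.
  have e20 : 0 < e / 2 by lra.
  have [|d d0 Hd] := @euler_left T n tau _ _ e20; first by apply/andP; split; lra.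
  have NP := sn_ge0 SN DP.
  have NP1 : 0 < N (Phi s (euler n s)) + 1 by lra.
  exists (Num.min d (e / 2 / (N (Phi s (euler n s)) + 1))).
    by rewrite lt_min d0 divr_gt0.
  move=> sg ssg /andP[].
  set m := Num.min _ _ => h3 h4.
  have [m1 m2] : m <= d /\ m <= e / 2 / (N (Phi s (euler n s)) + 1).
    by split; rewrite ge_min lexx ?orbT.
  have H1 : N (euler n tau - euler n sg) <= e / 2 by apply: Hd; [lra|apply/andP; split; lra].
  have -> : f tau - f sg = (euler n tau - euler n sg) + (sg - tau) *: Phi s (euler n s).
    by rewrite /f; vring.
  apply: le_trans (snD SN _ _) _; [by apply: snDB; exact: D_euler|exact: snDZ|].
  rewrite (snZ SN) // ltr0_norm; last lra.
  have h5 : tau - sg < e / 2 / (N (Phi s (euler n s)) + 1) by lra.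
  rewrite ltr_pdivlMr // in h5; nra.
Qed.

(** Gronwall's lemma for the distance of two polygons, each of which solves
    the equation up to its slope error. *)
Lemma euler_dist T n m t : 0 <= t <= T ->
  N (euler n t - euler m t) <= (K T + 1) * expR (L T * T) * (dl n + dl m).
Proof.
move=> /andP[t0 tT].
have := @gronwall R t (L T) (euler_err T n + euler_err T m)
  (fun t => N (euler n t - euler m t)) t0 (L0 T).
have E0 k : 0 <= euler_err T k.
  apply: mulr_ge0; last exact: ltW.
  by apply: mulr_ge0; [exact: ltW|rewrite addr_ge0].
have DB s : D (euler n s - euler m s) by apply: snDB; exact: D_euler.
rewrite /= => H; apply: le_trans (H _ _ _ _) _.
- by rewrite addr_ge0.
- by move=> s _; exact: (sn_ge0 SN).
- move=> s /andP[s0 st] e e0.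
  have [|d1 d10 H1] := @euler_right T n s; first by apply/andP; split; lra.
  have [|d2 d20 H2] := @euler_right T m s; first by apply/andP; split; lra.
  exists (Num.min d1 d2); first by rewrite lt_min d10.
  move=> h /andP[h0]; rewrite lt_min => /andP[hd1 hd2] sht.
  have [|G1 _] := H1 h _ (le_trans sht tT); first by rewrite h0.
  have [|G2 _] := H2 h _ (le_trans sht tT); first by rewrite h0.
  have D1 : D (Phi s (euler n s)) by apply: DPhi => //; exact: D_euler.
  have D2 : D (Phi s (euler m s)) by apply: DPhi => //; exact: D_euler.
  set a := _ - _ - _ in G1; set b := _ - _ - _ in G2.
  have Da : D a by apply: snDB; [apply: snDB; exact: D_euler|exact: snDZ].
  have Db : D b by apply: snDB; [apply: snDB; exact: D_euler|exact: snDZ].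
  have -> : euler n (s + h) - euler m (s + h) = (euler n s - euler m s) +
      (h *: (Phi s (euler n s) - Phi s (euler m s)) + (a - b)).
    by rewrite /a /b; vring.
  have H3 : N (Phi s (euler n s) - Phi s (euler m s)) <= L T * N (euler n s - euler m s).
    apply: le_trans (@Phi_lip T _ _ _ _ _ _ (D_euler n s) (D_euler m s)) _.
    - by apply/andP; split; lra.
    - by apply/andP; split; lra.
    by rewrite subrr normr0 addr0.
  apply: le_trans (snD SN _ _) _ => //.
    by apply: snDD; [apply: snDZ; exact: snDB|exact: snDB].
  apply: le_trans (lerD (lexx _) (snD SN _ _)) _.
  + by apply: snDZ; exact: snDB.
  + exact: snDB.
  apply: le_trans (lerD (lexx _) (lerD (lexx _) (snD SN Da (snDN Db)))) _.
  rewrite (snZ SN); last exact: snDB.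
  rewrite gtr0_norm // snN //.
  have := ler_wpM2l (ltW h0) H3; nra.
- move=> s /andP[s0 st] e e0.
  have e20 : 0 < e / 2 by lra.
  have [|d1 d10 H1] := @euler_left T n s _ _ e20; first by apply/andP; split; lra.
  have [|d2 d20 H2] := @euler_left T m s _ _ e20; first by apply/andP; split; lra.
  exists (Num.min d1 d2); first by rewrite lt_min d10.
  move=> r r0 /andP[]; set mm := Num.min _ _ => h3 h4.
  have [m1 m2] : mm <= d1 /\ mm <= d2 by split; rewrite ge_min lexx ?orbT.
  have G1 : N (euler n s - euler n r) <= e / 2 by apply: H1 => //; apply/andP; split; lra.
  have G2 : N (euler m s - euler m r) <= e / 2 by apply: H2 => //; apply/andP; split; lra.
  have := snT (D_euler n s) (D_euler n r) (D_euler m s).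
  have := snT (D_euler n r) (D_euler m r) (D_euler m s).
  have := snBC (D_euler m r) (D_euler m s).
  lra.
have -> : euler n 0 - euler m 0 = 0.
  rewrite (@euler_cell n 0) ?mul0r ?lexx ?mulr_ge0 // ?ltW //.
  rewrite (@euler_cell m 0) ?mul0r ?lexx ?mulr_ge0 // ?ltW //.
  by rewrite subr0 !scale0r !addr0 /= subrr.
rewrite snN0 add0r /euler_err -mulrDr.
have -> : L T * (K T + 1) * (dl n + dl m) / L T = (K T + 1) * (dl n + dl m).
  by field; rewrite gt_eqF.
rewrite mulrAC; apply: ler_wpM2r; first by rewrite addr_ge0 // ltW.
apply: ler_wpM2l; first by rewrite addr_ge0.
by rewrite ler_expR ler_pM2l.
Qed.

Lemma inv_small (e : R) : 0 < e -> exists n0 : nat, forall n, (n0 <= n)%N ->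
  (n.+1%:R : R)^-1 <= e.
Proof.
move=> e0; exists (Num.truncn e^-1) => n hn.
rewrite -[leRHS]invrK lef_pV2 ?posrE ?invr_gt0 //.
have /andP[_ h] := truncn_itv (ltW (eqbRL (invr_gt0 e) e0)).
by apply: le_trans (ltW h) _; rewrite ler_nat.
Qed.

Lemma le_eps_mul (a b c : R) : 0 <= c -> (forall e, 0 < e -> a <= b + c * e) -> a <= b.
Proof.
move=> c0 H; apply/ler_addgt0Pr => e e0.
have c1 : 0 < c + 1 by lra.
apply: le_trans (H (e / (c + 1)) _) _; first by rewrite divr_gt0.
by rewrite lerD2l mulrCA ger_pMr // ler_pdivrMr //; lra.
Qed.

Lemma euler_limit : exists U : R -> V, [/\ U 0 = U0,
  forall t, D (U t) &
  forall t, 0 <= t -> forall e, 0 < e -> exists n0 : nat, forall n, (n0 <= n)%N ->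
    N (euler n t - U t) <= e].
Proof.
have H t : exists l, D l /\ (0 < t -> forall e, 0 < e -> exists n0 : nat, forall n, (n0 <= n)%N ->
    N (euler n t - l) <= e).
  have [t0|t0] := ltP 0 t; last by exists U0; split => // /lt_geF; rewrite t0.
  have [|l Dl Hl] := comp (D_euler ^~ t); last by exists l.
  move=> e e0; pose C := (K t + 1) * expR (L t * t).
  have C0 : 0 < C by rewrite mulr_gt0 ?expR_gt0 // ltr_wpDl.
  have [|n0 Hn0] := @inv_small (e / 2 / C); first by rewrite !divr_gt0.
  exists n0 => m n hm hn.
  apply: le_trans (@euler_dist t _ _ _ _) _; first by rewrite lexx ltW.
  rewrite -/C mulrC -ler_pdivlMr //.
  have := Hn0 _ hm; have := Hn0 _ hn.
  rewrite /dl; move: (m.+1%:R^-1) (n.+1%:R^-1) => x y.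
  by rewrite mulrAC => hx hy; lra.
have [W HW] := choice H.
(* The limit is only determined up to seminorm 0; at time 0 it is set to U0
   itself. *)
exists (fun t => if t == 0 then U0 else W t); split; first by rewrite eqxx.
  by move=> t; case: eqP => // _; case: (HW t).
move=> t t0 e e0; case: eqP => [->|/eqP tn].
  exists 0%N => n _; rewrite (@euler_cell n 0) ?mul0r ?lexx ?mulr_ge0 //; last exact: ltW.
  by rewrite subr0 !scale0r !addr0 /= subrr snN0; exact: ltW.
by case: (HW t) => _; apply => //; rewrite lt_neqAle eq_sym tn.
Qed.

(** The limit of the Euler polygons satisfies the estimate of [euler_deriv]
    without the step error. Backward increments are reduced to forward ones at
    the earlier time, at the cost of the Lipschitz bound for the vector field. *)
Lemma lipschitz_ode : exists U : R -> V, [/\ U 0 = U0,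
  forall t, D (U t) &
  has_deriv N [set t | 0 <= t] U (fun t => Phi t (U t))].
Proof.
have [U [U00 DU HU]] := euler_limit.
exists U; split => //.
have DE n t := D_euler n t.
have small T t e : 0 <= t -> 0 < e -> exists n0 : nat, forall n, (n0 <= n)%N ->
    N (euler n t - U t) <= e /\ euler_err T n <= e.
  move=> t0 e0; have [n1 H1] := HU t t0 e e0.
  have C0 : 0 < L T * (K T + 1) by rewrite mulr_gt0 // ltr_wpDl.
  have [|n2 H2] := @inv_small (e / (L T * (K T + 1))); first by rewrite divr_gt0.
  exists (maxn n1 n2) => n; rewrite geq_max => /andP[h1 h2]; split; first exact: H1.
  by rewrite /euler_err mulrC -ler_pdivlMr //; exact: H2.
have dist T s t : 0 <= s -> s <= t -> t <= T -> N (U t - U s) <= K T * (t - s).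
  move=> s0 st tT; apply: (@le_eps_mul _ _ 2) => // e e0.
  have [n1 H1] := small T t e (le_trans s0 st) e0.
  have [n2 H2] := small T s e s0 e0.
  set n := maxn n1 n2.
  have [G1 _] := H1 n (leq_maxl _ _); have [G2 _] := H2 n (leq_maxr _ _).
  have G3 := @euler_lip T n s t s0 st tT.
  have G4 := snT (DU t) (DE n t) (DU s).
  have G5 := snT (DE n t) (DE n s) (DU s).
  rewrite snBC // in G1; lra.
have right T s t : 0 <= s -> s <= t -> t <= T ->
  N (U t - U s - (t - s) *: Phi s (U s)) <= L T * (K T + 1) * (t - s) * (t - s).
  move=> s0 st tT; apply: (@le_eps_mul _ _ (2 + (t - s) * (L T + 1))).
    by have := L0 T; nra.
  move=> e e0.
  have [n1 H1] := small T t e (le_trans s0 st) e0.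
  have [n2 H2] := small T s e s0 e0.
  set n := maxn n1 n2.
  have [G1 E1] := H1 n (leq_maxl _ _); have [G2 _] := H2 n (leq_maxr _ _).
  have G3 := @euler_deriv T n s t s0 st tT.
  have D1 : D (Phi s (euler n s)) by exact: DPhi.
  have D2 : D (Phi s (U s)) by exact: DPhi.
  have -> : U t - U s - (t - s) *: Phi s (U s) =
    (euler n t - euler n s - (t - s) *: Phi s (euler n s)) +
    ((U t - euler n t) + ((euler n s - U s) + (t - s) *: (Phi s (euler n s) - Phi s (U s)))).
    by vring.
  apply: le_trans (snD SN _ _) _.
  - by apply: snDB; [exact: snDB|exact: snDZ].
  - by apply: snDD; [exact: snDB|apply: snDD; [exact: snDB|apply: snDZ; exact: snDB]].
  have A1 := snD SN (snDB (DU t) (DE n t)) (snDD (snDB (DE n s) (DU s)) (snDZ (t - s) (snDB D1 D2))).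
  have A2 := snD SN (snDB (DE n s) (DU s)) (snDZ (t - s) (snDB D1 D2)).
  have A3 : N (Phi s (euler n s) - Phi s (U s)) <= L T * N (euler n s - U s).
    have sT : 0 <= s <= T by apply/andP; split; lra.
    by have := @Phi_lip T _ _ _ _ sT sT (DE n s) (DU s); rewrite subrr normr0 addr0.
  rewrite (snZ SN) in A2; last exact: snDB.
  rewrite ger0_norm in A2; last lra.
  rewrite snBC // in G1.
  have A4 : (t - s) * N (Phi s (euler n s) - Phi s (U s)) <= (t - s) * (L T * e).
    apply: ler_wpM2l; first lra.
    by apply: le_trans A3 _; apply: ler_wpM2l => //; exact: ltW.
  have A5 : euler_err T n * (t - s) <= e * (t - s) by apply: ler_wpM2r => //; lra.
  lra.
move=> t /= t0 e e0.
pose T := t + 1.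
(* Twice the forward constant, to absorb the change of base point for h < 0. *)
pose C := 2 * (L T * (K T + 1)).
have C0 : 0 < C by rewrite !mulr_gt0 // ltr_wpDl.
exists (Num.min 1 (e / C)); first by rewrite lt_min ltr01 divr_gt0.
move=> h; rewrite lt_min => /andP[h1]; rewrite ltr_pdivlMr // => h2 th0.
suff : N (U (t + h) - U t - h *: Phi t (U t)) <= C * `|h| * `|h|.
  by move=> H; apply: le_trans H _; apply: ler_wpM2r => //; lra.
have [hn|hp] := leP 0 h.
  have -> : h = (t + h) - t by ring.
  have -> : t + ((t + h) - t) = t + h by ring.
  have hT : t + h <= T by rewrite /T; have := ler_norm h; lra.
  apply: le_trans (@right T t (t + h) _ _ hT) _ => //; first lra.
  rewrite ger0_norm; last lra.
  have := L0 T; have := K0 T; rewrite /C => k0 l0.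
  have -> : t + h - t = h by ring.
  have p0 : 0 <= L T * (K T + 1) * h * h.
    by apply: mulr_ge0 => //; apply: mulr_ge0 => //; apply: mulr_ge0; lra.
  lra.
have tT : t <= T by rewrite /T; lra.
have R1 := @right T (t + h) t th0 (ltW (ltac:(lra) : t + h < t)) tT.
have R2 := @dist T (t + h) t th0 (ltW (ltac:(lra) : t + h < t)) tT.
have D1 : D (Phi t (U t)) by exact: DPhi.
have D2 : D (Phi (t + h) (U (t + h))) by exact: DPhi.
have R3 : N (Phi t (U t) - Phi (t + h) (U (t + h))) <= L T * (K T + 1) * (- h).
  apply: le_trans (@Phi_lip T _ _ _ _ _ _ (DU t) (DU (t + h))) _.
  - by rewrite t0.
  - by rewrite th0 /=; lra.
  rewrite -mulrA; apply: ler_wpM2l; first exact: ltW.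
  have -> : t - (t + h) = - h by ring.
  rewrite normrN ltr0_norm //; lra.
have -> : U (t + h) - U t - h *: Phi t (U t) =
  - (U t - U (t + h) - (t - (t + h)) *: Phi (t + h) (U (t + h))) +
  (- h) *: (Phi t (U t) - Phi (t + h) (U (t + h))).
  by vring.
apply: le_trans (snD SN _ _) _.
- by apply: snDN; apply: snDB; [exact: snDB|exact: snDZ].
- by apply: snDZ; exact: snDB.
rewrite snN; last by apply: snDB; [exact: snDB|exact: snDZ].
rewrite (snZ SN); last exact: snDB.
rewrite normrN ltr0_norm // /C.
have R4 := ler_wpM2l (ltac:(lra) : 0 <= - h) R3.
lra.
Qed.

End Euler.

(** The radial retraction onto the ball of radius [r]. *)
Definition rad (r : R) (U : V) : V := (r / Num.max r (N U)) *: U.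

Lemma D_rad r U : D U -> D (rad r U).
Proof. exact: snDZ. Qed.

Lemma N_rad r U : 0 < r -> D U -> N (rad r U) <= r.
Proof.
move=> r0 DU; rewrite /rad (snZ SN) //.
have M0 : 0 < Num.max r (N U) by rewrite lt_max r0.
rewrite ger0_norm; last by rewrite divr_ge0 // ltW.
by rewrite mulrAC ler_pdivrMr // ler_pM2l // le_max lexx orbT.
Qed.

Lemma rad_id r U : 0 < r -> N U <= r -> rad r U = U.
Proof. by move=> r0 h; rewrite /rad max_l // divff ?scale1r // gt_eqF. Qed.

(** Lipschitz in the radius as well, since [global_ode] truncates at a radius
    that depends on time. *)
Lemma rad_lip r r' U U' : 0 < r -> 0 < r' -> D U -> D U' ->
  N (rad r U - rad r' U') <= 2 * N (U - U') + 2 * `|r - r'|.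
Proof.
move=> r0 r0' DU DU'.
rewrite /rad; set M := Num.max r (N U); set M' := Num.max r' (N U').
have M0 : 0 < M by rewrite lt_max r0.
have M0' : 0 < M' by rewrite lt_max r0'.
have [rM nM] : r <= M /\ N U <= M by split; rewrite le_max lexx ?orbT.
have [rM' nM'] : r' <= M' /\ N U' <= M' by split; rewrite le_max lexx ?orbT.
have -> : (r / M) *: U - (r' / M') *: U' =
   (r / M) *: (U - U') + (r / M - r' / M') *: U' by vring.
apply: le_trans (snD SN _ _) _; [by apply: snDZ; exact: snDB|exact: snDZ|].
rewrite !(snZ SN) //; last exact: snDB.
have H1 : `|r / M| * N (U - U') <= N (U - U').
  apply: ler_piMl; first by apply: (sn_ge0 SN); exact: snDB.
  rewrite ger0_norm; last by apply: divr_ge0; exact: ltW.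
  by rewrite ler_pdivrMr // mul1r.
have H2 : `|M - M'| <= `|r - r'| + N (U - U').
  have a1 := snB_le DU DU'; have a2 := snB_le DU' DU; rewrite (snBC DU' DU) in a2.
  have b1 := ler_norm (r - r'); have b2 := ler_norm (r' - r); rewrite distrC in b2.
  have c0 := sn_ge0 SN (snDB DU DU'); have d0 := normr_ge0 (r - r').
  rewrite ler_norml; apply/andP; split.
    rewrite lerNl opprB lerBlDr /M' ge_max; apply/andP; split; lra.
  rewrite lerBlDr /M ge_max; apply/andP; split; lra.
have H3 : `|r / M - r' / M'| * N U' <= `|M - M'| + `|r - r'|.
  have -> : r / M - r' / M' = ((r / M) * (M' - M) + (r - r')) / M'.
    by field; rewrite !gt_eqF.
  rewrite normrM (@gtr0_norm _ M'^-1) ?invr_gt0 // mulrAC ler_pdivrMr //.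
  have n0 := sn_ge0 SN DU'.
  apply: le_trans (ler_wpM2l _ nM') _ => //; apply: ler_wpM2r; first exact: ltW.
  apply: le_trans (ler_normD _ _) _; rewrite lerD2r normrM distrC.
  apply: ler_piMl => //; rewrite ger0_norm; last by apply: divr_ge0; exact: ltW.
  by rewrite ler_pdivrMr // mul1r.
lra.
Qed.

(** The vector field is replaced by F composed with the retraction onto the
    ball of radius Rb t + 1, which is globally Lipschitz on bounded time
    intervals, so [lipschitz_ode] applies. As long as the retraction has been
    inactive, the solution solves the true equation and the a-priori bound
    leaves a margin of 1; by continuity and real induction it is never active. *)
Theorem global_ode (F : V -> V) (U0 : V) (LF Rb ell : R -> R) :
  seq_complete D N -> D U0 -> (forall U, D U -> D (F U)) ->
  (forall r, 0 < LF r) ->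
  (forall r U U', D U -> D U' -> N U <= r -> N U' <= r ->
     N (F U - F U') <= LF r * N (U - U')) ->
  (forall t, 0 <= t -> 0 <= Rb t) ->
  (forall s t, 0 <= s -> s <= t -> Rb s <= Rb t) ->
  (forall t, 0 <= ell t) ->
  (forall T s t, 0 <= s <= T -> 0 <= t <= T -> `|Rb s - Rb t| <= ell T * `|s - t|) ->
  (forall T U, 0 <= T -> U 0 = U0 -> (forall t, D (U t)) ->
     has_deriv N `[0, T] U (F \o U) -> N (U T) <= Rb T) ->
  exists U : R -> V, [/\ U 0 = U0, forall t, D (U t) &
    has_deriv N [set t | 0 <= t] U (F \o U)].
Proof.
move=> comp DU0 DF LF0 FL Rb0 Rbm ell0 Rbl ap.
(* The margin 1 above the a-priori bound leaves room for the continuity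
   argument. *)
pose Phi t U := F (rad (Rb t + 1) U).
pose L T := LF (Rb T + 1) * (2 + 2 * ell T).
pose K T := LF (Rb T + 1) * `|Rb T + 1| + N (F 0).
have D0 := sn0 SN.
have R1 t : 0 <= t -> 0 < Rb t + 1 by move=> t0; have := Rb0 t t0; lra.
have radT T t U : 0 <= t <= T -> D U -> N (rad (Rb t + 1) U) <= Rb T + 1.
  move=> /andP[t0 tT] DU; apply: le_trans (N_rad (R1 t t0) DU) _.
  by rewrite lerD2r Rbm.
have [U [UU0 DU HU]] : exists U : R -> V, [/\ U 0 = U0, forall t, D (U t) &
    has_deriv N [set t | 0 <= t] U (fun t => Phi t (U t))].
  apply: (@lipschitz_ode Phi U0 L K) => //.
  - by move=> t U t0 DU; apply: DF; exact: D_rad.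
  - by move=> T; rewrite mulr_gt0 //; have := ell0 T; lra.
  - move=> T; apply: addr_ge0; last by apply: (sn_ge0 SN); exact: DF.
    by apply: mulr_ge0 => //; exact: ltW.
  - move=> T t U tT DU; rewrite /Phi /K.
    have Dr : D (rad (Rb t + 1) U) by exact: D_rad.
    apply: le_trans (snB_le (DF _ Dr) (DF _ D0)) _; rewrite addrC lerD2r.
    have T0 : 0 <= T by case/andP: tT => /le_trans; apply.
    have h := radT T t U tT DU.
    apply: le_trans (FL (Rb T + 1) _ _ Dr D0 h _) _.
      by rewrite snN0 ltW // R1.
    apply: ler_wpM2l; first exact: ltW.
    rewrite subr0; apply: le_trans h _; exact: ler_norm.
  - move=> T t t' U U' tT tT' DU DU'; rewrite /Phi /L.
    apply: le_trans (FL (Rb T + 1) _ _ (D_rad _ DU) (D_rad _ DU') _ _) _.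
    + exact: radT.
    + exact: radT.
    rewrite -mulrA; apply: ler_wpM2l; first exact: ltW.
    case/andP: (tT) => t0 _; case/andP: (tT') => t0' _.
    apply: le_trans (rad_lip (R1 t t0) (R1 t' t0') DU DU') _.
    have -> : Rb t + 1 - (Rb t' + 1) = Rb t - Rb t' by ring.
    have := Rbl T t t' tT tT'.
    have := ell0 T; have := sn_ge0 SN (snDB DU DU'); have := normr_ge0 (t - t').
    set a := N _; set b := `|t - t'|; set c := `|_|; nra.
exists U; split => //.
have true_sol T : 0 <= T -> (forall s, 0 <= s <= T -> N (U s) <= Rb s + 1) ->
    N (U T) <= Rb T.
  move=> T0 HT; apply: ap => //.
  move=> t; rewrite /= in_itv /= => /andP[t0 tT] e e0.
  have [d d0 Hd] := HU t t0 e e0.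
  exists d => // h hd; rewrite in_itv /= => /andP[th0 _].
  have := Hd h hd th0; rewrite /Phi rad_id //; first exact: R1.
  by apply: HT; rewrite t0.
have cont t e : 0 <= t -> 0 < e -> exists2 d, 0 < d & forall s, 0 <= s -> `|s - t| < d ->
    N (U s - U t) <= e.
  move=> t0 e0; apply: (has_deriv_cont HU) => //.
  by apply: DF; exact: D_rad.
(* Real induction: up to T the retraction acts as the identity. *)
have bd T : 0 <= T -> forall s, 0 <= s <= T -> N (U s) <= Rb s + 1.
  move=> T0; apply: real_induction => //.
  - have := true_sol 0 (lexx _).
    have U00 : N U0 <= Rb 0.
      have := ap 0 (fun=> U0) (lexx _) erefl (fun=> DU0); apply.
      move=> t; rewrite /= in_itv /= => /le_anti <- e e0.
      exists 1 => // h _; rewrite in_itv /= add0r => /le_anti <-.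
      by rewrite scale0r subr0 subrr snN0 normr0 mulr0.
    by move=> _; rewrite UU0; lra.
  - move=> t /andP[t0 tT] Pt.
    have Ut := true_sol t t0 Pt.
    have [d d0 Hd] := cont t 1 t0 ltr01.
    exists d => // s /andP[ts std] sT.
    have s0 : 0 <= s by lra.
    have H1 : N (U s - U t) <= 1 by apply: Hd => //; rewrite gtr0_norm; lra.
    have := snB_le (DU s) (DU t); have := Rbm t s t0 (ltW ts); lra.
  - move=> t /andP[t0 tT] Pt; apply/ler_addgt0Pr => e e0.
    have [d d0 Hd] := cont t e (ltW t0) e0.
    pose s := Num.max 0 (t - d / 2).
    have st : s < t by rewrite /s gt_max t0 /=; lra.
    have s0 : 0 <= s by rewrite /s le_max lexx.
    have ds : t - d < s by rewrite /s lt_max; apply/orP; right; lra.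
    have H1 : N (U s - U t) <= e by apply: Hd => //; rewrite ltr0_norm; lra.
    have H2 : N (U s) <= Rb s + 1 by apply: Pt; rewrite s0.
    have := snB_le (DU t) (DU s); rewrite snBC //.
    have := Rbm s t s0 (ltW st); lra.
move=> t /= t0 e e0; have [d d0 Hd] := HU t t0 e e0.
exists d => // h hd th0; have := Hd h hd th0; rewrite /Phi rad_id //; first exact: R1.
by apply: (bd t) => //; rewrite t0 lexx.
Qed.

End SeminormedODE.

(** * Lebesgue integrals of real-valued functions *)

Section RealIntegrals.
Context {R : realType}.
Local Notation mu := (@lebesgue_measure R).
Implicit Types (f g h : R -> R).

#[local] Instance ae_filter_leb : Filter (nbhs (almost_everywhere mu)) :=
  ae_filter_ringOfSetsType mu.

Lemma ae_imp (P Q : R -> Prop) : (forall x, P x -> Q x) ->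
  {ae mu, forall x, P x} -> {ae mu, forall x, Q x}.
Proof. by move=> H h; apply: filterS h. Qed.

Lemma ae_imp2 (P Q S : R -> Prop) : (forall x, P x -> Q x -> S x) ->
  {ae mu, forall x, P x} -> {ae mu, forall x, Q x} -> {ae mu, forall x, S x}.
Proof. by move=> H h1 h2; apply: filterS2 h1 h2. Qed.

Lemma ae_all (P : R -> Prop) : (forall x, P x) -> {ae mu, forall x, P x}.
Proof. by move=> H; apply: filterS filterT. Qed.

Definition intg f := mu.-integrable setT (EFin \o f).
Definition mfun1 f := measurable_fun (setT : set R) f.

Lemma intg_m f : intg f -> mfun1 f.
Proof. by move=> /integrableP[/measurable_EFinP]. Qed.

Lemma intg_dom f g : mfun1 f -> intg g -> (forall x, `|f x| <= g x) -> intg f.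
Proof.
move=> mf ig H; apply: le_integrable ig => //; first exact/measurable_EFinP.
by move=> x _; rewrite lee_fin; apply: le_trans (H x) _; exact: ler_norm.
Qed.

Lemma intgD f g : intg f -> intg g -> intg (fun x => f x + g x).
Proof.
move=> hf hg; rewrite /intg (_ : EFin \o _ = (EFin \o f) \+ (EFin \o g)); last by [].
exact: integrableD.
Qed.

Lemma intgZ a f : intg f -> intg (fun x => a * f x).
Proof.
move=> hf; rewrite /intg (_ : EFin \o _ = (fun x => a%:E * (EFin \o f) x)%E); last by [].
exact: integrableZl.
Qed.

Lemma intgB f g : intg f -> intg g -> intg (fun x => f x - g x).
Proof.
move=> hf hg; have := integrableB measurableT hf hg.
by apply: eq_integrable => // x _; rewrite /= EFinB.
Qed.

Lemma intg_abs f : intg f -> intg (fun x => `|f x|).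
Proof. by move=> hf; exact: integrable_norm. Qed.

Lemma intg0 : intg (fun=> 0).
Proof. exact: integrable0. Qed.

Lemma intg_bdd M h f : mfun1 h -> intg f -> (forall x, `|h x| <= M) ->
  intg (fun x => h x * f x).
Proof.
move=> mh hf H; apply: (@intg_dom _ (fun x => M * `|f x|)).
- by apply: measurable_funM => //; exact: intg_m.
- by apply: intgZ; exact: intg_abs.
- by move=> x; rewrite normrM ler_wpM2r.
Qed.

Lemma I_Z a f : intg f -> \int[mu]_x (a * f x) = a * \int[mu]_x f x.
Proof. by move=> hf; rewrite RintegralZl. Qed.

Lemma I_D f g : intg f -> intg g ->
  \int[mu]_x (f x + g x) = \int[mu]_x f x + \int[mu]_x g x.
Proof. by move=> hf hg; rewrite RintegralD. Qed.

Lemma I_B f g : intg f -> intg g ->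
  \int[mu]_x (f x - g x) = \int[mu]_x f x - \int[mu]_x g x.
Proof. by move=> hf hg; rewrite RintegralB. Qed.

Lemma I_0 : \int[mu]_x (0 : R) = 0.
Proof. by rewrite /Rintegral integral0. Qed.

Lemma I_N f : intg f -> \int[mu]_x (- f x) = - \int[mu]_x f x.
Proof. by move=> hf; rewrite -mulN1r -I_Z //; congr Rintegral; apply/funext => x; rewrite mulN1r. Qed.

Lemma I_le f g : intg f -> intg g -> (forall x, f x <= g x) ->
  \int[mu]_x f x <= \int[mu]_x g x.
Proof. by move=> hf hg H; apply: le_Rintegral. Qed.

Lemma I_ge0 f : (forall x, 0 <= f x) -> 0 <= \int[mu]_x f x.
Proof. by move=> H; apply: Rintegral_ge0. Qed.

Lemma I_abs f : intg f -> `|\int[mu]_x f x| <= \int[mu]_x `|f x|.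
Proof. by move=> hf; apply: le_normr_Rintegral. Qed.

Lemma I_eq f g : f =1 g -> \int[mu]_x f x = \int[mu]_x g x.
Proof. by move=> H; congr Rintegral; exact/funext. Qed.

Lemma EFin_I f : intg f -> (\int[mu]_x (f x)%:E)%E = (\int[mu]_x f x)%:E.
Proof. by move=> hf; rewrite /Rintegral fineK //; exact: integrable_fin_num. Qed.

Definition aeq f g := {ae mu, forall x, f x = g x}.

Lemma aeq_refl f : aeq f f. Proof. exact: ae_all. Qed.
Lemma aeq_sym f g : aeq f g -> aeq g f.
Proof. exact: ae_imp. Qed.
Lemma aeq_trans f g h : aeq f g -> aeq g h -> aeq f h.
Proof. by apply: ae_imp2 => x -> ->. Qed.

Lemma I_ae f g : mfun1 f -> mfun1 g -> aeq f g -> \int[mu]_x f x = \int[mu]_x g x.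
Proof.
move=> mf mg H; congr fine; apply: ae_eq_integral => //; try exact/measurable_EFinP.
by apply: ae_imp H => x -> _.
Qed.

Lemma intg_ae f g : intg f -> mfun1 g -> aeq f g -> intg g.
Proof.
move=> hf mg H; apply/integrableP; split; first exact/measurable_EFinP.
case/integrableP : hf => mf.
rewrite (@ae_eq_integral _ _ _ mu _ (abse \o (EFin \o g)) (abse \o (EFin \o f))) //.
- exact/measurableT_comp.
- by apply/measurableT_comp => //; exact/measurable_EFinP.
- by apply: ae_imp H => x /= -> _.
Qed.

Lemma I_eq0 f : intg f -> (forall x, 0 <= f x) -> \int[mu]_x f x = 0 -> aeq f (fun=> 0).
Proof.
move=> hf f0 H.
have : (\int[mu]_x `|(EFin \o f) x| = 0)%E.
  under eq_integral => x _ do rewrite /= ger0_norm //.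
  by rewrite EFin_I // H.
case/integrableP: (hf) => mf _ /(ae_eq_integral_abs _ measurableT mf) HH.
by apply: ae_imp HH => x /= /(_ Logic.I) [].
Qed.

(** Dominated convergence. *)
Lemma dct (f_ : nat -> R -> R) f g : (forall n, mfun1 (f_ n)) -> mfun1 f ->
  {ae mu, forall x, f_ n x @[n --> \oo] --> f x} -> intg g ->
  (forall n x, `|f_ n x| <= g x) ->
  intg f /\ \int[mu]_x f_ n x @[n --> \oo] --> \int[mu]_x f x.
Proof.
move=> mf_ mf cv ig dom.
have [] := @dominated_convergence _ _ _ mu _ measurableT (fun n => EFin \o f_ n)
  (EFin \o f) (EFin \o g) _ _ _ ig _.
- by move=> n; apply/measurable_EFinP; exact: mf_.
- exact/measurable_EFinP.
- by apply: ae_imp cv => x cx _; apply: cvg_EFin => //; exact: nearW.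
- by apply: ae_all => x n _; rewrite lee_fin.
move=> i1 _ i3; split => //.
by apply: fine_cvg; rewrite -EFin_I.
Qed.

(** Fatou's lemma, with a bound that is uniform along the sequence. *)
Lemma fatouR (f_ : nat -> R -> R) f C : (forall n, intg (f_ n)) -> mfun1 f ->
  (forall n x, 0 <= f_ n x) -> (forall x, 0 <= f x) ->
  {ae mu, forall x, f_ n x @[n --> \oo] --> f x} ->
  (forall n, \int[mu]_x f_ n x <= C) -> intg f /\ \int[mu]_x f x <= C.
Proof.
move=> if_ mf f0_ f0 cv HC.
have C0 : 0 <= C by apply: le_trans (HC 0%N); exact: I_ge0.
have H : (\int[mu]_x (f x)%:E <= C%:E)%E.
  have := @fatou _ _ _ mu _ measurableT (fun n => EFin \o f_ n) _ _.
  move=> /(_ (fun n => measurable_int _ (if_ n)) (fun n x _ => _)) F.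
  have {}F := F f0_.
  rewrite (_ : (\int[mu]_x (f x)%:E)%E = (\int[mu]_x limn_einf (fun n => (EFin \o f_ n) x))%E); last first.
    apply: ae_eq_integral => //; first exact/measurable_EFinP.
      rewrite /limn_einf; apply: measurableT_comp => //.
      apply: measurable_fun_limn_esup => n; apply: measurableT_comp => //.
      exact: measurable_int (if_ n).
    apply: ae_imp cv => x cx _.
    have cE : (EFin \o f_ n) x @[n --> \oo] --> (f x)%:E.
      by apply: cvg_EFin => //; exact: nearW.
    by have [-> _] := cvg_limn_einf_sup cE.
  apply: le_trans F _; rewrite limn_einf_lim; apply: lime_le; first exact: is_cvg_einfs.
  apply: nearW => n; apply: le_trans (_ : \int[mu]_x (f_ n x)%:E <= _)%E.
    by apply: ereal_inf_lbound; exists n => /=.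
  by rewrite EFin_I // lee_fin.
have ifi : intg f.
  apply/integrableP; split; first exact/measurable_EFinP.
  under eq_integral => x _ do rewrite /= ger0_norm //.
  by apply: le_lt_trans H _; rewrite ltry.
by split => //; rewrite EFin_I // lee_fin in H.
Qed.

Lemma lebesgue_measure_shift (h : R) (A : set R) : measurable A ->
  pushforward mu ((fun x : R => x + h) : _ -> measurableTypeR R) A = mu A.
Proof.
have mh : measurable_fun setT ((fun x : R => x + h) : _ -> measurableTypeR R).
  by apply: measurable_funD.
move=> mA; apply/esym/lebesgue_measure_unique => //= _ [[a b]] _ <-.
rewrite /pushforward /= lebesgue_measure_itv /=.
rewrite (_ : _ @^-1` _ = `]a - h, b - h]%classic); last first.
  by apply/seteqP; split => x /=; rewrite !in_itv /= => /andP[h1 h2]; apply/andP; split; lra.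
rewrite lebesgue_measure_itv /= !lte_fin.
have -> : (a - h < b - h) = (a < b) by apply/idP/idP; lra.
by case: ifP => // _; congr EFin; ring.
Qed.

Lemma lebesgue_measure_dilate (c : R) (A : set R) : 0 < c -> measurable A ->
  (c%:E * pushforward mu ((fun x : R => c * x)%R : _ -> measurableTypeR R) A = mu A)%E.
Proof.
move=> c0 mA.
have mh : measurable_fun setT ((fun x : R => c * x) : _ -> measurableTypeR R).
  by apply: measurable_funM.
apply/esym.
rewrite (@lebesgue_measure_unique R (mscale (NngNum (ltW c0)) (pushforward mu ((fun x : R => c * x) : _ -> measurableTypeR R)))) //.
  move=> _ [[a b]] _ <-.
  rewrite /= /mscale /= /pushforward /= lebesgue_measure_itv /=.
  rewrite (_ : _ @^-1` _ = `]a / c, b / c]%classic); last first.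
    apply/seteqP; split => x /=; rewrite !in_itv /= ltr_pdivrMr // ler_pdivlMr // => /andP[h1 h2]; apply/andP; split; lra.
  rewrite lebesgue_measure_itv /= !lte_fin ltr_pM2r ?invr_gt0 //.
  case: ifP => // _; last by rewrite mule0.
  by rewrite -EFinM; congr EFin; field; rewrite gt_eqF.
Qed.

(** Change of variables for a map that multiplies the measure by [c]; the
    signed case follows from the nonnegative one applied to |f| and |f| - f. *)
Lemma intg_push (phi : R -> R) (c : R) f : measurable_fun setT (phi : R -> measurableTypeR R) -> 0 < c ->
  (forall A : set R, measurable A ->
     (c%:E * pushforward mu (phi : _ -> measurableTypeR R) A = mu A)%E) ->
  intg f -> intg (fun x => f (phi x)) /\ c * \int[mu]_x f (phi x) = \int[mu]_x f x.
Proof.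
move=> mphi c0 H hf.
have mf := intg_m hf.
have mE : measurable_fun setT (EFin \o f) by exact/measurable_EFinP.
have mab : measurable_fun setT (fun x => `|(f x)%:E|%E).
  by apply: (measurableT_comp _ mE); exact: abse_measurable.
have mfp : measurable_fun setT (EFin \o (fun x => f (phi x))).
  by apply/measurable_EFinP; exact: (measurableT_comp mf mphi).
pose nu : {measure set (measurableTypeR R) -> \bar R} := pushforward mu (phi : R -> measurableTypeR R).
have E (g : R -> \bar R) : (\int[mu]_x g x = \int[mscale (NngNum (ltW c0)) (nu mphi)]_x g x)%E.
  by apply: eq_measure_integral => A mA _; first [exact: (H A mA)|exact: (esym (H A mA))|have := H A mA; rewrite /= /mscale /= => ->; by []].
have ifp : intg (fun x => f (phi x)).
  apply/integrableP; split => //.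
  case/integrableP: hf => _; rewrite E ge0_integral_mscale //=.
  rewrite ge0_integral_pushforward // preimage_setT /=.
  case: (\int[_]_(_ in _) _)%E => [r _||_] //=; first by rewrite ltry.
  by rewrite mulry gtr0_sg // mul1e.
have ge0 (g : R -> R) : (forall x, 0 <= g x) -> intg g -> intg (fun x => g (phi x)) ->
   c * \int[mu]_x g (phi x) = \int[mu]_x g x.
  move=> g0 ig igp.
  have mg : measurable_fun setT (EFin \o g) by apply/measurable_EFinP; exact: intg_m.
  apply: EFin_inj; rewrite EFinM -!EFin_I // [RHS]E ge0_integral_mscale //=.
    by rewrite ge0_integral_pushforward ?preimage_setT // => y _; rewrite lee_fin.
  by move=> x _; rewrite lee_fin.
split => //.
have ia := intg_abs hf; have iap := intg_abs ifp.
have ib := intgB ia hf; have ibp := intgB iap ifp.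
have G1 := ge0 _ (fun x => normr_ge0 (f x)) ia iap.
have G2 := ge0 (fun x => `|f x| - f x) _ ib ibp.
rewrite /= !I_B // in G2; have {}G2 := G2 (fun x => _).
have h x : 0 <= `|f x| - f x by rewrite subr_ge0 ler_norm.
move: (G2 h); lra.
Qed.

Lemma I_shift (h : R) f : intg f -> intg (fun x => f (x + h)) /\
  \int[mu]_x f (x + h) = \int[mu]_x f x.
Proof.
move=> hf; have [|||i1 i2] := @intg_push (fun x => x + h) 1 f _ _ _ hf => //.
- exact: measurable_funD.
- by move=> A mA; rewrite mul1e lebesgue_measure_shift.
- by split => //; rewrite mul1r in i2.
Qed.

Lemma I_dilate (c : R) f : 0 < c -> intg f -> intg (fun x => f (c * x)) /\
  c * \int[mu]_x f (c * x) = \int[mu]_x f x.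
Proof.
move=> c0 hf; apply: (@intg_push (fun x => c * x)) => //.
- exact: measurable_funM.
- by move=> A mA; rewrite lebesgue_measure_dilate.
Qed.

Lemma I_opp f : intg f -> intg (fun x => f (- x)) /\
  \int[mu]_x f (- x) = \int[mu]_x f x.
Proof.
move=> hf; have [|||i1 i2] := @intg_push (fun x => - x) 1 f _ _ _ hf => //.
- exact: oppr_measurable.
- by move=> A mA; rewrite mul1e lebesgue_measureN.
- by split => //; rewrite mul1r in i2.
Qed.

End RealIntegrals.

(** * Square-integrable functions *)

Section L2Theory.
Context {R : realType}.
Local Notation mu := (@lebesgue_measure R).
Implicit Types (f g h u v w : R -> R).

#[local] Instance ae_filter_leb' : Filter (nbhs (almost_everywhere mu)) :=
  ae_filter_ringOfSetsType mu.

Definition L2p f := mfun1 f /\ intg (fun x => f x ^+ 2).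

Lemma L2E f : L2 f <-> L2p f.
Proof.
split=> [|[mf H]].
  rewrite /L2 /= => Lf; split; last exact: Lfun2_integrable_sqr.
  by move: Lf; rewrite inE => /andP[]; rewrite inE.
rewrite /L2 /= inE; apply/andP; split; first by rewrite inE.
rewrite inE /= /finite_norm unlock.
rewrite (_ : (\int[mu]_x _)%E = (\int[mu]_x (f x ^+ 2)%:E)%E).
  by rewrite EFin_I // poweR_EFin ltry.
apply: eq_integral => x _ /=.
by rewrite (powR_mulrn 2) // real_normK // num_real.
Qed.

Lemma L2_m f : L2p f -> mfun1 f. Proof. by case. Qed.

Lemma L2_mul f g : L2p f -> L2p g -> intg (fun x => f x * g x).
Proof.
move=> [mf hf] [mg hg]; apply: (@intg_dom _ _ (fun x => f x ^+ 2 + g x ^+ 2)).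
- exact: measurable_funM.
- exact: intgD.
- move=> x; rewrite normrM.
  rewrite -(@real_normK _ (f x)) ?num_real // -(@real_normK _ (g x)) ?num_real //.
  have := sqr_ge0 (`|f x| - `|g x|); have := normr_ge0 (f x); have := normr_ge0 (g x); nra.
Qed.

Lemma L2_0 : L2p (0 : R -> R).
Proof.
split; first exact: measurable_cst.
by under eq_fun do rewrite expr0n /=; exact: intg0.
Qed.

Lemma L2_dom f g : mfun1 f -> L2p g -> (forall x, `|f x| <= `|g x|) -> L2p f.
Proof.
move=> mf [mg hg] H; split => //; apply: intg_dom hg _.
  exact: measurable_funX.
by move=> x; rewrite ger0_norm ?sqr_ge0 // -(@real_normK _ (f x)) ?num_real // -(@real_normK _ (g x)) ?num_real // lerXn2r ?nnegrE.
Qed.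

Lemma L2_Z a f : L2p f -> L2p (fun x => a * f x).
Proof.
move=> [mf hf]; split; first exact: measurable_funM.
by under eq_fun do rewrite exprMn; exact: intgZ.
Qed.

Lemma L2_D f g : L2p f -> L2p g -> L2p (fun x => f x + g x).
Proof.
move=> hf hg; split; first exact: measurable_funD (L2_m hf) (L2_m hg).
under eq_fun do rewrite sqrrD.
apply: intgD; [apply: intgD; first by case: hf|by case: hg].
by under eq_fun do rewrite -mulr_natl; apply: intgZ; exact: L2_mul.
Qed.

Lemma L2_N f : L2p f -> L2p (fun x => - f x).
Proof. by move=> hf; under eq_fun do rewrite -mulN1r; exact: L2_Z. Qed.

Lemma L2_B f g : L2p f -> L2p g -> L2p (fun x => f x - g x).
Proof. by move=> hf hg; apply: L2_D => //; exact: L2_N. Qed.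

Lemma L2_bdd M h f : mfun1 h -> L2p f -> (forall x, `|h x| <= M) ->
  L2p (fun x => h x * f x).
Proof.
move=> mh hf H; apply: (@L2_dom _ (fun x => M * f x)).
- exact: measurable_funM mh (L2_m hf).
- exact: L2_Z.
- move=> x; rewrite !normrM ler_wpM2r //; apply: le_trans (H x) _; exact: ler_norm.
Qed.

Lemma L2_ae f g : L2p f -> mfun1 g -> aeq f g -> L2p g.
Proof.
move=> [mf hf] mg H; split => //; apply: intg_ae hf _ _.
  exact: measurable_funX.
by apply: ae_imp H => x ->.
Qed.

Lemma L2_abs f : L2p f -> L2p (fun x => `|f x|).
Proof.
move=> hf; apply: (L2_dom _ hf); first by apply: measurableT_comp => //; case: hf.
by move=> x; rewrite normr_id.
Qed.

(** Inner product, norm and transform are locked so that comparing two norms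
    never makes unification unfold integrals. *)
Fact ip_key : unit. Proof. exact: tt. Qed.
Definition ip := locked_with ip_key (fun f g => \int[mu]_x (f x * g x)).
Lemma ip_def f g : ip f g = \int[mu]_x (f x * g x).
Proof. by rewrite /ip unlock. Qed.

Fact nm_key : unit. Proof. exact: tt. Qed.
Definition nm := locked_with nm_key (fun f => Num.sqrt (ip f f)).
Lemma nm_def f : nm f = Num.sqrt (ip f f).
Proof. by rewrite /nm unlock. Qed.

Lemma ipC f g : ip f g = ip g f.
Proof. by rewrite !ip_def; apply: I_eq => x; rewrite mulrC. Qed.

Lemma ip_ge0 f : 0 <= ip f f.
Proof. by rewrite ip_def; apply: I_ge0 => x; rewrite -expr2 sqr_ge0. Qed.

Lemma ipE f : ip f f = \int[mu]_x (f x ^+ 2).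
Proof. by rewrite ip_def. Qed.

Lemma ipDl f g h : L2p f -> L2p g -> L2p h -> ip (fun x => f x + g x) h = ip f h + ip g h.
Proof.
move=> hf hg hh; rewrite !ip_def -I_D; try exact: L2_mul.
by apply: I_eq => x; rewrite mulrDl.
Qed.

Lemma ipZl a f h : L2p f -> L2p h -> ip (fun x => a * f x) h = a * ip f h.
Proof.
move=> hf hh; rewrite !ip_def -I_Z; last exact: L2_mul.
by apply: I_eq => x; rewrite mulrA.
Qed.

Lemma ipBl f g h : L2p f -> L2p g -> L2p h -> ip (fun x => f x - g x) h = ip f h - ip g h.
Proof.
move=> hf hg hh; rewrite !ip_def -I_B; try exact: L2_mul.
by apply: I_eq => x; rewrite mulrBl.
Qed.

Lemma ipDr f g h : L2p f -> L2p g -> L2p h -> ip h (fun x => f x + g x) = ip h f + ip h g.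
Proof. by move=> hf hg hh; rewrite ipC ipDl // !(ipC _ h). Qed.

Lemma ipBr f g h : L2p f -> L2p g -> L2p h -> ip h (fun x => f x - g x) = ip h f - ip h g.
Proof. by move=> hf hg hh; rewrite ipC ipBl // !(ipC _ h). Qed.

Lemma ipZr a f h : L2p f -> L2p h -> ip h (fun x => a * f x) = a * ip h f.
Proof. by move=> hf hh; rewrite ipC ipZl // (ipC _ h). Qed.

Lemma ip_ae f f' g g' : mfun1 f -> mfun1 f' -> mfun1 g -> mfun1 g' ->
  aeq f f' -> aeq g g' -> ip f g = ip f' g'.
Proof.
move=> mf mf' mg mg' h1 h2; rewrite !ip_def; apply: I_ae; try exact: measurable_funM.
by apply: ae_imp2 h1 h2 => x -> ->.
Qed.

(** Discriminant of a nonnegative quadratic, allowing a leading coefficient 0. *)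
Lemma quad_disc (a b c : R) : 0 <= c -> (forall t, 0 <= a - 2 * t * b + t ^+ 2 * c) ->
  b ^+ 2 <= a * c.
Proof.
rewrite le_eqVlt => /orP[/eqP <- H|c0 H].
  have [->|b0] := eqVneq b 0; first by rewrite expr0n mulr0.
  have := H ((a + 1) / (2 * b)).
  have -> : a - 2 * ((a + 1) / (2 * b)) * b + ((a + 1) / (2 * b)) ^+ 2 * 0 = -1.
    by field.
  by rewrite lerNr oppr0 ler10.
have := H (b / c).
have -> : a - 2 * (b / c) * b + (b / c) ^+ 2 * c = (a * c - b ^+ 2) / c.
  by field; rewrite gt_eqF.
by rewrite pmulr_lge0 ?invr_gt0 // subr_ge0.
Qed.

Lemma nm_ge0 f : 0 <= nm f. Proof. by rewrite nm_def sqrtr_ge0. Qed.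

Lemma nm_sq f : nm f ^+ 2 = ip f f.
Proof. by rewrite nm_def sqr_sqrtr // ip_ge0. Qed.

Lemma nm_le f C : 0 <= C -> (nm f <= C) = (ip f f <= C ^+ 2).
Proof. by move=> C0; rewrite -nm_sq ler_sqr ?nnegrE // nm_ge0. Qed.

Lemma ip_quad t f g : L2p f -> L2p g ->
  ip (fun x => f x - t * g x) (fun x => f x - t * g x) =
  ip f f - 2 * t * ip f g + t ^+ 2 * ip g g.
Proof.
move=> hf hg; have hz := L2_Z t hg; have hb := L2_B hf hz.
rewrite ipBl // !ipBr // ipZl // !ipZr // ipZl // (ipC g f); ring.
Qed.

Lemma cauchy_schwarz f g : L2p f -> L2p g -> `|ip f g| <= nm f * nm g.
Proof.
move=> hf hg; rewrite -ler_sqr ?nnegrE ?mulr_ge0 ?nm_ge0 // exprMn !nm_sq real_normK ?num_real //.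
apply: quad_disc; first exact: ip_ge0.
by move=> t; rewrite -ip_quad // ip_ge0.
Qed.

Lemma nmD f g : L2p f -> L2p g -> nm (fun x => f x + g x) <= nm f + nm g.
Proof.
move=> hf hg; rewrite nm_le ?addr_ge0 ?nm_ge0 //.
have hd := L2_D hf hg.
rewrite ipDl // !ipDr // (ipC g f) sqrrD !nm_sq -mulr_natl.
have := le_trans (ler_norm _) (cauchy_schwarz hf hg); lra.
Qed.

Lemma nmZ a f : L2p f -> nm (fun x => a * f x) = `|a| * nm f.
Proof.
move=> hf; rewrite !nm_def ipZl //; last exact: L2_Z.
by rewrite ipZr // mulrA -expr2 sqrtrM ?sqr_ge0 // sqrtr_sqr.
Qed.

Lemma nm_ae f g : mfun1 f -> mfun1 g -> aeq f g -> nm f = nm g.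
Proof. by move=> mf mg H; rewrite !nm_def (ip_ae mf mg mf mg). Qed.

Lemma nm_eq0 f : L2p f -> nm f = 0 -> aeq f (fun=> 0).
Proof.
move=> [mf hf] H; have : ip f f = 0 by rewrite -nm_sq H expr0n.
rewrite ipE => /(I_eq0 hf (fun x => sqr_ge0 _)); apply: ae_imp => x /eqP.
by rewrite sqrf_eq0 => /eqP.
Qed.

Lemma nm_dom f g : mfun1 f -> L2p g -> (forall x, `|f x| <= `|g x|) -> nm f <= nm g.
Proof.
move=> mf hg H; have [_ hf] := L2_dom mf hg H.
rewrite !nm_def ler_wsqrtr // !ipE; apply: I_le => //; first by case: hg.
by move=> x; rewrite -(@real_normK _ (f x)) ?num_real // -(@real_normK _ (g x)) ?num_real // lerXn2r ?nnegrE.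
Qed.

Lemma L2_seminorm : seminorm_on L2p nm.
Proof.
split.
- exact: L2_0.
- by move=> a u v hu hv; apply: L2_D => //; exact: L2_Z.
- by move=> u _; exact: nm_ge0.
- by move=> u v hu hv; exact: nmD.
- by move=> a u hu; exact: nmZ.
Qed.

Lemma L2_dct (f_ : nat -> R -> R) f g : (forall n, mfun1 (f_ n)) -> mfun1 f ->
  {ae mu, forall x, f_ n x @[n --> \oo] --> f x} -> L2p g ->
  (forall n x, `|f_ n x| <= g x) -> (forall x, `|f x| <= g x) ->
  nm (fun x => f_ n x - f x) @[n --> \oo] --> 0.
Proof.
move=> mf_ mf cv hg Hn Hf.
have := @dct R (fun n x => (f_ n x - f x) ^+ 2) (fun=> 0) (fun x => 4 * g x ^+ 2).
case.
- by move=> n; apply: measurable_funX; apply: measurable_funB => //; exact: mf_.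
- exact: measurable_cst.
- apply: ae_imp cv => x cx.
  have : (f_ n x - f x) ^+ 2 @[n --> \oo] --> (f x - f x) ^+ 2.
    by apply: (cvgM (cvgB cx (cvg_cst _))); exact: (cvgB cx (cvg_cst _)).
  by rewrite subrr expr0n.
- by apply: intgZ; case: hg.
- move=> n x; rewrite ger0_norm ?sqr_ge0 //.
  have H : `|f_ n x - f x| <= 2 * g x.
    by apply: le_trans (ler_normB _ _) _; have := Hn n x; have := Hf x; lra.
  rewrite -(@real_normK _ (f_ n x - f x)) ?num_real //.
  have -> : 4 * g x ^+ 2 = (2 * g x) ^+ 2 by ring.
  by rewrite lerXn2r ?nnegrE //; apply: le_trans H.
move=> _; rewrite I_0 => H.
under eq_fun do rewrite nm_def ipE.
rewrite -(@sqrtr0 R); apply: (continuous_cvg _ (@sqrt_continuous R 0)).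
exact: H.
Qed.

(** Riesz and Fischer. A subsequence with increments below 2^-k converges
    almost everywhere because the series of its absolute increments is
    square-integrable; Fatou's lemma identifies its limit as the limit in norm
    of the whole sequence. *)
Lemma L2_complete : seq_complete L2p nm.
Proof.
move=> f Lf Cf.
pose e_ (k : nat) : R := 2^-1 ^+ k.
have e0 k : 0 < e_ k by rewrite exprn_gt0.
have /choice[N HN] : forall k, exists n0 : nat, forall m n : nat,
     (n0 <= m)%N -> (n0 <= n)%N -> nm (f m - f n) <= e_ k.
  by move=> k; exact: Cf.
(* The running maximum of the thresholds N makes the subsequence monotone in
   its index. *)
pose nk := fix nk k : nat := if k is k'.+1 then maxn (N k) (nk k') else N 0%N.
have nkN k : (N k <= nk k)%N by case: k => //= k; rewrite leq_maxl.
have nkS k : (nk k <= nk k.+1)%N by rewrite /= leq_maxr.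
have nkle j k : (j <= k)%N -> (nk j <= nk k)%N.
  move=> jk; rewrite -(subnK jk) addnC; elim: (k - j)%N => [|i IH]; first by rewrite addn0.
  by rewrite addnS (leq_trans IH).
pose g k := f (nk k).
have Lg k : L2p (g k) by exact: Lf.
pose d k (x : R) : R := `|g k.+1 x - g k x|.
have Ld k : L2p (d k) by apply: L2_abs; exact: L2_B.
have nd k : nm (d k) <= e_ k.
  apply: le_trans (_ : nm (g k.+1 - g k) <= _).
    apply: nm_dom; [exact: L2_m (Ld k)|exact: L2_B|by move=> x; rewrite /d normr_id].
  apply: HN; last exact: nkN.
  by apply: leq_trans (nkN k) _.
pose S K (x : R) : R := \sum_(k < K) d k x.
have LS K : L2p (S K).
  elim: K => [|K IH].
    by rewrite /S; under eq_fun do rewrite big_ord0; exact: L2_0.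
  by rewrite /S; under eq_fun do rewrite big_ord_recr /=; exact: L2_D.
have nS K : nm (S K) <= 2 - 2 * e_ K.
  elim: K => [|K IH].
    rewrite /S (_ : (fun x => _) = 0); first by rewrite (snN0 L2_seminorm) /e_ expr0; lra.
    by apply/funext => x; rewrite big_ord0.
  have -> : S K.+1 = (fun x => S K x + d K x).
    by apply/funext => x; rewrite /S big_ord_recr.
  apply: le_trans (nmD (LS K) (Ld K)) _.
  have h1 : e_ K.+1 = e_ K / 2 by rewrite /e_ exprSr.
  move: (nd K) IH; rewrite h1; move: (e_ K) (nm (S K)) (nm (d K)) => x y z; lra.
have S0 K x : 0 <= S K x by apply: sumr_ge0 => k _; exact: normr_ge0.
have Smono x : nondecreasing_seq (S ^~ x).
  by apply/nondecreasing_seqP => n; rewrite /S [leRHS]big_ord_recr /= lerDl /d normr_ge0.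
(* Monotone convergence for the squares of the partial sums, whose integrals
   are at most 4. *)
have fin : {ae mu, forall x, exists M, forall K, S K x <= M}.
  pose T K (x : R) := ((S K x) ^+ 2)%:E.
  have mT K : measurable_fun setT (T K).
    by apply/measurable_EFinP; apply: measurable_funX; exact: L2_m (LS K).
  have Tm x : setT x -> {homo (fun K => T K x) : n m / (n <= m)%N >-> (n <= m)%E}.
    move=> _ n m nm_; rewrite lee_fin lerXn2r ?nnegrE //; exact: Smono.
  have T0 K x : setT x -> (0 <= T K x)%E by move=> _; rewrite lee_fin sqr_ge0.
  have := @cvg_monotone_convergence _ _ _ mu _ measurableT T mT T0 Tm => cv.
  have mlim : measurable_fun setT (fun x => limn (T ^~ x)).
    apply: (emeasurable_fun_cvg T) => // x _.
    by apply: ereal_nondecreasing_is_cvgn; exact: Tm.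
  have lim0 x : (0 <= limn (T ^~ x))%E.
    apply: lime_ge; first by apply: ereal_nondecreasing_is_cvgn; exact: Tm.
    by apply: nearW => n; exact: T0.
  have ile : (\int[mu]_x limn (T ^~ x) <= 4%:E)%E.
    rewrite -(cvg_lim _ cv) //; apply: lime_le; first by apply/cvg_ex; eexists; exact: cv.
    apply: nearW => n; rewrite EFin_I; last by case: (LS n).
    rewrite lee_fin -ipE -nm_sq.
    have h1 : nm (S n) <= 2 by have := nS n; have := e0 n; lra.
    have := nm_ge0 (S n); nra.
  have ii : mu.-integrable setT (fun x => limn (T ^~ x)).
    apply/integrableP; split => //.
    under eq_integral => x _ do rewrite gee0_abs //.
    by apply: le_lt_trans ile _; rewrite ltry.
  have := integrable_ae measurableT ii; apply: ae_imp => x /(_ Logic.I) fx.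
  exists (Num.sqrt (fine (limn (T ^~ x)))) => K.
  rewrite -[leLHS]ger0_norm // -sqrtr_sqr ler_wsqrtr //.
  rewrite -lee_fin fineK //; apply: lime_ge.
    by apply: ereal_nondecreasing_is_cvgn; exact: Tm.
  by exists K => // n /= Kn; exact: Tm.
have cvg_g : {ae mu, forall x, cvgn (fun k => g k x)}.
  apply: ae_imp fin => x [M HM].
  have cS : cvgn (S ^~ x).
    by apply: nondecreasing_is_cvgn => //; exists M => _ [K _ <-].
  have cd : cvgn (series (fun k => g k.+1 x - g k x)).
    apply: normed_cvg; rewrite /=.
    rewrite (_ : [normed _] = S ^~ x) //.
    by apply/funext => K; rewrite /S -(big_mkord xpredT (fun k => d k x)).
  have -> : (fun k => g k x) = (fun K => g 0%N x + series (fun k => g k.+1 x - g k x) K).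
    by apply/funext => K; rewrite /series /= telescope_sumr // addrC subrK.
  by apply: is_cvgD => //; exact: is_cvg_cst.
pose l x := fine (limn_esup (fun k => (g k x)%:E)).
have ml : mfun1 l.
  apply: measurableT_comp => //; apply: measurable_fun_limn_esup => k.
  by apply/measurable_EFinP; exact: L2_m (Lg k).
have gl : {ae mu, forall x, g k x @[k --> \oo] --> l x}.
  apply: ae_imp cvg_g => x /cvg_ex[a ca].
  rewrite /l (_ : limn_esup _ = a%:E) //.
  have cE : (g k x)%:E @[k --> \oo] --> a%:E by apply: cvg_EFin => //; exact: nearW.
  by have [_ ->] := cvg_limn_einf_sup cE.
have key j n : (nk j <= n)%N -> L2p (fun x => f n x - l x) /\ nm (fun x => f n x - l x) <= e_ j.
  move=> jn.
  have [] := @fatouR R (fun k x => (f n x - g (k + j)%N x) ^+ 2) (fun x => (f n x - l x) ^+ 2) (e_ j ^+ 2).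
  - by move=> k; case: (L2_B (Lf n) (Lg (k + j)%N)).
  - by apply: measurable_funX; apply: measurable_funB => //; exact: L2_m (Lf n).
  - by move=> k x; rewrite sqr_ge0.
  - by move=> x; rewrite sqr_ge0.
  - apply: ae_imp gl => x cx.
    have cx' : f n x - g (k + j)%N x @[k --> \oo] --> f n x - l x.
      apply: cvgB; first exact: cvg_cst.
      by rewrite (cvg_shiftn j (fun k => g k x)).
    exact: (cvgM cx' cx').
  - move=> k; rewrite -ipE -nm_le; last exact: ltW.
    apply: (HN j).
      by apply: leq_trans jn; exact: nkN.
    by apply: leq_trans (nkN j) _; apply: nkle; rewrite leq_addl.
  move=> i1 i2; have Ll : L2p (fun x => f n x - l x).
    by split => //; apply: measurable_funB => //; exact: L2_m (Lf n).
  by split => //; rewrite nm_le; [rewrite ipE|exact: ltW].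
have Ll : L2p l.
  have -> : l = (fun x => f (nk 0%N) x - (f (nk 0%N) x - l x)).
    by apply/funext => x; rewrite opprB addrC subrK.
  by apply: L2_B => //; have [] := key 0%N (nk 0%N) (leqnn _).
exists l => // e e1.
have [j Hj] : exists j, e_ j <= e.
  have : (fun k => e_ k) @ \oo --> 0.
    by apply: cvg_expr; rewrite ger0_norm // invf_lt1 // ltr1n.
  move=> /cvgrPdist_le /(_ e e1) [j _ Hj]; exists j.
  by have := Hj j (leqnn j); rewrite sub0r normrN ger0_norm //; exact: ltW.
exists (nk j) => n hn; apply: le_trans Hj; have [] := key j n hn; by [].
Qed.

End L2Theory.

(** * The integral Hartley transform and the Poisson kernel *)

Section Kernels.
Context {R : realType}.
Local Notation mu := (@lebesgue_measure R).

Lemma intg_prod (F : R -> R -> R) (a b : R -> R) :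
  measurable_fun setT (fun p : R * R => F p.1 p.2) -> intg a -> intg b ->
  (forall x, 0 <= a x) -> (forall x y, `|F x y| <= a x * b y) ->
  [/\ forall x, intg (F x), intg (fun x => \int[mu]_y F x y) &
    (mu \x mu)%E.-integrable setT (fun p : R * R => (F p.1 p.2)%:E)].
Proof.
move=> mF ia ib a0 H.
have m1 x : mfun1 (F x).
  by apply: (measurableT_comp mF (g := fun y => (x, y))); exact: measurable_pair1.
have i1 x : intg (F x) by apply: (intg_dom (m1 x) (intgZ (a x) ib)).
have mE : measurable_fun setT (fun p : R * R => (F p.1 p.2)%:E) by exact/measurable_EFinP.
suff iF : (mu \x mu)%E.-integrable setT (fun p : R * R => (F p.1 p.2)%:E).
  have E1 x : (\int[mu]_y (F x y)%:E)%E = (\int[mu]_y F x y)%:E by rewrite EFin_I.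
  split => //.
  by have := integrable_fubini_F iF; apply: eq_integrable => // x _ /=; rewrite -E1.
apply/(integrable12ltyP mu mu mE) => /=.
apply: (@le_lt_trans _ _ (\int[mu]_x (a x * \int[mu]_y b y)%:E)%E); last first.
  rewrite EFin_I ?ltry //.
  have -> : (fun x => a x * \int[mu]_y b y) = (fun x => (\int[mu]_y b y) * a x).
    by apply/funext => x; rewrite mulrC.
  exact: intgZ.
apply: ge0_le_integral => //.
- by move=> x _; exact: integral_ge0.
- apply: (@measurable_fun_fubini_tonelli_F _ _ _ _ R mu (fun p => `|(F p.1 p.2)%:E|%E)).
    exact: measurableT_comp.
  by move=> p; exact: abse_ge0.
- apply/measurable_EFinP; apply: measurable_funM => //; exact: intg_m.
- move=> x _.
  rewrite -I_Z // -EFin_I; last exact: intgZ.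
  apply: ge0_le_integral => //.
  + by apply/measurable_EFinP; exact: (intg_m (intg_abs (i1 x))).
  + by apply/measurable_EFinP; apply: measurable_funM => //; exact: intg_m.
  + by move=> y _; rewrite lee_fin.
Qed.

Lemma fubiniR (F : R -> R -> R) (a b : R -> R) :
  measurable_fun setT (fun p : R * R => F p.1 p.2) -> intg a -> intg b ->
  (forall x, 0 <= a x) -> (forall y, 0 <= b y) ->
  (forall x y, `|F x y| <= a x * b y) ->
  [/\ forall x, intg (F x), forall y, intg (F ^~ y),
      intg (fun x => \int[mu]_y F x y), intg (fun y => \int[mu]_x F x y) &
      \int[mu]_x \int[mu]_y F x y = \int[mu]_y \int[mu]_x F x y].
Proof.
move=> mF ia ib a0 b0 H.
have [i1 j1 iF] := intg_prod mF ia ib a0 H.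
have mF' : measurable_fun setT (fun p : R * R => F p.2 p.1).
  exact: (measurableT_comp mF (@measurable_swap _ _ R R)).
have [i2 j2 _] := intg_prod (F := fun y x => F x y) mF' ib ia b0 (fun y x => eq_ind_r (fun z => _ <= z) (H x y) (mulrC _ _)).
have E1 x : (\int[mu]_y (F x y)%:E)%E = (\int[mu]_y F x y)%:E by rewrite EFin_I; last exact: i1.
have E2 y : (\int[mu]_x (F x y)%:E)%E = (\int[mu]_x F x y)%:E by rewrite EFin_I; last exact: i2.
split; [exact: i1|exact: i2|exact: j1|exact: j2|].
have := Fubini iF; rewrite /=.
under eq_integral => x _ do rewrite E1.
under [in RHS]eq_integral => y _ do rewrite E2.
rewrite (EFin_I j1) (EFin_I j2) => H1; exact: EFin_inj H1.
Qed.

Definition cas (x : R) : R := cos x + sin x.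

Lemma cas_le2 x : `|cas x| <= 2.
Proof.
apply: le_trans (ler_normD _ _) _.
have h1 : `|cos x| <= 1 by rewrite ler_norml cos_geN1 cos_le1.
have h2 : `|sin x| <= 1 by rewrite ler_norml sin_geN1 sin_le1.
lra.
Qed.

Lemma continuous_cas : continuous cas.
Proof. by move=> x; apply: cvgD; [exact: continuous_cos|exact: continuous_sin]. Qed.

Lemma measurable_cas : mfun1 cas.
Proof. exact: continuous_measurable_fun continuous_cas. Qed.

(** The term sin (a + b) is odd in the integration variable of [hart1_exp] and
    drops out there, which leaves a kernel that depends on the difference
    only. *)
Lemma casM a b : cas a * cas b = cos (a - b) + sin (a + b).
Proof. rewrite /cas cosB sinD; ring. Qed.

Lemma casB a b : cas (a - b) = cos b * cas a - sin b * cas (- a).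
Proof. rewrite /cas cosB sinB cosN sinN; ring. Qed.

Lemma casD a b : cas (a + b) = cos b * cas a + sin b * cas (- a).
Proof. rewrite /cas cosD sinD cosN sinN; ring. Qed.

Section ExpKernel.
Variables (e z : R).
Hypothesis e0 : 0 < e.

Let F (x : R) : R := - (e^-1 * expR (- e * x)) +
  (e ^+ 2 + z ^+ 2)^-1 * (expR (- e * x) * (z * sin (z * x) - e * cos (z * x))).
Let f (x : R) : R := expR (- e * x) * (1 + cos (z * x)).

Let dF (x : R) : is_derive x 1 F (f x).
Proof.
have d0 : e ^+ 2 + z ^+ 2 != 0 by rewrite gt_eqF // ltr_pwDl ?exprn_gt0 // sqr_ge0.
apply: is_derive_eq.
rewrite /f /GRing.scale /=; have en : e != 0 by rewrite gt_eqF.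
by field; rewrite ?d0 ?en.
Qed.

Let limF : F x @[x --> +oo] --> 0.
Proof.
have s0 : 0 < e ^+ 2 + z ^+ 2 by rewrite ltr_pwDl ?exprn_gt0 // sqr_ge0.
pose C := e^-1 + (e ^+ 2 + z ^+ 2)^-1 * (`|z| + e).
have C0 : 0 < C.
  rewrite /C ltr_pwDl ?invr_gt0 //; apply: mulr_ge0; first by rewrite invr_ge0 ltW.
  by rewrite addr_ge0 // ltW.
have bd x : `|F x| <= C * expR (- e * x).
  rewrite /F /C mulrDl; apply: le_trans (ler_normD _ _) _; apply: lerD.
    by rewrite normrN normrM !gtr0_norm ?expR_gt0 ?invr_gt0.
  rewrite normrM gtr0_norm ?invr_gt0 // -mulrA ler_pM2l ?invr_gt0 //.
  rewrite normrM gtr0_norm ?expR_gt0 // mulrC ler_pM2r ?expR_gt0 //.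
  apply: le_trans (ler_normB _ _) _; rewrite !normrM (gtr0_norm e0).
  apply: lerD; [rewrite ler_piMr //|rewrite ler_piMr ?(ltW e0) //].
    by rewrite ler_norml sin_geN1 sin_le1.
  by rewrite ler_norml cos_geN1 cos_le1.
apply/cvgrPdist_le => d d0; near=> x.
rewrite sub0r normrN; apply: le_trans (bd x) _.
have x0 : 0 < x by near: x; apply: nbhs_pinfty_gt; rewrite num_real.
have xd : C / (e * d) <= x by near: x; apply: nbhs_pinfty_ge; rewrite num_real.
rewrite mulNr expRN ler_pdivrMr ?expR_gt0 //.
rewrite ler_pdivrMr ?mulr_gt0 // in xd.
apply: le_trans xd _.
have := expR_ge1Dx (e * x).
have dd := ltW d0; nra.
Unshelve. all: end_near. Qed.

(** Adding 1 to the cosine makes the integrand nonnegative, so the fundamental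
    theorem of calculus on a half line applies; the explicit primitive is [F]. *)
Lemma int_exp_1cos :
  intg (fun x => expR (- (e * `|x|)) * (1 + cos (z * x))) /\
  \int[mu]_x (expR (- (e * `|x|)) * (1 + cos (z * x))) =
   2 / e + 2 * e / (e ^+ 2 + z ^+ 2).
Proof.
pose g x := expR (- (e * `|x|)) * (1 + cos (z * x)).
have g0 x : 0 <= g x.
  by rewrite mulr_ge0 ?expR_ge0 //; have := cos_geN1 (z * x); lra.
have cg : continuous g.
  move=> x; apply: cvgM.
    apply: (@continuous_comp _ _ _ (fun x : R => - (e * `|x|)) expR); last exact: continuous_expR.
    by apply: cvgN; apply: cvgM; [exact: cvg_cst|exact: cvg_norm].
  apply: cvgD; first exact: cvg_cst.
  apply: (@continuous_comp _ _ _ (fun x : R => z * x) cos); last exact: continuous_cos.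
  by apply: cvgM; [exact: cvg_cst|exact: cvg_id].
have ev : g =1 g \o -%R by move=> x; rewrite /g /= normrN mulrN cosN.
have f0 x : 0 <= f x.
  by rewrite mulr_ge0 ?expR_ge0 //; have := cos_geN1 (z * x); lra.
have cf : continuous f.
  move=> x; apply: cvgM.
    apply: (@continuous_comp _ _ _ (fun x : R => - e * x) expR); last exact: continuous_expR.
    by apply: cvgM; [exact: cvg_cst|exact: cvg_id].
  apply: cvgD; first exact: cvg_cst.
  apply: (@continuous_comp _ _ _ (fun x : R => z * x) cos); last exact: continuous_cos.
  by apply: cvgM; [exact: cvg_cst|exact: cvg_id].
have cF : continuous F.
  by move=> x; apply/differentiable_continuous/derivable1_diffP; have := dF x.
have en : e != 0 by rewrite gt_eqF.
have d0 : e ^+ 2 + z ^+ 2 != 0 by rewrite gt_eqF // ltr_pwDl ?exprn_gt0 // sqr_ge0.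
have E : (\int[mu]_x (g x)%:E = (2 / e + 2 * e / (e ^+ 2 + z ^+ 2))%:E)%E.
  rewrite (ge0_symfun_integralT g0 cg ev) -set_itvcy.
  rewrite (_ : (\int[mu]_(x in _) _)%E = (\int[mu]_(x in `[0%R, +oo[) (f x)%:E)%E); last first.
    apply: eq_integral => x; rewrite inE /= in_itv /= andbT => x0.
    by rewrite /g /f ger0_norm // mulNr.
  rewrite (@ge0_continuous_FTC2y R f F 0 0) //.
  - rewrite -!EFinB -EFinM; congr EFin; rewrite /F !mulr0 expR0 sin0 cos0 !mulr1 !mulr0 !mul1r sub0r.
    by field; rewrite ?d0 ?en.
  - exact: continuous_subspaceT.
  - by apply: cvg_at_right_filter; exact: cF.
  - by move=> x _; rewrite derive1E; have := dF x => -[_ ->].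
have ig : intg g.
  apply/integrableP; split.
    by apply/measurable_EFinP; exact: continuous_measurable_fun.
  under eq_integral => x _ do rewrite /= ger0_norm //.
  by rewrite E ltry.
by split => //; apply: EFin_inj; rewrite -EFin_I.
Qed.

End ExpKernel.

Lemma int_exp (e : R) : 0 < e -> intg (fun x => expR (- (e * `|x|))).
Proof.
move=> e0; have [+ _] := int_exp_1cos 0 e0; move=> /(intgZ 2^-1).
congr intg; apply/funext => x; by rewrite mul0r cos0; field.
Qed.

Lemma int_exp_cos (e z : R) : 0 < e ->
  intg (fun x => cos (z * x) * expR (- (e * `|x|))) /\
  \int[mu]_x (cos (z * x) * expR (- (e * `|x|))) = 2 * e / (e ^+ 2 + z ^+ 2).
Proof.
move=> e0; have [i1 E1] := int_exp_1cos z e0; have [i0 E0] := int_exp_1cos 0 e0.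
have i2 := intgZ 2^-1 i0.
have E : (fun x => cos (z * x) * expR (- (e * `|x|))) =
  (fun x => expR (- (e * `|x|)) * (1 + cos (z * x)) - 2^-1 * (expR (- (e * `|x|)) * (1 + cos (0 * x)))).
  by apply/funext => x; by rewrite mul0r cos0; field.
rewrite E; split; first exact: intgB.
rewrite I_B // I_Z // E1 E0.
have en : e != 0 by rewrite gt_eqF.
have d0 : e ^+ 2 + z ^+ 2 != 0 by rewrite gt_eqF // ltr_pwDl ?exprn_gt0 // sqr_ge0.
by rewrite expr0n /= addr0; field; rewrite ?d0 ?en.
Qed.

Lemma int_odd (f : R -> R) : intg f -> (forall x, f (- x) = - f x) -> \int[mu]_x f x = 0.
Proof.
move=> hf H; have [_ E] := I_opp hf.
have : \int[mu]_x f (- x) = - \int[mu]_x f x by rewrite -I_N //; exact: I_eq.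
rewrite E; lra.
Qed.

Lemma int_exp_sin (e z : R) : 0 < e ->
  intg (fun x => sin (z * x) * expR (- (e * `|x|))) /\
  \int[mu]_x (sin (z * x) * expR (- (e * `|x|))) = 0.
Proof.
move=> e0.
have i : intg (fun x => sin (z * x) * expR (- (e * `|x|))).
  apply: (@intg_bdd _ 1); last by move=> x; rewrite ler_norml sin_geN1 sin_le1.
  - apply: (measurableT_comp (f := sin)); last exact: measurable_funM.
    exact: continuous_measurable_fun (@continuous_sin R).
  - exact: int_exp.
by split => //; apply: int_odd => // x; rewrite normrN mulrN sinN mulNr.
Qed.

Lemma int_cauchy : intg (fun x : R => (1 + x ^+ 2)^-1) /\
  \int[mu]_x (1 + x ^+ 2)^-1 = (pi : R).
Proof.
have g0 (x : R) : 0 <= (oneDsqr x)^-1 by rewrite invr_ge0 addr_ge0 // sqr_ge0.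
have E : (\int[mu]_x ((oneDsqr x)^-1)%:E = (pi : R)%:E)%E.
  rewrite (ge0_symfun_integralT g0) //.
  - rewrite -set_itvcy integral0y_oneDsqr -EFinM; congr EFin; by field.
  - exact: continuous_oneDsqrV.
  - by move=> x /=; rewrite /oneDsqr sqrrN.
have ig : intg (fun x : R => (oneDsqr x)^-1).
  apply/integrableP; split.
    by apply/measurable_EFinP; exact: continuous_measurable_fun (@continuous_oneDsqrV R).
  under eq_integral => x _ do rewrite /= ger0_norm //.
  by rewrite E ltry.
by split => //; apply: EFin_inj; rewrite -EFin_I.
Qed.

(** With this normalization the transform is an isometric involution. *)
Definition c0 : R := (Num.sqrt (2 * pi))^-1.

Lemma c0_gt0 : 0 < c0.
Proof. by rewrite invr_gt0 sqrtr_gt0 mulr_gt0 // pi_gt0. Qed.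

Lemma c0_sq : c0 ^+ 2 = (2 * pi)^-1.
Proof. by rewrite exprVn sqr_sqrtr // mulr_ge0 // ltW // pi_gt0. Qed.

Definition hart1 (f : R -> R) (xi : R) : R := c0 * \int[mu]_x (cas (xi * x) * f x).

Implicit Types f g w : R -> R.

Lemma mcasM xi : mfun1 (fun x => cas (xi * x)).
Proof. by apply: (measurableT_comp measurable_cas); exact: measurable_funM. Qed.

Lemma int_cas f xi : intg f -> intg (fun x => cas (xi * x) * f x).
Proof. by move=> hf; apply: (@intg_bdd _ 2) => //; [exact: mcasM|move=> x; exact: cas_le2]. Qed.

Lemma hart1_bd f xi : intg f -> `|hart1 f xi| <= 2 * c0 * \int[mu]_x `|f x|.
Proof.
move=> hf; rewrite /hart1 normrM (gtr0_norm c0_gt0) (mulrC 2) -mulrA ler_pM2l ?c0_gt0 //.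
apply: le_trans (I_abs (int_cas xi hf)) _; rewrite -I_Z; last exact: intg_abs.
apply: I_le; first exact/intg_abs/int_cas.
  exact/intgZ/intg_abs.
by move=> x; rewrite normrM ler_wpM2r // cas_le2.
Qed.

(** Dominated convergence. *)
Lemma hart1_cont f : intg f -> continuous (hart1 f).
Proof.
move=> hf xi; apply: cvgM; first exact: cvg_cst.
have := @continuity_under_integral R _ _ mu (fun xi x => cas (xi * x) * f x) setT measurableT
  (xi - 1) (xi + 1) (fun x _ => int_cas x hf) _ (fun x => 2 * `|f x|) (intgZ 2 (intg_abs hf)).
move=> /(_ _ _ xi); apply.
- apply: ae_all => x _ y _; apply: cvgM; last exact: cvg_cst.
  apply: (@continuous_comp _ _ _ (fun y : R => y * x) cas); last exact: continuous_cas.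
  by apply: cvgM; [exact: cvg_id|exact: cvg_cst].
- move=> x _; apply: ae_all => y _; rewrite normrM ler_wpM2r //; exact: cas_le2.
- by rewrite inE /= in_itv /=; apply/andP; split; lra.
Qed.

Lemma hart1_m f : intg f -> mfun1 (hart1 f).
Proof. by move=> hf; exact: continuous_measurable_fun (hart1_cont hf). Qed.

Lemma hart1D f g xi : intg f -> intg g ->
  hart1 (fun x => f x + g x) xi = hart1 f xi + hart1 g xi.
Proof.
move=> hf hg; rewrite /hart1 -mulrDr -I_D; try exact: int_cas.
by congr (_ * _); apply: I_eq => x; rewrite mulrDr.
Qed.

Lemma hart1Z a f xi : intg f -> hart1 (fun x => a * f x) xi = a * hart1 f xi.
Proof.
move=> hf; rewrite /hart1 [RHS]mulrCA -(I_Z a); last exact: int_cas.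
by congr (_ * _); apply: I_eq => x; rewrite mulrCA.
Qed.

Lemma hart1B f g xi : intg f -> intg g ->
  hart1 (fun x => f x - g x) xi = hart1 f xi - hart1 g xi.
Proof.
move=> hf hg; rewrite /hart1 -mulrBr -I_B; try exact: int_cas.
by congr (_ * _); apply: I_eq => x; rewrite mulrBr.
Qed.

(** Fubini, the kernel cas (x y) being symmetric. *)
Lemma hart1_sym f g : intg f -> intg g ->
  \int[mu]_x (hart1 f x * g x) = \int[mu]_x (f x * hart1 g x).
Proof.
move=> hf hg.
have [] := @fubiniR (fun x y => cas (x * y) * f y * g x) (fun x => `|g x|) (fun y => 2 * `|f y|).
- apply: measurable_funM; last exact: (measurableT_comp (intg_m hg) measurable_fst).
  apply: measurable_funM; last exact: (measurableT_comp (intg_m hf) measurable_snd).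
  apply: (measurableT_comp measurable_cas); apply: measurable_funM.
    exact: measurable_fst.
  exact: measurable_snd.
- exact: intg_abs.
- exact/intgZ/intg_abs.
- by move=> x; exact: normr_ge0.
- by move=> y; rewrite mulr_ge0.
- by move=> x y; rewrite !normrM mulrC ler_wpM2l // ler_wpM2r // cas_le2.
move=> _ _ i1 i2 E.
have -> : \int[mu]_x (hart1 f x * g x) = c0 * \int[mu]_x \int[mu]_y (cas (x * y) * f y * g x).
  rewrite -I_Z //; apply: I_eq => x; rewrite /hart1 -mulrA; congr (_ * _).
  rewrite mulrC -I_Z; last exact: int_cas.
  by apply: I_eq => y; rewrite mulrC.
rewrite E -I_Z //; apply: I_eq => y; rewrite /hart1 mulrCA; congr (_ * _).
rewrite -I_Z; last exact: int_cas.
by apply: I_eq => x; rewrite (mulrC x); ring.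
Qed.

Lemma hart1_exp (e x y : R) : 0 < e ->
  intg (fun xi => cas (x * xi) * expR (- (e * `|xi|))) /\
  hart1 (fun xi => cas (x * xi) * expR (- (e * `|xi|))) y = c0 * (2 * e / (e ^+ 2 + (x - y) ^+ 2)).
Proof.
move=> e0; split; first exact/int_cas/int_exp.
have [i1 E1] := int_exp_cos (x - y) e0; have [i2 E2] := int_exp_sin (x + y) e0.
rewrite /hart1 -E1 -[X in _ = _ * X]addr0 -E2 -I_D //; congr (_ * _).
apply: I_eq => xi; rewrite mulrA (mulrC (cas (y * xi))) casM.
by rewrite -mulrBl -mulrDl (mulrDl (cos _)).
Qed.

(** The Poisson kernel (e / pi) / (e^2 + z^2), written as [hart1_exp] produces
    it. *)
Definition pois (e z : R) : R := c0 ^+ 2 * (2 * e / (e ^+ 2 + z ^+ 2)).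
Definition pois1 (s : R) : R := pi^-1 * (1 + s ^+ 2)^-1.

Lemma intg_pois1 : intg pois1. Proof. by apply: intgZ; case: int_cauchy. Qed.

Lemma pois1_ge0 s : 0 <= pois1 s.
Proof.
rewrite /pois1 mulr_ge0 // invr_ge0; first exact: ltW (pi_gt0 R).
by rewrite addr_ge0 // sqr_ge0.
Qed.

Lemma I_pois1 : \int[mu]_s pois1 s = 1.
Proof. by have [i1 E] := int_cauchy; rewrite /pois1 I_Z // E mulVf // gt_eqF // pi_gt0. Qed.

(** Rescaling turns the kernel of width [e] into the fixed kernel [pois1], the
    form in which dominated convergence applies. *)
Lemma pois_conv w (M e x : R) : mfun1 w -> (forall y, `|w y| <= M) -> 0 < e ->
  [/\ intg (fun s => w (e * s + x) * pois1 s), intg (fun y => w y * pois e (x - y)) &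
  \int[mu]_y (w y * pois e (x - y)) = \int[mu]_s (w (e * s + x) * pois1 s)].
Proof.
move=> mw wM e0.
have i1 : intg (fun s => w (e * s + x) * pois1 s).
  apply: (@intg_bdd _ M) => //; last exact: intg_pois1.
  apply: (measurableT_comp mw); apply: measurable_funD => //; exact: measurable_funM.
have ei : 0 < e^-1 by rewrite invr_gt0.
have [i2 E2] := I_dilate ei i1.
have [i3 E3] := I_shift (- x) i2.
have Ey y : w y * pois e (x - y) = e^-1 * (w (e * (e^-1 * (y - x)) + x) * pois1 (e^-1 * (y - x))).
  have -> : e * (e^-1 * (y - x)) + x = y by field; rewrite gt_eqF.
  rewrite [RHS]mulrCA; congr (_ * _).
  rewrite /pois /pois1 c0_sq.
  have en : e != 0 by rewrite gt_eqF.
  have pn : (pi : R) != 0 by rewrite gt_eqF // pi_gt0.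
  have d0 : e ^+ 2 + (x - y) ^+ 2 != 0 by rewrite gt_eqF // ltr_pwDl ?exprn_gt0 // sqr_ge0.
  have d1 : 1 + (e^-1 * (y - x)) ^+ 2 != 0 by rewrite gt_eqF // ltr_pwDl // sqr_ge0.
  have -> : 1 + (e^-1 * (y - x)) ^+ 2 = (e ^+ 2 + (x - y) ^+ 2) / e ^+ 2 by field; rewrite en.
  move: d0; move: (e ^+ 2 + _) => D d0; move: pn; move: (pi : R) => p pn.
  by field; rewrite ?d0 ?en ?pn.
split => //.
- by rewrite (funext Ey); exact: intgZ.
- by rewrite (I_eq Ey) I_Z // E3.
Qed.

Lemma pois_conv_bd w (M e x : R) : mfun1 w -> (forall y, `|w y| <= M) -> 0 < e ->
  `|\int[mu]_y (w y * pois e (x - y))| <= M.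
Proof.
move=> mw wM e0; have [i1 i2 ->] := pois_conv x mw wM e0.
apply: le_trans (I_abs i1) _.
rewrite -[leRHS]mulr1 -I_pois1 -I_Z; last exact: intg_pois1.
apply: I_le; [exact: intg_abs|exact/intgZ/intg_pois1|].
by move=> s; rewrite normrM (ger0_norm (pois1_ge0 s)) ler_wpM2r // pois1_ge0.
Qed.

Definition ep (n : nat) : R := n.+1%:R^-1.
Lemma ep_gt0 n : 0 < ep n. Proof. by rewrite invr_gt0. Qed.
Lemma ep_cvg : ep n @[n --> \oo] --> 0.
Proof. exact: cvg_harmonic. Qed.

Lemma pois_conv_cvg w (M x : R) : continuous w -> (forall y, `|w y| <= M) ->
  \int[mu]_y (w y * pois (ep n) (x - y)) @[n --> \oo] --> w x.
Proof.
move=> cw wM; have mw := continuous_measurable_fun cw.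
have -> : (fun n => \int[mu]_y (w y * pois (ep n) (x - y))) =
          (fun n => \int[mu]_s (w (ep n * s + x) * pois1 s)).
  by apply/funext => n; have [_ _ ->] := pois_conv x mw wM (ep_gt0 n).
have -> : w x = \int[mu]_s (w x * pois1 s).
  by rewrite I_Z ?I_pois1 ?mulr1 //; exact: intg_pois1.
have [] := @dct R (fun n s => w (ep n * s + x) * pois1 s) (fun s => w x * pois1 s) (fun s => M * pois1 s).
- by move=> n; have [/intg_m ? _ _] := pois_conv x mw wM (ep_gt0 n).
- by apply: intg_m; apply: intgZ; exact: intg_pois1.
- apply: ae_all => s; apply: cvgM; last exact: cvg_cst.
  have hc : ep n * s + x @[n --> \oo] --> x.
    rewrite -[X in _ --> X]add0r -(mul0r s); apply: cvgD; last exact: cvg_cst.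
    by apply: cvgM; [exact: ep_cvg|exact: cvg_cst].
  exact: (cvg_comp _ _ hc (cw x)).
- by apply: intgZ; exact: intg_pois1.
- by move=> n s; rewrite normrM (ger0_norm (pois1_ge0 s)) ler_wpM2r // pois1_ge0.
by [].
Qed.

(** By symmetry the damped inverse transform of [hart1 f] pairs [f] with the
    transform of a damped character, which [hart1_exp] computes. *)
Lemma hart1_abel f (e x : R) : intg f -> 0 < e ->
  hart1 (fun xi => expR (- (e * `|xi|)) * hart1 f xi) x = \int[mu]_y (f y * pois e (x - y)).
Proof.
move=> hf e0; have [i1 _] := hart1_exp x 0 e0.
rewrite {1}/hart1.
rewrite (@I_eq _ _ (fun xi => hart1 f xi * (cas (x * xi) * expR (- (e * `|xi|))))); last by move=> xi; ring.
rewrite hart1_sym // -I_Z; last first.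
  apply: (@intg_dom _ _ (fun y => (2 * c0 * \int[mu]_xi `|cas (x * xi) * expR (- (e * `|xi|))|) * `|f y|)).
  - by apply: measurable_funM; [exact: intg_m|exact: hart1_m].
  - exact/intgZ/intg_abs.
  - by move=> y; rewrite normrM mulrC ler_wpM2r // hart1_bd.
apply: I_eq => y; have [_ ->] := hart1_exp x y e0.
rewrite /pois; ring.
Qed.

Lemma L2_of_bdd f (M : R) : intg f -> (forall x, `|f x| <= M) -> L2p f.
Proof.
move=> hf fM; split; first exact: intg_m.
by apply: (@intg_bdd _ M) => //; exact: intg_m.
Qed.

Lemma expabs_le1 (e x : R) : 0 < e -> `|expR (- (e * `|x|))| <= 1.
Proof.
by move=> e0; rewrite gtr0_norm ?expR_gt0 // -expR0 ler_expR oppr_le0 mulr_ge0 // ltW.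
Qed.

(** The damped energy of [hart1 g] equals the pairing of [g] with its Poisson
    regularization. As the damping is removed the right side tends to the
    integral of g^2; Fatou's lemma then shows that [hart1 g] is
    square-integrable, and dominated convergence computes its norm. *)
Lemma plancherel_cont g (M : R) : intg g -> continuous g -> (forall x, `|g x| <= M) ->
  L2p (hart1 g) /\ ip (hart1 g) (hart1 g) = ip g g.
Proof.
move=> ig cg gM.
have mg := intg_m ig.
have [M0 mh] : 0 <= M /\ mfun1 (hart1 g).
  by split; [exact: le_trans (gM 0)|exact: hart1_m].
pose C := 2 * c0 * \int[mu]_x `|g x|.
have hC xi : `|hart1 g xi| <= C by exact: hart1_bd.
pose E n (xi : R) := expR (- (ep n * `|xi|)).
have iE n : intg (E n) by exact/int_exp/ep_gt0.
have ih n : intg (fun xi => E n xi * hart1 g xi).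
  have -> : (fun xi => E n xi * hart1 g xi) = (fun xi => hart1 g xi * E n xi).
    by apply/funext => xi; rewrite mulrC.
  exact: (@intg_bdd _ C).
have ihh n : intg (fun xi => E n xi * hart1 g xi ^+ 2).
  have -> : (fun xi => E n xi * hart1 g xi ^+ 2) = (fun xi => hart1 g xi * (E n xi * hart1 g xi)).
    by apply/funext => xi; ring.
  exact: (@intg_bdd _ C).
(* The damped energy, written as a pairing of g with its Poisson
   regularization. *)
have EJ n : \int[mu]_xi (E n xi * hart1 g xi ^+ 2) =
     \int[mu]_x (g x * \int[mu]_y (g y * pois (ep n) (x - y))).
  rewrite (@I_eq _ _ (fun xi => hart1 g xi * (E n xi * hart1 g xi))); last by move=> xi; ring.
  rewrite hart1_sym //; apply: I_eq => x; rewrite hart1_abel //; exact: ep_gt0.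
have mP n : mfun1 (fun x => \int[mu]_y (g y * pois (ep n) (x - y))).
  have -> : (fun x => \int[mu]_y (g y * pois (ep n) (x - y))) =
            hart1 (fun xi => E n xi * hart1 g xi).
    by apply/funext => x; rewrite hart1_abel //; exact: ep_gt0.
  exact: hart1_m.
have [_ cJ] : intg (fun x => g x * g x) /\
   \int[mu]_xi (E n xi * hart1 g xi ^+ 2) @[n --> \oo] --> \int[mu]_x (g x * g x).
  rewrite (funext EJ); apply: (@dct _ _ _ (fun x => M * `|g x|)).
  - by move=> n; apply: measurable_funM => //; exact: mP.
  - exact: measurable_funM.
  - apply: ae_all => x; apply: cvgM; first exact: cvg_cst.
    by apply: pois_conv_cvg => //; exact: gM.
  - exact/intgZ/intg_abs.
  - move=> n x; rewrite normrM mulrC ler_wpM2r //; apply: pois_conv_bd => //; exact: ep_gt0.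
have Ecv xi : E n xi * hart1 g xi ^+ 2 @[n --> \oo] --> hart1 g xi ^+ 2.
  rewrite -[X in _ --> X]mul1r; apply: cvgM; last exact: cvg_cst.
  have hc : - (ep n * `|xi|) @[n --> \oo] --> 0.
    rewrite -[X in _ --> X]oppr0 -(mul0r `|xi|); apply: cvgN; apply: cvgM; last exact: cvg_cst.
    exact: ep_cvg.
  rewrite -(@expR0 R); exact: (cvg_comp _ _ hc (@continuous_expR R 0)).
have E1 n xi : `|E n xi| <= 1 by apply: expabs_le1; exact: ep_gt0.
have [L _] : intg (fun xi => hart1 g xi ^+ 2) /\ \int[mu]_xi (hart1 g xi ^+ 2) <= \int[mu]_x (M * `|g x|).
  apply: (@fatouR _ (fun n xi => E n xi * hart1 g xi ^+ 2)) => //.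
  - exact: measurable_funX.
  - by move=> n xi; rewrite mulr_ge0 ?expR_ge0 ?sqr_ge0.
  - by move=> xi; exact: sqr_ge0.
  - exact: ae_all.
  - move=> n; rewrite EJ; apply: I_le.
    + apply: (@intg_dom _ _ (fun x => M * `|g x|)).
      * by apply: measurable_funM => //; exact: mP.
      * exact/intgZ/intg_abs.
      * move=> x; rewrite normrM mulrC ler_wpM2r //; apply: pois_conv_bd => //; exact: ep_gt0.
    + exact/intgZ/intg_abs.
    + move=> x; apply: le_trans (ler_norm _) _; rewrite normrM mulrC ler_wpM2r //.
      by apply: pois_conv_bd => //; exact: ep_gt0.
split; first by split.
have [_ cJ'] : intg (fun xi => hart1 g xi ^+ 2) /\
   \int[mu]_xi (E n xi * hart1 g xi ^+ 2) @[n --> \oo] --> \int[mu]_xi (hart1 g xi ^+ 2).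
  apply: (@dct _ _ _ (fun xi => hart1 g xi ^+ 2)) => //.
  - by move=> n; exact: intg_m.
  - exact: measurable_funX.
  - exact: ae_all.
  - by move=> n xi; rewrite normrM (ger0_norm (sqr_ge0 (hart1 g xi))) ler_piMl // sqr_ge0.
rewrite ipE ip_def; exact: (cvg_unique _ cJ' cJ).
Qed.

End Kernels.

(** * The Hartley transform on square-integrable functions *)

Section HartleyL2.
Context {R : realType}.
Local Notation mu := (@lebesgue_measure R).
Implicit Types (f g h u v w : R -> R).

Definition clamp (c y : R) : R := Num.max (- c) (Num.min c y).

Lemma clamp_bd c y : 0 <= c -> `|clamp c y| <= c.
Proof.
move=> c0; rewrite /clamp ler_norml le_max lexx /= ge_max ge_min lexx /= andbT; lra.
Qed.

Lemma clamp_id c y : `|y| <= c -> clamp c y = y.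
Proof. by rewrite ler_norml => /andP[h1 h2]; rewrite /clamp min_r // max_r. Qed.

Lemma clamp_lip c x y : `|clamp c x - clamp c y| <= `|x - y|.
Proof.
rewrite /clamp.
have h1 a b : `|Num.min c a - Num.min c b| <= `|a - b|.
  have := ler_norm (a - b); have := ler_norm (b - a); rewrite (distrC b a) => *.
  have := normr_ge0 (a - b) => *.
  by rewrite ler_norml; case: (lerP c a) => ?; case: (lerP c b) => ?; apply/andP; split; lra.
have h2 a b : `|Num.max (- c) a - Num.max (- c) b| <= `|a - b|.
  have := ler_norm (a - b); have := ler_norm (b - a); rewrite (distrC b a) => *.
  have := normr_ge0 (a - b) => *.
  by rewrite ler_norml; case: (lerP (- c) a) => ?; case: (lerP (- c) b) => ?; apply/andP; split; lra.
exact: le_trans (h2 _ _) (h1 _ _).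
Qed.

Lemma clamp_le c y : 0 <= c -> `|clamp c y| <= `|y|.
Proof.
move=> c0; have := clamp_lip c y 0.
by rewrite (clamp_id (y := 0)) ?normr0 // !subr0.
Qed.

Lemma clamp_cont c : continuous (clamp c).
Proof.
move=> x; apply/cvgrPdist_le => e e0; near=> y.
apply: le_trans (clamp_lip c x y) _; near: y.
exact: cvgr_dist_le.
Unshelve. all: end_near. Qed.

Definition box (n : R) (x : R) : R := \1_(`[- n, n]%classic) x.

Lemma box_m n : mfun1 (box n).
Proof. exact: measurable_indic. Qed.

Lemma boxE (n x : R) : box n x = (`|x| <= n)%R%:R.
Proof. by rewrite /box indicE mem_setE in_itv /= ler_norml. Qed.

Lemma box_le1 n x : `|box n x| <= 1.
Proof. by rewrite boxE; case: (leP `|x| n) => _; rewrite /= ?normr1 ?normr0. Qed.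

Lemma box_int n : intg (box n).
Proof.
exact: integrable_indic_itv.
Qed.

Lemma box_L2 n : L2p (box n).
Proof. exact: (L2_of_bdd (box_int n) (box_le1 n)). Qed.

Lemma box_cvg (x : R) : box n%:R x @[n --> \oo] --> (1 : R).
Proof.
apply: cvg_near_cst; exists (Num.truncn `|x|).+1 => // n /= hn.
rewrite boxE; have /andP[_ h] := truncn_itv (normr_ge0 x).
by rewrite (le_trans (ltW h)) // ler_nat.
Qed.

Definition tr (n : nat) u (x : R) : R := box n%:R x * u x.

Lemma tr_m n u : mfun1 u -> mfun1 (tr n u).
Proof. by move=> mu_; apply: measurable_funM => //; exact: box_m. Qed.

Lemma tr_L2 n u : L2p u -> L2p (tr n u).
Proof. by move=> Lu; apply: (@L2_bdd _ 1) => //; [exact: box_m|exact: box_le1]. Qed.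

Lemma tr_intg n u : L2p u -> intg (tr n u).
Proof. by move=> Lu; exact: L2_mul (box_L2 _) Lu. Qed.

Lemma tr_cvg u x : tr n u x @[n --> \oo] --> u x.
Proof.
have H : box n%:R x * u x @[n --> \oo] --> 1 * u x.
  by apply: cvgM; [exact: box_cvg|exact: cvg_cst].
by rewrite mul1r in H.
Qed.

Lemma tr_le n u x : `|tr n u x| <= `|u x|.
Proof. by rewrite /tr normrM ler_piMl // box_le1. Qed.

Definition L2cvg (F : nat -> R -> R) f := nm (fun x => F n x - f x) @[n --> \oo] --> 0.

(** Truncation to [-n, n] links square-integrable functions to the integral
    transform. *)
Lemma tr_L2cvg u : L2p u -> L2cvg (tr ^~ u) u.
Proof.
move=> Lu; apply: (@L2_dct _ _ _ (fun x => `|u x|)).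
- by move=> n; exact: tr_m (L2_m Lu).
- exact: L2_m.
- by apply: ae_all => x; exact: tr_cvg.
- exact: L2_abs.
- by move=> n x; exact: tr_le.
- by [].
Qed.

Lemma L2cvg_nm F f : (forall n, L2p (F n)) -> L2p f -> L2cvg F f ->
  nm (F n) @[n --> \oo] --> nm f.
Proof.
move=> LF Lf c; apply/cvgrPdist_le => e e0.
move/cvgrPdist_le: c => /(_ e e0); apply: filterS => n.
rewrite sub0r normrN ger0_norm ?nm_ge0 // => h; apply: le_trans h.
have SN := @L2_seminorm R.
have h1 := snB_le SN (LF n) Lf; have h2 := snB_le SN Lf (LF n).
rewrite (snBC SN Lf (LF n)) in h2.
rewrite ler_norml; apply/andP; split.
  by rewrite lerNl opprB lerBlDl.
by rewrite lerBlDl.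
Qed.

Lemma L2cvg_ip F f G g : (forall n, L2p (F n)) -> L2p f -> (forall n, L2p (G n)) -> L2p g ->
  L2cvg F f -> L2cvg G g -> ip (F n) (G n) @[n --> \oo] --> ip f g.
Proof.
move=> LF Lf LG Lg cF cG.
have cn := L2cvg_nm LG Lg cG.
have H : nm (fun x => F n x - f x) * nm (G n) + nm f * nm (fun x => G n x - g x) @[n --> \oo]
    --> 0 * nm g + nm f * 0.
  by apply: cvgD; apply: cvgM => //; exact: cvg_cst.
rewrite mul0r mulr0 addr0 in H.
apply/cvgrPdist_le => e e0; move/cvgrPdist_le: H => /(_ e e0); apply: filterS => n.
rewrite sub0r normrN => h; apply: (le_trans _ h).
have E : ip f g - ip (F n) (G n) =
  - (ip (fun x => F n x - f x) (G n) + ip f (fun x => G n x - g x)).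
  rewrite ipBl // ipBr //; ring.
rewrite E normrN; apply: le_trans (ler_normD _ _) _.
rewrite (ger0_norm (addr_ge0 (mulr_ge0 (nm_ge0 _) (nm_ge0 _)) (mulr_ge0 (nm_ge0 _) (nm_ge0 _)))).
by apply: lerD; apply: cauchy_schwarz => //; exact: L2_B.
Qed.

Lemma L2cvg_unique F f g : (forall n, L2p (F n)) -> L2p f -> L2p g ->
  L2cvg F f -> L2cvg F g -> aeq f g.
Proof.
move=> LF Lf Lg cf cg.
have SN := @L2_seminorm R.
have H : nm (fun x => f x - g x) <= 0.
  apply/ler_addgt0Pr => e e0; rewrite add0r.
  have e20 : 0 < e / 2 by lra.
  have /cvgrPdist_le /(_ _ e20) [n1 _ H1] := cf.
  have /cvgrPdist_le /(_ _ e20) [n2 _ H2] := cg.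
  set n := maxn n1 n2.
  have := H1 n (leq_maxl _ _); have := H2 n (leq_maxr _ _).
  rewrite /= !sub0r !normrN !ger0_norm ?nm_ge0 // => h2 h1.
  have := snT SN Lf (LF n) Lg; rewrite (snBC SN Lf (LF n)).
  rewrite (_ : f - g = (fun x => f x - g x)) // (_ : F n - f = (fun x => F n x - f x)) // (_ : F n - g = (fun x => F n x - g x)) //; lra.
have H0 : nm (fun x => f x - g x) = 0 by apply/le_anti; rewrite H nm_ge0.
by apply: ae_imp (nm_eq0 (L2_B Lf Lg) H0) => x /eqP; rewrite subr_eq0 => /eqP.
Qed.

(** Approximation in both norms at once by a bounded continuous function:
    truncate in value and in space, approximate the result on a compact
    interval, then restore the bound and the support by clamping and by a
    continuous cutoff. Boundedness turns closeness in the first norm into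
    closeness in the second. *)
Lemma dense_cont f (e : R) : intg f -> L2p f -> 0 < e ->
  exists g, exists M : R, [/\ continuous g, forall x, `|g x| <= M, intg g,
    \int[mu]_x `|f x - g x| <= e & nm (fun x => f x - g x) <= e].
Proof.
move=> hf Lf e0.
have e20 : 0 < e / 2 by lra.
pose fn (n : nat) x := tr n (fun x => clamp n%:R (f x)) x.
have mfn n : mfun1 (fn n).
  apply: tr_m; apply: measurableT_comp (intg_m hf).
  exact: continuous_measurable_fun (@clamp_cont n%:R).
have fnle n x : `|fn n x| <= `|f x|.
  by apply: le_trans (tr_le _ _ _) _; exact: clamp_le.
have fncv x : fn n x @[n --> \oo] --> f x.
  have c1 : clamp n%:R (f x) @[n --> \oo] --> f x.
    apply: cvg_near_cst; exists (Num.truncn `|f x|).+1 => // n /= hn.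
    apply: clamp_id; have /andP[_ h] := truncn_itv (normr_ge0 (f x)).
    by rewrite (le_trans (ltW h)) // ler_nat.
  by rewrite -[X in _ --> X]mul1r; apply: cvgM => //; exact: box_cvg.
have [_ c1] : intg (fun=> 0 : R) /\ \int[mu]_x `|fn n x - f x| @[n --> \oo] --> \int[mu]_x (0 : R).
  apply: (@dct _ _ _ (fun x => 2 * `|f x|)).
  - move=> n; apply: measurableT_comp => //; apply: measurable_funB; [exact: mfn|exact: intg_m].
  - exact: measurable_cst.
  - apply: ae_all => x; rewrite -[X in _ --> X](normr0 R) -(subrr (f x)).
    by apply: cvg_norm; apply: cvgB => //; exact: cvg_cst.
  - exact/intgZ/intg_abs.
  - move=> n x; rewrite normr_id; apply: le_trans (ler_normB _ _) _.
    by have := fnle n x; lra.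
rewrite I_0 in c1.
have c2 : nm (fun x => fn n x - f x) @[n --> \oo] --> 0.
  apply: (@L2_dct _ _ _ (fun x => `|f x|)) => //; [exact: L2_m|exact: ae_all|exact: L2_abs].
have [n [Hn1 Hn2]] : exists n, \int[mu]_x `|fn n x - f x| <= e / 2 /\ nm (fun x => fn n x - f x) <= e / 2.
  have /cvgrPdist_le /(_ _ e20) [n1 _ H1] := c1.
  have /cvgrPdist_le /(_ _ e20) [n2 _ H2] := c2.
  exists (maxn n1 n2).
  have := H1 _ (leq_maxl n1 n2); have := H2 _ (leq_maxr n1 n2).
  rewrite /= !sub0r !normrN !ger0_norm ?nm_ge0 //.
  by apply: I_ge0 => x.
(* The index n bounds both the values and the support of the truncation. *)
set M : R := n%:R.
have M0 : 0 <= M by [].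
set p := fn n in Hn1 Hn2.
have ip_ : intg p by apply: (intg_dom (mfn n) (intg_abs hf)).
have Lp : L2p p by apply: (L2_dom (mfn n) Lf).
have pM x : `|p x| <= M.
  by rewrite /p /fn; apply: le_trans (tr_le _ _ _) _; exact: clamp_bd.
have p0 x : M < `|x| -> p x = 0.
  by move=> h; rewrite /p /fn /tr boxE leNgt h /= mul0r.
pose E : set R := `[- (M + 1), M + 1]%classic.
have mE : measurable E by exact: measurable_itv.
have [g_ [cg ig cvg]] : exists g_ : (R -> R)^nat, [/\ forall n, continuous (g_ n),
    forall n, mu.-integrable E (EFin \o g_ n) &
    (\int[mu]_(z in E) `|(p z - g_ n z)%:E|)%E @[n --> \oo] --> 0%E].
  apply: (@approximation_continuous_integrable R E p) => //.
  - have H : (@lebesgue_measure R E < +oo)%E.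
      by rewrite /E lebesgue_measure_itv /=; case: ifP => // _; rewrite ltry.
    exact: H.
  - exact: integrableS ip_.
pose dl := Num.min (e / 2) ((e / 2) ^+ 2 / (2 * M + 1)).
have dl0 : 0 < dl by rewrite lt_min e20 divr_gt0 ?exprn_gt0 // ltr_wpDl // mulr_ge0.
have [k Hk] : exists k, (\int[mu]_(z in E) `|(p z - g_ k z)%:E| <= dl%:E)%E.
  have /fine_cvgP[[n1 _ F1]] := cvg.
  move=> /cvgrPdist_le /(_ _ dl0) [n2 _ H2].
  exists (maxn n1 n2).
  have := F1 _ (leq_maxl n1 n2); have := H2 _ (leq_maxr n1 n2).
  rewrite /= sub0r normrN => h1 h2; rewrite -(fineK h2) lee_fin.
  by apply: le_trans h1; exact: ler_norm.
(* A continuous cutoff that is 1 for |x| <= M and 0 for |x| >= M + 1. *)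
pose chi (x : R) : R := 2^-1 * (1 + clamp 1 (2 * (M + 1 - `|x|) - 1)).
have chi01 x : 0 <= chi x <= 1.
  by have := clamp_bd (2 * (M + 1 - `|x|) - 1) (@ler01 R); rewrite ler_norml /chi => /andP[h1 h2]; apply/andP; split; lra.
pose h x := chi x * clamp M (g_ k x).
have ch : continuous h.
  move=> x; apply: cvgM.
    apply: cvgM; first exact: cvg_cst.
    apply: cvgD; first exact: cvg_cst.
    have hc : {for x, continuous (fun x : R => 2 * (M + 1 - `|x|) - 1)}.
      apply: cvgB; last exact: cvg_cst.
      apply: cvgM; first exact: cvg_cst.
      by apply: cvgB; [exact: cvg_cst|exact: cvg_norm].
    exact: (cvg_comp _ _ hc (@clamp_cont 1 _)).
  exact: (cvg_comp _ _ (cg k x) (@clamp_cont M (g_ k x))).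
have hM x : `|h x| <= M.
  rewrite /h normrM; have /andP[h1 h2] := chi01 x.
  by rewrite ger0_norm // -[leRHS]mul1r ler_pM // clamp_bd.
have h0 x : M + 1 < `|x| -> h x = 0.
  move=> hx; rewrite /h /chi /clamp min_r; last lra.
  by rewrite max_l; [rewrite subrr mulr0 mul0r|lra].
have ih : intg h.
  apply: (@intg_dom _ _ (fun x => M * box (M + 1) x)).
  - exact: continuous_measurable_fun.
  - exact/intgZ/box_int.
  - move=> x; rewrite boxE; case: (lerP `|x| (M + 1)) => hx /=; first by rewrite mulr1.
    by rewrite h0 // normr0 mulr0.
pose dd := (fun x => `|p x - g_ k x|) \_ E.
have dE : (\int[mu]_x (dd x)%:E <= dl%:E)%E.
  rewrite (_ : (\int[mu]_x (dd x)%:E)%E = (\int[mu]_(z in E) `|(p z - g_ k z)%:E|)%E) //.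
  rewrite [RHS]integral_mkcond; apply: eq_integral => x _.
  by rewrite /dd !patchE; case: ifP.
have dd0 x : 0 <= dd x by rewrite /dd patchE; case: ifP.
have md : mfun1 dd.
  apply: (measurable_restrict _ mE measurableT).1.
  rewrite setTI; apply: measurableT_comp => //; apply: measurable_funB.
    exact: measurable_funTS (mfn n).
  exact: measurable_funTS (continuous_measurable_fun (cg k)).
have id : intg dd.
  apply/integrableP; split; first exact/measurable_EFinP.
  under eq_integral => x _ do rewrite /= ger0_norm //.
  by apply: le_lt_trans dE _; rewrite ltry.
rewrite EFin_I // lee_fin in dE.
have key x : `|p x - h x| <= dd x.
  rewrite /dd patchE mem_setE in_itv /= -ler_norml; case: (lerP `|x| (M + 1)) => hx.
    have [xM|Mx] := lerP `|x| M.
      have -> : h x = clamp M (g_ k x).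
        rewrite /h /chi {1}/clamp min_l; last lra.
        by rewrite max_r; [rewrite -[1 + 1]/(2) mulVf ?mul1r|lra].
      by rewrite -{1}(clamp_id (pM x)); exact: clamp_lip.
    rewrite p0 // !sub0r !normrN /h normrM; have /andP[h1 h2] := chi01 x.
    by rewrite ger0_norm // -[leRHS]mul1r ler_pM // clamp_le.
  by rewrite h0 // p0 ?subrr ?normr0 //; lra.
have iph : intg (fun x => `|p x - h x|) by exact/intg_abs/intgB.
have K1 : \int[mu]_x `|p x - h x| <= dl by apply: le_trans dE; exact: I_le.
have Lph : L2p (fun x => p x - h x) by apply: L2_B => //; exact: L2_of_bdd ih hM.
have K2 : nm (fun x => p x - h x) <= e / 2.
  rewrite nm_le; last exact: ltW.
  apply: (@le_trans _ _ ((2 * M) * dl)).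
    apply: le_trans (ler_wpM2l _ K1); last by rewrite mulr_ge0.
    rewrite -I_Z // ipE; apply: I_le; [by case: Lph|exact: intgZ|].
    move=> x; rewrite -(@real_normK _ (p x - h x)) ?num_real // expr2 ler_wpM2r //.
    by apply: le_trans (ler_normB _ _) _; have := pM x; have := hM x; lra.
  have d2 : dl <= (e / 2) ^+ 2 / (2 * M + 1) by rewrite /dl ge_min lexx orbT.
  rewrite ler_pdivlMr in d2; last by rewrite ltr_wpDl // mulr_ge0.
  by apply: le_trans d2; rewrite mulrDr mulr1 (mulrC dl) lerDl ltW.
exists h, M; split => //.
- apply: le_trans (_ : \int[mu]_x (`|p x - f x| + `|p x - h x|) <= _).
    apply: I_le; [exact/intg_abs/intgB|apply: intgD => //; exact/intg_abs/intgB|].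
    by move=> x; rewrite (distrC (p x)) -[f x - h x](subrKA (p x)) ler_normD.
  rewrite I_D //; last exact/intg_abs/intgB.
  have : dl <= e / 2 by rewrite /dl ge_min lexx.
  move=> h1; have := le_trans K1 h1; move: Hn1; clear; lra.
- have SN := @L2_seminorm R.
  have Lh : L2p h by exact: L2_of_bdd ih hM.
  have := snT SN Lf Lp Lh; rewrite (snBC SN Lf Lp).
  rewrite (_ : f - h = (fun x => f x - h x)) // (_ : p - f = (fun x => p x - f x)) // (_ : p - h = (fun x => p x - h x)) //; lra.
Qed.

(** Fatou's lemma for the norm. *)
Lemma L2_trunc_le (F : nat -> R -> R) f C : (forall n, L2p (F n)) -> mfun1 f -> 0 <= C ->
  {ae mu, forall x, F n x @[n --> \oo] --> f x} -> (forall n, nm (F n) <= C) ->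
  L2p f /\ nm f <= C.
Proof.
move=> LF mf C0 cv HC.
have [] := @fatouR R (fun n x => F n x ^+ 2) (fun x => f x ^+ 2) (C ^+ 2).
- by move=> n; case: (LF n).
- exact: measurable_funX.
- by move=> n x; exact: sqr_ge0.
- by move=> x; exact: sqr_ge0.
- by apply: ae_imp cv => x cx; exact: (cvgM cx cx).
- by move=> n; rewrite -ipE -nm_le.
by move=> i1 i2; split; [split|rewrite nm_le // ipE].
Qed.

(** Approximation in the first norm makes the transforms converge at every
    point, approximation in the second one controls their norms. *)
Lemma dense_seq f (d : R) : intg f -> L2p f -> 0 < d -> exists G : nat -> R -> R,
  [/\ forall n, intg (G n), forall n, L2p (G n) /\ L2p (hart1 (G n)),
   forall n, nm (hart1 (G n)) = nm (G n),
   forall n, nm (fun x => f x - G n x) <= d * ep n &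
   forall xi, hart1 (G n) xi @[n --> \oo] --> hart1 f xi].
Proof.
move=> hf Lf d0.
have /choice[G HG] : forall n, exists g, exists M : R, [/\ continuous g, forall x, `|g x| <= M, intg g,
    \int[mu]_x `|f x - g x| <= d * @ep R n & nm (fun x => f x - g x) <= d * ep n].
  by move=> n; apply: dense_cont => //; rewrite mulr_gt0 // ep_gt0.
have iG n : intg (G n) by case: (HG n) => M [].
exists G; split => //.
- move=> n; case: (HG n) => M [cg gM ig _ _]; split; first exact: L2_of_bdd ig gM.
  by case: (plancherel_cont ig cg gM).
- by move=> n; case: (HG n) => M [cg gM ig _ _]; rewrite !nm_def; case: (plancherel_cont ig cg gM) => _ ->.
- by move=> n; case: (HG n) => M [].
- move=> xi; apply/cvgrPdist_le => e e0.
  have c : 2 * c0 * (d * @ep R n) @[n --> \oo] --> 2 * c0 * (d * 0 : R).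
    apply: cvgM; first exact: cvg_cst.
    by apply: cvgM; [exact: cvg_cst|exact: ep_cvg].
  rewrite !mulr0 in c.
  move/cvgrPdist_le: c => /(_ e e0); apply: filterS => n; rewrite sub0r normrN => h.
  rewrite -hart1B //; apply: le_trans (hart1_bd _ (intgB hf (iG n))) _.
  apply: le_trans (le_trans _ (ler_norm _)) h.
  case: (HG n) => M [_ _ _ h1 _].
  apply: ler_wpM2l => //; rewrite mulr_ge0 //; exact: ltW c0_gt0.
Qed.

(** The isometry for continuous functions passes to the limit as an
    inequality, by Fatou's lemma. *)
Lemma hart1_contraction f : intg f -> L2p f -> L2p (hart1 f) /\ nm (hart1 f) <= nm f.
Proof.
move=> hf Lf.
have H (d : R) : 0 < d -> L2p (hart1 f) /\ nm (hart1 f) <= nm f + d.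
  move=> d0; have [G [iG LG EG nG cG]] := dense_seq hf Lf d0.
  apply: (@L2_trunc_le (fun n => hart1 (G n))).
  - by move=> n; case: (LG n).
  - exact: hart1_m.
  - by rewrite addr_ge0 ?nm_ge0 // ltW.
  - exact: ae_all.
  - move=> n; rewrite EG; case: (LG n) => L1 _.
    have := snB_le (@L2_seminorm R) L1 Lf; rewrite (snBC (@L2_seminorm R) L1 Lf).
    move=> h; apply: le_trans h _; rewrite lerD2l; apply: le_trans (nG n) _.
    by rewrite ler_piMr //; [exact: ltW|rewrite invf_le1 // ler1n].
split; first by case: (H 1 ltr01).
by apply/ler_addgt0Pr => d d0; case: (H d d0).
Qed.

(** Applying the contraction property to the difference of [f] and a
    continuous approximation upgrades it to an isometry. *)
Lemma plancherel_L1L2 f : intg f -> L2p f -> L2p (hart1 f) /\ nm (hart1 f) = nm f.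
Proof.
move=> hf Lf; have [Lh hle] := hart1_contraction hf Lf; split => //.
apply/le_anti; rewrite hle /=; apply/ler_addgt0Pr => d d0.
have d20 : 0 < d / 2 by lra.
have [G [iG LG EG nG cG]] := dense_seq hf Lf d20.
have [L1 L2_] := LG 0%N.
have [L3 h3] := hart1_contraction (intgB hf (iG 0%N)) (L2_B Lf L1).
have SN := @L2_seminorm R.
have h4 := snB_le SN Lf L1; have h5 := snB_le SN L2_ Lh; rewrite (snBC SN L2_ Lh) EG in h5.
have h6 := nG 0%N; rewrite /ep invr1 mulr1 in h6.
have E : hart1 f - hart1 (G 0%N) = hart1 (fun x => f x - G 0%N x).
  by apply/funext => xi; rewrite hart1B.
rewrite E in h5.
rewrite (_ : f - G 0%N = (fun x => f x - G 0%N x)) // in h4.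
lra.
Qed.

Definition isH u w := L2p w /\ L2cvg (fun n => hart1 (tr n u)) w.

Lemma hart1_trB n m u : L2p u ->
  nm (hart1 (tr n u) - hart1 (tr m u)) = nm (tr n u - tr m u).
Proof.
move=> Lu.
have [_ <-] := plancherel_L1L2 (intgB (tr_intg n Lu) (tr_intg m Lu)) (L2_B (tr_L2 n Lu) (tr_L2 m Lu)).
by congr nm; apply/funext => x; rewrite hart1B //; exact: tr_intg.
Qed.

Lemma L2_hart1_tr n u : L2p u -> L2p (hart1 (tr n u)).
Proof. by move=> Lu; have [] := plancherel_L1L2 (tr_intg n Lu) (tr_L2 n Lu). Qed.

(** The transforms of the truncations form a Cauchy sequence, by Plancherel. *)
Lemma isH_ex u : L2p u -> exists w, isH u w.
Proof.
move=> Lu; have SN := @L2_seminorm R.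
have [|e e0|w Lw Hw] := @L2_complete R (fun n => hart1 (tr n u)).
- by move=> n; exact: L2_hart1_tr.
- have e20 : 0 < e / 2 by lra.
  have /cvgrPdist_le /(_ _ e20) [n0 _ H] := tr_L2cvg Lu.
  exists n0 => m n hm hn; rewrite hart1_trB //.
  apply: le_trans (snT SN (tr_L2 m Lu) Lu (tr_L2 n Lu)) _.
  rewrite (snBC SN Lu (tr_L2 n Lu)).
  have := H m hm; have := H n hn; rewrite /= !sub0r !normrN !ger0_norm ?nm_ge0 //.
  rewrite (_ : tr n u - u = (fun x => tr n u x - u x)) // (_ : tr m u - u = (fun x => tr m u x - u x)) //; lra.
exists w; split => //; apply/cvgrPdist_le => e e0.
have [n0 H] := Hw e e0; exists n0 => // n hn /=.
by rewrite sub0r normrN ger0_norm ?nm_ge0 //; exact: H.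
Qed.

Fact hart_key : unit. Proof. exact: tt. Qed.
(** The transform is chosen among functions that agree almost everywhere,
    hence all identities below hold almost everywhere. *)
Definition hart := locked_with hart_key (fun u : R -> R => xget (fun=> 0) [set w | isH u w]).

Lemma hartP u : L2p u -> isH u (hart u).
Proof. by move=> Lu; have [w Hw] := isH_ex Lu; rewrite /hart unlock; exact: (@xgetPex _ _ [set w | isH u w] (ex_intro _ w Hw)). Qed.

Lemma hart_L2 u : L2p u -> L2p (hart u).
Proof. by move=> /hartP[]. Qed.

Lemma hart_cvg u : L2p u -> L2cvg (fun n => hart1 (tr n u)) (hart u).
Proof. by move=> /hartP[]. Qed.

Lemma hart_sym u v : L2p u -> L2p v -> ip (hart u) v = ip u (hart v).
Proof.
move=> Lu Lv.
have c1 := L2cvg_ip (fun n => L2_hart1_tr n Lu) (hart_L2 Lu) (fun n => tr_L2 n Lv) Lv (hart_cvg Lu) (tr_L2cvg Lv).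
have c2 := L2cvg_ip (fun n => tr_L2 n Lu) Lu (fun n => L2_hart1_tr n Lv) (hart_L2 Lv) (tr_L2cvg Lu) (hart_cvg Lv).
apply: (cvg_unique _ c1) => //.
rewrite (_ : (fun n => ip (hart1 (tr n u)) (tr n v)) = (fun n => ip (tr n u) (hart1 (tr n v)))) //.
by apply/funext => n; rewrite !ip_def; apply: hart1_sym; exact: tr_intg.
Qed.

Lemma hart_iso u : L2p u -> nm (hart u) = nm u.
Proof.
move=> Lu.
have c1 := L2cvg_nm (fun n => L2_hart1_tr n Lu) (hart_L2 Lu) (hart_cvg Lu).
have c2 := L2cvg_nm (fun n => tr_L2 n Lu) Lu (tr_L2cvg Lu).
apply: (cvg_unique _ c1) => //.
rewrite (_ : (fun n => nm (hart1 (tr n u))) = (fun n => nm (tr n u))) //.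
by apply/funext => n; have [] := plancherel_L1L2 (tr_intg n Lu) (tr_L2 n Lu).
Qed.

(** On functions that are both integrable and square-integrable the two
    transforms agree. *)
Lemma hart_L1 u : L2p u -> intg u -> aeq (hart u) (hart1 u).
Proof.
move=> Lu iu; have [Lh _] := plancherel_L1L2 iu Lu.
apply: (L2cvg_unique (fun n => L2_hart1_tr n Lu)) => //; [exact: hart_L2|exact: hart_cvg|].
have := tr_L2cvg Lu; rewrite /L2cvg.
rewrite (_ : (fun n => nm (fun x => tr n u x - u x)) = (fun n => nm (fun x => hart1 (tr n u) x - hart1 u x))) //.
apply/funext => n.
have [_ <-] := plancherel_L1L2 (intgB (tr_intg n Lu) iu) (L2_B (tr_L2 n Lu) Lu).
by congr nm; apply/funext => x; rewrite hart1B //; exact: tr_intg.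
Qed.

Lemma L2cvg_lin a F f G g : (forall n, L2p (F n)) -> L2p f -> (forall n, L2p (G n)) -> L2p g ->
  L2cvg F f -> L2cvg G g -> L2cvg (fun n x => a * F n x + G n x) (fun x => a * f x + g x).
Proof.
move=> LF Lf LG Lg cF cG.
have H : `|a| * nm (fun x => F n x - f x) + nm (fun x => G n x - g x) @[n --> \oo] --> `|a| * 0 + 0.
  by apply: cvgD => //; apply: cvgM => //; exact: cvg_cst.
rewrite mulr0 addr0 in H.
apply/cvgrPdist_le => e e0; move/cvgrPdist_le: H => /(_ e e0); apply: filterS => n.
rewrite !sub0r !normrN => h; apply: (le_trans _ h).
rewrite ger0_norm ?nm_ge0 // ger0_norm ?addr_ge0 ?mulr_ge0 ?nm_ge0 //.
have L1 := L2_B (LF n) Lf; have L2 := L2_B (LG n) Lg.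
rewrite -nmZ //; apply: le_trans (nmD (L2_Z a L1) L2).
by rewrite (_ : (fun x => _) = (fun x => a * (F n x - f x) + (G n x - g x))) //; apply/funext => x; ring.
Qed.

Lemma hart_lin a u v : L2p u -> L2p v ->
  aeq (hart (fun x => a * u x + v x)) (fun x => a * hart u x + hart v x).
Proof.
move=> Lu Lv; have Lw : L2p (fun x => a * u x + v x) by apply: L2_D => //; exact: L2_Z.
apply: (L2cvg_unique (fun n => L2_hart1_tr n Lw)); [exact: hart_L2| |exact: hart_cvg|].
  by apply: L2_D; [exact/L2_Z/hart_L2|exact: hart_L2].
have := L2cvg_lin a (fun n => L2_hart1_tr n Lu) (hart_L2 Lu) (fun n => L2_hart1_tr n Lv) (hart_L2 Lv) (hart_cvg Lu) (hart_cvg Lv).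
rewrite (_ : (fun n x => a * hart1 (tr n u) x + hart1 (tr n v) x) = (fun n => hart1 (tr n (fun x => a * u x + v x)))) //.
apply/funext => n; apply/funext => xi.
rewrite -hart1Z; last exact: tr_intg.
rewrite -hart1D; [|by apply: intgZ; exact: tr_intg|exact: tr_intg].
by congr hart1; apply/funext => x; rewrite /tr; ring.
Qed.

Lemma hartB u v : L2p u -> L2p v ->
  aeq (hart (fun x => u x - v x)) (fun x => hart u x - hart v x).
Proof.
move=> Lu Lv; have := hart_lin (-1) Lv Lu.
rewrite (_ : (fun x => -1 * v x + u x) = (fun x => u x - v x)); last by apply/funext => x; ring.
by apply: ae_imp => x ->; ring.
Qed.

Lemma hartZ a u : L2p u -> aeq (hart (fun x => a * u x)) (fun x => a * hart u x).
Proof.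
move=> Lu; have := hart_lin (a - 1) Lu Lu.
rewrite (_ : (fun x => (a - 1) * u x + u x) = (fun x => a * u x)); last by apply/funext => x; ring.
by apply: ae_imp => x ->; ring.
Qed.

Lemma nm_eq_ae u v : L2p u -> L2p v -> nm (fun x => u x - v x) = 0 -> aeq u v.
Proof.
move=> Lu Lv H; apply: ae_imp (nm_eq0 (L2_B Lu Lv) H) => x /eqP.
by rewrite subr_eq0 => /eqP.
Qed.

Lemma nm0_ae u v : L2p u -> L2p v -> aeq u v -> nm (fun x => u x - v x) = 0.
Proof.
move=> Lu Lv H; rewrite (@nm_ae _ _ (fun=> 0)).
- exact: (snN0 (@L2_seminorm R)).
- by apply: measurable_funB; exact: L2_m.
- exact: measurable_cst.
- by apply: ae_imp H => x ->; rewrite subrr.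
Qed.

Lemma hart_ae u v : L2p u -> L2p v -> aeq u v -> aeq (hart u) (hart v).
Proof.
move=> Lu Lv H; apply: nm_eq_ae; [exact: hart_L2|exact: hart_L2|].
rewrite -(nm0_ae Lu Lv H) -(hart_iso (L2_B Lu Lv)).
apply: nm_ae; last by apply: aeq_sym; exact: hartB.
  by apply: measurable_funB; apply: L2_m; exact: hart_L2.
by apply: L2_m; apply: hart_L2; exact: L2_B.
Qed.

(** A symmetric isometry T satisfies |T T u - u|^2 = 2 |u|^2 - 2 (T T u, u) =
    0. *)
Lemma hart_inv u : L2p u -> aeq (hart (hart u)) u.
Proof.
move=> Lu; have L1 := hart_L2 Lu; have L2_ := hart_L2 L1.
apply: nm_eq_ae => //; apply/eqP; rewrite -sqrf_eq0 nm_sq.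
rewrite ipBl ?ipBr //; try exact: L2_B.
rewrite (ipC u) (hart_sym L1 Lu) -!nm_sq (hart_iso L1) (hart_iso Lu).
by apply/eqP; ring.
Qed.

End HartleyL2.

(** * Sobolev weights *)

Local Open Scope complex_scope.
Section Weights.
Context {R : realType}.
Local Notation mu := (@lebesgue_measure R).
Implicit Types (f g h u v w : R -> R) (a s xi : R).

(** The Sobolev weight with exponent [a]; H^s uses [a] = s / 2 in norms. *)
Definition jw a xi : R := (1 + xi ^+ 2) `^ a.

Lemma oneDsq_ge1 xi : 1 <= 1 + xi ^+ 2.
Proof. by rewrite lerDl sqr_ge0. Qed.

Lemma oneDsq_gt0 xi : 0 < 1 + xi ^+ 2.
Proof. exact: lt_le_trans ltr01 (oneDsq_ge1 xi). Qed.

Lemma jw_gt0 a xi : 0 < jw a xi. Proof. by rewrite powR_gt0 // oneDsq_gt0. Qed.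
Lemma jw_ge0 a xi : 0 <= jw a xi. Proof. exact: ltW (jw_gt0 a xi). Qed.

Lemma jwD a s xi : jw (a + s) xi = jw a xi * jw s xi.
Proof. by rewrite /jw powRD // (gt_eqF (oneDsq_gt0 xi)) implybT. Qed.

Lemma jw0 xi : jw 0 xi = 1. Proof. by rewrite /jw powRr0. Qed.

Lemma jw1 xi : jw 1 xi = 1 + xi ^+ 2.
Proof. by rewrite /jw powRr1 // ltW // oneDsq_gt0. Qed.

Lemma jw_sq a xi : jw a xi ^+ 2 = jw (2 * a) xi.
Proof. by rewrite expr2 -jwD; congr jw; ring. Qed.

Lemma jw_le a s xi : a <= s -> jw a xi <= jw s xi.
Proof. by move=> h; apply: ler_powR => //; exact: oneDsq_ge1. Qed.

Lemma jwN a xi : jw a (- xi) = jw a xi. Proof. by rewrite /jw sqrrN. Qed.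

Lemma jwV a xi : jw (- a) xi = (jw a xi)^-1. Proof. by rewrite /jw powRN. Qed.

Lemma jw_m a : mfun1 (jw a).
Proof.
by apply: (measurableT_comp (measurable_powR a)); apply: measurable_funD.
Qed.

Lemma jw_le1 a xi : a <= 0 -> `|jw a xi| <= 1.
Proof. by move=> a0; rewrite ger0_norm ?jw_ge0 // -(jw0 xi) jw_le. Qed.

Lemma cont_oneDabs : continuous (fun x : R => 1 + `|x|).
Proof. by move=> x; apply: cvgD; [exact: cvg_cst|exact: cvg_norm]. Qed.

Lemma int_pow_tail (p : R) : 1 < p -> intg (fun x => (1 + `|x|) `^ (- p)).
Proof.
move=> p1.
pose f (x : R) := (1 + `|x|) `^ (- p).
have f0 x : 0 <= f x by exact: powR_ge0.
have P0 x : 0 < 1 + `|x : R| by rewrite ltr_pwDl.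
have cf : continuous f.
  move=> x.
  have d : derivable (fun y : R => y `^ (- p)) (1 + `|x|) 1.
    by have := @is_derive1_powR R (- p) _ (P0 x) => -[].
  have c := differentiable_continuous (iffLR (derivable1_diffP _ _) d).
  have k := @cont_oneDabs x.
  exact: (cvg_comp _ _ k c).
pose F (x : R) := (1 - p)^-1 * (1 + x) `^ (1 - p).
have pn : 1 - p != 0 by rewrite lt_eqF // subr_lt0.
have dG (q x : R) : -1 < x -> is_derive x 1 (fun y : R => (1 + y) `^ q) ((q * (1 + x) `^ (q - 1)) * (0 + 1)).
  move=> x1; have x0 : 0 < 1 + x by lra.
  have D := @is_derive1_powR R q _ x0.
  have D1 : is_derive x 1 (fun y : R => 1 + y) (0 + 1).
    exact: (is_deriveD (is_derive_cst (1 : R) x (1 : R)) (is_derive_id x (1 : R))).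
  exact: (@is_derive1_comp R (fun y => y `^ q) (fun y => 1 + y) x _ _ D D1).
have dF (x : R) : -1 < x -> is_derive x 1 F ((1 + x) `^ (- p)).
  move=> x1; have D3 : is_derive x 1 F _ := is_deriveZ (1 - p)^-1 (dG (1 - p) x x1).
  apply: (is_derive_eq D3).
  rewrite add0r mulr1 /GRing.scale /= mulrA mulVf // mul1r.
  by congr (_ `^ _); ring.
have E : (\int[mu]_x (f x)%:E = (2 * (p - 1)^-1)%:E)%E.
  rewrite (ge0_symfun_integralT f0 cf); last by move=> x; rewrite /f /= normrN.
  rewrite -set_itvcy.
  rewrite (_ : (\int[mu]_(x in _) _)%E = (\int[mu]_(x in `[0%R, +oo[) ((1 + x) `^ (- p))%:E)%E); last first.
    by apply: eq_integral => x; rewrite inE /= in_itv /= andbT => x0; rewrite /f ger0_norm.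
  rewrite (@ge0_continuous_FTC2y R (fun x => (1 + x) `^ (- p)) F 0 0).
  - rewrite -!EFinB -EFinM; congr EFin; rewrite /F addr0 powR1 mulr1 sub0r.
    by rewrite -invrN opprB.
  - by move=> x _; exact: powR_ge0.
  - apply: continuous_in_subspaceT => x; rewrite inE /= in_itv /= andbT => x0.
    have [d _] := dG (- p) x (lt_le_trans (ltrN10 R) x0).
    exact: (differentiable_continuous (iffLR (derivable1_diffP _ _) d)).
  - apply/cvgrPdist_le => e e0; near=> x.
    have x0 : 0 < x by near: x; apply: nbhs_pinfty_gt; rewrite num_real.
    have xe : ((p - 1) * e) `^ (1 - p)^-1 <= x by near: x; apply: nbhs_pinfty_ge; rewrite num_real.
    have pe : 0 < (p - 1) * e by rewrite mulr_gt0 // subr_gt0.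
    rewrite sub0r normrN /F normrM (ger0_norm (powR_ge0 _ _)).
    have -> : `|(1 - p)^-1| = (p - 1)^-1 by rewrite normrV ?unitfE // ltr0_norm ?subr_lt0 // opprB.
    rewrite mulrC ler_pdivrMr ?subr_gt0 // (mulrC e).
    have -> : (p - 1) * e = (((p - 1) * e) `^ (1 - p)^-1) `^ (1 - p).
      by rewrite -powRrM mulVf // powRr1 // ltW.
    have z0 : 0 < ((p - 1) * e) `^ (1 - p)^-1 by exact: powR_gt0.
    move: (_ `^ (1 - p)^-1) z0 xe => z z0 xe.
    have -> : 1 - p = - (p - 1) by ring.
    rewrite !powRN lef_pV2 ?posrE ?powR_gt0 ?addr_gt0 //.
    by apply: ge0_ler_powR; rewrite ?nnegrE ?subr_ge0 ?(ltW p1) //; lra.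
  - by move=> x x0; have := dF x (lt_trans (ltrN10 R) x0) => -[].
  - apply: cvg_at_right_filter.
    have := dF 0 (ltrN10 R) => -[d _].
    exact: (differentiable_continuous (iffLR (derivable1_diffP _ _) d)).
  - move=> x; rewrite in_itv /= andbT => x0; rewrite derive1E.
    by have := dF x (lt_trans (ltrN10 R) x0) => -[_ ->].
apply/integrableP; split.
  by apply/measurable_EFinP; exact: continuous_measurable_fun.
under eq_integral => x _ do rewrite /= ger0_norm //.
by rewrite E ltry.
Unshelve. all: end_near. Qed.

(** Comparison with (1 + |xi|)^(2 a), as (1 + |xi|)^2 <= 2 (1 + xi^2). *)
Lemma jw_int a : a < - 2^-1 -> intg (jw a).
Proof.
move=> ha.
have p1 : 1 < - 2 * a by lra.
apply: (intg_dom (jw_m a) (intgZ (2 `^ (- a)) (int_pow_tail p1))) => xi.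
rewrite ger0_norm ?jw_ge0 // /jw.
have x0 : 0 < 1 + `|xi| by rewrite ltr_pwDl.
have -> : (1 + `|xi|) `^ (- (- 2 * a)) = ((1 + `|xi|) ^+ 2) `^ a.
  rewrite -powR_mulrn; last exact: ltW.
  by rewrite -powRrM; congr (_ `^ _); ring.
have [b Eb] : exists b, a = - b by exists (- a); rewrite opprK.
rewrite Eb in ha p1 *.
rewrite opprK !powRN.
rewrite ler_pdivlMr ?powR_gt0 ?exprn_gt0 // mulrC.
rewrite ler_pdivrMr ?powR_gt0 ?oneDsq_gt0 //.
have xx := normr_ge0 xi; have o0 := ltW (oneDsq_gt0 xi).
have b0 : 0 <= b by lra.
rewrite -powRM //.
apply: ge0_ler_powR; rewrite ?nnegrE ?exprn_ge0 ?mulr_ge0 ?(ltW x0) //.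
rewrite -(@real_normK _ xi) ?num_real //.
have := sqr_ge0 (1 - `|xi|); nra.
Qed.

Lemma jw_L2 a : a < - (2^-1 / 2) -> L2p (jw a).
Proof.
move=> ha; split; first exact: jw_m.
by under eq_fun do rewrite jw_sq; apply: jw_int; lra.
Qed.

End Weights.

(** * Fourier and Hartley transforms *)

Section FourierHartley.
Context {R : realType}.
Local Notation mu := (@lebesgue_measure R).
Implicit Types (f g h u v : R -> R) (xi : R).

(** The Fourier transform expressed by the Hartley transform: the even part
    gives the real part and the odd part gives the imaginary part, up to sign. *)
Definition fw f xi : R[i] :=
  ((f xi + f (- xi)) / (2 * c0)) +i* ((f (- xi) - f xi) / (2 * c0)).

Lemma normsq_fw f xi : normsq (fw f xi) = (f xi ^+ 2 + f (- xi) ^+ 2) / (2 * c0 ^+ 2).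
Proof.
have c0n : (c0 : R) != 0 by rewrite gt_eqF // c0_gt0.
by rewrite /normsq /fw /=; move: (c0 : R) c0n => c cn; field; rewrite cn.
Qed.

Lemma int_cos_on f xi : intg f -> intg (fun x => cos (xi * x) * f x).
Proof.
move=> hf; apply: (@intg_bdd R 1) => //.
  apply: (measurableT_comp (f := cos)); last exact: measurable_funM.
  exact: continuous_measurable_fun (@continuous_cos R).
by move=> x; rewrite ler_norml cos_geN1 cos_le1.
Qed.

Lemma int_sin_on f xi : intg f -> intg (fun x => sin (xi * x) * f x).
Proof.
move=> hf; apply: (@intg_bdd R 1) => //.
  apply: (measurableT_comp (f := sin)); last exact: measurable_funM.
  exact: continuous_measurable_fun (@continuous_sin R).
by move=> x; rewrite ler_norml sin_geN1 sin_le1.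
Qed.

Lemma fourier_hart1 f xi : intg f -> fourier f xi = fw (hart1 f) xi.
Proof.
move=> hf; rewrite /fourier /fourier_on /cintegral /fw /hart1 /=.
have c0n : (c0 : R) != 0 by rewrite gt_eqF // c0_gt0.
have ic := int_cos_on xi hf; have is_ := int_sin_on xi hf.
have E1 : \int[mu]_x (cas (xi * x) * f x) =
   \int[mu]_x (cos (xi * x) * f x) + \int[mu]_x (sin (xi * x) * f x).
  by rewrite -I_D //; apply: I_eq => x; rewrite /cas mulrDl.
have E2 : \int[mu]_x (cas (- xi * x) * f x) =
   \int[mu]_x (cos (xi * x) * f x) - \int[mu]_x (sin (xi * x) * f x).
  by rewrite -I_B //; apply: I_eq => x; rewrite /cas mulNr cosN sinN mulrDl mulNr.
rewrite E1 E2; congr (_ +i* _).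
- rewrite [X in X = _](@I_eq _ _ (fun x => cos (xi * x) * f x)); last by move=> x /=; rewrite cosN mulr0 subr0.
  by move: (c0 : R) c0n => c cn; field; rewrite cn.
- rewrite [X in X = _](@I_eq _ _ (fun x => - (sin (xi * x) * f x))); last by move=> x /=; rewrite sinN mulr0 add0r mulNr.
  rewrite I_N //.
  by move: (c0 : R) c0n => c cn; field; rewrite cn.
Qed.

Lemma fourier_on_tr n f xi : L2p f -> fourier_on `[- n%:R, n%:R] f xi = fw (hart1 (tr n f)) xi.
Proof.
move=> Lf; rewrite -fourier_hart1; last exact: tr_intg.
rewrite /fourier /fourier_on /cintegral.
have H (k : R -> R) : \int[mu]_(x in `[(- n%:R), n%:R]) (k x * f x) =
   \int[mu]_x (k x * tr n f x).
  rewrite Rintegral_mkcond; apply: I_eq => x; rewrite patchE /tr /box indicE.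
  by case: (x \in _); rewrite ?mul1r // mul0r mulr0.
congr (_ +i* _) => /=.
- rewrite -(_ : \int[mu]_(x in `[(- n%:R), n%:R]) (cos (- (xi * x)) * f x) = \int[mu]_(x in _) _).
    by rewrite H; apply: I_eq => x; rewrite mulr0 subr0.
  by apply: eq_Rintegral => x _; rewrite mulr0 subr0.
- rewrite -(_ : \int[mu]_(x in `[(- n%:R), n%:R]) (sin (- (xi * x)) * f x) = \int[mu]_(x in _) _).
    by rewrite H; apply: I_eq => x; rewrite mulr0 add0r.
  by apply: eq_Rintegral => x _; rewrite mulr0 add0r.
Qed.

Lemma L2_opp f : L2p f -> L2p (fun x => f (- x)).
Proof.
move=> [mf hf]; split; last by have [] := I_opp hf.
exact: (measurableT_comp mf (@oppr_measurable R setT)).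
Qed.

Lemma I_opp_sq f : L2p f -> \int[mu]_x (f (- x) ^+ 2) = ip f f.
Proof. by move=> [mf hf]; rewrite ipE; have [_ ->] := I_opp hf. Qed.

(** The two halves of the formula for [normsq (fw f)] are reflections of each
    other. *)
Lemma int_normsq_fw f : L2p f ->
  intg (fun xi => normsq (fw f xi)) /\ \int[mu]_xi normsq (fw f xi) = ip f f / c0 ^+ 2.
Proof.
move=> Lf; have Lo := L2_opp Lf.
have E xi : normsq (fw f xi) = (2 * c0 ^+ 2)^-1 * (f xi ^+ 2 + f (- xi) ^+ 2).
  by rewrite normsq_fw mulrC.
have i1 : intg (fun x => f x ^+ 2) by case: Lf.
have i2 : intg (fun x => f (- x) ^+ 2) by case: Lo.
split; first by rewrite (funext E); apply: intgZ; exact: intgD.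
rewrite (I_eq E) I_Z; last exact: intgD.
rewrite I_D // I_opp_sq // -ipE.
have c0n : (c0 : R) != 0 by rewrite gt_eqF // c0_gt0.
by move: (c0 : R) c0n => c cn; field; rewrite cn.
Qed.

Lemma L2C_fw f : L2p f -> L2C (fw f).
Proof.
move=> Lf; have Lo := L2_opp Lf; split.
- by apply: measurable_funM => //; apply: measurable_funD; exact: L2_m.
- by apply: measurable_funM => //; apply: measurable_funB; exact: L2_m.
- by have [i _] := int_normsq_fw Lf; rewrite EFin_I // ltry.
Qed.

Lemma fwB f g xi : fw f xi - fw g xi = fw (fun x => f x - g x) xi.
Proof. by rewrite /fw; congr (_ +i* _); ring. Qed.

Lemma is_fourierL2_hart u : L2p u -> is_fourierL2 u (fw (hart u)).
Proof.
move=> Lu; have Lh := hart_L2 Lu; split; [exact/L2E|exact: L2C_fw|].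
have c := hart_cvg Lu; rewrite /L2cvg in c.
rewrite (_ : (fun n : nat => _) = (fun n => (nm (fun x => hart1 (tr n u) x - hart u x) ^+ 2 / c0 ^+ 2)%:E)).
  apply: cvg_EFin; first exact: nearW.
  have H : nm (fun x => hart1 (tr n u) x - hart u x) ^+ 2 / c0 ^+ 2 @[n --> \oo] --> (0 * 0) / c0 ^+ 2.
    by apply: cvgM; [exact: (cvgM c c)|exact: cvg_cst].
  by rewrite mulr0 mul0r in H.
apply/funext => n.
have Ld := L2_B (L2_hart1_tr n Lu) Lh.
have [i1 i2] := int_normsq_fw Ld.
rewrite nm_sq -i2 -EFin_I //; apply: eq_integral => xi _.
by rewrite fourier_on_tr // fwB.
Qed.

Lemma L2C_comp (w : R -> R[i]) : L2C w ->
  [/\ L2p (fun xi => complex.Re (w xi)), L2p (fun xi => complex.Im (w xi)) &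
   intg (fun xi => normsq (w xi))].
Proof.
move=> [m1 m2 i].
have mn : mfun1 (fun xi => normsq (w xi)).
  by apply: measurable_funD; exact: measurable_funX.
have n0 xi : 0 <= normsq (w xi) by rewrite addr_ge0 // sqr_ge0.
have hi : intg (fun xi => normsq (w xi)).
  apply/integrableP; split; first exact/measurable_EFinP.
  by under eq_integral => x _ do rewrite /= ger0_norm //.
split => //.
- split => //; apply: (intg_dom _ hi); first exact: measurable_funX.
  by move=> xi; rewrite ger0_norm ?sqr_ge0 // /normsq lerDl sqr_ge0.
- split => //; apply: (intg_dom _ hi); first exact: measurable_funX.
  by move=> xi; rewrite ger0_norm ?sqr_ge0 // /normsq lerDr sqr_ge0.
Qed.

Lemma L2C_B (w z : R -> R[i]) : L2C w -> L2C z -> L2C (fun xi => w xi - z xi).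
Proof.
move=> /L2C_comp[a1 a2 _] /L2C_comp[b1 b2 _].
have c1 := L2_B a1 b1; have c2 := L2_B a2 b2.
have E xi : normsq (w xi - z xi) = (complex.Re (w xi) - complex.Re (z xi)) ^+ 2 + (complex.Im (w xi) - complex.Im (z xi)) ^+ 2.
  by case: (w xi) => ? ?; case: (z xi).
have R1 : (fun xi => complex.Re (w xi - z xi)) = (fun xi => complex.Re (w xi) - complex.Re (z xi)).
  by apply/funext => xi; case: (w xi) => ? ?; case: (z xi).
have R2 : (fun xi => complex.Im (w xi - z xi)) = (fun xi => complex.Im (w xi) - complex.Im (z xi)).
  by apply/funext => xi; case: (w xi) => ? ?; case: (z xi).
split; rewrite ?R1 ?R2; [exact: L2_m c1|exact: L2_m c2|].
under eq_integral => xi _ do rewrite E.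
by rewrite EFin_I ?ltry //; apply: intgD; [case: c1|case: c2].
Qed.

(** The limit of the truncated transforms determines the transform almost
    everywhere. *)
Lemma fourierL2_unique u (w z : R -> R[i]) : is_fourierL2 u w -> is_fourierL2 u z ->
  {ae mu, forall xi, w xi = z xi}.
Proof.
move=> [Lu Lw cw] [_ Lz cz].
pose F n := fourier_on `[- n%:R, n%:R] u.
have LF n : L2C (F n).
  have Lup : L2p u by apply/L2E.
  rewrite (_ : F n = fw (hart1 (tr n u))); first exact/L2C_fw/L2_hart1_tr.
  by apply/funext => xi; rewrite /F fourier_on_tr.
have I0 (y : R -> R[i]) : L2C y -> (\int[mu]_xi (normsq (F n xi - y xi))%:E)%E @[n --> \oo] --> 0%E ->
   \int[mu]_xi normsq (F n xi - y xi) @[n --> \oo] --> 0.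
  by move=> Ly /fine_cvg.
have J1 := I0 w Lw cw; have J2 := I0 z Lz cz.
have [_ _ iwz] := L2C_comp (L2C_B Lw Lz).
have n0 (y : R[i]) : 0 <= normsq y by rewrite addr_ge0 // sqr_ge0.
have tri (x y c : R[i]) : normsq (x - y) <= 2 * (normsq (c - x) + normsq (c - y)).
  case: x => x1 x2; case: y => y1 y2; case: c => c1 c2; rewrite /normsq /=.
  have := sqr_ge0 (c1 - x1 + (c1 - y1)); have := sqr_ge0 (c2 - x2 + (c2 - y2)); nra.
have H : \int[mu]_xi normsq (w xi - z xi) = 0.
  apply/le_anti; rewrite I_ge0 // andbT.
  have c : 2 * (\int[mu]_xi normsq (F n xi - w xi) + \int[mu]_xi normsq (F n xi - z xi)) @[n --> \oo] --> 2 * (0 + 0 : R).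
    by apply: cvgM; [exact: cvg_cst|exact: cvgD].
  rewrite addr0 mulr0 in c.
  rewrite -(cvg_lim (@Rhausdorff R) c); apply: limr_ge; first by apply/cvg_ex; exists 0.
  apply: nearW => n.
  have [_ _ i1] := L2C_comp (L2C_B (LF n) Lw); have [_ _ i2] := L2C_comp (L2C_B (LF n) Lz).
  rewrite -I_D // -I_Z; last exact: intgD.
  by apply: I_le => //; apply: intgZ; exact: intgD.
have := I_eq0 iwz (fun xi => n0 _) H; apply: ae_imp => xi.
case: (w xi) => w1 w2; case: (z xi) => z1 z2; rewrite /normsq /= => /eqP.
by rewrite paddr_eq0 ?sqr_ge0 // !sqrf_eq0 !subr_eq0 => /andP[/eqP -> /eqP ->].
Qed.

Lemma fourierL2P u : L2p u -> is_fourierL2 u (fourierL2 u) /\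
  {ae mu, forall xi, fourierL2 u xi = fw (hart u) xi}.
Proof.
move=> Lu; have H := is_fourierL2_hart Lu.
have H1 : is_fourierL2 u (fourierL2 u).
  by apply: (@xgetPex _ _ [set w | is_fourierL2 u w]); exists (fw (hart u)).
by split; [exact: H1|exact: (fourierL2_unique H1 H)].
Qed.

(** The Sobolev norm computed from the Hartley transform; it is [c0] times
    [sobolev_norm]. *)
Definition hnm (s : R) u : R := nm (fun xi => jw (s / 2) xi * hart u xi).
Definition HsR (s : R) : set (R -> R) :=
  [set u | L2p u /\ L2p (fun xi => jw (s / 2) xi * hart u xi)].

(** The weight is even, so it commutes with the passage [fw] from the Hartley
    to the Fourier transform. *)
Lemma sobolev_int (s : R) u : L2p u -> (\int[mu]_xi ((1 + xi ^+ 2) `^ s * normsq (fourierL2 u xi))%:E =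
  \int[mu]_xi (normsq (fw (fun xi => jw (s / 2) xi * hart u xi) xi))%:E)%E.
Proof.
move=> Lu; have [H1 H2] := fourierL2P Lu.
have [_ /L2C_comp[m1 m2 i1] _] := H1.
have Lh := hart_L2 Lu.
apply: ge0_ae_eq_integral => //.
- apply/measurable_EFinP; apply: measurable_funM; [exact: (jw_m s)|exact: intg_m i1].
- have mw : mfun1 (fun xi => jw (s / 2) xi * hart u xi).
    by apply: measurable_funM; [exact: jw_m|exact: L2_m Lh].
  apply/measurable_EFinP; under eq_fun do rewrite normsq_fw.
  apply: measurable_funM => //; apply: measurable_funD; apply: measurable_funX => //.
  exact: (measurableT_comp mw (@oppr_measurable R setT)).
- by move=> x _; rewrite lee_fin mulr_ge0 ?powR_ge0 // addr_ge0 // sqr_ge0.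
- by move=> x _; rewrite lee_fin addr_ge0 // sqr_ge0.
apply: ae_imp H2 => xi -> _; congr EFin; rewrite !normsq_fw jwN.
have -> : (1 + xi ^+ 2) `^ s = jw (s / 2) xi ^+ 2.
  by rewrite jw_sq /jw; congr (_ `^ _); field.
by rewrite !exprMn -mulrDr mulrA.
Qed.

Lemma sobolev_normE (s : R) u : HsR s u -> sobolev_norm s u = (hnm s u / c0)%:E.
Proof.
move=> [Lu Lw]; rewrite /sobolev_norm sobolev_int //.
have [i E] := int_normsq_fw Lw.
rewrite EFin_I // E poweR_EFin; congr EFin.
rewrite powR12_sqrt; last by rewrite divr_ge0 ?ip_ge0 ?sqr_ge0.
by rewrite -nm_sq -expr_div_n sqrtr_sqr ger0_norm // divr_ge0 ?nm_ge0 // ltW // c0_gt0.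
Qed.

(** Membership in the Sobolev space, freed of the choice made in [fourierL2]. *)
Lemma HsE (s : R) u : Hs s u <-> HsR s u.
Proof.
split=> [[[Lu _ _] fin]|[Lu Lw]].
  have Lup : L2p u by apply/L2E.
  split => //; move: fin; rewrite /sobolev_norm sobolev_int // => fin.
  set w := (fun xi => _).
  have mw : mfun1 w by apply: measurable_funM; [exact: jw_m|exact: L2_m (hart_L2 Lup)].
  split => //.
  have mn : mfun1 (fun xi => normsq (fw w xi)).
    under eq_fun do rewrite normsq_fw.
    apply: measurable_funM => //; apply: measurable_funD; apply: measurable_funX => //.
    exact: (measurableT_comp mw (@oppr_measurable R setT)).
  have n0 (y : R[i]) : 0 <= normsq y by rewrite addr_ge0 // sqr_ge0.
  have hi : intg (fun xi => normsq (fw w xi)).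
    apply/integrableP; split; first exact/measurable_EFinP.
    under eq_integral => x _ do rewrite /= ger0_norm //.
    rewrite ltNge leye_eq; apply/negP => /eqP E.
    by move: fin; rewrite -/w E poweRE /= invr_eq0 pnatr_eq0 /=.
  apply: (intg_dom _ (intgZ (2 * c0 ^+ 2) hi)); first exact: measurable_funX.
  move=> xi; rewrite normsq_fw ger0_norm ?sqr_ge0 //.
  have c2 : 0 < 2 * (c0 : R) ^+ 2 by rewrite mulr_gt0 // exprn_gt0 // c0_gt0.
  by rewrite mulrCA divff ?gt_eqF // mulr1 lerDl sqr_ge0.
split; first by have [] := fourierL2P Lu.
by rewrite sobolev_normE ?ltry //.
Qed.

End FourierHartley.

(** * Multiplier operators *)

Section Multiplier.
Context {R : realType}.
Local Notation mu := (@lebesgue_measure R).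
Implicit Types (f g h u v w q : R -> R) (x xi s : R).

Lemma hart1_ae f g : mfun1 f -> mfun1 g -> aeq f g -> hart1 f =1 hart1 g.
Proof.
move=> mf mg e x; rewrite /hart1; congr (_ * _); apply: I_ae.
- exact: measurable_funM (mcasM x) mf.
- exact: measurable_funM (mcasM x) mg.
- by apply: ae_imp e => y ->.
Qed.

Lemma hart_ip u v : L2p u -> L2p v -> ip (hart u) (hart v) = ip u v.
Proof.
move=> Lu Lv; have Lh := hart_L2 Lv.
rewrite hart_sym //; apply: ip_ae; [exact: L2_m|exact: L2_m|exact: (L2_m (hart_L2 Lh))|exact: L2_m|exact: aeq_refl|exact: hart_inv].
Qed.

(** A function whose spectrum is integrable and square-integrable has a
    continuous representative given at every point by the transform of its
    spectrum. *)
Lemma synth f : intg f -> L2p f ->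
  [/\ L2p (hart1 f), aeq (hart (hart1 f)) f & nm (hart1 f) = nm f].
Proof.
move=> i Lf; have [L e] := plancherel_L1L2 i Lf; split=> //.
have H := hart_L1 Lf i.
apply: aeq_trans (hart_inv Lf); apply: hart_ae => //; first exact: hart_L2.
exact: aeq_sym.
Qed.

Lemma L2_bddr f g (M : R) : mfun1 f -> L2p g -> (forall x, `|f x| <= M * `|g x|) -> L2p f /\ nm f <= M * nm g.
Proof.
move=> mf Lg h; have [M0|M0] := leP 0 M.
  have LM := L2_Z M Lg.
  have h' x : `|f x| <= `|M * g x| by rewrite normrM (ger0_norm M0).
  split; first exact: (L2_dom mf LM h').
  by rewrite -(ger0_norm M0) -nmZ //; exact: (nm_dom mf LM h').
have f0 : f = (fun=> 0).
  apply/funext => x; apply/eqP; rewrite -normr_le0 (le_trans (h x)) //.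
  by rewrite nmulr_rle0.
have g0 x : g x = 0.
  apply/eqP; rewrite -normr_le0 -(nmulr_rge0 _ M0).
  by rewrite (le_trans _ (h x)).
have -> : g = (fun=> 0) by apply/funext.
have L0 : L2p (fun=> 0 : R) by exact: L2_0.
have n0 : nm (fun=> 0 : R) = 0 by exact: (snN0 L2_seminorm).
by rewrite f0 n0 mulr0.
Qed.

Lemma abs_m : mfun1 (fun x : R => `|x|).
Proof. exact: (continuous_measurable_fun (@norm_continuous R R)). Qed.

(** Square-integrability makes the multiplier map L^2 to bounded continuous
    functions; the decay is that of a gain of half a derivative. *)
Record symb (b : R -> R) (K : R) : Prop := Symb {
  symb_L2 : L2p b; symb_K : 0 <= K; symb_le : forall xi, `|b xi| <= K * jw (- 4^-1) xi }.

(** Defined at every point, not just almost everywhere: the spectrum b hat q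
    is integrable by the Cauchy-Schwarz inequality. *)
Definition Bop (b q : R -> R) (x : R) : R := hart1 (fun xi => b xi * hart q xi) x.

Section WithSymb.
Variables (b : R -> R) (K : R).
Hypothesis Sb : symb b K.
Let Lb := symb_L2 Sb.
Let mb := L2_m Lb.

Lemma symb_bd xi : `|b xi| <= K.
Proof.
apply: le_trans (symb_le Sb xi) _; rewrite -[leRHS]mulr1; apply: ler_wpM2l; first exact: symb_K Sb.
by rewrite -[leLHS]ger0_norm ?jw_ge0 // jw_le1 // oppr_le0 invr_ge0.
Qed.

Lemma bq_int q : L2p q -> intg (fun xi => b xi * hart q xi).
Proof. by move=> Lq; apply: L2_mul Lb (hart_L2 Lq). Qed.

Lemma bq_L2 q : L2p q -> L2p (fun xi => b xi * hart q xi).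
Proof. by move=> Lq; exact: (L2_bdd mb (hart_L2 Lq) symb_bd). Qed.

Lemma Bop_lin a q v x : L2p q -> L2p v -> Bop b (fun x => a * q x + v x) x = a * Bop b q x + Bop b v x.
Proof.
move=> Lq Lv; have Lz := L2_D (L2_Z a Lq) Lv.
have i1 := bq_int Lq; have i2 := bq_int Lv.
rewrite /Bop -hart1Z // -hart1D //; last exact: intgZ.
apply: hart1_ae; first exact: L2_m (bq_L2 Lz).
  by apply: intg_m; apply: intgD => //; exact: intgZ.
by apply: ae_imp (hart_lin a Lq Lv) => y ->; ring.
Qed.

Lemma Bop_cont q : L2p q -> continuous (Bop b q).
Proof. by move=> Lq; exact: hart1_cont (bq_int Lq). Qed.

Lemma Bop_bd q x : L2p q -> `|Bop b q x| <= 2 * c0 * nm b * nm q.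
Proof.
move=> Lq; apply: le_trans (hart1_bd x (bq_int Lq)) _.
rewrite -(mulrA (2 * c0)); apply: ler_wpM2l; first by rewrite mulr_ge0 // ltW // c0_gt0.
have La := L2_abs Lb; have Lh := L2_abs (hart_L2 Lq).
have e : \int[mu]_xi `|b xi * hart q xi| = ip (fun xi => `|b xi|) (fun xi => `|hart q xi|).
  by rewrite ip_def; apply: I_eq => xi; rewrite normrM.
rewrite e; apply: le_trans (ler_norm _) _; apply: le_trans (cauchy_schwarz La Lh) _.
rewrite -(hart_iso Lq); apply: ler_pM; rewrite ?nm_ge0 //.
  by apply: nm_dom (L2_m La) Lb _ => xi; rewrite normr_id.
by apply: nm_dom (L2_m Lh) (hart_L2 Lq) _ => xi; rewrite normr_id.
Qed.

Lemma Bop_synth q : L2p q ->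
  [/\ L2p (Bop b q), aeq (hart (Bop b q)) (fun xi => b xi * hart q xi) & nm (Bop b q) <= K * nm q].
Proof.
move=> Lq; have [L e n] := synth (bq_int Lq) (bq_L2 Lq); split => //.
rewrite n -(hart_iso Lq); apply: (L2_bddr (L2_m (bq_L2 Lq)) (hart_L2 Lq) _).2 => xi.
by rewrite normrM ler_wpM2r // symb_bd.
Qed.

Lemma Bop_L2 q : L2p q -> L2p (Bop b q).
Proof. by move=> /Bop_synth[]. Qed.

Lemma Bop_nm q : L2p q -> nm (Bop b q) <= K * nm q.
Proof. by move=> /Bop_synth[]. Qed.

Lemma Bop_hart q : L2p q -> aeq (hart (Bop b q)) (fun xi => b xi * hart q xi).
Proof. by move=> /Bop_synth[]. Qed.

(** The symbol is real and the transform is an isometry. *)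
Lemma Bop_sym q w : L2p q -> L2p w -> ip (Bop b q) w = ip q (Bop b w).
Proof.
move=> Lq Lw; have LBq := Bop_L2 Lq; have LBw := Bop_L2 Lw.
have Hq := hart_L2 Lq; have Hw := hart_L2 Lw.
rewrite -(hart_ip LBq Lw) -(hart_ip Lq LBw).
rewrite (ip_ae (L2_m (hart_L2 LBq)) (L2_m (bq_L2 Lq)) (L2_m Hw) (L2_m Hw) (Bop_hart Lq) (aeq_refl _)).
rewrite (ip_ae (L2_m Hq) (L2_m Hq) (L2_m (hart_L2 LBw)) (L2_m (bq_L2 Lw)) (aeq_refl _) (Bop_hart Lw)).
by rewrite !ip_def; apply: I_eq => xi; ring.
Qed.

Lemma Bop_hnm s q : HsR s q -> HsR (s + 2^-1) (Bop b q) /\ hnm (s + 2^-1) (Bop b q) <= K * hnm s q.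
Proof.
move=> [Lq Ls]; have LB := Bop_L2 Lq.
have mB : mfun1 (fun xi => jw ((s + 2^-1) / 2) xi * hart (Bop b q) xi).
  exact: measurable_funM (jw_m _) (L2_m (hart_L2 LB)).
have mC : mfun1 (fun xi => jw ((s + 2^-1) / 2) xi * (b xi * hart q xi)).
  exact: measurable_funM (jw_m _) (L2_m (bq_L2 Lq)).
have e : aeq (fun xi => jw ((s + 2^-1) / 2) xi * hart (Bop b q) xi) (fun xi => jw ((s + 2^-1) / 2) xi * (b xi * hart q xi)).
  by apply: ae_imp (Bop_hart Lq) => xi ->.
have d xi : `|jw ((s + 2^-1) / 2) xi * (b xi * hart q xi)| <= K * `|jw (s / 2) xi * hart q xi|.
  have -> : (s + 2^-1) / 2 = s / 2 + 4^-1 by field.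
  rewrite jwD !normrM (ger0_norm (jw_ge0 _ _)) (ger0_norm (jw_ge0 _ _)).
  have := symb_le Sb xi; rewrite jwV => hb.
  have j0 := jw_gt0 4^-1 xi.
  have hb' : jw 4^-1 xi * `|b xi| <= K.
    by rewrite mulrC -ler_pdivlMr.
  rewrite mulrA -(mulrA (jw (s/2) xi)) (mulrC (jw (s/2) xi)) -mulrA.
  by apply: ler_wpM2r => //; rewrite mulr_ge0 ?jw_ge0.
have [LC nC] := L2_bddr mC Ls d.
split; last by rewrite /hnm (nm_ae mB mC e).
by split => //; apply: (L2_ae LC mB); exact: aeq_sym.
Qed.

End WithSymb.

Section GoodRep.
Variable s : R.
Hypothesis hs : 2^-1 < s.

(** The Sobolev embedding: for s > 1/2 the weight with exponent - s / 2 is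
    square-integrable. *)
Lemma hs_int u : HsR s u -> intg (hart u) /\ \int[mu]_xi `|hart u xi| <= nm (@jw R (- (s / 2))) * hnm s u.
Proof.
move=> [Lu Ls]; have Lj : L2p (@jw R (- (s / 2))) by apply: jw_L2; rewrite ltrN2 ltr_pM2r ?invr_gt0.
have E xi : hart u xi = jw (- (s / 2)) xi * (jw (s / 2) xi * hart u xi).
  by rewrite jwV mulrA mulVf ?mul1r // gt_eqF // jw_gt0.
split; first by rewrite (funext E); exact: L2_mul.
have La := L2_abs Ls.
have e : \int[mu]_xi `|hart u xi| = ip (jw (- (s / 2))) (fun xi => `|jw (s / 2) xi * hart u xi|).
  by rewrite ip_def; apply: I_eq => xi; rewrite {1}E normrM ger0_norm // jw_ge0.
rewrite e; apply: le_trans (ler_norm _) _; apply: le_trans (cauchy_schwarz Lj La) _.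
apply: ler_wpM2l; first exact: nm_ge0.
by apply: nm_dom (L2_m La) Ls _ => xi; rewrite normr_id.
Qed.

(** The continuous representative of a function in H^s, s > 1/2. *)
Definition cont_repr u x : R := hart1 (hart u) x.

Lemma cont_repr_spec u : HsR s u ->
  [/\ aeq (cont_repr u) u, continuous (cont_repr u), L2p (cont_repr u) &
   forall x, `|cont_repr u x| <= 2 * c0 * (nm (@jw R (- (s / 2))) * hnm s u)].
Proof.
move=> Hu; have [i ib] := hs_int Hu; have [Lu _] := Hu.
have Lh := hart_L2 Lu; have [L _ _] := synth i Lh.
split => //; last 1 first.
- move=> x; apply: le_trans (hart1_bd x i) _; apply: ler_wpM2l => //.
  by rewrite mulr_ge0 // ltW // c0_gt0.
- apply: aeq_trans (hart_inv Lu); apply: aeq_sym; exact: hart_L1.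
- exact: hart1_cont.
Qed.

End GoodRep.

Lemma HsR_ae s u v : HsR s u -> L2p v -> aeq u v -> HsR s v /\ hnm s v = hnm s u.
Proof.
move=> [Lu Ls] Lv e; have eh := hart_ae Lu Lv e.
have mv : mfun1 (fun xi => jw (s / 2) xi * hart v xi).
  exact: measurable_funM (jw_m _) (L2_m (hart_L2 Lv)).
have ew : aeq (fun xi => jw (s / 2) xi * hart u xi) (fun xi => jw (s / 2) xi * hart v xi).
  by apply: ae_imp eh => xi ->.
split; last by apply: nm_ae; [exact: mv|exact: L2_m Ls|exact: aeq_sym].
by split=> //; exact: L2_ae Ls mv ew.
Qed.

End Multiplier.

(** * The symbol of a kernel *)

Section Kernel.
Context {R : realType}.
Local Notation mu := (@lebesgue_measure R).
Variables (beta : R -> R) (C r : R).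
Hypothesis beta_int : mu.-integrable setT (EFin \o beta).
Hypothesis hr : 3 < r.
Hypothesis hC : 0 < C.
Hypothesis beta_hat : forall xi : R, 0 <= fourier beta xi <= (C * (1 + xi ^+ 2) `^ (- r / 2))%:C.

(** The Fourier transform of the kernel, as a real function; the hypothesis on
    it forces it to be real, hence even ([kernel_hat_fourier]). *)
Definition kernel_hat (xi : R) : R := hart1 beta xi / c0.

Lemma kernel_hat_fourier xi : complex.Re (fourier beta xi) = kernel_hat xi /\ hart1 beta (- xi) = hart1 beta xi.
Proof.
have c0n : (c0 : R) != 0 by rewrite gt_eqF // c0_gt0.
have := beta_hat xi; rewrite fourier_hart1 // /fw lecE /= => /andP[/andP[/eqP E _] _].
have E' : hart1 beta (- xi) = hart1 beta xi.
  move: E; move: (hart1 beta (- xi)) (hart1 beta xi) (c0 : R) c0n => y z c cn E.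
  have : (y - z) / (2 * c) * (2 * c) = 0 by rewrite E mul0r.
  by rewrite divfK ?mulf_neq0 // => /eqP; rewrite subr_eq0 => /eqP.
split=> //; rewrite E' /kernel_hat.
by move: (hart1 beta xi) (c0 : R) c0n => z c cn; field; rewrite cn.
Qed.

Lemma kernel_hat_ge0 xi : 0 <= kernel_hat xi.
Proof.
have [<- _] := kernel_hat_fourier xi; have /andP[h _] := beta_hat xi.
by move: h; rewrite lecE /= => /andP[].
Qed.

Lemma kernel_hat_le xi : kernel_hat xi <= C * jw (- r / 2) xi.
Proof.
have [<- _] := kernel_hat_fourier xi; have /andP[_ h] := beta_hat xi.
by move: h; rewrite lecE /= => /andP[].
Qed.

Lemma fourier_kernel_hat xi : fourier beta xi = (kernel_hat xi)%:C.
Proof.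
have := beta_hat xi; rewrite -(kernel_hat_fourier xi).1.
case: (fourier beta xi) => a b /= /andP[h _]; move: h.
by rewrite lecE /= => /andP[/eqP -> _].
Qed.

Lemma kernel_hat_cont : continuous kernel_hat.
Proof. by move=> x; apply: cvgM; [exact: hart1_cont|exact: cvg_cst]. Qed.

Lemma kernel_hat_m : mfun1 kernel_hat.
Proof. exact: continuous_measurable_fun kernel_hat_cont. Qed.

(** The square root of the symbol xi^2 hat beta of - (beta * .)_xx. *)
Definition wave_symb (xi : R) : R := `|xi| * Num.sqrt (kernel_hat xi).

Lemma wave_symb_sq xi : wave_symb xi ^+ 2 = xi ^+ 2 * kernel_hat xi.
Proof. by rewrite exprMn real_normK ?num_real // sqr_sqrtr // kernel_hat_ge0. Qed.

(** The symbol decays with the power 1 - r / 2 of |xi|, which is below -1/2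
    exactly when r > 3. *)
Lemma wave_symb_symb : symb wave_symb (Num.sqrt C).
Proof.
have ge xi : 0 <= wave_symb xi by rewrite mulr_ge0 // sqrtr_ge0.
have m : mfun1 wave_symb.
  apply: measurable_funM; first exact: abs_m.
  apply: (measurableT_comp (f := @Num.sqrt R)); last exact: kernel_hat_m.
  exact: (continuous_measurable_fun (@sqrt_continuous R)).
have le xi : `|wave_symb xi| <= Num.sqrt C * jw (2^-1 - r / 4) xi.
  rewrite (ger0_norm (ge xi)) -(@ler_pXn2r _ 2) ?nnegrE ?mulr_ge0 ?sqrtr_ge0 ?jw_ge0 //.
  rewrite wave_symb_sq exprMn sqr_sqrtr ?(ltW hC) // jw_sq.
  have -> : 2 * (2^-1 - r / 4) = 1 + - r / 2 by field.
  rewrite jwD jw1; apply: le_trans (ler_wpM2l (sqr_ge0 xi) (kernel_hat_le xi)) _.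
  rewrite mulrCA; apply: ler_wpM2l; first exact: ltW.
  by apply: ler_wpM2r; [exact: jw_ge0|rewrite lerDr].
split.
- have ha : 2^-1 - r / 4 < - (2^-1 / 2) by have h := hr; lra.
  apply: (L2_dom m (L2_Z (Num.sqrt C) (jw_L2 ha))).
  by move=> xi; apply: le_trans (le xi) _; exact: ler_norm.
- exact: sqrtr_ge0.
- move=> xi; apply: le_trans (le xi) _; apply: ler_wpM2l; first exact: sqrtr_ge0.
  by apply: jw_le; have h := hr; lra.
Qed.

Hypothesis beta_zeros : isolated_zeros (fourier beta).

Lemma countable_ae (Z : set R) : countable Z -> {ae mu, forall x, ~ Z x}.
Proof.
move=> cZ; exists Z; split; [exact: countable_measurable|exact: countable_lebesgue_measure0|].
by move=> x /= h; apply: contrapT.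
Qed.

(** A set of isolated points of the line is countable, hence negligible. *)
Lemma kernel_hat_zeros_ae : {ae mu, forall xi, xi != 0 /\ kernel_hat xi != 0}.
Proof.
pose Z := [set xi | kernel_hat xi = 0].
have iZ : Z `<=` isolated Z.
  move=> x Zx; split; first by rewrite inE.
  have /beta_zeros : fourier beta x = 0 by rewrite fourier_kernel_hat Zx.
  rewrite /dnbhs /within /= => nV.
  exists [set y | y != x -> fourier beta y != 0]; first exact: nV.
  apply/seteqP; split=> y /=.
    move=> [h Zy]; apply: contrapT => /eqP yx; have := h yx.
    by rewrite fourier_kernel_hat Zy eqxx.
  by move=> ->; split => //; rewrite eqxx.
have cZ : countable Z := sub_countable (subset_card_le iZ) (countable_isolated Z).
apply: (ae_imp2 _ (countable_ae cZ) (countable_ae (countable1 (0 : R)))) => xi h h'.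
by split; apply/eqP => E; [apply: h'|apply: h].
Qed.

(** The function with transform |xi|^-1 (hat beta)^(-1/2) hat psi is
    square-integrable by hypothesis, and the multiplier undoes the division
    wherever xi and hat beta do not vanish, that is, almost everywhere. *)
Lemma psi_lift psi : Hs 0 psi -> P_in_L2 beta psi ->
  exists2 p0, L2p p0 & aeq (Bop wave_symb p0) psi.
Proof.
move=> /HsE[Lp _] /L2C_comp[_ _ iP].
pose c xi : R := `|xi|^-1 * (kernel_hat xi) `^ (- 2^-1).
have Lh := hart_L2 Lp.
have mc : mfun1 c.
  have -> : c = (fun xi => `|xi| `^ (-1) * (kernel_hat xi) `^ (- 2^-1)).
    by apply/funext => xi; rewrite /c powR_inv1.
  apply: measurable_funM.
    by apply: (measurableT_comp (measurable_powR _)); exact: abs_m.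
  by apply: (measurableT_comp (measurable_powR _)); exact: kernel_hat_m.
have mch : mfun1 (fun xi => c xi * hart psi xi) by exact: measurable_funM mc (L2_m Lh).
have Lch : L2p (fun xi => c xi * hart psi xi).
  split=> //.
  have mn : mfun1 (fun xi => c xi ^+ 2 * normsq (fw (hart psi) xi)).
    by apply: measurable_funM; [exact: measurable_funX|have [i _] := int_normsq_fw Lh; exact: intg_m i].
  have i2 : intg (fun xi => c xi ^+ 2 * normsq (fw (hart psi) xi)).
    apply: (intg_ae iP mn); have [_ e] := fourierL2P Lp.
    apply: ae_imp e => xi E; rewrite /P_symbol E (kernel_hat_fourier xi).1 -/(c xi).
    by case: (fw _ _) => y z; rewrite /normsq /=; ring.
  apply: (intg_dom _ (intgZ (2 * c0 ^+ 2) i2)); first exact: measurable_funX.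
  move=> xi; rewrite ger0_norm ?sqr_ge0 // normsq_fw.
  have c0n : (c0 : R) != 0 by rewrite gt_eqF // c0_gt0.
  have -> : 2 * c0 ^+ 2 * (c xi ^+ 2 * ((hart psi xi ^+ 2 + hart psi (- xi) ^+ 2) / (2 * c0 ^+ 2))) = c xi ^+ 2 * hart psi xi ^+ 2 + c xi ^+ 2 * hart psi (- xi) ^+ 2.
    by move: (c0 : R) c0n => d dn; field; rewrite dn.
  by rewrite exprMn lerDl mulr_ge0 ?sqr_ge0.
exists (hart (fun xi => c xi * hart psi xi)); first exact: hart_L2.
have Lp0 := hart_L2 Lch.
have Sb := wave_symb_symb; have LB := Bop_L2 Sb Lp0.
apply: aeq_trans (hart_inv Lp); apply: aeq_trans (aeq_sym (hart_inv LB)) _.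
apply: hart_ae => //; first exact: hart_L2.
apply: aeq_trans (Bop_hart Sb Lp0) _.
apply: (ae_imp2 _ kernel_hat_zeros_ae (hart_inv Lch)) => xi [x0 b0] ->.
have bp : 0 < kernel_hat xi by rewrite lt_def b0 kernel_hat_ge0.
rewrite mulrA -[RHS]mul1r; congr (_ * _).
rewrite /wave_symb /c powRN powR12_sqrt ?kernel_hat_ge0 //.
have s0 : Num.sqrt (kernel_hat xi) != 0 by rewrite gt_eqF // sqrtr_gt0.
have a0 : `|xi| != 0 by rewrite normr_eq0.
by move: (Num.sqrt _) `|xi| s0 a0 => y z y0 z0; field; rewrite y0 z0.
Qed.

End Kernel.

(** * Calculus in the plane *)

Section Plane.
Context {R : realType}.
Implicit Types (f F g : R * R -> R) (M K : R) (p : R * R).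

Definition box2 M p := `|p.1| <= M /\ `|p.2| <= M.
(** The distance of the sum norm, convenient for increments taken one variable
    at a time. *)
Definition d2 (p p' : R * R) : R := `|p'.1 - p.1| + `|p'.2 - p.2|.

Lemma cont_bd f M : continuous f -> exists2 K, 0 <= K & forall p, box2 M p -> `|f p| <= K.
Proof.
move=> cf.
have cK : compact (`[- M, M]%classic `*` `[- M, M]%classic : set (R * R)).
  by apply: compact_setX; exact: segment_compact.
have cI : compact (f @` (`[- M, M]%classic `*` `[- M, M]%classic : set (R * R))).
  by apply: continuous_compact => //; exact: continuous_subspaceT.
have [K [_ hK]] := compact_bounded cI.
exists `|K + 1| => // p [h1 h2]; apply: le_trans (ler_norm (K + 1)); apply: (hK (K + 1)); first by rewrite ltrDl.
by exists p => //; split; rewrite /= in_itv /= -ler_norml.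
Qed.

Definition grad F F1 F2 := forall p, is_derive p (1, 0) F (F1 p) /\ is_derive p (0, 1) F (F2 p).

Lemma grad_sec1 F F1 F2 : grad F F1 F2 -> forall a b : R, is_derive a 1 (fun t : R => F (t, b)) (F1 (a, b)).
Proof.
move=> hg a b; have [[d e] _] := hg (a, b).
have E : (fun h : R => h^-1 *: ((fun t : R => F (t, b)) (h *: (1 : R) + a) - F (a, b))) =
         (fun h : R => h^-1 *: (F (h *: ((1, 0) : R * R) + (a, b)) - F (a, b))).
  apply/funext => h; congr (_ *: (F _ - _)).
  by rewrite (_ : h *: (1, 0) + (a, b) = (h *: 1 + a, h *: 0 + b)) // scaler0 add0r.
split; first by rewrite /derivable /= E.
by rewrite -e /derive /= E.
Qed.

Lemma grad_sec2 F F1 F2 : grad F F1 F2 -> forall a b : R, is_derive b 1 (fun t : R => F (a, t)) (F2 (a, b)).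
Proof.
move=> hg a b; have [_ [d e]] := hg (a, b).
have E : (fun h : R => h^-1 *: ((fun t : R => F (a, t)) (h *: (1 : R) + b) - F (a, b))) =
         (fun h : R => h^-1 *: (F (h *: ((0, 1) : R * R) + (a, b)) - F (a, b))).
  apply/funext => h; congr (_ *: (F _ - _)).
  by rewrite (_ : h *: (0, 1) + (a, b) = (h *: 0 + a, h *: 1 + b)) // scaler0 add0r.
split; first by rewrite /derivable /= E.
by rewrite -e /derive /= E.
Qed.

Lemma mvt1 (phi dphi : R -> R) (a b : R) : (forall x : R, is_derive x 1 phi (dphi x)) ->
  exists c : R, [/\ phi b - phi a = dphi c * (b - a), `|c - a| <= `|b - a| & forall M, `|a| <= M -> `|b| <= M -> `|c| <= M].
Proof.
move=> h.
have cphi : continuous phi.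
  by move=> x; have [d _] := h x; exact: (differentiable_continuous (iffLR (derivable1_diffP _ _) d)).
have [ab|ba|->] := ltrgtP a b.
- have [c /itvP ci e] := MVT ab (fun x _ => h x) (continuous_subspaceT cphi).
  have c1 : a < c by rewrite ci. have c2 : c < b by rewrite ci.
  exists c; split => //.
    by rewrite !ger0_norm ?subr_ge0 ?ltW //; lra.
  by move=> M; rewrite !ler_norml => /andP[? ?] /andP[? ?]; apply/andP; split; lra.
- have [c /itvP ci e] := MVT ba (fun x _ => h x) (continuous_subspaceT cphi).
  have c1 : b < c by rewrite ci. have c2 : c < a by rewrite ci.
  exists c; split => //.
  - by rewrite -opprB e; ring.
  - by rewrite !ler0_norm ?subr_le0 ?ltW //; lra.
  by move=> M; rewrite !ler_norml => /andP[? ?] /andP[? ?]; apply/andP; split; lra.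
- by exists b; rewrite !subrr; split => //; rewrite ?mulr0 ?normr0.
Qed.

(** Move in one variable after the other; the intermediate points stay in
    every box that contains both end points. *)
Lemma mvt2 F F1 F2 p p' : grad F F1 F2 -> exists q1 q2,
  [/\ F p' - F p = F1 q1 * (p'.1 - p.1) + F2 q2 * (p'.2 - p.2),
      d2 p q1 <= d2 p p', d2 p q2 <= d2 p p' &
      forall M, box2 M p -> box2 M p' -> box2 M q1 /\ box2 M q2].
Proof.
case: p => a b; case: p' => a' b' hg.
have [c [e1 c1 c2]] := @mvt1 (fun t => F (t, b')) (fun t => F1 (t, b')) a a' (fun x => grad_sec1 hg x b').
have [d [e2 d1 d2']] := @mvt1 (fun t => F (a, t)) (fun t => F2 (a, t)) b b' (fun x => grad_sec2 hg a x).
exists (c, b'), (a, d); rewrite /d2 /=; split.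
- by rewrite -e1 -e2; ring.
- by rewrite lerD2r.
- by rewrite subrr normr0 add0r (le_trans d1) // lerDr.
- by move=> M [/= h1 h2] [/= h3 h4]; split; split => //=; [exact: c2|exact: d2'].
Qed.

Definition loclip f := forall M, exists2 K, 0 <= K & forall p p', box2 M p -> box2 M p' -> `|f p' - f p| <= K * d2 p p'.

Lemma grad_loclip F F1 F2 : grad F F1 F2 -> continuous F1 -> continuous F2 -> loclip F.
Proof.
move=> hg c1 c2 M; have [K1 K10 h1] := cont_bd M c1; have [K2 K20 h2] := cont_bd M c2.
exists (K1 + K2); first exact: addr_ge0.
move=> p p' bp bp'; have [q1 [q2 [-> _ _ hb]]] := mvt2 p p' hg.
have [b1 b2] := hb M bp bp'.
apply: le_trans (ler_normD _ _) _; rewrite !normrM.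
have := h1 _ b1; have := h2 _ b2; rewrite /d2.
move: `|F1 q1| `|F2 q2| `|p'.1 - p.1| `|p'.2 - p.2| (normr_ge0 (F1 q1)) (normr_ge0 (F2 q2)) (normr_ge0 (p'.1 - p.1)) (normr_ge0 (p'.2 - p.2)) => x y z w x0 y0 z0 w0 hy hx.
have := ler_wpM2r z0 hx; have := ler_wpM2r w0 hy.
have := mulr_ge0 K10 w0; have := mulr_ge0 K20 z0; rewrite mulrDl !mulrDr; lra.
Qed.

(** The error in [mvt2] of evaluating the partial derivatives at the
    intermediate points is controlled by their Lipschitz constants. *)
Lemma taylor2 F F1 F2 : grad F F1 F2 -> loclip F1 -> loclip F2 -> forall M,
  exists2 K, 0 <= K & forall p p', box2 M p -> box2 M p' ->
    `|F p' - F p - (F1 p * (p'.1 - p.1) + F2 p * (p'.2 - p.2))| <= K * d2 p p' ^+ 2.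
Proof.
move=> hg l1 l2 M; have [K1 K10 h1] := l1 M; have [K2 K20 h2] := l2 M.
exists (K1 + K2); first exact: addr_ge0.
move=> p p' bp bp'; have [q1 [q2 [-> e1 e2 hb]]] := mvt2 p p' hg.
have [b1 b2] := hb M bp bp'.
have -> : F1 q1 * (p'.1 - p.1) + F2 q2 * (p'.2 - p.2) - (F1 p * (p'.1 - p.1) + F2 p * (p'.2 - p.2)) = (F1 q1 - F1 p) * (p'.1 - p.1) + (F2 q2 - F2 p) * (p'.2 - p.2) by ring.
apply: le_trans (ler_normD _ _) _; rewrite !normrM.
have := h1 _ _ bp b1; have := h2 _ _ bp b2.
have a1 : `|p'.1 - p.1| <= d2 p p' by rewrite lerDl.
have a2 : `|p'.2 - p.2| <= d2 p p' by rewrite lerDr.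
move=> k2 k1.
have k1' := le_trans k1 (ler_wpM2l K10 e1); have k2' := le_trans k2 (ler_wpM2l K20 e2).
rewrite mulrDl expr2 !mulrA; apply: lerD; apply: ler_pM => //.
Qed.

Lemma Csmooth_cont f : Csmooth f -> continuous f.
Proof. by move=> /(_ 0%N). Qed.

Lemma Csmooth_d1 f : Csmooth f -> Csmooth (fun p => 'D_(1, 0) f p).
Proof. by move=> h k; have [_ _] := h k.+1. Qed.

Lemma Csmooth_d2 f : Csmooth f -> Csmooth (fun p => 'D_(0, 1) f p).
Proof. by move=> h k; have [_ _] := h k.+1. Qed.

Lemma Csmooth_grad f : Csmooth f -> grad f (fun p => 'D_(1, 0) f p) (fun p => 'D_(0, 1) f p).
Proof.
move=> h p; have [_ /(_ p)[d1 d2] _ _] := h 1%N.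
by split; exact: DeriveDef.
Qed.

Lemma Csmooth_loclip f : Csmooth f -> loclip f.
Proof.
move=> h; apply: (grad_loclip (Csmooth_grad h)); apply: Csmooth_cont; [exact: Csmooth_d1|exact: Csmooth_d2].
Qed.

Lemma grad_uniq F F1 F2 : grad F F1 F2 ->
  (fun p => 'D_(1, 0) F p) = F1 /\ (fun p => 'D_(0, 1) F p) = F2.
Proof. by move=> h; split; apply/funext => p; have [[_ e1] [_ e2]] := h p. Qed.

(** Smoothness from any explicit gradient, so that derivatives need not be
    computed as limits. *)
Lemma Ck_grad F F1 F2 : grad F F1 F2 -> continuous F -> forall k, Ck k F1 -> Ck k F2 -> Ck k.+1 F.
Proof.
move=> h cF k h1 h2; have [e1 e2] := grad_uniq h.
have k1 : Ck k (fun p => 'D_(1, 0) F p) by rewrite (_ : (fun p => _) = F1).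
have k2 : Ck k (fun p => 'D_(0, 1) F p) by rewrite (_ : (fun p => _) = F2).
split=> //.
by move=> p; have [[d1 _] [d2 _]] := h p.
Qed.

Lemma lin_cont (a b c : R) : continuous (fun p : R * R => a * p.1 + b * p.2 + c).
Proof.
move=> p; apply: cvgD; last exact: cvg_cst.
by apply: cvgD; apply: cvgM; [exact: cvg_cst|exact: cvg_fst|exact: cvg_cst|exact: cvg_snd].
Qed.

Lemma lin_grad (a b c : R) : grad (fun p : R * R => a * p.1 + b * p.2 + c) (fun=> a) (fun=> b).
Proof.
have H (v : R * R) p : is_derive p v (fun p : R * R => a * p.1 + b * p.2 + c) (a * v.1 + b * v.2).
  have C : (fun h : R => h^-1 *: ((fun p : R * R => a * p.1 + b * p.2 + c) (h *: v + p) - (a * p.1 + b * p.2 + c)))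
     @ 0^' --> a * v.1 + b * v.2.
    apply: cvg_near_cst; near=> h.
    have hn : h != 0 by near: h; exact: nbhs_dnbhs_neq.
    have e1 : (h *: v + p).1 = h * v.1 + p.1 by [].
    have e2 : (h *: v + p).2 = h * v.2 + p.2 by [].
    by rewrite e1 e2 /GRing.scale /=; field.
  by split; [apply/cvg_ex; eexists; exact: C|exact: cvg_lim C].
by move=> p; split; apply: (is_derive_eq (H _ p)) => /=; ring.
Unshelve. all: end_near. Qed.

Lemma Csmooth_lin (a b c : R) : Csmooth (fun p : R * R => a * p.1 + b * p.2 + c).
Proof.
move=> k; elim: k a b c => [|k IH] a b c; first exact: lin_cont.
have cst (d : R) : Ck k (fun=> d).
  have := IH 0 0 d; rewrite (_ : (fun _ => _) = (fun=> d)) //.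
  by apply/funext => p; ring.
by apply: (Ck_grad (lin_grad a b c)); [exact: lin_cont|exact: cst|exact: cst].
Qed.

(** The gradient is linear, hence smooth by [Csmooth_lin]. *)
Lemma Csmooth_prod : Csmooth (fun p : R * R => p.1 * p.2).
Proof.
have c : continuous (fun p : R * R => p.1 * p.2).
  by move=> p; apply: cvgM; [exact: cvg_fst|exact: cvg_snd].
have g : grad (fun p : R * R => p.1 * p.2) (fun p => 0 * p.1 + 1 * p.2 + 0) (fun p => 1 * p.1 + 0 * p.2 + 0).
  have H (v : R * R) p : is_derive p v (fun p : R * R => p.1 * p.2) (v.1 * p.2 + v.2 * p.1).
    have C : (fun h : R => h^-1 *: ((fun p : R * R => p.1 * p.2) (h *: v + p) - (p.1 * p.2)))
       @ 0^' --> v.1 * p.2 + v.2 * p.1.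
      have E : \forall h \near 0^', v.1 * p.2 + v.2 * p.1 + h * (v.1 * v.2) = (h^-1 *: ((fun p : R * R => p.1 * p.2) (h *: v + p) - (p.1 * p.2))).
        near=> h.
        have hn : h != 0 by near: h; exact: nbhs_dnbhs_neq.
        have e1 : (h *: v + p).1 = h * v.1 + p.1 by [].
    have e2 : (h *: v + p).2 = h * v.2 + p.2 by [].
    by rewrite e1 e2 /GRing.scale /=; field.
      suff L : (v.1 * p.2 + v.2 * p.1 + h * (v.1 * v.2)) @[h --> 0^'] --> v.1 * p.2 + v.2 * p.1.
        by apply: (cvg_trans _ L); apply: near_eq_cvg; near=> h; near: h.
      rewrite -[X in _ --> X](addr0 (v.1 * p.2 + v.2 * p.1)).
      apply: cvgD; first exact: cvg_cst.
      rewrite -[X in _ --> X](mul0r (v.1 * v.2)); apply: cvgM; last exact: cvg_cst.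
      exact: cvg_within.
    by split; [apply/cvg_ex; eexists; exact: C|exact: cvg_lim C].
  by move=> p; split; apply: (is_derive_eq (H _ p)) => /=; ring.
by case=> [|k] //; apply: (Ck_grad g) => //; exact: Csmooth_lin.
Unshelve. all: end_near. Qed.

End Plane.

(** * Curves of square-integrable functions *)

Section SumSpace.
Context {R : realType} {X Y : Type}.
Variables (DX : set (X -> R)) (NX : (X -> R) -> R) (DY : set (Y -> R)) (NY : (Y -> R) -> R).
(** A product of function spaces is realized as functions on the disjoint
    union of the domains, so that it is again a space of real-valued
    functions. *)
Definition sumD : set (X + Y -> R) := [set U : X + Y -> R | DX (U \o inl) /\ DY (U \o inr)].
Definition sumN (U : X + Y -> R) : R := NX (U \o inl) + NY (U \o inr).

Lemma sum_seminorm : seminorm_on DX NX -> seminorm_on DY NY -> seminorm_on sumD sumN.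
Proof.
move=> SX SY; split.
- by split; [exact: (sn0 SX)|exact: (sn0 SY)].
- by move=> a u v [u1 u2] [v1 v2]; split; [exact: (snL SX a u1 v1)|exact: (snL SY a u2 v2)].
- by move=> u [u1 u2]; apply: addr_ge0; [exact: (sn_ge0 SX)|exact: (sn_ge0 SY)].
- move=> u v [u1 u2] [v1 v2]; rewrite /sumN.
  have h1 := snD SX u1 v1; have h2 := snD SY u2 v2.
  by rewrite addrACA; exact: lerD.
- move=> a u [u1 u2]; rewrite /sumN mulrDr; congr (_ + _); [exact: (snZ SX)|exact: (snZ SY)].
Qed.

Lemma sum_complete : seminorm_on DX NX -> seminorm_on DY NY ->
  seq_complete DX NX -> seq_complete DY NY -> seq_complete sumD sumN.
Proof.
move=> SX SY cX cY f Df cf.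
have D1 n : DX (f n \o inl) by case: (Df n). have D2 n : DY (f n \o inr) by case: (Df n).
have [|l1 Dl1 h1] := cX (fun n => f n \o inl) D1.
  move=> e e0; have [n0 h] := cf e e0; exists n0 => m n hm hn.
  apply: le_trans (h m n hm hn); rewrite /sumN lerDl; apply: (sn_ge0 SY).
  exact: (snDB SY (D2 m) (D2 n)).
have [|l2 Dl2 h2] := cY (fun n => f n \o inr) D2.
  move=> e e0; have [n0 h] := cf e e0; exists n0 => m n hm hn.
  apply: le_trans (h m n hm hn); rewrite /sumN lerDr; apply: (sn_ge0 SX).
  exact: (snDB SX (D1 m) (D1 n)).
pose l (z : X + Y) : R := match z with inl x => l1 x | inr y => l2 y end.
exists l; first by split.
move=> e e0; have e2 : 0 < e / 2 by rewrite divr_gt0.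
have [n1 k1] := h1 _ e2; have [n2 k2] := h2 _ e2.
exists (maxn n1 n2) => n hn; rewrite [e]splitr; apply: lerD.
  by apply: k1; exact: leq_trans (leq_maxl _ _) hn.
by apply: k2; exact: leq_trans (leq_maxr _ _) hn.
Qed.
End SumSpace.

Section Curves.
Context {R : realType}.
Implicit Types (f u v w q : R -> R) (g : R * R -> R) (M K : R).

Lemma nm_dom2 f u v K : 0 <= K -> mfun1 f -> L2p u -> L2p v -> (forall x, `|f x| <= K * (`|u x| + `|v x|)) ->
  L2p f /\ nm f <= K * (nm u + nm v).
Proof.
move=> K0 mf Lu Lv h; have La := L2_abs Lu; have Lb := L2_abs Lv; have Ls := L2_D La Lb.
have h' x : `|f x| <= K * `|(`|u x| + `|v x|)|.
  by rewrite [X in _ <= _ * X]ger0_norm ?addr_ge0.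
have [L n] := L2_bddr mf Ls h'; split => //.
apply: le_trans n _; apply: ler_wpM2l => //; apply: le_trans (nmD La Lb) _.
apply: lerD; [apply: nm_dom (L2_m La) Lu _|apply: nm_dom (L2_m Lb) Lv _] => x; by rewrite normr_id.
Qed.

(** The functions whose composition with a locally Lipschitz map stays under
    control: the Lipschitz constant on the box of size [M] applies. *)
Definition nice M u := [/\ L2p u, continuous u & forall x, `|u x| <= M].

Definition comp2 (g : R * R -> R) u v x := g (u x, v x).

Lemma comp2_cont g u v : continuous g -> continuous u -> continuous v -> continuous (comp2 g u v).
Proof.
move=> cg cu cv x; apply: (@continuous_comp _ _ _ (fun x => (u x, v x)) g); last exact: cg.
exact: cvg_pair (cu x) (cv x).
Qed.

Lemma comp2_lip g K M u v u' v' : 0 <= K -> continuous g ->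
  (forall p p', box2 M p -> box2 M p' -> `|g p' - g p| <= K * d2 p p') ->
  nice M u -> nice M v -> nice M u' -> nice M v' ->
  L2p (fun x => comp2 g u' v' x - comp2 g u v x) /\
  nm (fun x => comp2 g u' v' x - comp2 g u v x) <= K * (nm (fun x => u' x - u x) + nm (fun x => v' x - v x)).
Proof.
move=> K0 cg hK [Lu cu bu] [Lv cv bv] [Lu' cu' bu'] [Lv' cv' bv'].
apply: nm_dom2 => //; [|exact: L2_B|exact: L2_B|].
  by apply: measurable_funB; apply: continuous_measurable_fun; exact: comp2_cont.
move=> x; apply: (hK (u x, v x) (u' x, v' x)).
  by split; [exact: bu|exact: bv].
by split; [exact: bu'|exact: bv'].
Qed.

(** Comparison with the composition at the zero function. *)
Lemma comp2_L2 g M u v : loclip g -> continuous g -> nice M u -> nice M v ->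
  L2p (fun x => comp2 g u v x - g (0, 0)).
Proof.
move=> hg cg nu nv; have [K K0 hK] := hg M.
have M0 : 0 <= M by have [_ _ b] := nu; exact: le_trans (normr_ge0 _) (b 0).
have n0 : nice M (fun=> 0) by split; [exact: L2_0|exact: cst_continuous|move=> x; rewrite normr0].
exact: (comp2_lip K0 cg hK n0 n0 nu nv).1.
Qed.

(** The increment of the square is |h W + r|^2 + 2 (U, h W + r) with a
    remainder r of smaller order. *)
Lemma has_deriv_ip (I : set R) (U W : R -> R -> R) :
  (forall t, I t -> L2p (U t)) -> (forall t, I t -> L2p (W t)) -> has_deriv nm I U W ->
  forall t, I t -> forall e : R, 0 < e -> exists2 d, 0 < d & forall h, `|h| < d -> I (t + h) ->
   `|ip (U (t + h)) (U (t + h)) - ip (U t) (U t) - h * (2 * ip (U t) (W t))| <= e * `|h|.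
Proof.
move=> LU LW hd t It e e0.
have LUt := LU t It; have LWt := LW t It.
pose A := nm (U t); pose B := nm (W t); have A0 : 0 <= A := nm_ge0 _; have B0 : 0 <= B := nm_ge0 _.
pose e1 := e / (2 * (2 * A + 1)).
have e10 : 0 < e1 by rewrite divr_gt0 // mulr_gt0 //; lra.
have [d d0 hd1] := hd t It e1 e10.
pose d' := Num.min d (e / (2 * (B + e1 + 1) ^+ 2)).
have Be : 0 < B + e1 + 1 by lra.
have d'0 : 0 < d' by rewrite lt_min d0 divr_gt0 // mulr_gt0 // exprn_gt0.
exists d' => // h; rewrite lt_min => /andP[hh1 hh2] Ith.
have LUh := LU _ Ith.
pose D := (fun x => U (t + h) x - U t x).
have LD : L2p D by exact: L2_B.
have LE : L2p (fun x => D x - h * W t x) by apply: L2_B => //; exact: L2_Z.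
have nE : nm (fun x => D x - h * W t x) <= e1 * `|h| := hd1 h hh1 Ith.
have nD : nm D <= (B + e1) * `|h|.
  have -> : D = (fun x => h * W t x + (D x - h * W t x)) by apply/funext => x; ring.
  apply: le_trans (nmD (L2_Z h LWt) LE) _; rewrite nmZ // mulrDl mulrC.
  by apply: lerD.
have -> : ip (U (t + h)) (U (t + h)) - ip (U t) (U t) - h * (2 * ip (U t) (W t)) =
   2 * ip (fun x => D x - h * W t x) (U t) + ip D D.
  have -> : U (t + h) = (fun x => U t x + D x) by apply/funext => x; rewrite /D; ring.
  rewrite (ipBl LD (L2_Z h LWt) LUt) (ipZl h LWt LUt).
  rewrite (ipDl LUt LD (L2_D LUt LD)) (ipDr LUt LD LUt) (ipDr LUt LD LD) (ipC D (U t)) (ipC (W t)).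
  ring.
apply: le_trans (ler_normD _ _) _; rewrite normrM (ger0_norm (ip_ge0 D)) ger0_norm // -nm_sq.
have c1 : `|ip (fun x => D x - h * W t x) (U t)| <= e1 * `|h| * A.
  by apply: le_trans (cauchy_schwarz LE LUt) _; apply: ler_wpM2r.
have c2 : nm D ^+ 2 <= ((B + e1) * `|h|) ^+ 2.
  by rewrite ler_pXn2r ?nnegrE ?nm_ge0 // mulr_ge0 //; lra.
have c3 : 2 * (e1 * `|h| * A) <= e / 2 * `|h|.
  have -> : 2 * (e1 * `|h| * A) = (e1 * (2 * A)) * `|h| by ring.
  apply: ler_wpM2r => //.
  have -> : e / 2 = e1 * (2 * A + 1) by rewrite /e1; field; lra.
  by apply: ler_wpM2l; [exact: ltW|lra].
have c4 : ((B + e1) * `|h|) ^+ 2 <= e / 2 * `|h|.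
  rewrite expr2 mulrA; apply: ler_wpM2r => //.
  move: hh2; rewrite ltr_pdivlMr ?mulr_gt0 ?exprn_gt0 // => hh2.
  have hb : (B + e1) ^+ 2 <= (B + e1 + 1) ^+ 2.
    have s0 : 0 <= B + e1 by lra.
    by rewrite !expr2; apply: ler_pM => //; lra.
  have := ler_wpM2l (normr_ge0 h) hb.
  have -> : (B + e1) * `|h| * (B + e1) = `|h| * (B + e1) ^+ 2 by ring.
  lra.
lra.
Qed.

Definition sder (I : set R) (y w : R -> R) := forall t, I t -> forall e : R, 0 < e ->
  exists2 d, 0 < d & forall h : R, `|h| < d -> I (t + h) -> `|y (t + h) - y t - h * w t| <= e * `|h|.

Lemma sderD (I : set R) (y w y' w' : R -> R) : sder I y w -> sder I y' w' ->
  sder I (fun t => y t + y' t) (fun t => w t + w' t).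
Proof.
move=> h1 h2 t It e e0; have e2 : 0 < e / 2 by rewrite divr_gt0.
have [d d0 k1] := h1 t It _ e2; have [d' d'0 k2] := h2 t It _ e2.
exists (Num.min d d'); first by rewrite lt_min d0.
move=> h; rewrite lt_min => /andP[a1 a2] Ih.
have -> : y (t + h) + y' (t + h) - (y t + y' t) - h * (w t + w' t) =
  (y (t + h) - y t - h * w t) + (y' (t + h) - y' t - h * w' t) by ring.
apply: le_trans (ler_normD _ _) _.
have := k1 h a1 Ih; have := k2 h a2 Ih; lra.
Qed.

Lemma sder_ip (I : set R) (U W : R -> R -> R) :
  (forall t, I t -> L2p (U t)) -> (forall t, I t -> L2p (W t)) -> has_deriv nm I U W ->
  sder I (fun t => ip (U t) (U t)) (fun t => 2 * ip (U t) (W t)).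
Proof. exact: has_deriv_ip. Qed.

(** The mean value inequality for a space with a single point. *)
Lemma sder_const (T : R) (y w : R -> R) : 0 <= T -> sder `[0, T] y w -> (forall t, 0 <= t <= T -> w t = 0) -> y T = y 0.
Proof.
move=> T0 hs w0.
pose N (v : unit -> R) := `|v tt|.
have SN : seminorm_on setT N.
  split => //; rewrite /N.
  - by move=> u _; exact: normr_ge0.
  - by move=> u v _ _; exact: ler_normD.
  - by move=> a u _; exact: normrM.
have H : N ((fun=> y T) - (fun=> y 0)) <= 0 * (T - 0).
  apply: (deriv_mean_value (D := setT) SN (f := fun t => (fun=> y t)) (w := fun=> 0)) => //; last first.
    by move=> t _; rewrite /N normr0.
  move=> t It e e0; have [d d0 hd] := hs t It e e0; exists d => // h hh Ih.
  have := hd h hh Ih; rewrite w0 ?mulr0 //.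
  by rewrite scaler0.
move: H; rewrite mul0r /N normr_le0 => /eqP H.
by apply/eqP; rewrite -subr_eq0; apply/eqP.
Qed.

(** The gradient of G vanishes at the origin, so G (u, v) - G (0, 0) is
    quadratic in (u, v) by Taylor's formula. *)
Lemma potential_intg (G g1 g2 : R * R -> R) M u v : grad G g1 g2 -> loclip g1 -> loclip g2 ->
  continuous G -> g1 (0, 0) = 0 -> g2 (0, 0) = 0 -> nice M u -> nice M v ->
  intg (fun x => comp2 G u v x - G (0, 0)).
Proof.
move=> gG l1 l2 cG g10 g20 [Lu cu bu] [Lv cv bv].
have M0 : 0 <= M by exact: le_trans (normr_ge0 _) (bu 0).
have [K K0 hK] := taylor2 gG l1 l2 M.
have [_ i] := L2_D (L2_abs Lu) (L2_abs Lv).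
apply: (intg_dom _ (intgZ K i)).
  by apply: measurable_funB => //; apply: continuous_measurable_fun; exact: comp2_cont.
move=> x; have X0 : box2 M (0, 0) by split; rewrite /= normr0.
have X1 : box2 M (u x, v x) by split; [exact: bu|exact: bv].
by have := hK _ _ X0 X1; rewrite g10 g20 /d2 /= !mul0r !subr0 addr0 subr0.
Qed.

(** The integral of Taylor's remainder is quadratic in the increments, hence
    of smaller order; the linear part is differentiated as a pairing with the
    fixed gradient. *)
Lemma sder_G (I : set R) (G g1 g2 : R * R -> R) (U1 U2 W1 W2 : R -> R -> R) :
  grad G g1 g2 -> loclip g1 -> loclip g2 -> continuous G -> continuous g1 -> continuous g2 ->
  g1 (0, 0) = 0 -> g2 (0, 0) = 0 -> G (0, 0) = 0 ->
  (forall t, I t -> L2p (W1 t) /\ L2p (W2 t)) ->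
  has_deriv nm I U1 W1 -> has_deriv nm I U2 W2 ->
  (forall t, I t -> exists M, exists2 d, 0 < d & forall h : R, `|h| < d -> I (t + h) -> nice M (U1 (t + h)) /\ nice M (U2 (t + h))) ->
  sder I (fun t => \int[@lebesgue_measure R]_x comp2 G (U1 t) (U2 t) x)
    (fun t => ip (comp2 g1 (U1 t) (U2 t)) (W1 t) + ip (comp2 g2 (U1 t) (U2 t)) (W2 t)).
Proof.
move=> hG l1 l2 cG c1 c2 g10 g20 G0 LW hd1 hd2 hM t It e e0.
have [LW1 LW2] := LW t It.
have [M [dM dM0 nM]] := hM t It.
have nice_t : nice M (U1 t) /\ nice M (U2 t).
  by have := nM 0; rewrite normr0 addr0; apply.
have [n1 n2] := nice_t; have [LU1 _ b1] := n1; have [LU2 _ b2] := n2.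
have M0 : 0 <= M by exact: le_trans (normr_ge0 _) (b1 0).
have Lg1 : L2p (comp2 g1 (U1 t) (U2 t)).
  by have := comp2_L2 l1 c1 n1 n2; rewrite g10; under eq_fun do rewrite subr0.
have Lg2 : L2p (comp2 g2 (U1 t) (U2 t)).
  by have := comp2_L2 l2 c2 n1 n2; rewrite g20; under eq_fun do rewrite subr0.
have [K K0 hK] := taylor2 hG l1 l2 M.
have iG u v : nice M u -> nice M v -> intg (comp2 G u v).
  move=> nu nv; have := potential_intg hG l1 l2 cG g10 g20 nu nv.
  by rewrite G0; under eq_fun do rewrite subr0.
pose A := nm (comp2 g1 (U1 t) (U2 t)); pose B := nm (comp2 g2 (U1 t) (U2 t)).
have A0 : 0 <= A := nm_ge0 _. have B0 : 0 <= B := nm_ge0 _.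
pose C := nm (W1 t) + nm (W2 t) + 2; have C0 : 0 < C by rewrite ltr_wpDl // addr_ge0 ?nm_ge0.
pose e1 := Num.min 1 (e / (2 * (A + B + 1))).
have S0 : 0 < A + B + 1 by lra.
have e10 : 0 < e1 by rewrite lt_min ltr01 divr_gt0 // mulr_gt0.
have e11 : e1 <= 1 by rewrite ge_min lexx.
have e1e : e1 * (A + B) <= e / 2.
  have : e1 <= e / (2 * (A + B + 1)) by rewrite ge_min lexx orbT.
  rewrite ler_pdivlMr ?mulr_gt0 // => h; have := ltW e10; nra.
have [d1 d10 k1] := hd1 t It e1 e10; have [d2 d20 k2] := hd2 t It e1 e10.
pose d3 := e / (2 * (K * C ^+ 2 + 1)).
have KC : 0 <= K * C ^+ 2 by rewrite mulr_ge0 // sqr_ge0.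
have KC1 : 0 < K * C ^+ 2 + 1 by lra.
have d30 : 0 < d3 by rewrite divr_gt0 // mulr_gt0.
exists (Num.min (Num.min dM d3) (Num.min d1 d2)); first by rewrite !lt_min dM0 d10 d20 d30.
move=> h; rewrite !lt_min => /andP[/andP[hhM hh3] /andP[hh1 hh2]] Ih.
have [n1' n2'] := nM h hhM Ih.
have [LU1' _ b1'] := n1'; have [LU2' _ b2'] := n2'.
pose D1 := (fun x => U1 (t + h) x - U1 t x); pose D2 := (fun x => U2 (t + h) x - U2 t x).
have LD1 : L2p D1 by exact: L2_B. have LD2 : L2p D2 by exact: L2_B.
have LE1 : L2p (fun x => D1 x - h * W1 t x) by apply: L2_B => //; exact: L2_Z.
have LE2 : L2p (fun x => D2 x - h * W2 t x) by apply: L2_B => //; exact: L2_Z.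
have nE1 : nm (fun x => D1 x - h * W1 t x) <= e1 * `|h| := k1 h hh1 Ih.
have nE2 : nm (fun x => D2 x - h * W2 t x) <= e1 * `|h| := k2 h hh2 Ih.
have nD (D W : R -> R) : L2p D -> L2p W -> L2p (fun x => D x - h * W x) -> nm (fun x => D x - h * W x) <= e1 * `|h| -> nm D <= (nm W + 1) * `|h|.
  move=> LD LW' LE nE.
  have -> : D = (fun x => h * W x + (D x - h * W x)) by apply/funext => x; ring.
  apply: le_trans (nmD (L2_Z h LW') LE) _; rewrite nmZ // mulrDl mulrC.
  by rewrite lerD2l (le_trans nE) // ler_wpM2r.
have nD1 := nD _ _ LD1 LW1 LE1 nE1; have nD2 := nD _ _ LD2 LW2 LE2 nE2.
pose rem x := comp2 G (U1 (t + h)) (U2 (t + h)) x - comp2 G (U1 t) (U2 t) x - (comp2 g1 (U1 t) (U2 t) x * D1 x + comp2 g2 (U1 t) (U2 t) x * D2 x).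
have i1 := iG _ _ n1' n2'; have i2 := iG _ _ n1 n2.
have j1 := L2_mul Lg1 LD1; have j2 := L2_mul Lg2 LD2.
have irem : intg rem by apply: intgB; [exact: intgB|exact: intgD].
have Lad := L2_D (L2_abs LD1) (L2_abs LD2); have [_ iad] := Lad.
have crem : `|\int[@lebesgue_measure R]_x rem x| <= K * (C * `|h|) ^+ 2.
  apply: le_trans (I_abs irem) _.
  apply: (@le_trans _ _ (\int[@lebesgue_measure R]_x (K * (`|D1 x| + `|D2 x|) ^+ 2))).
    apply: I_le; [exact: intg_abs|exact: intgZ|].
    move=> x; apply: (hK (U1 t x, U2 t x) (U1 (t + h) x, U2 (t + h) x)).
      by split; [exact: b1|exact: b2].
    by split; [exact: b1'|exact: b2'].
  rewrite I_Z // -ipE; apply: ler_wpM2l => //; rewrite -nm_le; last by rewrite mulr_ge0 // ltW.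
  apply: le_trans (nmD (L2_abs LD1) (L2_abs LD2)) _.
  have a1 : nm (fun x => `|D1 x|) <= nm D1 by apply: nm_dom (L2_m (L2_abs LD1)) LD1 _ => x; rewrite normr_id.
  have a2 : nm (fun x => `|D2 x|) <= nm D2 by apply: nm_dom (L2_m (L2_abs LD2)) LD2 _ => x; rewrite normr_id.
  by rewrite /C; move: nD1 nD2 a1 a2; clear; lra.
have -> : \int[@lebesgue_measure R]_x comp2 G (U1 (t + h)) (U2 (t + h)) x - \int[@lebesgue_measure R]_x comp2 G (U1 t) (U2 t) x
   - h * (ip (comp2 g1 (U1 t) (U2 t)) (W1 t) + ip (comp2 g2 (U1 t) (U2 t)) (W2 t)) =
   \int[@lebesgue_measure R]_x rem x + (ip (comp2 g1 (U1 t) (U2 t)) (fun x => D1 x - h * W1 t x) + ip (comp2 g2 (U1 t) (U2 t)) (fun x => D2 x - h * W2 t x)).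
  rewrite /rem I_B; [|exact: intgB|exact: intgD].
  rewrite I_B // I_D // -!ip_def.
  rewrite (ipBr LD1 (L2_Z h LW1) Lg1) (ipBr LD2 (L2_Z h LW2) Lg2) !ipZr //; ring.
apply: le_trans (ler_normD _ _) _.
have q1 := cauchy_schwarz Lg1 LE1; have q2 := cauchy_schwarz Lg2 LE2; rewrite -/A in q1; rewrite -/B in q2.
have q1' := le_trans q1 (ler_wpM2l A0 nE1); have q2' := le_trans q2 (ler_wpM2l B0 nE2).
have q3 := ler_normD (ip (comp2 g1 (U1 t) (U2 t)) (fun x => D1 x - h * W1 t x)) (ip (comp2 g2 (U1 t) (U2 t)) (fun x => D2 x - h * W2 t x)).
have q4 := ler_wpM2r (normr_ge0 h) e1e.
have q5 : K * (C * `|h|) ^+ 2 <= e / 2 * `|h|.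
  have -> : K * (C * `|h|) ^+ 2 = (`|h| * (K * C ^+ 2)) * `|h| by ring.
  apply: ler_wpM2r => //.
  have : `|h| * (K * C ^+ 2 + 1) <= e / 2.
    move: (ltW hh3); rewrite /d3 ler_pdivlMr ?mulr_gt0 //; clear; lra.
  rewrite mulrDr; have := normr_ge0 h; clear; lra.
move: q4; rewrite (_ : e1 * (A + B) * `|h| = A * (e1 * `|h|) + B * (e1 * `|h|)); last by ring.
move: crem q1' q2' q3 q5; clear; lra.
Qed.

End Curves.

(** * The wave system as an ordinary differential equation *)

Lemma loclip_cont {R : realType} (G : R * R -> R) : loclip G -> continuous G.
Proof.
move=> lG p; apply/cvgrPdist_le => e e0.
have [K K0 hK] := lG (`|p.1| + `|p.2| + 1).
have K1 : 0 < K + 1 by lra.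
have d0 : 0 < Num.min 1 (e / (2 * (K + 1))) by rewrite lt_min ltr01 divr_gt0 // mulr_gt0.
exists (ball p.1 (Num.min 1 (e / (2 * (K + 1)))), ball p.2 (Num.min 1 (e / (2 * (K + 1))))).
  by split; exact: nbhsx_ballx.
move=> p' [/=].
rewrite /ball /= !lt_min => /andP[h1 h2] /andP[h3 h4].
have bp : box2 (`|p.1| + `|p.2| + 1) p by split; have := normr_ge0 p.1; have := normr_ge0 p.2; lra.
have bp' : box2 (`|p.1| + `|p.2| + 1) p'.
  have t1 := ler_normB p.1 (p.1 - p'.1); have t2 := ler_normB p.2 (p.2 - p'.2).
  rewrite subKr in t1; rewrite subKr in t2.
  by split; have := normr_ge0 p.1; have := normr_ge0 p.2; lra.
rewrite distrC; apply: le_trans (hK p p' bp bp') _.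
rewrite /d2 (distrC p'.1) (distrC p'.2).
move: h2 h4; rewrite !ltr_pdivlMr ?mulr_gt0 //.
have := normr_ge0 (p.1 - p'.1); have := normr_ge0 (p.2 - p'.2).
move: (`|p.1 - p'.1|) (`|p.2 - p'.2|) => y z y0 z0 h2 h4.
by rewrite mulrDr; lra.
Qed.

(** The arithmetic of [velocity_bound]: D, V, A and y stand for the squared
    norms of velocities, displacements, the unknowns q_i and the initial data,
    J for the integral of G. *)
Lemma velocity_arith {R : realType} (k S1 S2 y1 y2 J A1 A2 V1 V2 D1 D2 E : R) :
  0 <= k -> 0 <= S1 -> 0 <= S2 -> - k * (V1 + V2) <= J ->
  V1 <= 2 * y1 + 2 * S1 * A1 -> V2 <= 2 * y2 + 2 * S2 * A2 ->
  0 <= A1 -> 0 <= A2 -> 0 <= V1 -> 0 <= V2 -> D1 + D2 + (V1 + V2) + (J + J) <= E ->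
  D1 + D2 <= E + 4 * k * (y1 + y2) + 4 * k * (S1 + S2) * (A1 + A2).
Proof.
move=> k0 S10 S20 J0 h1 h2 A10 A20 V10 V20 hE.
have kh1 := ler_wpM2l k0 h1; have kh2 := ler_wpM2l k0 h2.
have t1 := mulr_ge0 (mulr_ge0 k0 S10) A20; have t2 := mulr_ge0 (mulr_ge0 k0 S20) A10.
have -> : E + 4 * k * (y1 + y2) + 4 * k * (S1 + S2) * (A1 + A2) = E + 2 * (k * (2 * y1 + 2 * S1 * A1)) + 2 * (k * (2 * y2 + 2 * S2 * A2)) + 4 * (k * S1 * A2) + 4 * (k * S2 * A1) by ring.
move: J0; rewrite mulNr mulrDr => J0.
move: hE J0 kh1 kh2 t1 t2 V10 V20.
by move: (k * V1) (k * V2) (k * (_ + _)) (k * (_ + _)) (k * _ * _) (k * _ * _) => *; lra.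
Qed.

Section WaveODE.
Context {R : realType}.
Local Notation mu := (@lebesgue_measure R).
Implicit Types (f u v w q b : R -> R) (M K r : R).

(** The displacement u = phi + B q, where [f] is the spectrum of phi. *)
Definition displ b f q x : R := hart1 f x + Bop b q x.
(** The sup norm of a displacement is controlled by the L^2 norm of the
    unknown; this is what tames a nonlinearity of arbitrary growth. *)
Definition displ_sup b f r : R := 2 * c0 * (\int[mu]_x `|f x|) + 2 * c0 * nm b * r.

Lemma displ_nice b K f q r : symb b K -> intg f -> L2p f -> L2p q -> nm q <= r -> nice (displ_sup b f r) (displ b f q).
Proof.
move=> Sb i Lf Lq nq; have [L _ _] := synth i Lf; have LB := Bop_L2 Sb Lq; split.
- exact: L2_D.
- by move=> x; apply: cvgD; [exact: hart1_cont|exact: (Bop_cont Sb)].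
- move=> x; apply: le_trans (ler_normD _ _) _; apply: lerD; first exact: hart1_bd.
  apply: le_trans (Bop_bd Sb x Lq) _; apply: ler_wpM2l => //.
  by rewrite mulr_ge0 ?nm_ge0 // mulr_ge0 // ltW // c0_gt0.
Qed.

Lemma BopB b K q v x : symb b K -> L2p q -> L2p v -> Bop b (fun y => q y - v y) x = Bop b q x - Bop b v x.
Proof.
move=> Sb Lq Lv; have := Bop_lin Sb (-1) x Lv Lq.
rewrite (_ : (fun x0 => _) = (fun y => q y - v y)) => [->|]; first by ring.
by apply/funext => y; ring.
Qed.

Lemma BopZ b K a q x : symb b K -> L2p q -> Bop b (fun y => a * q y) x = a * Bop b q x.
Proof.
move=> Sb Lq; have Z0 : Bop b (fun=> 0) x = 0.
  by have := BopB x Sb Lq Lq; under eq_fun do rewrite subrr; rewrite subrr.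
have := Bop_lin Sb a x Lq L2_0.
rewrite Z0 addr0 => <-; congr (Bop b _ x).
by apply/funext => y; rewrite addr0.
Qed.

Lemma BopNB b K v w : symb b K -> L2p v -> L2p w ->
  nm (fun x => - Bop b v x - - Bop b w x) <= K * nm (fun x => v x - w x).
Proof.
move=> Sb Lv Lw; have Ld := L2_B Lv Lw.
have -> : (fun x => - Bop b v x - - Bop b w x) = (fun x => -1 * Bop b (fun y => v y - w y) x).
  apply/funext => x; rewrite (BopB x Sb) //.
  by move: (Bop b v x) (Bop b w x) => y z; ring.
by rewrite nmZ ?normrN1 ?mul1r; [exact: (Bop_nm Sb)|exact: (Bop_L2 Sb)].
Qed.

Lemma displB b K f q v : symb b K -> L2p q -> L2p v ->
  (fun x => displ b f q x - displ b f v x) = Bop b (fun y => q y - v y).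
Proof. by move=> Sb Lq Lv; apply/funext => x; rewrite (BopB x Sb) // /displ; ring. Qed.

Variables (b1 b2 : R -> R) (K1 K2 : R) (f1 f2 : R -> R) (g1 g2 G : R * R -> R) (k : R).
Hypotheses (Sb1 : symb b1 K1) (Sb2 : symb b2 K2).
Hypotheses (if1 : intg f1) (Lf1 : L2p f1) (if2 : intg f2) (Lf2 : L2p f2).
Hypotheses (cg1 : continuous g1) (cg2 : continuous g2) (lg1 : loclip g1) (lg2 : loclip g2).
Hypotheses (g10 : g1 (0, 0) = 0) (g20 : g2 (0, 0) = 0) (gradG : grad G g1 g2) (G0 : G (0, 0) = 0).
Hypotheses (k0 : 0 <= k) (G_lb : forall p, - k * (p.1 ^+ 2 + p.2 ^+ 2) <= G p).

Let u1 q := displ b1 f1 q.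
Let u2 q := displ b2 f2 q.
Definition displ_sup2 r := Num.max (displ_sup b1 f1 r) (displ_sup b2 f2 r).

Lemma nice_le M M' u : M <= M' -> nice M u -> nice M' u.
Proof. by move=> h [? ? b]; split=> // x; exact: le_trans (b x) h. Qed.

Lemma u1_nice r q : L2p q -> nm q <= r -> nice (displ_sup2 r) (u1 q).
Proof. by move=> Lq h; apply: nice_le (displ_nice Sb1 if1 Lf1 Lq h); rewrite le_max lexx. Qed.
Lemma u2_nice r q : L2p q -> nm q <= r -> nice (displ_sup2 r) (u2 q).
Proof. by move=> Lq h; apply: nice_le (displ_nice Sb2 if2 Lf2 Lq h); rewrite le_max lexx orbT. Qed.

Definition force1 q v x : R := u1 q x + comp2 g1 (u1 q) (u2 v) x.
Definition force2 q v x : R := u2 v x + comp2 g2 (u1 q) (u2 v) x.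

Lemma gu_L2 (g : R * R -> R) q v : continuous g -> loclip g -> g (0, 0) = 0 -> L2p q -> L2p v -> L2p (comp2 g (u1 q) (u2 v)).
Proof.
move=> cg lg g0 Lq Lv.
have n1 := u1_nice Lq (lexx (nm q)); have n2 := u2_nice Lv (lexx (nm v)).
pose M := Num.max (displ_sup2 (nm q)) (displ_sup2 (nm v)).
have n1' : nice M (u1 q) by apply: nice_le n1; rewrite le_max lexx.
have n2' : nice M (u2 v) by apply: nice_le n2; rewrite le_max lexx orbT.
by have := comp2_L2 lg cg n1' n2'; rewrite g0; under eq_fun do rewrite subr0.
Qed.

Lemma u1_L2 q : L2p q -> L2p (u1 q). Proof. by move=> Lq; have [] := u1_nice Lq (lexx _). Qed.
Lemma u2_L2 q : L2p q -> L2p (u2 q). Proof. by move=> Lq; have [] := u2_nice Lq (lexx _). Qed.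

Lemma force1_L2 q v : L2p q -> L2p v -> L2p (force1 q v).
Proof. by move=> Lq Lv; apply: L2_D (u1_L2 Lq) (gu_L2 _ _ _ Lq Lv). Qed.
Lemma force2_L2 q v : L2p q -> L2p v -> L2p (force2 q v).
Proof. by move=> Lq Lv; apply: L2_D (u2_L2 Lv) (gu_L2 _ _ _ Lq Lv). Qed.

(** On a ball of unknowns the displacements take values in a fixed box, on
    which the nonlinearities are Lipschitz. *)
Lemma force_lip r : exists L, 0 <= L /\ forall q v q' v', L2p q -> L2p v -> L2p q' -> L2p v' ->
  nm q <= r -> nm v <= r -> nm q' <= r -> nm v' <= r ->
  nm (fun x => force1 q' v' x - force1 q v x) <= L * (nm (fun x => q' x - q x) + nm (fun x => v' x - v x)) /\
  nm (fun x => force2 q' v' x - force2 q v x) <= L * (nm (fun x => q' x - q x) + nm (fun x => v' x - v x)).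
Proof.
have [L1 L10 h1] := lg1 (displ_sup2 r); have [L2 L20 h2] := lg2 (displ_sup2 r).
have K10 := symb_K Sb1; have K20 := symb_K Sb2.
exists ((1 + L1 + L2) * (K1 + K2)); split; first by rewrite mulr_ge0 ?addr_ge0.
move=> q v q' v' Lq Lv Lq' Lv' nq nv nq' nv'.
have LDq := L2_B Lq' Lq; have LDv := L2_B Lv' Lv.
pose A := nm (fun x => q' x - q x); pose B := nm (fun x => v' x - v x).
have A0 : 0 <= A := nm_ge0 _. have B0 : 0 <= B := nm_ge0 _.
have e1 : nm (fun x => u1 q' x - u1 q x) <= K1 * A by rewrite (displB f1 Sb1 Lq' Lq); exact: Bop_nm.
have e2 : nm (fun x => u2 v' x - u2 v x) <= K2 * B by rewrite (displB f2 Sb2 Lv' Lv); exact: Bop_nm.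
have n1 := u1_nice Lq nq; have n1' := u1_nice Lq' nq'.
have n2 := u2_nice Lv nv; have n2' := u2_nice Lv' nv'.
have [c1 c1'] := comp2_lip L10 cg1 h1 n1 n2 n1' n2'.
have [c2 c2'] := comp2_lip L20 cg2 h2 n1 n2 n1' n2'.
have z1 : 0 <= K1 * A by rewrite mulr_ge0.
have z2 : 0 <= K2 * B by rewrite mulr_ge0.
have z3 : 0 <= K2 * A by rewrite mulr_ge0.
have z4 : 0 <= K1 * B by rewrite mulr_ge0.
have X1 : L1 * (nm (fun x => u1 q' x - u1 q x) + nm (fun x => u2 v' x - u2 v x)) <= L1 * ((K1 + K2) * (A + B)).
  by apply: ler_wpM2l => //; rewrite mulrDl !mulrDr; lra.
have X2 : L2 * (nm (fun x => u1 q' x - u1 q x) + nm (fun x => u2 v' x - u2 v x)) <= L2 * ((K1 + K2) * (A + B)).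
  by apply: ler_wpM2l => //; rewrite mulrDl !mulrDr; lra.
have X0 : K1 * A <= (K1 + K2) * (A + B) by rewrite mulrDl !mulrDr; lra.
have X0' : K2 * B <= (K1 + K2) * (A + B) by rewrite mulrDl !mulrDr; lra.
have Y : 0 <= (K1 + K2) * (A + B) by lra.
have Y1 : 0 <= L1 * ((K1 + K2) * (A + B)) by rewrite mulr_ge0.
have Y2 : 0 <= L2 * ((K1 + K2) * (A + B)) by rewrite mulr_ge0.
rewrite -/A -/B -mulrA !mulrDl mul1r; split.
- have -> : (fun x => force1 q' v' x - force1 q v x) = (fun x => (u1 q' x - u1 q x) + (comp2 g1 (u1 q') (u2 v') x - comp2 g1 (u1 q) (u2 v) x)).
    by apply/funext => x; rewrite /force1; ring.
  apply: le_trans (nmD (L2_B (u1_L2 Lq') (u1_L2 Lq)) c1) _.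
  move: (le_trans c1' X1) (le_trans e1 X0) Y2; lra.
- have -> : (fun x => force2 q' v' x - force2 q v x) = (fun x => (u2 v' x - u2 v x) + (comp2 g2 (u1 q') (u2 v') x - comp2 g2 (u1 q) (u2 v) x)).
    by apply/funext => x; rewrite /force2; ring.
  apply: le_trans (nmD (L2_B (u2_L2 Lv') (u2_L2 Lv)) c2) _.
  move: (le_trans c2' X2) (le_trans e2 X0') Y1; lra.
Qed.

Lemma hart1_nm f : intg f -> L2p f -> nm (hart1 f) = nm f.
Proof. by move=> i L; have [_ ->] := plancherel_L1L2 i L. Qed.

Lemma G_int q v : L2p q -> L2p v -> intg (comp2 G (u1 q) (u2 v)).
Proof.
move=> Lq Lv.
have n1 := u1_nice Lq (lexx (nm q)); have n2 := u2_nice Lv (lexx (nm v)).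
pose M := Num.max (displ_sup2 (nm q)) (displ_sup2 (nm v)).
have n1' : nice M (u1 q) by apply: nice_le n1; rewrite le_max lexx.
have n2' : nice M (u2 v) by apply: nice_le n2; rewrite le_max lexx orbT.
have cG := loclip_cont (grad_loclip gradG cg1 cg2).
have := potential_intg gradG lg1 lg2 cG g10 g20 n1' n2'.
by rewrite G0; under eq_fun do rewrite subr0.
Qed.

Lemma G_lower q v : L2p q -> L2p v ->
  - k * (ip (u1 q) (u1 q) + ip (u2 v) (u2 v)) <= \int[mu]_x comp2 G (u1 q) (u2 v) x.
Proof.
move=> Lq Lv; have [_ i1] := u1_L2 Lq; have [_ i2] := u2_L2 Lv.
rewrite !ipE -I_D // -I_Z; last exact: intgD.
apply: I_le; [by apply: intgZ; exact: intgD|exact: G_int|].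
by move=> x; exact: (G_lb (u1 q x, u2 v x)).
Qed.

Lemma displ_sq b K f q : symb b K -> intg f -> L2p f -> L2p q -> ip (displ b f q) (displ b f q) <= 2 * nm f ^+ 2 + 2 * K ^+ 2 * ip q q.
Proof.
move=> Sb i Lf Lq; have [Lh _ _] := synth i Lf; have LB := Bop_L2 Sb Lq.
have := nmD Lh LB; rewrite hart1_nm // -/(displ b f q) => h.
have h' := le_trans h (lerD (lexx _) (Bop_nm Sb Lq)).
have n1 := nm_ge0 f; have n2 := nm_ge0 q; have n3 := nm_ge0 (displ b f q).
rewrite -!nm_sq; apply: (@le_trans _ _ ((nm f + K * nm q) ^+ 2)).
  by rewrite !expr2; apply: ler_pM.
have := sqr_ge0 (nm f - K * nm q).
have -> : 2 * nm f ^+ 2 + 2 * K ^+ 2 * nm q ^+ 2 = (nm f + K * nm q) ^+ 2 + (nm f - K * nm q) ^+ 2 by ring.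
lra.
Qed.

Let X := ((R + R) + (R + R))%type.
Let DS : set (X -> R) := sumD (sumD L2p L2p) (sumD L2p L2p).
Let NS : (X -> R) -> R := sumN (sumN nm nm) (sumN nm nm).
Let SS : seminorm_on DS NS.
Proof. by do !apply: sum_seminorm; exact: L2_seminorm. Qed.
Let CS_ : seq_complete DS NS.
Proof.
have S2 : seminorm_on (sumD L2p L2p) (sumN (@nm R) (@nm R)) by apply: sum_seminorm; exact: L2_seminorm.
have C2 : seq_complete (sumD L2p L2p) (sumN (@nm R) (@nm R)).
  by apply: sum_complete; [exact: L2_seminorm|exact: L2_seminorm|exact: L2_complete|exact: L2_complete].
exact: sum_complete.
Qed.

Let q1 (U : X -> R) x := U (inl (inl x)).
Let q2 (U : X -> R) x := U (inl (inr x)).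
Let p1 (U : X -> R) x := U (inr (inl x)).
Let p2 (U : X -> R) x := U (inr (inr x)).

Let mk (a b c d : R -> R) : X -> R := fun z => match z with
  | inl (inl x) => a x | inl (inr x) => b x | inr (inl x) => c x | inr (inr x) => d x end.

Let DSP U : DS U <-> [/\ L2p (q1 U), L2p (q2 U), L2p (p1 U) & L2p (p2 U)].
Proof. by split=> [[[? ?] [? ?]]|[? ? ? ?]]; split. Qed.

Let NSE U : NS U = nm (q1 U) + nm (q2 U) + (nm (p1 U) + nm (p2 U)).
Proof. by []. Qed.

Let F (U : X -> R) : X -> R := mk (p1 U) (p2 U)
  (fun x => - Bop b1 (force1 (q1 U) (q2 U)) x) (fun x => - Bop b2 (force2 (q1 U) (q2 U)) x).

Let F_D U : DS U -> DS (F U).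
Proof.
move=> /DSP[? ? ? ?]; apply/DSP; split => //; apply: L2_N.
  by apply: (Bop_L2 Sb1); exact: force1_L2.
by apply: (Bop_L2 Sb2); exact: force2_L2.
Qed.

Let F_lip r : exists L, 0 < L /\ forall U U', DS U -> DS U' -> NS U <= r -> NS U' <= r ->
  NS (F U - F U') <= L * NS (U - U').
Proof.
have [L [L0 hL]] := force_lip r.
have K10 := symb_K Sb1; have K20 := symb_K Sb2.
exists (1 + (K1 + K2) * L); split; first by rewrite ltr_pwDl // mulr_ge0 // addr_ge0.
move=> U U' /DSP[Lq1 Lq2 Lp1 Lp2] /DSP[Lq1' Lq2' Lp1' Lp2'].
rewrite !NSE => nU nU'.
have := nm_ge0 (q1 U); have := nm_ge0 (q2 U); have := nm_ge0 (p1 U); have := nm_ge0 (p2 U).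
have := nm_ge0 (q1 U'); have := nm_ge0 (q2 U'); have := nm_ge0 (p1 U'); have := nm_ge0 (p2 U').
move=> ? ? ? ? ? ? ? ?.
have [||||||||H1 H2] := hL (q1 U') (q2 U') (q1 U) (q2 U) => //; try lra.
have W1 := force1_L2 Lq1 Lq2; have W1' := force1_L2 Lq1' Lq2'.
have W2 := force2_L2 Lq1 Lq2; have W2' := force2_L2 Lq1' Lq2'.
have E1 : nm (p1 (F U - F U')) <= K1 * nm (fun x => force1 (q1 U) (q2 U) x - force1 (q1 U') (q2 U') x).
  exact: (BopNB Sb1 W1 W1').
have E2 : nm (p2 (F U - F U')) <= K2 * nm (fun x => force2 (q1 U) (q2 U) x - force2 (q1 U') (q2 U') x).
  exact: (BopNB Sb2 W2 W2').
have Eq1 : q1 (F U - F U') = p1 (U - U') by [].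
have Eq2 : q2 (F U - F U') = p2 (U - U') by [].
rewrite Eq1 Eq2.
have A1 : nm (q1 (U - U')) = nm (fun x => q1 U x - q1 U' x) by [].
have A2 : nm (q2 (U - U')) = nm (fun x => q2 U x - q2 U' x) by [].
rewrite A1 A2.
have := nm_ge0 (p1 (U - U')); have := nm_ge0 (p2 (U - U')).
move: E1 E2 H1 H2.
move: (nm (p1 (F U - F U'))) (nm (p2 (F U - F U'))) (nm (fun x => force1 _ _ x - _)) (nm (fun x => force2 _ _ x - _)) => a1 a2 n1 n2.
move: (nm (fun x => q1 U x - q1 U' x)) (nm (fun x => q2 U x - q2 U' x)) (nm (p1 (U - U'))) (nm (p2 (U - U'))) (nm_ge0 (fun x => q1 U x - q1 U' x)) (nm_ge0 (fun x => q2 U x - q2 U' x)) => y1 y2 z1 z2 y10 y20 E1 E2 H1 H2 z20 z10.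
have G1 := le_trans E1 (ler_wpM2l K10 H1); have G2 := le_trans E2 (ler_wpM2l K20 H2).
have -> : (1 + (K1 + K2) * L) * (y1 + y2 + (z1 + z2)) = y1 + y2 + (z1 + z2) + K1 * (L * (y1 + y2)) + K2 * (L * (y1 + y2)) + (K1 + K2) * L * (z1 + z2) by ring.
have : 0 <= (K1 + K2) * L * (z1 + z2) by rewrite mulr_ge0 ?addr_ge0 // mulr_ge0 // addr_ge0.
move: G1 G2; move: (K1 * (L * _)) (K2 * (L * _)) (_ * L * _) => x1 x2 x3; lra.
Qed.

Section Apriori.
Variables (T : R) (U : R -> X -> R).
Hypotheses (T0 : 0 <= T) (DU : forall t, DS (U t)) (dU : has_deriv NS `[0, T] U (F \o U)).

Let a1 t := q1 (U t). Let a2 t := q2 (U t). Let c1 t := p1 (U t). Let c2 t := p2 (U t).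
Let w1 t := force1 (a1 t) (a2 t). Let w2 t := force2 (a1 t) (a2 t).
Let v1 t := u1 (a1 t). Let v2 t := u2 (a2 t).

Let La1 t : L2p (a1 t). Proof. by have /DSP[] := DU t. Qed.
Let La2 t : L2p (a2 t). Proof. by have /DSP[] := DU t. Qed.
Let Lc1 t : L2p (c1 t). Proof. by have /DSP[] := DU t. Qed.
Let Lc2 t : L2p (c2 t). Proof. by have /DSP[] := DU t. Qed.

Lemma has_deriv_sub (N' : (R -> R) -> R) (pr : (X -> R) -> R -> R) (V W : R -> X -> R) (I : set R) :
  (forall t h, N' (fun x => pr (V (t + h)) x - pr (V t) x - h * pr (W t) x) <= NS (V (t + h) - V t - h *: W t)) ->
  has_deriv NS I V W -> has_deriv N' I (fun t => pr (V t)) (fun t => pr (W t)).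
Proof.
move=> hle hd t It e e0; have [d d0 h1] := hd t It e e0; exists d => // h hh Ih.
exact: le_trans (hle t h) (h1 h hh Ih).
Qed.

Lemma comp_derivs (V : R -> X -> R) (I : set R) : has_deriv NS I V (F \o V) ->
  [/\ has_deriv nm I (fun t => q1 (V t)) (fun t => p1 (V t)),
   has_deriv nm I (fun t => q2 (V t)) (fun t => p2 (V t)),
   has_deriv nm I (fun t => p1 (V t)) (fun t x => - Bop b1 (force1 (q1 (V t)) (q2 (V t))) x) &
   has_deriv nm I (fun t => p2 (V t)) (fun t x => - Bop b2 (force2 (q1 (V t)) (q2 (V t))) x)].
Proof.
move=> hd; have n0 := @nm_ge0 R.
split.
- by apply: (has_deriv_sub (pr := q1) _ hd) => t h; rewrite NSE -addrA lerDl !addr_ge0.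
- by apply: (has_deriv_sub (pr := q2) _ hd) => t h; rewrite NSE (addrC (nm (q1 _))) -addrA lerDl !addr_ge0.
- by apply: (has_deriv_sub (pr := p1) _ hd) => t h; rewrite NSE addrCA lerDl !addr_ge0.
- by apply: (has_deriv_sub (pr := p2) _ hd) => t h; rewrite NSE addrA lerDr !addr_ge0.
Qed.

Lemma displ_deriv b K f (I : set R) (q p : R -> R -> R) : symb b K -> (forall t, L2p (q t)) -> (forall t, L2p (p t)) ->
  has_deriv nm I q p -> has_deriv nm I (fun t => displ b f (q t)) (fun t => Bop b (p t)).
Proof.
move=> Sb Lq Lp hd t It e e0; have K0 := symb_K Sb.
have e1 : 0 < e / (K + 1) by rewrite divr_gt0 //; lra.
have [d d0 h1] := hd t It _ e1; exists d => // h hh Ih.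
have L1 := L2_B (Lq (t + h)) (Lq t); have L2 := L2_Z h (Lp t).
have E : displ b f (q (t + h)) - displ b f (q t) - h *: Bop b (p t) = Bop b (fun x => q (t + h) x - q t x - h * p t x).
  apply/funext => x; rewrite (BopB x Sb L1 L2) (BopB x Sb (Lq (t + h)) (Lq t)) (BopZ h x Sb (Lp t)).
  rewrite /displ !(addrfctE, opprfctE, scalrfctE).
  by move: (Bop b (q (t + h)) x) (Bop b (q t) x) (Bop b (p t) x) (hart1 f x) => y1 y2 y3 y4; rewrite /GRing.scale /=; ring.
rewrite E; apply: le_trans (Bop_nm Sb (L2_B L1 L2)) _.
apply: le_trans (ler_wpM2l K0 (h1 h hh Ih)) _.
rewrite mulrA; apply: ler_wpM2r => //; rewrite mulrA ler_pdivrMr; last by lra.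
by rewrite mulrC ler_wpM2l ?ltW //; lra.
Qed.

Let dq1 : has_deriv nm `[0, T] a1 c1. Proof. by have [] := comp_derivs dU. Qed.
Let dq2 : has_deriv nm `[0, T] a2 c2. Proof. by have [] := comp_derivs dU. Qed.
Let dp1 : has_deriv nm `[0, T] c1 (fun t x => - Bop b1 (w1 t) x). Proof. by have [] := comp_derivs dU. Qed.
Let dp2 : has_deriv nm `[0, T] c2 (fun t x => - Bop b2 (w2 t) x). Proof. by have [] := comp_derivs dU. Qed.
Let du1 : has_deriv nm `[0, T] v1 (fun t => Bop b1 (c1 t)) := displ_deriv f1 Sb1 La1 Lc1 dq1.
Let du2 : has_deriv nm `[0, T] v2 (fun t => Bop b2 (c2 t)) := displ_deriv f2 Sb2 La2 Lc2 dq2.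

Let Lw1 t : L2p (w1 t). Proof. exact: force1_L2. Qed.
Let Lw2 t : L2p (w2 t). Proof. exact: force2_L2. Qed.
Let Lv1 t : L2p (v1 t). Proof. exact: u1_L2. Qed.
Let Lv2 t : L2p (v2 t). Proof. exact: u2_L2. Qed.
Let LB1 q : L2p q -> L2p (Bop b1 q). Proof. exact: (Bop_L2 Sb1). Qed.
Let LB2 q : L2p q -> L2p (Bop b2 q). Proof. exact: (Bop_L2 Sb2). Qed.
Let Lg1 t : L2p (comp2 g1 (v1 t) (v2 t)). Proof. exact: gu_L2. Qed.
Let Lg2 t : L2p (comp2 g2 (v1 t) (v2 t)). Proof. exact: gu_L2. Qed.

Let contG : continuous G := loclip_cont (grad_loclip gradG cg1 cg2).

(** Twice the physical energy; the integral of G occurs as a sum so that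
    [sderD] differentiates it. *)
Definition energy (c d v w : R -> R) := ip c c + ip d d + (ip v v + ip w w) +
  (\int[mu]_x comp2 G v w x + \int[mu]_x comp2 G v w x).

(** The derivative of |p_i|^2 is - 2 (p_i, B_i w_i) = - 2 (B_i p_i, w_i), and
    B_i p_i is the derivative of u_i; so these terms cancel the derivatives of
    |u_i|^2 and of twice the integral of G. *)
Lemma energy_const : energy (c1 T) (c2 T) (v1 T) (v2 T) = energy (c1 0) (c2 0) (v1 0) (v2 0).
Proof.
have sc1 := sder_ip (I := `[0, T]%classic) (fun t _ => Lc1 t) (fun t _ => L2_N (LB1 (Lw1 t))) dp1.
have sc2 := sder_ip (I := `[0, T]%classic) (fun t _ => Lc2 t) (fun t _ => L2_N (LB2 (Lw2 t))) dp2.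
have sv1 := sder_ip (I := `[0, T]%classic) (fun t _ => Lv1 t) (fun t _ => LB1 (Lc1 t)) du1.
have sv2 := sder_ip (I := `[0, T]%classic) (fun t _ => Lv2 t) (fun t _ => LB2 (Lc2 t)) du2.
have sG : sder `[0, T] (fun t => \int[mu]_x comp2 G (v1 t) (v2 t) x)
    (fun t => ip (comp2 g1 (v1 t) (v2 t)) (Bop b1 (c1 t)) + ip (comp2 g2 (v1 t) (v2 t)) (Bop b2 (c2 t))).
  apply: (sder_G gradG lg1 lg2 contG cg1 cg2 g10 g20 G0 _ du1 du2); first by move=> t _; split; [exact: LB1|exact: LB2].
  move=> t It; have [d d0 hd] := has_deriv_cont SS dU It (fun s _ => DU s) (F_D (DU t)) ltr01.
  exists (displ_sup2 (NS (U t) + 1)), d => // h hh Ih.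
  have h1 : NS (U (t + h) - U t) <= 1 by apply: hd => //; rewrite addrAC subrr add0r.
  have h2 : NS (U (t + h)) <= NS (U t) + 1.
    by apply: le_trans (snB_le SS (DU (t + h)) (DU t)) _; rewrite lerD2l.
  have n0 := @nm_ge0 R.
  rewrite NSE in h2; have e1 := n0 (q1 (U (t + h))); have e2 := n0 (q2 (U (t + h))).
  have e3 := n0 (p1 (U (t + h))); have e4 := n0 (p2 (U (t + h))).
  by split; [apply: u1_nice => //; rewrite /a1; lra|apply: u2_nice => //; rewrite /a2; lra].
have S := sderD (sderD (sderD sc1 sc2) (sderD sv1 sv2)) (sderD sG sG).
apply: (sder_const T0 S) => t _.
have H b K c w v g : symb b K -> L2p c -> L2p w -> L2p v -> L2p g -> w = (fun x => v x + g x) ->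
  ip c (fun x => - Bop b w x) = - (ip v (Bop b c) + ip g (Bop b c)).
  move=> Sb Lc Lw Lv Lg ->; have Lvg := L2_D Lv Lg.
  have -> : (fun x => - Bop b (fun y => v y + g y) x) = (fun x => -1 * Bop b (fun y => v y + g y) x).
    by apply/funext => x; rewrite mulN1r.
  rewrite ipZr //; last exact: (Bop_L2 Sb).
  rewrite -(Bop_sym Sb Lc Lvg) (ipDr Lv Lg (Bop_L2 Sb Lc)) (ipC v) (ipC g); ring.
rewrite (H b1 K1 (c1 t) (w1 t) (v1 t) (comp2 g1 (v1 t) (v2 t))) // (H b2 K2 (c2 t) (w2 t) (v2 t) (comp2 g2 (v1 t) (v2 t))) //.
ring.
Qed.

(** The potential energy is bounded below by a multiple of the squared
    displacements, which the unknowns control linearly by [displ_sq]. *)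
Lemma velocity_bound :
  ip (c1 T) (c1 T) + ip (c2 T) (c2 T) <=
  `|energy (c1 0) (c2 0) (v1 0) (v2 0)| + 4 * k * (nm f1 ^+ 2 + nm f2 ^+ 2)
   + 4 * k * (K1 ^+ 2 + K2 ^+ 2) * (ip (a1 T) (a1 T) + ip (a2 T) (a2 T)).
Proof.
have e := energy_const; have l := G_lower (La1 T) (La2 T).
have s1 := displ_sq Sb1 if1 Lf1 (La1 T); have s2 := displ_sq Sb2 if2 Lf2 (La2 T).
have z1 := ip_ge0 (a1 T); have z2 := ip_ge0 (a2 T).
have z3 := ip_ge0 (v1 T); have z4 := ip_ge0 (v2 T).
have E := ler_norm (energy (c1 0) (c2 0) (v1 0) (v2 0)); move: E; rewrite -{1}e /energy.
rewrite -/(v1 T) -/(v2 T) in l s1 s2.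
exact: (velocity_arith k0 (sqr_ge0 K1) (sqr_ge0 K2) l s1 s2 z1 z2 z3 z4).
Qed.

End Apriori.

Lemma sder_cont (I : set R) (y w : R -> R) t : sder I y w -> I t -> forall e : R, 0 < e ->
  exists2 d, 0 < d & forall s, I s -> `|s - t| < d -> `|y s - y t| <= e.
Proof.
move=> hs It e e0; have [d d0 h1] := hs t It 1 ltr01.
have w0 : 0 < `|w t| + 1 by rewrite ltr_wpDl.
exists (Num.min d (e / (`|w t| + 1))); first by rewrite lt_min d0 divr_gt0.
move=> s Is; rewrite lt_min => /andP[st1 st2].
have := h1 (s - t) st1; rewrite addrC subrK => /(_ Is) H.
move: (ltW st2); rewrite ler_pdivlMr // => st3.
have -> : y s - y t = (y s - y t - (s - t) * w t) + (s - t) * w t by ring.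
apply: le_trans (ler_normD _ _) _; rewrite normrM.
by move: st3 H; rewrite mulrDr mul1r mulr1; lra.
Qed.

Variables (p01 p02 : R -> R).
Hypotheses (Lp01 : L2p p01) (Lp02 : L2p p02).
Let U0 : X -> R := mk (fun=> 0) (fun=> 0) p01 p02.

Let A := `|energy p01 p02 (u1 (fun=> 0)) (u2 (fun=> 0))| + 4 * k * (nm f1 ^+ 2 + nm f2 ^+ 2).
Let B := 4 * k * (K1 ^+ 2 + K2 ^+ 2).
Let Rb t := 4 + A + A * expR ((1 + B) * t).

Let A_ge0 : 0 <= A.
Proof. by rewrite addr_ge0 // mulr_ge0 ?mulr_ge0 // addr_ge0 ?sqr_ge0. Qed.
Let B_ge0 : 0 <= B.
Proof. by rewrite mulr_ge0 ?mulr_ge0 // addr_ge0 ?sqr_ge0. Qed.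

(** With y the squared norm of q and z that of p, energy gives z <= A + B y,
    and y' = 2 (q, p) <= y + z <= (1 + B) y + A with y 0 = 0; Gronwall's lemma
    bounds y, and then z. *)
Lemma apriori T U : 0 <= T -> U 0 = U0 -> (forall t, DS (U t)) ->
  has_deriv NS `[0, T] U (F \o U) -> NS (U T) <= Rb T.
Proof.
move=> T0 UU0 DU dU.
pose a1 t := q1 (U t); pose a2 t := q2 (U t); pose c1 t := p1 (U t); pose c2 t := p2 (U t).
have La1 t : L2p (a1 t) by have /DSP[] := DU t.
have La2 t : L2p (a2 t) by have /DSP[] := DU t.
have Lc1 t : L2p (c1 t) by have /DSP[] := DU t.
have Lc2 t : L2p (c2 t) by have /DSP[] := DU t.
pose y t := ip (a1 t) (a1 t) + ip (a2 t) (a2 t).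
pose z t := ip (c1 t) (c1 t) + ip (c2 t) (c2 t).
have y0 t : 0 <= y t by rewrite addr_ge0 // ip_ge0.
have vb t : 0 <= t <= T -> z t <= A + B * y t.
  move=> /andP[t0 tT].
  have dU' : has_deriv NS `[0, t] U (F \o U).
    apply: has_deriv_restr dU => s /=; rewrite !in_itv /= => /andP[-> st].
    exact: le_trans st tT.
  have := velocity_bound t0 DU dU'.
  by rewrite UU0 -/(a1 t) -/(a2 t) -/(c1 t) -/(c2 t).
have [dq1 dq2 _ _] := comp_derivs dU.
have s1 := sder_ip (I := `[0, T]%classic) (fun t _ => La1 t) (fun t _ => Lc1 t) dq1.
have s2 := sder_ip (I := `[0, T]%classic) (fun t _ => La2 t) (fun t _ => Lc2 t) dq2.
have sy := sderD s1 s2; rewrite -/y in sy.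
(* From |f - g|^2 >= 0, written with the factor 1 of [ip_quad]. *)
have young f g : L2p f -> L2p g -> 2 * ip f g <= ip f f + ip g g.
  move=> Lf Lg; have := ip_ge0 (fun x => f x - 1 * g x).
  by rewrite (ip_quad 1 Lf Lg) expr1n; lra.
have L0 : 0 < 1 + B by rewrite ltr_pwDl.
have yT : y T <= (y 0 + A / (1 + B)) * expR ((1 + B) * T).
  apply: (gronwall T0 L0 A_ge0 (fun t _ => y0 t)).
    move=> t /andP[t0 tT] e e0.
    have It : `[0, T]%classic t by rewrite /= in_itv /= t0 ltW.
    have [d d0 h1] := sy t It e e0; exists d => // h /andP[h0 hd] hT.
    have Ih : `[0, T]%classic (t + h) by rewrite /= in_itv /= hT addr_ge0 // ltW.
    have := h1 h; rewrite (gtr0_norm h0) => /(_ hd Ih) H.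
    have v := vb t; rewrite t0 (ltW tT) in v; have {}v := v isT.
    have Y1 := young _ _ (La1 t) (Lc1 t); have Y2 := young _ _ (La2 t) (Lc2 t).
    have W : 2 * ip (a1 t) (c1 t) + 2 * ip (a2 t) (c2 t) <= (1 + B) * y t + A.
      have -> : (1 + B) * y t + A = y t + (A + B * y t) by rewrite mulrDl mul1r -addrA (addrC _ A).
      by apply: le_trans (lerD (lexx _) v); rewrite /y /z; lra.
    have := ler_wpM2l (ltW h0) W; have := ler_norm (y (t + h) - y t - h * (2 * ip (a1 t) (c1 t) + 2 * ip (a2 t) (c2 t))).
    move: H; rewrite -/(a1 t) -/(a2 t) -/(c1 t) -/(c2 t).
    move=> P1 P2 P3; have := le_trans P2 P1; move: P3.
    by move: (h * (2 * _ + _)) (h * ((1 + B) * _ + _)) (e * h) => n1 n2 n3; lra.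
  move=> t /andP[t0 tT] e e0.
  have It : `[0, T]%classic t by rewrite /= in_itv /= tT ltW.
  have [d d0 h1] := sder_cont sy It e0; exists d => // s s0 /andP[sd st].
  have Is : `[0, T]%classic s by rewrite /= in_itv /= s0 (le_trans (ltW st)).
  have sdt : `|s - t| < d by rewrite ltr0_norm ?subr_lt0 //; lra.
  by have := h1 s Is sdt; rewrite ler_norml => /andP[]; lra.
have y00 : y 0 = 0.
  have Z0 : ip (fun=> 0 : R) (fun=> 0) = 0 by rewrite ipE (@I_eq _ _ (fun=> 0)) ?I_0 // => x; rewrite expr0n.
  by rewrite /y /a1 /a2 UU0 /q1 /q2 /= Z0 addr0.
have zT : z T <= A + B * y T by apply: vb; rewrite T0 lexx.
have sq f : nm f <= 1 + ip f f.
  by rewrite -nm_sq; have := sqr_ge0 (nm f - 1); have := nm_ge0 f; nra.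
have n1 := sq (a1 T); have n2 := sq (a2 T); have n3 := sq (c1 T); have n4 := sq (c2 T).
have E : (1 + B) * y T <= A * expR ((1 + B) * T).
  apply: le_trans (ler_wpM2l (ltW L0) yT) _.
  by rewrite y00 add0r mulrA (mulrC _ (A / _)) divfK // gt_eqF.
rewrite NSE /Rb -/(a1 T) -/(a2 T) -/(c1 T) -/(c2 T).
move: E zT; rewrite mulrDl mul1r /z {1 2}/y.
move: (B * _) (A * _) => x1 x2; rewrite /y; lra.
Qed.

Lemma expR_lip (L T s t : R) : 0 < L -> 0 <= s <= T -> 0 <= t <= T ->
  `|expR (L * s) - expR (L * t)| <= L * expR (L * T) * `|s - t|.
Proof.
move=> L0.
have H (x y : R) : 0 <= x <= T -> 0 <= y <= T -> x <= y -> `|expR (L * x) - expR (L * y)| <= L * expR (L * T) * `|x - y|.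
  move=> /andP[x0 xT] /andP[y0 yT] xy.
  rewrite ler0_norm ?subr_le0 ?ler_expR ?ler_pM2l // ler0_norm ?subr_le0 // !opprB.
  have e1 : expR (L * x) = expR (L * y) * expR (L * (x - y)) by rewrite -expRD; congr expR; ring.
  have e2 := expR_ge1Dx (L * (x - y)).
  have e3 : expR (L * y) <= expR (L * T) by rewrite ler_expR ler_pM2l.
  have p := expR_gt0 (L * y).
  rewrite e1; apply: (@le_trans _ _ (expR (L * y) * (L * (y - x)))).
    by have := ler_wpM2l (ltW p) e2; rewrite !mulrDr; lra.
  have -> : L * expR (L * T) * (y - x) = expR (L * T) * (L * (y - x)) by ring.
  apply: ler_wpM2r => //.
  by rewrite mulr_ge0 ?subr_ge0 // ltW.
move=> hs ht; have [st|ts] := leP s t; first exact: H.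
by rewrite distrC (distrC s); apply: H => //; exact: ltW.
Qed.

Theorem wave_ode : exists a1 a2 c1 c2 : R -> R -> R,
  [/\ a1 0 = (fun=> 0) /\ a2 0 = (fun=> 0), c1 0 = p01 /\ c2 0 = p02,
   forall t, [/\ L2p (a1 t), L2p (a2 t), L2p (c1 t) & L2p (c2 t)],
   forall T, exists C, forall t, 0 <= t <= T -> nm (a1 t) <= C /\ nm (a2 t) <= C &
   [/\ has_deriv nm [set t | 0 <= t] a1 c1, has_deriv nm [set t | 0 <= t] a2 c2,
    has_deriv nm [set t | 0 <= t] c1 (fun t x => - Bop b1 (force1 (a1 t) (a2 t)) x) &
    has_deriv nm [set t | 0 <= t] c2 (fun t x => - Bop b2 (force2 (a1 t) (a2 t)) x)]].
Proof.
have L0 : 0 < 1 + B by rewrite ltr_pwDl.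
have [LF hLF] := @choice R R (fun r L => 0 < L /\ forall U U', DS U -> DS U' -> NS U <= r -> NS U' <= r ->
  NS (F U - F U') <= L * NS (U - U')) F_lip.
have DU0 : DS U0 by apply/DSP; split => //; exact: L2_0.
have ex0 t : 0 <= expR ((1 + B) * t) := expR_ge0 _.
have lipR T s t : 0 <= s <= T -> 0 <= t <= T -> `|Rb s - Rb t| <= A * ((1 + B) * expR ((1 + B) * T)) * `|s - t|.
  move=> hs ht.
  have -> : Rb s - Rb t = A * (expR ((1 + B) * s) - expR ((1 + B) * t)).
    by rewrite /Rb mulrBr; move: (A * _) (A * _) => x y; ring.
  by rewrite normrM (ger0_norm A_ge0) -mulrA; apply: ler_wpM2l => //; exact: expR_lip.
have [U [e0 DU dU]] := @global_ode R X DS NS SS F U0 LF Rb (fun T => A * ((1 + B) * expR ((1 + B) * T)))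
  CS_ DU0 F_D (fun r => (hLF r).1) (fun r => (hLF r).2)
  (fun t _ => addr_ge0 (addr_ge0 (ler0n _ 4) A_ge0) (mulr_ge0 A_ge0 (ex0 t)))
  (fun s t (s0 : 0 <= s) (st : s <= t) => lerD (lexx _) (ler_wpM2l A_ge0 (etrans (ler_expR _ _) (etrans (ler_pM2l L0 s t) st))))
  (fun t => mulr_ge0 A_ge0 (mulr_ge0 (ltW L0) (ex0 t)))
  lipR apriori.
have [h1 h2 h3 h4] := comp_derivs dU.
exists (fun t => q1 (U t)), (fun t => q2 (U t)), (fun t => p1 (U t)), (fun t => p2 (U t)).
split => //; rewrite ?e0 //; first by move=> t; have /DSP := DU t.
move=> T; exists (Rb T) => t /andP[t0 tT].
have dU' : has_deriv NS `[0, t] U (F \o U).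
  by apply: has_deriv_restr dU => s /=; rewrite in_itv /= => /andP[].
have := apriori t0 e0 DU dU'; rewrite NSE => h.
have h' : Rb t <= Rb T by apply: lerD => //; apply: ler_wpM2l => //; rewrite ler_expR ler_pM2l.
have n1 := nm_ge0 (q1 (U t)); have n2 := nm_ge0 (q2 (U t)).
have n3 := nm_ge0 (p1 (U t)); have n4 := nm_ge0 (p2 (U t)).
have hh := le_trans h h'.
by split; apply: le_trans hh; rewrite ?lerDl; move: n1 n2 n3 n4; move: (nm _) (nm _) (nm _) (nm _) => y1 y2 y3 y4; lra.
Qed.

End WaveODE.

(** * Translations and derivatives of square-integrable functions *)

Section Translation.
Context {R : realType}.
Local Notation mu := (@lebesgue_measure R).
Implicit Types (f u v w : R -> R) (h s xi : R).

Definition shift h u x : R := u (x + h).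
(** The effect on transforms of a translation by [h]: for each xi a rotation
    in the pair of values at xi and - xi. *)
Definition rot h f xi : R := cos (xi * h) * f xi - sin (xi * h) * f (- xi).

Lemma shift_m h u : mfun1 u -> mfun1 (shift h u).
Proof. by move=> m; apply: (measurableT_comp m); exact: measurable_funD. Qed.

Lemma shift_L2 h u : L2p u -> L2p (shift h u) /\ nm (shift h u) = nm u.
Proof.
move=> [m i]; have [j e] := I_shift h i; split; first by split; [exact: shift_m|].
by rewrite !nm_def !ipE e.
Qed.

Lemma nm_opp f : L2p f -> nm (fun x => f (- x)) = nm f.
Proof. by move=> Lf; rewrite !nm_def ipE I_opp_sq. Qed.

Lemma aeq_opp u v : L2p u -> L2p v -> aeq u v -> aeq (fun x => u (- x)) (fun x => v (- x)).
Proof.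
move=> Lu Lv e; apply: nm_eq_ae; [exact: L2_opp|exact: L2_opp|].
by rewrite (nm_opp (L2_B Lu Lv)); exact: nm0_ae.
Qed.

Lemma sin_le_abs (a : R) : `|sin a| <= `|a|.
Proof.
have [c [+ _ _]] := @mvt1 R sin cos 0 a (fun x => is_derive_sin x).
rewrite sin0 !subr0 => ->; rewrite normrM -[leRHS]mul1r; apply: ler_wpM2r => //.
by rewrite ler_norml cos_geN1 cos_le1.
Qed.

Lemma cosB1_le (a : R) : `|cos a - 1| <= `|a| /\ `|cos a - 1| <= a ^+ 2.
Proof.
have [c [e h _]] := @mvt1 R cos (fun x => - sin x) 0 a (fun x => is_derive_cos x).
rewrite cos0 !subr0 in e h; rewrite e normrM normrN; split.
  by rewrite -[leRHS]mul1r; apply: ler_wpM2r => //; rewrite ler_norml sin_geN1 sin_le1.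
by rewrite -real_normK ?num_real // expr2; apply: ler_wpM2r => //; exact: le_trans (sin_le_abs c) h.
Qed.

Lemma sinB_le (a : R) : `|sin a - a| <= a ^+ 2.
Proof.
have d (x : R) : is_derive x 1 (fun y : R => sin y - y) (cos x - 1).
  exact: (is_deriveB (is_derive_sin x) (is_derive_id x (1 : R))).
have [c [e h _]] := mvt1 0 a d.
rewrite sin0 !subr0 in e h; rewrite e normrM.
by rewrite -real_normK ?num_real // expr2; apply: ler_wpM2r => //; exact: le_trans (cosB1_le c).1 h.
Qed.

Lemma mcos h : mfun1 (fun xi => cos (xi * h)).
Proof.
apply: (measurableT_comp (f := cos)); last exact: measurable_funM.
exact: continuous_measurable_fun (@continuous_cos R).
Qed.

Lemma msin h : mfun1 (fun xi => sin (xi * h)).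
Proof.
apply: (measurableT_comp (f := sin)); last exact: measurable_funM.
exact: continuous_measurable_fun (@continuous_sin R).
Qed.

Lemma rot_L2 h f : L2p f -> L2p (rot h f) /\ nm (rot h f) <= 2 * nm f.
Proof.
move=> Lf; have Lo := L2_opp Lf.
have := @nm_dom2 _ (rot h f) f (fun x => f (- x)) 1 ler01 _ Lf Lo.
rewrite (nm_opp Lf) mul1r; have -> : 2 * nm f = nm f + nm f by ring.
apply.
  apply: measurable_funB; apply: measurable_funM; [exact: mcos|exact: L2_m|exact: msin|exact: L2_m Lo].
move=> x; rewrite mul1r; apply: le_trans (ler_normB _ _) _; rewrite !normrM.
apply: lerD; rewrite -[leRHS]mul1r; apply: ler_wpM2r => //.
  by rewrite ler_norml cos_geN1 cos_le1.
by rewrite ler_norml sin_geN1 sin_le1.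
Qed.

Lemma hart1_shift h u xi : intg u -> hart1 (shift h u) xi = rot h (hart1 u) xi.
Proof.
move=> iu; rewrite /rot /hart1.
have i1 := int_cas xi iu; have i2 := int_cas (- xi) iu.
pose F y := cas (xi * (y - h)) * u y.
have EF y : F y = cos (xi * h) * (cas (xi * y) * u y) - sin (xi * h) * (cas (- xi * y) * u y).
  by rewrite /F mulrBr casB mulNr; ring.
have iF : intg F by rewrite (funext EF); apply: intgB; exact: intgZ.
have [_ e] := I_shift h iF.
have -> : \int[mu]_x (cas (xi * x) * shift h u x) = \int[mu]_x F x.
  by rewrite -e; apply: I_eq => x; rewrite /F addrK.
rewrite (I_eq EF) I_B; [|exact: intgZ|exact: intgZ].
by rewrite !I_Z //; ring.
Qed.

Lemma hart_isoB u v : L2p u -> L2p v -> nm (fun x => hart u x - hart v x) = nm (fun x => u x - v x).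
Proof.
move=> Lu Lv; have Ld := L2_B Lu Lv.
rewrite -(hart_iso Ld); apply: nm_ae; [exact: L2_m (L2_B (hart_L2 Lu) (hart_L2 Lv))|exact: L2_m (hart_L2 Ld)|].
exact: aeq_sym (hartB Lu Lv).
Qed.

(** The identity for integrable functions, applied to truncations; all three
    errors are bounded by that of the truncation. *)
Lemma hart_shift h u : L2p u -> aeq (hart (shift h u)) (rot h (hart u)).
Proof.
move=> Lu; have [Ls _] := shift_L2 h Lu; have Lh := hart_L2 Lu; have [Lr _] := rot_L2 h Lh.
apply: nm_eq_ae => //; first exact: hart_L2.
apply/le_anti; rewrite nm_ge0 andbT.
have c : 3 * nm (fun x => tr n u x - u x) @[n --> \oo] --> (3 * 0 : R).
  by apply: cvgM; [exact: cvg_cst|exact: tr_L2cvg].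
rewrite mulr0 in c; rewrite -(cvg_lim (@Rhausdorff R) c).
apply: limr_ge; first by apply/cvg_ex; exists 0.
apply: nearW => n; have Lt := tr_L2 n Lu; have it := tr_intg n Lu.
have [Lst _] := shift_L2 h Lt; have LH := hart_L2 Lt; have [LR _] := rot_L2 h LH.
have Ld := L2_B Lt Lu.
have e1 : nm (fun x => hart (shift h u) x - hart (shift h (tr n u)) x) = nm (fun x => tr n u x - u x).
  rewrite hart_isoB // -(shift_L2 h Ld).2 (_ : (fun x => _) = (fun x => -1 * shift h (fun x => tr n u x - u x) x)).
    by rewrite nmZ ?normrN1 ?mul1r //; exact: (shift_L2 h Ld).1.
  by apply/funext => x; rewrite /shift; ring.
have e2 : nm (fun x => rot h (hart (tr n u)) x - rot h (hart u) x) <= 2 * nm (fun x => tr n u x - u x).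
  rewrite -(hart_isoB Lt Lu) (_ : (fun x => rot _ _ x - _) = rot h (fun x => hart (tr n u) x - hart u x)).
    exact: (rot_L2 h (L2_B LH Lh)).2.
  by apply/funext => x; rewrite /rot; ring.
have e3 : aeq (hart (shift h (tr n u))) (rot h (hart (tr n u))).
  have is_ : intg (shift h (tr n u)) by have [] := I_shift h it.
  have k1 := hart_L1 Lt it; have k2 := hart_L1 Lst is_.
  have k3 : {ae mu, forall x, hart (tr n u) (- x) = hart1 (tr n u) (- x)} by apply: (aeq_opp _ _ k1); [exact: hart_L2|exact: L2_hart1_tr].
  apply: (ae_imp2 _ k2 (ae_imp2 (fun x a b => conj a b) k1 k3)) => x -> [a b].
  by rewrite hart1_shift // /rot a b.
have e4 : nm (fun x => hart (shift h (tr n u)) x - rot h (hart (tr n u)) x) = 0.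
  by apply: nm0_ae => //; exact: hart_L2.
have -> : (fun x => hart (shift h u) x - rot h (hart u) x) = (fun x => (hart (shift h u) x - hart (shift h (tr n u)) x) +
   ((hart (shift h (tr n u)) x - rot h (hart (tr n u)) x) + (rot h (hart (tr n u)) x - rot h (hart u) x))).
  by apply/funext => x; ring.
have d1 := L2_B (hart_L2 Ls) (hart_L2 Lst); have d2 := L2_B (hart_L2 Lst) LR; have d3 := L2_B LR Lr.
apply: le_trans (nmD d1 (L2_D d2 d3)) _; apply: le_trans (lerD (lexx _) (nmD d2 d3)) _.
rewrite e4 e1; move: e2; lra.
Qed.

Definition diff_quot h u x : R := h^-1 * (u (x + h) - u x).
(** v = u' expressed on the transforms: differentiation multiplies by - xi and
    reflects, since cas' (x) = cas (- x). *)
Definition L2deriv u v := aeq (hart v) (fun xi => - xi * hart u (- xi)).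
(** The action of the difference quotient on transforms. *)
Definition diff_symb h f xi : R := h^-1 * (rot h f xi - f xi).

Lemma diff_quot_L2 h u : L2p u -> L2p (diff_quot h u).
Proof. by move=> Lu; apply: L2_Z; apply: L2_B => //; exact: (shift_L2 h Lu).1. Qed.

Lemma hart_diff_quot h u : L2p u -> aeq (hart (diff_quot h u)) (diff_symb h (hart u)).
Proof.
move=> Lu; have [Ls _] := shift_L2 h Lu; have Ld := L2_B Ls Lu.
apply: aeq_trans (hartZ h^-1 Ld) _.
by apply: (ae_imp2 _ (hartB Ls Lu) (hart_shift h Lu)) => x -> ->.
Qed.

Lemma diff_symbE h f xi : diff_symb h f xi = (h^-1 * (cos (xi * h) - 1)) * f xi - (h^-1 * sin (xi * h)) * f (- xi).
Proof. by rewrite /diff_symb /rot; ring. Qed.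

Lemma diff_symb_err h f xi : 0 < h -> `|diff_symb h f xi - - xi * f (- xi)| <= h * (xi ^+ 2 * (`|f xi| + `|f (- xi)|)).
Proof.
move=> h0; have hn : h != 0 by rewrite gt_eqF.
have -> : diff_symb h f xi - - xi * f (- xi) = h^-1 * ((cos (xi * h) - 1) * f xi) - h^-1 * ((sin (xi * h) - xi * h) * f (- xi)).
  by rewrite diff_symbE; field.
apply: le_trans (ler_normB _ _) _; rewrite mulrDr mulrDr; apply: lerD; rewrite !normrM normfV (gtr0_norm h0) ler_pdivrMl //.
  have -> : h * (h * (xi ^+ 2 * `|f xi|)) = (xi * h) ^+ 2 * `|f xi| by ring.
  by apply: ler_wpM2r => //; exact: (cosB1_le _).2.
have -> : h * (h * (xi ^+ 2 * `|f (- xi)|)) = (xi * h) ^+ 2 * `|f (- xi)| by ring.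
by apply: ler_wpM2r => //; exact: sinB_le.
Qed.

Lemma diff_symb_cvg f xi : diff_symb (ep n) f xi @[n --> \oo] --> - xi * f (- xi).
Proof.
have c : ep n * (xi ^+ 2 * (`|f xi| + `|f (- xi)|)) @[n --> \oo] --> (0 * (xi ^+ 2 * (`|f xi| + `|f (- xi)|)) : R).
  by apply: cvgM; [exact: ep_cvg|exact: cvg_cst].
rewrite mul0r in c; move/cvgrPdist_le : c => c; apply/cvgrPdist_le => e e0.
have := c e e0; apply: filterS => n; rewrite sub0r normrN => H.
rewrite distrC; apply: le_trans (diff_symb_err f xi (ep_gt0 n)) _.
exact: le_trans (ler_norm _) H.
Qed.

Lemma diff_symb_le h f xi : 0 < h -> `|diff_symb h f xi| <= `|xi * f xi| + `|xi * f (- xi)|.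
Proof.
move=> h0; rewrite diff_symbE; apply: le_trans (ler_normB _ _) _; rewrite !normrM normfV (gtr0_norm h0).
apply: lerD; apply: ler_wpM2r => //; rewrite ler_pdivrMl // -(mulrC `|xi|) -{2}(gtr0_norm h0) -normrM.
  exact: (cosB1_le _).1.
exact: sin_le_abs.
Qed.

Lemma L2deriv_mul u v : L2p u -> L2p v -> L2deriv u v ->
  L2p (fun xi => xi * hart u xi) /\ L2p (fun xi => xi * hart u (- xi)).
Proof.
move=> Lu Lv d; have Lh := hart_L2 Lu; have Lo := L2_opp Lh.
have L2 : L2p (fun xi => xi * hart u (- xi)).
  have m : mfun1 (fun xi => xi * hart u (- xi)).
    by apply: measurable_funM; [exact: measurable_id|exact: L2_m Lo].
  apply: (L2_ae (L2_N (hart_L2 Lv)) m); apply: ae_imp d => xi ->; ring.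
split => //; have := L2_N (L2_opp L2); apply: (fun a b => eq_ind _ (@L2p R) b _ a).
by apply/funext => xi; rewrite opprK mulNr opprK.
Qed.

(** The symbols of the difference quotients converge pointwise and are
    dominated by |xi| times the transform. *)
Lemma L2deriv_diff_quot u v : L2p u -> L2p v -> L2deriv u v -> nm (fun x => diff_quot (ep n) u x - v x) @[n --> \oo] --> 0.
Proof.
move=> Lu Lv d; have Lh := hart_L2 Lu; have [L1 L2] := L2deriv_mul Lu Lv d.
have Lg := L2_D (L2_abs L1) (L2_abs L2).
have mr n : mfun1 (diff_symb (ep n) (hart u)).
  exact: L2_m (L2_Z _ (L2_B (rot_L2 (ep n) Lh).1 Lh)).
have mL : mfun1 (fun xi => - xi * hart u (- xi)).
  by have := L2_m (L2_N L2); under eq_fun do rewrite -mulNr.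
have c := L2_dct mr mL (ae_all (fun xi => @diff_symb_cvg (hart u) xi)) Lg
  (fun n xi => diff_symb_le (hart u) xi (ep_gt0 n)) _.
have {}c : nm (fun x => diff_symb (ep n) (hart u) x - - x * hart u (- x)) @[n --> \oo] --> 0.
  by apply: c => xi; rewrite mulNr normrN lerDr.
rewrite (_ : (fun n => _) = (fun n => nm (fun x => diff_symb (ep n) (hart u) x - - x * hart u (- x)))) //.
apply/funext => n; have Lq := diff_quot_L2 (ep n) Lu.
rewrite -(hart_isoB Lq Lv); apply: nm_ae.
- exact: L2_m (L2_B (hart_L2 Lq) (hart_L2 Lv)).
- exact: (measurable_funB (mr n) mL).
- by apply: (ae_imp2 _ (hart_diff_quot (ep n) Lu) d) => x -> ->.
Qed.

(** Fatou's lemma identifies the limit of the transforms of the difference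
    quotients. This converse is what yields the chain rule, whose proof takes
    place in physical space. *)
Lemma L2deriv_of_diff_quot u v : L2p u -> L2p v -> nm (fun x => diff_quot (ep n) u x - v x) @[n --> \oo] --> 0 -> L2deriv u v.
Proof.
move=> Lu Lv c; have Lh := hart_L2 Lu; have Hv := hart_L2 Lv.
have LF n : L2p (fun xi => diff_symb (ep n) (hart u) xi - hart v xi).
  by apply: L2_B => //; exact: (L2_Z _ (L2_B (rot_L2 (ep n) Lh).1 Lh)).
have NF n : nm (fun xi => diff_symb (ep n) (hart u) xi - hart v xi) = nm (fun x => diff_quot (ep n) u x - v x).
  have Lq := diff_quot_L2 (ep n) Lu.
  rewrite -(hart_isoB Lq Lv); apply: nm_ae; [exact: L2_m|exact: L2_m (L2_B (hart_L2 Lq) Hv)|].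
  by apply: ae_imp (hart_diff_quot (ep n) Lu) => x ->.
have mL : mfun1 (fun xi => - xi * hart u (- xi) - hart v xi).
  apply: measurable_funB; last exact: L2_m.
  by apply: measurable_funM; [exact: oppr_measurable|exact: L2_m (L2_opp Lh)].
have H e : 0 < e -> L2p (fun xi => - xi * hart u (- xi) - hart v xi) /\ nm (fun xi => - xi * hart u (- xi) - hart v xi) <= e.
  move=> e0; move/cvgrPdist_le : c => /(_ e e0)[N _ hN].
  apply: (L2_trunc_le (F := fun n xi => diff_symb (ep (n + N)) (hart u) xi - hart v xi)) => //.
  - exact: ltW.
  - apply: ae_all => xi; apply: cvgB; last exact: cvg_cst.
    by have := @diff_symb_cvg (hart u) xi; rewrite -(cvg_shiftn N).
  - move=> n; rewrite NF; have := hN (n + N)%N (leq_addl _ _).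
    by rewrite sub0r normrN; apply: le_trans; exact: ler_norm.
have [LL _] := H 1 ltr01.
have n0 : nm (fun xi => - xi * hart u (- xi) - hart v xi) = 0.
  apply/le_anti; rewrite nm_ge0 andbT; apply/ler_addgt0Pr => e e0.
  by rewrite add0r; have [] := H e e0.
apply: ae_imp (nm_eq0 LL n0) => xi /eqP; rewrite subr_eq0 => /eqP -> //.
Qed.

Lemma L2deriv_exists u : L2p u -> L2p (fun xi => xi * hart u xi) -> exists2 v, L2p v & L2deriv u v.
Proof.
move=> Lu L1; have L2 := L2_opp L1.
have L3 : L2p (fun xi => - xi * hart u (- xi)) by exact: L2.
by exists (hart (fun xi => - xi * hart u (- xi))); [exact: hart_L2|exact: hart_inv].
Qed.

Lemma jw_half_le xi : `|xi| <= jw 2^-1 xi /\ jw 2^-1 xi <= 1 + `|xi|.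
Proof.
have e : jw 2^-1 xi ^+ 2 = 1 + xi ^+ 2 by rewrite jw_sq divff // jw1.
have j0 := jw_ge0 2^-1 xi.
split; rewrite -(@ler_pXn2r _ 2) ?nnegrE ?addr_ge0 // e ?real_normK ?num_real //.
  by rewrite lerDr.
rewrite sqrrD real_normK ?num_real // expr1n mul1r lerD2r lerDl mulrn_wge0 //.
Qed.

(** A pointwise bound on weighted transforms, the common source of norm
    comparisons. *)
Lemma HsR_dom s s' u u' (K : R) : L2p u -> HsR s' u' ->
  (forall xi, `|jw (s / 2) xi * hart u xi| <= K * `|jw (s' / 2) xi * hart u' xi|) -> HsR s u /\ hnm s u <= K * hnm s' u'.
Proof.
move=> Lu [Lu' Lw] h; have m : mfun1 (fun xi => jw (s / 2) xi * hart u xi).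
  exact: measurable_funM (jw_m _) (L2_m (hart_L2 Lu)).
by have [L n] := L2_bddr m Lw h; split; [split|].
Qed.

Lemma HsR_mono s s' u : s <= s' -> HsR s' u -> HsR s u /\ hnm s u <= hnm s' u.
Proof.
move=> ss Hu; have [Lu _] := Hu; rewrite -[hnm s' u]mul1r; apply: HsR_dom => // xi.
rewrite mul1r !normrM; apply: ler_wpM2r => //.
by rewrite !ger0_norm ?jw_ge0 //; apply: jw_le; rewrite ler_pM2r ?invr_gt0.
Qed.

Lemma HsR0 u : L2p u -> HsR 0 u /\ hnm 0 u = nm u.
Proof.
move=> Lu; have e : (fun xi => jw (0 / 2) xi * hart u xi) = hart u.
  by apply/funext => xi; rewrite mul0r jw0 mul1r.
split; last by rewrite /hnm e hart_iso.
by split => //; rewrite e; exact: hart_L2.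
Qed.

Lemma HsR_lin s a u v : HsR s u -> HsR s v ->
  HsR s (fun x => a * u x + v x) /\ hnm s (fun x => a * u x + v x) <= `|a| * hnm s u + hnm s v.
Proof.
move=> [Lu Wu] [Lv Wv]; have Lz := L2_D (L2_Z a Lu) Lv.
have m : mfun1 (fun xi => jw (s / 2) xi * hart (fun x => a * u x + v x) xi).
  exact: measurable_funM (jw_m _) (L2_m (hart_L2 Lz)).
have L := L2_D (L2_Z a Wu) Wv.
have e : aeq (fun xi => a * (jw (s / 2) xi * hart u xi) + jw (s / 2) xi * hart v xi) (fun xi => jw (s / 2) xi * hart (fun x => a * u x + v x) xi).
  by apply: ae_imp (hart_lin a Lu Lv) => xi ->; ring.
split; first by split => //; exact: L2_ae L m e.
rewrite /hnm (nm_ae m (L2_m L) (aeq_sym e)).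
by apply: le_trans (nmD (L2_Z a Wu) Wv) _; rewrite nmZ.
Qed.

Lemma HsR_B s u v : HsR s u -> HsR s v ->
  HsR s (fun x => u x - v x) /\ hnm s (fun x => u x - v x) <= hnm s u + hnm s v.
Proof.
move=> Hu Hv; have [] := HsR_lin (-1) Hv Hu; rewrite normrN normr1 mul1r addrC.
by rewrite (_ : (fun x => -1 * v x + u x) = (fun x => u x - v x)) //; apply/funext => x; ring.
Qed.

Lemma HsR_deriv s u v : L2p v -> L2deriv u v -> HsR (s + 1) u -> HsR s v /\ hnm s v <= hnm (s + 1) u.
Proof.
move=> Lv d [Lu Wu]; have m : mfun1 (fun xi => jw (s / 2) xi * hart v xi).
  exact: measurable_funM (jw_m _) (L2_m (hart_L2 Lv)).
have Wo := L2_opp Wu; have No := nm_opp Wu.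
have m' : mfun1 (fun xi => jw (s / 2) xi * (- xi * hart u (- xi))).
  apply: measurable_funM; first exact: jw_m.
  by apply: measurable_funM; [exact: oppr_measurable|exact: L2_m (L2_opp (hart_L2 Lu))].
have h xi : `|jw (s / 2) xi * (- xi * hart u (- xi))| <= 1 * `|jw ((s + 1) / 2) (- xi) * hart u (- xi)|.
  rewrite mul1r mulrA !normrM; apply: ler_wpM2r => //.
  rewrite normrN jwN (_ : (s + 1) / 2 = s / 2 + 2^-1); last by field.
  by rewrite jwD !normrM; apply: ler_wpM2l => //; rewrite [leRHS]ger0_norm ?jw_ge0 //; exact: (jw_half_le xi).1.
have [L n] := L2_bddr m' Wo h.
have e : aeq (fun xi => jw (s / 2) xi * (- xi * hart u (- xi))) (fun xi => jw (s / 2) xi * hart v xi).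
  by apply: ae_imp d => xi ->.
split; first by split => //; exact: L2_ae L m e.
by rewrite /hnm -(nm_ae m' m e) (le_trans n) // mul1r No.
Qed.

(** (1 + xi^2)^(1/2) <= 1 + |xi|. *)
Lemma HsR_of_deriv s u v : L2deriv u v -> HsR s u -> HsR s v -> HsR (s + 1) u /\ hnm (s + 1) u <= hnm s u + hnm s v.
Proof.
move=> d [Lu Wu] [Lv Wv]; have m : mfun1 (fun xi => jw ((s + 1) / 2) xi * hart u xi).
  exact: measurable_funM (jw_m _) (L2_m (hart_L2 Lu)).
have Lo := L2_opp Wv.
have m2 : mfun1 (fun xi => jw (s / 2) xi * (xi * hart u xi)).
  apply: measurable_funM; first exact: jw_m.
  by apply: measurable_funM; [exact: measurable_id|exact: L2_m (hart_L2 Lu)].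
have e : aeq (fun xi => jw (s / 2) (- xi) * hart v (- xi)) (fun xi => jw (s / 2) xi * (xi * hart u xi)).
  have Hv := hart_L2 Lv.
  have m3 : mfun1 (fun xi => - xi * hart u (- xi)).
    by apply: measurable_funM; [exact: oppr_measurable|exact: L2_m (L2_opp (hart_L2 Lu))].
  have := aeq_opp Hv (L2_ae Hv m3 d) d.
  by apply: ae_imp => xi ->; rewrite !opprK jwN.
have L2 := L2_ae Lo m2 e.
have h xi : `|jw ((s + 1) / 2) xi * hart u xi| <= 1 * (`|jw (s / 2) xi * hart u xi| + `|jw (s / 2) xi * (xi * hart u xi)|).
  rewrite mul1r (_ : (s + 1) / 2 = s / 2 + 2^-1); last by field.
  rewrite jwD !normrM (ger0_norm (jw_ge0 _ _)) (ger0_norm (jw_ge0 _ _)) -mulrA -mulrDr.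
  apply: ler_wpM2l; first exact: jw_ge0.
  by rewrite -[X in _ <= X + _]mul1r -mulrDl; apply: ler_wpM2r => //; exact: (jw_half_le xi).2.
have [L n] := nm_dom2 ler01 m Wu L2 h.
split; first by split.
by apply: le_trans n _; rewrite mul1r -(nm_ae (L2_m Lo) m2 e) (nm_opp Wv).
Qed.

Lemma HsR_deriv_ex s u : 0 <= s -> HsR (s + 1) u -> exists v, [/\ L2deriv u v, HsR s v & hnm s v <= hnm (s + 1) u].
Proof.
move=> s0 Hu; have [Lu _] := Hu; have s1 : 1 <= s + 1 by rewrite lerDr.
have [[_ W1] _] := HsR_mono s1 Hu.
have [|v Lv d] := L2deriv_exists Lu.
  apply: (L2_dom _ W1); first by apply: measurable_funM; [exact: measurable_id|exact: L2_m (hart_L2 Lu)].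
  move=> xi; rewrite !normrM; apply: ler_wpM2r => //; rewrite mul1r.
  by rewrite [leRHS]ger0_norm ?jw_ge0 //; exact: (jw_half_le xi).1.
by exists v; have [] := HsR_deriv Lv d Hu.
Qed.

End Translation.

(** * Composition with smooth functions in Sobolev spaces *)

Section Composition.
Context {R : realType}.
Local Notation mu := (@lebesgue_measure R).
Implicit Types (f u v w : R -> R) (h s xi M K : R) (g : R * R -> R).

(** The inversion formula, valid at every point, makes these functions
    continuous and lets their increments be estimated at every point. *)
Definition spectral u := [/\ L2p u, intg (hart u) & u = hart1 (hart u)].

Lemma spectral_cont u : spectral u -> continuous u.
Proof. by move=> [Lu i ->]; exact: hart1_cont. Qed.

Lemma spectral_hart1 f : intg f -> L2p f -> spectral (hart1 f).
Proof.
move=> i Lf; have [L e _] := synth i Lf; have Lh := hart_L2 L; split => //.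
  exact: (intg_ae i (L2_m Lh) (aeq_sym e)).
by apply/funext => x; apply: hart1_ae; [exact: L2_m|exact: L2_m|exact: aeq_sym].
Qed.

Lemma spectral_repr s u : 2^-1 < s -> HsR s u -> spectral (cont_repr u).
Proof. by move=> hs Hu; have [i _] := hs_int hs Hu; apply: spectral_hart1 => //; case: Hu => Lu _; exact: hart_L2. Qed.

(** Uniform continuity along 1 / (n + 1): the increments are bounded by the
    integral of the increment of the kernel against the spectrum, which tends
    to 0 by dominated convergence. *)
Lemma spectral_unif u : spectral u -> exists2 eta : nat -> R, eta n @[n --> \oo] --> 0 &
  forall n, 0 <= eta n /\ forall x, `|u (x + ep n) - u x| <= eta n.
Proof.
move=> [Lu i E].
pose m n xi := 2 * (`|cos (xi * ep n) - 1| + `|sin (xi * ep n)|) * `|hart u xi|.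
have m0 n xi : 0 <= m n xi by rewrite mulr_ge0 // mulr_ge0 // addr_ge0.
have mh := intg_m i.
have mm n : mfun1 (m n).
  apply: measurable_funM; last by apply: (measurableT_comp abs_m).
  apply: measurable_funM => //; apply: measurable_funD.
    by apply: (measurableT_comp abs_m); apply: measurable_funB => //; exact: mcos.
  by apply: (measurableT_comp abs_m); exact: msin.
have ml n xi : `|m n xi| <= 6 * `|hart u xi|.
  rewrite ger0_norm //; apply: ler_wpM2r => //.
  have c1 : `|cos (xi * ep n) - 1| <= 2.
    by rewrite ler_norml; have := cos_geN1 (xi * ep n); have := cos_le1 (xi * ep n); lra.
  have c2 : `|sin (xi * ep n)| <= 1 by rewrite ler_norml sin_geN1 sin_le1.
  lra.
have mc xi : m n xi @[n --> \oo] --> (0 : R).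
  have c : 2 * (`|xi| * ep n + `|xi| * ep n) * `|hart u xi| @[n --> \oo] --> (2 * (`|xi| * 0 + `|xi| * 0) * `|hart u xi| : R).
    apply: cvgM; last exact: cvg_cst.
    apply: cvgM; first exact: cvg_cst.
    by apply: cvgD; apply: cvgM; [exact: cvg_cst|exact: ep_cvg|exact: cvg_cst|exact: ep_cvg].
  rewrite mulr0 addr0 mulr0 mul0r in c.
  apply: (squeeze_cvgr _ (cvg_cst 0) c); apply: nearW => n; rewrite m0 /=.
  apply: ler_wpM2r => //; apply: ler_wpM2l => //.
  have e0 := ep_gt0 (R := R) n; rewrite -(gtr0_norm e0) -normrM (gtr0_norm e0).
  by apply: lerD; [exact: (cosB1_le _).1|exact: sin_le_abs].
have [im cm] := dct mm (measurable_cst (0 : R)) (ae_all mc) (intgZ 6 (intg_abs i)) ml.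
have imn n : intg (m n) := intg_dom (mm n) (intgZ 6 (intg_abs i)) (ml n).
exists (fun n => c0 * \int[mu]_xi m n xi).
  have e0 : \int[mu]_x (cst 0 x : R) = 0 by exact: I_0.
  rewrite e0 in cm; rewrite -[X in _ --> X](mulr0 (c0 : R)).
  by apply: cvgM; [exact: cvg_cst|exact: cm].
move=> n; split; first by rewrite mulr_ge0 ?I_ge0 // ltW // c0_gt0.
move=> x; rewrite E /hart1 -mulrBr normrM (gtr0_norm c0_gt0).
have i1 := int_cas (x + ep n) i; have i2 := int_cas x i.
apply: ler_wpM2l; first by rewrite ltW // c0_gt0.
rewrite -I_B //; apply: le_trans (I_abs (intgB i1 i2)) _.
apply: I_le; [exact: intg_abs (intgB i1 i2)|exact: imn|].
move=> xi; rewrite -mulrBl normrM /m; apply: ler_wpM2r => //.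
rewrite mulrDl casD.
have -> : cos (ep n * xi) * cas (x * xi) + sin (ep n * xi) * cas (- (x * xi)) - cas (x * xi) =
  (cos (xi * ep n) - 1) * cas (x * xi) + sin (xi * ep n) * cas (- (x * xi)) by rewrite (mulrC (ep n)); ring.
apply: le_trans (ler_normD _ _) _; rewrite !normrM mulrDr; apply: lerD; rewrite mulrC; apply: ler_wpM2r => //; exact: cas_le2.
Qed.

Lemma comp2_m g u v : continuous g -> spectral u -> spectral v -> mfun1 (comp2 g u v).
Proof.
by move=> cg su sv; apply: continuous_measurable_fun; apply: comp2_cont => //; exact: spectral_cont.
Qed.

Lemma spectral_nice M u : spectral u -> (forall x, `|u x| <= M) -> nice M u.
Proof. by move=> su b; have [Lu _ _] := su; split => //; exact: spectral_cont. Qed.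

(** The chain rule in L^2. Taylor's remainder divided by h is bounded by the
    sup of the increments, which tends to 0 by [spectral_unif], times the
    difference quotients, which stay bounded in L^2. *)
Lemma comp2_L2deriv g M u1 u2 v1 v2 : Csmooth g -> spectral u1 -> spectral u2 ->
  (forall x, `|u1 x| <= M) -> (forall x, `|u2 x| <= M) ->
  L2p v1 -> L2p v2 -> L2deriv u1 v1 -> L2deriv u2 v2 ->
  let w x := comp2 (fun p => 'D_(1, 0) g p) u1 u2 x * v1 x + comp2 (fun p => 'D_(0, 1) g p) u1 u2 x * v2 x in
  L2p w /\ L2deriv (fun x => comp2 g u1 u2 x - g (0, 0)) w.
Proof.
move=> sg s1 s2 b1 b2 Lv1 Lv2 d1 d2 w.
have [Lu1 _ _] := s1; have [Lu2 _ _] := s2.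
set g1 := fun p => 'D_(1, 0) g p; set g2 := fun p => 'D_(0, 1) g p.
have sg1 := Csmooth_d1 sg; have sg2 := Csmooth_d2 sg; rewrite -/g1 in sg1; rewrite -/g2 in sg2.
have gg : grad g g1 g2 := Csmooth_grad sg.
have [B1 B10 hB1] := cont_bd M (Csmooth_cont sg1).
have [B2 B20 hB2] := cont_bd M (Csmooth_cont sg2).
have [K K0 hK] := taylor2 gg (Csmooth_loclip sg1) (Csmooth_loclip sg2) M.
have bx x : box2 M (u1 x, u2 x) by split; [exact: b1|exact: b2].
have m1 := comp2_m (Csmooth_cont sg1) s1 s2; have m2 := comp2_m (Csmooth_cont sg2) s1 s2.
have k1 x : `|comp2 g1 u1 u2 x| <= B1 := hB1 _ (bx x).
have k2 x : `|comp2 g2 u1 u2 x| <= B2 := hB2 _ (bx x).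
have Lw : L2p w by apply: L2_D; [exact: (L2_bdd m1 Lv1 k1)|exact: (L2_bdd m2 Lv2 k2)].
split => //.
have Lf := comp2_L2 (Csmooth_loclip sg) (Csmooth_cont sg) (spectral_nice s1 b1) (spectral_nice s2 b2).
apply: L2deriv_of_diff_quot => //.
have [e1 ce1 he1] := spectral_unif s1; have [e2 ce2 he2] := spectral_unif s2.
have c1 := L2deriv_diff_quot Lu1 Lv1 d1; have c2 := L2deriv_diff_quot Lu2 Lv2 d2.
pose a1 n := nm (fun x => diff_quot (ep n) u1 x - v1 x); pose a2 n := nm (fun x => diff_quot (ep n) u2 x - v2 x).
have C : K * (e1 n + e2 n) * ((nm v1 + a1 n) + (nm v2 + a2 n)) + (B1 * a1 n + B2 * a2 n) @[n --> \oo] -->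
   K * (0 + 0) * ((nm v1 + 0) + (nm v2 + 0)) + (B1 * 0 + B2 * 0).
  apply: cvgD; last by apply: cvgD; apply: cvgM => //; exact: cvg_cst.
  apply: cvgM; last by apply: cvgD; apply: cvgD => //; exact: cvg_cst.
  by apply: cvgM; [exact: cvg_cst|exact: cvgD].
rewrite addr0 !mulr0 mul0r !addr0 in C.
apply: (squeeze_cvgr _ (cvg_cst 0) C); apply: nearW => n; rewrite nm_ge0 /=.
have h0 := ep_gt0 (R := R) n; set h := ep n in h0 *.
have [p1 q1] := he1 n; have [p2 q2] := he2 n.
have LD1 := L2_B (diff_quot_L2 h Lu1) Lv1; have LD2 := L2_B (diff_quot_L2 h Lu2) Lv2.
pose f x := comp2 g u1 u2 x - g (0, 0).
pose rem x := h^-1 * (comp2 g u1 u2 (x + h) - comp2 g u1 u2 x -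
  (comp2 g1 u1 u2 x * (u1 (x + h) - u1 x) + comp2 g2 u1 u2 x * (u2 (x + h) - u2 x))).
have E x : diff_quot h f x - w x = rem x + (comp2 g1 u1 u2 x * (diff_quot h u1 x - v1 x) + comp2 g2 u1 u2 x * (diff_quot h u2 x - v2 x)).
  have -> : w x = comp2 g1 u1 u2 x * v1 x + comp2 g2 u1 u2 x * v2 x by [].
  rewrite /diff_quot /f /rem.
  move: (comp2 g u1 u2 (x + h)) (comp2 g u1 u2 x) (comp2 g1 u1 u2 x) (comp2 g2 u1 u2 x).
  move: (u1 (x + h)) (u1 x) (u2 (x + h)) (u2 x) (v1 x) (v2 x) (g _) h^-1 => *; ring.
have Lz := L2_D (L2_bdd m1 LD1 k1) (L2_bdd m2 LD2 k2).
have Ldf := L2_B (diff_quot_L2 h Lf) Lw.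
have Er : rem = (fun x => (diff_quot h f x - w x) - (comp2 g1 u1 u2 x * (diff_quot h u1 x - v1 x) + comp2 g2 u1 u2 x * (diff_quot h u2 x - v2 x))).
  by apply/funext => x; rewrite E addrK.
have mrem : mfun1 rem by rewrite Er; exact: L2_m (L2_B Ldf Lz).
have Ke : 0 <= K * (e1 n + e2 n) by rewrite mulr_ge0 // addr_ge0.
have scale (z a b : R) : `|z| <= K * (`|a| + `|b|) ^+ 2 -> `|a| <= e1 n -> `|b| <= e2 n ->
    `|h^-1 * z| <= K * (e1 n + e2 n) * (`|h^-1 * a| + `|h^-1 * b|).
  move=> H qa qb; rewrite !normrM normfV (gtr0_norm h0) -mulrDr mulrCA; apply: ler_wpM2l.
    by rewrite invr_ge0 ltW.
  apply: le_trans H _; rewrite expr2 mulrA; apply: ler_wpM2r; first by rewrite addr_ge0.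
  by apply: ler_wpM2l => //; exact: lerD.
have hr x : `|rem x| <= K * (e1 n + e2 n) * (`|diff_quot h u1 x| + `|diff_quot h u2 x|).
  apply: scale; [exact: (hK _ _ (bx x) (bx (x + h)))|exact: q1|exact: q2].
have [Lrem nrem] := nm_dom2 Ke mrem (diff_quot_L2 h Lu1) (diff_quot_L2 h Lu2) hr.
rewrite (_ : (fun x => _) = (fun x => rem x + (comp2 g1 u1 u2 x * (diff_quot h u1 x - v1 x) + comp2 g2 u1 u2 x * (diff_quot h u2 x - v2 x)))); last first.
  by apply/funext => x; rewrite -E.
apply: le_trans (nmD Lrem Lz) _; apply: lerD.
  apply: le_trans nrem _; apply: ler_wpM2l => //.
  have T (u v : R -> R) : L2p u -> L2p v -> nm (diff_quot h u) <= nm v + nm (fun x => diff_quot h u x - v x).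
    move=> Lu Lv; have := nmD Lv (L2_B (diff_quot_L2 h Lu) Lv).
    by rewrite (_ : (fun x => v x + _) = diff_quot h u) //; apply/funext => x; ring.
  by apply: lerD; exact: T.
apply: le_trans (nmD (L2_bdd m1 LD1 k1) (L2_bdd m2 LD2 k2)) _.
have T (B : R) (m z : R -> R) : 0 <= B -> mfun1 m -> (forall x, `|m x| <= B) -> L2p z -> nm (fun x => m x * z x) <= B * nm z.
  move=> B0' mm hm Lz'; apply: (L2_bddr (L2_m (L2_bdd mm Lz' hm)) Lz' _).2 => x.
  by rewrite normrM ler_wpM2r.
by apply: lerD; apply: T.
Qed.

(** Composition is bounded in H^j on sets of functions that are bounded both
    in H^j and in the sup norm. The smooth map is quantified inside, so that
    an induction on j can be applied to its partial derivatives. *)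
Definition comp_bounded (j : nat) := forall g, Csmooth g -> forall M K, exists K', forall u1 u2, spectral u1 -> spectral u2 ->
  (forall x, `|u1 x| <= M) -> (forall x, `|u2 x| <= M) ->
  HsR j%:R u1 -> HsR j%:R u2 -> hnm j%:R u1 <= K -> hnm j%:R u2 <= K ->
  HsR j%:R (fun x => comp2 g u1 u2 x - g (0, 0)) /\ hnm j%:R (fun x => comp2 g u1 u2 x - g (0, 0)) <= K'.

Lemma hnm_ge0 s u : 0 <= hnm s u. Proof. exact: nm_ge0. Qed.

(** The product is composition with the smooth map p.1 * p.2, so it inherits
    the bound from [comp_bounded]. For j = 0 only the sup norm of [f] is
    available, for j > 0 both factors are bounded through the Sobolev
    embedding. *)
Lemma prod_bounded j : comp_bounded j -> forall M K, exists K', forall f v, mfun1 f -> (forall x, `|f x| <= M) ->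
  HsR j%:R f -> HsR j%:R v -> hnm j%:R f <= K -> hnm j%:R v <= K ->
  HsR j%:R (fun x => f x * v x) /\ hnm j%:R (fun x => f x * v x) <= K'.
Proof.
move=> Sj M K; case: j Sj => [|j] Sj.
  exists (M * K) => f v mf bf _ [Lv _] _ nv.
  have L := L2_bdd mf Lv bf; have [H ->] := HsR0 L; split => //.
  have [_ e] := HsR0 Lv; rewrite e in nv.
  have M0 : 0 <= M := le_trans (normr_ge0 _) (bf 0).
  apply: le_trans (ler_wpM2l M0 nv); apply: (L2_bddr (L2_m L) Lv _).2 => x.
  by rewrite normrM ler_wpM2r.
have hs : 2^-1 < (1 : R) by rewrite invf_lt1 // ltr1n.
have j1 : (1 : R) <= j.+1%:R by rewrite ler1n.
(* The constant of the embedding of H^1 in bounded functions. *)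
pose C : R := 2 * c0 * nm (@jw R (- (1 / 2))).
have C0 : 0 <= C by rewrite mulr_ge0 ?nm_ge0 // mulr_ge0 // ltW // c0_gt0.
have [K' hK'] := Sj _ Csmooth_prod (C * K) K.
exists K' => f v mf bf Hf Hv nf nv.
have G u : HsR j.+1%:R u -> hnm j.+1%:R u <= K ->
  [/\ aeq (cont_repr u) u, spectral (cont_repr u), forall x, `|cont_repr u x| <= C * K, HsR j.+1%:R (cont_repr u) & hnm j.+1%:R (cont_repr u) <= K].
  move=> Hu nu; have [H1 n1] := HsR_mono j1 Hu.
  have [e c L b] := cont_repr_spec hs H1.
  have [H' n'] := HsR_ae Hu L (aeq_sym e).
  split => //; [exact: spectral_repr hs H1| |by rewrite n'].
  move=> x; apply: le_trans (b x) _; rewrite mulrA; apply: ler_wpM2l => //.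
  exact: le_trans n1 nu.
have [ef sf bf' Hf' nf'] := G f Hf nf; have [ev sv bv' Hv' nv'] := G v Hv nv.
have [H n] := hK' _ _ sf sv bf' bv' Hf' Hv' nf' nv'.
have Lfv : L2p (fun x => f x * v x) by have [Lv _] := Hv; exact: (L2_bdd mf Lv bf).
have e : aeq (fun x => comp2 (fun p : R * R => p.1 * p.2) (cont_repr f) (cont_repr v) x - ((0 : R), (0 : R)).1 * ((0 : R), (0 : R)).2) (fun x => f x * v x).
  by apply: (ae_imp2 _ ef ev) => x; rewrite /comp2 /= mulr0 subr0 => -> ->.
by have [H2 ->] := HsR_ae H Lfv e.
Qed.

(** By the chain rule the derivative of g (u1, u2) is the sum of the products
    of the partial derivatives of g along (u1, u2) with u1' and u2'. The
    induction hypothesis bounds the former in H^j after subtraction of their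
    values at the origin, and the products by [prod_bounded]. *)
Theorem comp_boundedP j : comp_bounded j.
Proof.
elim: j => [|j IH] g sg M K.
  have [L L0 hL] := Csmooth_loclip sg M.
  exists (L * (K + K)) => u1 u2 s1 s2 b1 b2 [Lu1 _] [Lu2 _].
  have [_ ->] := HsR0 Lu1; have [_ ->] := HsR0 Lu2 => n1 n2.
  have M0 : 0 <= M := le_trans (normr_ge0 _) (b1 0).
  have N0 : nice M (fun=> 0) by split; [exact: L2_0|exact: cst_continuous|move=> x; rewrite normr0].
  have [La na] := comp2_lip L0 (Csmooth_cont sg) hL N0 N0 (spectral_nice s1 b1) (spectral_nice s2 b2).
  have [H ->] := HsR0 La; split => //; apply: le_trans na _; apply: ler_wpM2l => //.
  by apply: lerD; under eq_fun do rewrite subr0.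
set g1 := fun p => 'D_(1, 0) g p; set g2 := fun p => 'D_(0, 1) g p.
have sg1 : Csmooth g1 := Csmooth_d1 sg; have sg2 : Csmooth g2 := Csmooth_d2 sg.
have [Ka hKa] := IH g sg M K; have [Kb hKb] := IH g1 sg1 M K; have [Kc hKc] := IH g2 sg2 M K.
have [B1 B10 hB1] := cont_bd M (Csmooth_cont sg1).
have [B2 B20 hB2] := cont_bd M (Csmooth_cont sg2).
pose Q := Num.max K (Num.max Kb Kc); pose B := Num.max (B1 + `|g1 (0, 0)|) (B2 + `|g2 (0, 0)|).
have [P hP] := prod_bounded IH B Q.
(* The shape of the bound follows the decomposition Ew of the derivative. *)
exists (Ka + (`|g1 (0, 0)| * K + (1 * P + (`|g2 (0, 0)| * K + P)))) => u1 u2 s1 s2 b1 b2.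
rewrite -!natr1 => Hu1 Hu2 n1 n2.
have j0 : (0 : R) <= j%:R by [].
have jj : j%:R <= j%:R + 1 :> R by rewrite lerDl.
have [Hj1 m1] := HsR_mono jj Hu1; have [Hj2 m2] := HsR_mono jj Hu2.
have m1' := le_trans m1 n1; have m2' := le_trans m2 n2.
have [v1 [d1 Hv1 nv1]] := HsR_deriv_ex j0 Hu1; have [v2 [d2 Hv2 nv2]] := HsR_deriv_ex j0 Hu2.
have nv1' := le_trans nv1 n1; have nv2' := le_trans nv2 n2.
have [Lv1 _] := Hv1; have [Lv2 _] := Hv2.
have [Lw dw] := comp2_L2deriv sg s1 s2 b1 b2 Lv1 Lv2 d1 d2.
have [Ha na] := hKa _ _ s1 s2 b1 b2 Hj1 Hj2 m1' m2'.
have [Hb nb] := hKb _ _ s1 s2 b1 b2 Hj1 Hj2 m1' m2'.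
have [Hc nc] := hKc _ _ s1 s2 b1 b2 Hj1 Hj2 m1' m2'.
have bx x : box2 M (u1 x, u2 x) by split; [exact: b1|exact: b2].
have bb x : `|comp2 g1 u1 u2 x - g1 (0, 0)| <= B.
  apply: le_trans (ler_normB _ _) _; rewrite le_max; apply/orP; left; rewrite lerD2r; exact: (hB1 _ (bx x)).
have bc x : `|comp2 g2 u1 u2 x - g2 (0, 0)| <= B.
  apply: le_trans (ler_normB _ _) _; rewrite le_max; apply/orP; right; rewrite lerD2r; exact: (hB2 _ (bx x)).
have mb : mfun1 (fun x => comp2 g1 u1 u2 x - g1 (0, 0)).
  by apply: measurable_funB => //; exact: (comp2_m (Csmooth_cont sg1) s1 s2).
have mc : mfun1 (fun x => comp2 g2 u1 u2 x - g2 (0, 0)).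
  by apply: measurable_funB => //; exact: (comp2_m (Csmooth_cont sg2) s1 s2).
have qK : K <= Q by rewrite le_max lexx.
have qb : Kb <= Q by rewrite !le_max lexx orbT.
have qc : Kc <= Q by rewrite !le_max lexx !orbT.
have [Hp1 np1] := hP _ _ mb bb Hb Hv1 (le_trans nb qb) (le_trans nv1' qK).
have [Hp2 np2] := hP _ _ mc bc Hc Hv2 (le_trans nc qc) (le_trans nv2' qK).
have [H3 n3] := HsR_lin (g2 (0, 0)) Hv2 Hp2.
have [H4 n4] := HsR_lin 1 Hp1 H3.
have [H5 n5] := HsR_lin (g1 (0, 0)) Hv1 H4.
have Ew : (fun x => g1 (0, 0) * v1 x + (1 * ((comp2 g1 u1 u2 x - g1 (0, 0)) * v1 x) + (g2 (0, 0) * v2 x + (comp2 g2 u1 u2 x - g2 (0, 0)) * v2 x))) =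
  (fun x => comp2 g1 u1 u2 x * v1 x + comp2 g2 u1 u2 x * v2 x).
  have dist (a b c d a0 b0 : R) :
    a0 * c + (1 * ((a - a0) * c) + (b0 * d + (b - b0) * d)) = a * c + b * d by ring.
  by apply/funext => x; exact: dist.
rewrite Ew in H5 n5.
have [H6 n6] := HsR_of_deriv dw Ha H5.
split => //; apply: le_trans n6 _; apply: lerD => //.
apply: le_trans n5 _; apply: lerD; first by apply: ler_wpM2l.
apply: le_trans n4 _; rewrite normr1; apply: lerD; first by apply: ler_wpM2l.
by apply: le_trans n3 _; apply: lerD => //; apply: ler_wpM2l.
Qed.

End Composition.

(** * Curves in Sobolev spaces *)

Section Truncated.
Context {R : realType}.
Local Notation mu := (@lebesgue_measure R).
Implicit Types (f u v w : R -> R) (h s xi M K : R).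

Lemma jw_le_box a (n xi : R) : 0 <= a -> 0 <= n -> `|box n xi * jw a xi| <= jw a n.
Proof.
move=> a0 n0; rewrite boxE; case: (leP `|xi| n) => h; last by rewrite mul0r normr0 jw_ge0.
rewrite mul1r ger0_norm ?jw_ge0 //; apply: ge0_ler_powR => //; rewrite ?nnegrE ?(ltW (oneDsq_gt0 _)) //.
by rewrite lerD2l -(@real_normK _ xi) ?num_real // ler_pXn2r ?nnegrE.
Qed.

Definition tr_spec s (n : nat) f xi : R := box n%:R xi * (jw (s / 2) xi * hart f xi).
(** The H^s norm restricted to frequencies at most n: a seminorm on all of L^2
    that is dominated by a multiple of the L^2 norm, so that derivatives in
    L^2 are derivatives for it. *)
Definition tr_norm s n f : R := nm (tr_spec s n f).

Lemma tr_spec_L2 s n f : 0 <= s -> L2p f -> L2p (tr_spec s n f) /\ tr_norm s n f <= jw (s / 2) n%:R * nm f.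
Proof.
move=> s0 Lf; have Lh := hart_L2 Lf.
have m : mfun1 (tr_spec s n f).
  by apply: measurable_funM; [exact: box_m|apply: measurable_funM; [exact: jw_m|exact: L2_m]].
have h xi : `|tr_spec s n f xi| <= jw (s / 2) n%:R * `|hart f xi|.
  rewrite /tr_spec mulrA normrM; apply: ler_wpM2r => //; apply: jw_le_box => //.
  by rewrite divr_ge0.
by have := L2_bddr m Lh h; rewrite hart_iso.
Qed.

Lemma tr_specD s n a f g : L2p f -> L2p g -> aeq (tr_spec s n (fun x => a * f x + g x)) (fun xi => a * tr_spec s n f xi + tr_spec s n g xi).
Proof. by move=> Lf Lg; apply: ae_imp (hart_lin a Lf Lg) => xi e; rewrite /tr_spec e; ring. Qed.

Lemma tr_norm_lin s n a f g : 0 <= s -> L2p f -> L2p g -> tr_norm s n (fun x => a * f x + g x) <= `|a| * tr_norm s n f + tr_norm s n g.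
Proof.
move=> s0 Lf Lg; have [L1 _] := tr_spec_L2 n s0 Lf; have [L2 _] := tr_spec_L2 n s0 Lg.
have [L3 _] := tr_spec_L2 n s0 (L2_D (L2_Z a Lf) Lg).
rewrite /tr_norm (nm_ae (L2_m L3) (L2_m (L2_D (L2_Z a L1) L2)) (tr_specD s n a Lf Lg)).
by apply: le_trans (nmD (L2_Z a L1) L2) _; rewrite nmZ.
Qed.

Lemma tr_norm_seminorm s n : 0 <= s -> seminorm_on L2p (tr_norm s n).
Proof.
move=> s0; have SN := @L2_seminorm R; split.
- exact: (sn0 SN).
- exact: (snL SN).
- by move=> u _; exact: nm_ge0.
- move=> u v Lu Lv; have := tr_norm_lin n 1 s0 Lu Lv.
  by rewrite normr1 mul1r; under [X in tr_norm _ _ X]eq_fun do rewrite mul1r.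
- move=> a u Lu; have [L1 _] := tr_spec_L2 n s0 Lu; rewrite /tr_norm -nmZ //.
  have Lz := L2_Z a Lu; have [L3 _] := tr_spec_L2 n s0 Lz.
  apply: nm_ae; [exact: L2_m L3|exact: L2_m (L2_Z a L1)|].
  by apply: ae_imp (hartZ a Lu) => xi e; rewrite /tr_spec e; ring.
Qed.

Lemma tr_norm_le s n f : HsR s f -> tr_norm s n f <= hnm s f.
Proof.
move=> [Lf Lw]; apply: nm_dom => //.
  by apply: measurable_funM; [exact: box_m|exact: L2_m].
by move=> xi; rewrite /tr_spec normrM -[leRHS]mul1r; apply: ler_wpM2r => //; exact: box_le1.
Qed.

(** Fatou's lemma as the truncation is removed. *)
Lemma tr_norm_sup s f C : 0 <= s -> 0 <= C -> L2p f -> (forall n, tr_norm s n f <= C) -> HsR s f /\ hnm s f <= C.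
Proof.
move=> s0 C0 Lf h; have m : mfun1 (fun xi => jw (s / 2) xi * hart f xi).
  exact: measurable_funM (jw_m _) (L2_m (hart_L2 Lf)).
have [|L n] := L2_trunc_le (fun n => (tr_spec_L2 n s0 Lf).1) m C0 _ h; last by split.
apply: ae_all => xi; rewrite -[X in _ --> X]mul1r; apply: cvgM; [exact: box_cvg|exact: cvg_cst].
Qed.

(** The mean value inequality for each truncated norm, whose bound does not
    depend on the truncation. It shows that the increment belongs to H^s while
    the curve itself need not. *)
Lemma Hs_mean_value s (a b C : R) (U W : R -> R -> R) : 0 <= s -> a <= b -> 0 <= C ->
  (forall t, a <= t <= b -> L2p (U t)) -> has_deriv nm `[a, b] U W ->
  (forall t, a <= t <= b -> HsR s (W t) /\ hnm s (W t) <= C) ->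
  HsR s (fun x => U b x - U a x) /\ hnm s (fun x => U b x - U a x) <= C * (b - a).
Proof.
move=> s0 ab C0 LU hd hW.
have LUa : L2p (U a) by apply: LU; rewrite lexx.
have LUb : L2p (U b) by apply: LU; rewrite lexx andbT.
apply: tr_norm_sup => //; [by rewrite mulr_ge0 // subr_ge0|exact: L2_B|].
move=> n.
apply: (deriv_mean_value (tr_norm_seminorm n s0) ab LU (w := W)) => //.
- by move=> t /hW[[]].
- move=> t It e e0; pose J := jw (s / 2) (n%:R : R).
  have J0 : 0 < J := jw_gt0 _ _.
  have [d d0 h1] := hd t It (e / J) (divr_gt0 e0 J0).
  exists d => // h hh Ih.
  have LD : L2p (U (t + h) - U t - h *: W t).
    have SN := @L2_seminorm R; apply: (snDB SN); last by apply: (snDZ SN); have [[]] := hW t It.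
    by apply: (snDB SN); apply: LU.
  apply: le_trans (tr_spec_L2 n s0 LD).2 _.
  apply: le_trans (ler_wpM2l (ltW J0) (h1 h hh Ih)) _.
  by rewrite -/J mulrA (mulrC J) divfK ?gt_eqF.
- by move=> t It; have [H n'] := hW t It; exact: le_trans (tr_norm_le n H) n'.
Qed.

Lemma has_deriv_sub_lin (I : set R) (U W : R -> R -> R) (w : R -> R) :
  has_deriv nm I U W -> has_deriv nm I (fun t x => U t x - t * w x) (fun t x => W t x - w x).
Proof.
move=> hd t It e e0; have [d d0 h1] := hd t It e e0; exists d => // h hh Ih.
have := h1 h hh Ih; congr (nm _ <= _); apply/funext => x.
rewrite !(addrfctE, opprfctE, scalrfctE) /GRing.scale /=; ring.
Qed.

Lemma hnmZ s a u : HsR s u -> HsR s (fun x => a * u x) /\ hnm s (fun x => a * u x) = `|a| * hnm s u.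
Proof.
move=> [Lu Wu]; have Lz := L2_Z a Lu; have LW := L2_Z a Wu.
have m : mfun1 (fun xi => jw (s / 2) xi * hart (fun x => a * u x) xi).
  exact: measurable_funM (jw_m _) (L2_m (hart_L2 Lz)).
have e : aeq (fun xi => a * (jw (s / 2) xi * hart u xi)) (fun xi => jw (s / 2) xi * hart (fun x => a * u x) xi).
  by apply: ae_imp (hartZ a Lu) => xi ->; ring.
split; first by split => //; exact: L2_ae LW m e.
by rewrite /hnm -(nm_ae (L2_m LW) m e) nmZ.
Qed.

Definition contH s (I : set R) (W : R -> R -> R) := forall t, I t -> forall e : R, 0 < e ->
  exists2 d, 0 < d & forall t', I t' -> `|t' - t| < d -> hnm s (fun x => W t' x - W t x) <= e.

Let I0 : set R := [set t | 0 <= t].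

Lemma sub_itv_I0 a b : 0 <= a -> `[a, b]%classic `<=` I0.
Proof. by move=> a0 t /=; rewrite in_itv /= => /andP[h _]; exact: le_trans a0 h. Qed.

(** The mean value inequality for the curve U - t W (t0), whose derivative is
    small near t0. *)
Lemma Hs_derivable s (U W : R -> R -> R) : 0 <= s -> (forall t, L2p (U t)) -> has_deriv nm I0 U W ->
  (forall t, I0 t -> HsR s (W t)) -> contH s I0 W ->
  forall t, I0 t -> forall e : R, 0 < e -> exists2 d, 0 < d & forall h, `|h| < d -> I0 (t + h) ->
    HsR s (fun x => U (t + h) x - U t x - h * W t x) /\ hnm s (fun x => U (t + h) x - U t x - h * W t x) <= e * `|h|.
Proof.
move=> s0 LU hd HW cW t t0 e e0; have [d d0 h1] := cW t t0 e e0; exists d => // h hh th0.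
have [LWt _] := HW t t0.
have key a b : 0 <= a -> a <= b -> `|a - t| < d -> `|b - t| < d ->
  HsR s (fun x => (U b x - b * W t x) - (U a x - a * W t x)) /\
  hnm s (fun x => (U b x - b * W t x) - (U a x - a * W t x)) <= e * (b - a).
  move=> a0 ab ha hb.
  apply: (Hs_mean_value (U := fun t' x => U t' x - t' * W t x) (W := fun t' x => W t' x - W t x)) => //.
  - exact: ltW.
  - by move=> t' _; apply: L2_B => //; exact: L2_Z.
  - exact: has_deriv_sub_lin (has_deriv_restr (@sub_itv_I0 a b a0) hd).
  - move=> t' /andP[at' t'b]; have t'0 : 0 <= t' := le_trans a0 at'.
    split; first by have [] := HsR_B (HW t' t'0) (HW t t0).
    apply: h1 => //; move: ha hb; rewrite !ltr_norml => /andP[? ?] /andP[? ?]; apply/andP; split; lra.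
have d0' : `|t - t| < d by rewrite subrr normr0.
have dh : `|t + h - t| < d by rewrite addrAC subrr add0r.
have [hp|hn] := leP 0 h.
- have [] := key t (t + h) t0 _ d0' dh; first by rewrite lerDl.
  have -> : (fun x => (U (t + h) x - (t + h) * W t x) - (U t x - t * W t x)) = (fun x => U (t + h) x - U t x - h * W t x).
    by apply/funext => x; ring.
  by rewrite (_ : t + h - t = h) ?ger0_norm // addrAC subrr add0r.
- have [] := key (t + h) t th0 _ dh d0'; first by rewrite gerDl ltW.
  move=> H1 H2; have [H3 n3] := hnmZ (-1) H1.
  have E : (fun x => -1 * ((U t x - t * W t x) - (U (t + h) x - (t + h) * W t x))) = (fun x => U (t + h) x - U t x - h * W t x).
    by apply/funext => x; ring.
  rewrite E in H3 n3; split => //; rewrite n3 normrN normr1 mul1r ltr0_norm //.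
  by apply: le_trans H2 _; rewrite opprD addrA subrr add0r.
Qed.

Lemma lip_contH s (W : R -> R -> R) : (forall T, exists2 C, 0 <= C & forall a b, 0 <= a -> a <= b -> b <= T ->
    HsR s (fun x => W b x - W a x) /\ hnm s (fun x => W b x - W a x) <= C * (b - a)) -> contH s I0 W.
Proof.
move=> hl t t0 e e0; have [C C0 hC] := hl (t + 1).
exists (Num.min 1 (e / (C + 1))); first by rewrite lt_min ltr01 divr_gt0 // ltr_wpDl.
move=> t' t'0; rewrite lt_min => /andP[h1 h2].
have C1 : 0 < C + 1 by rewrite ltr_wpDl.
move: (ltW h2); rewrite ler_pdivlMr // => h3.
have h4 : C * `|t' - t| <= e by have := normr_ge0 (t' - t); move: h3; rewrite mulrDr mulr1 mulrC; lra.
move: h1; rewrite ltr_norml => /andP[a1 a2].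
have [tt|tt] := leP t t'.
  have [|_ n] := hC t t' t0 tt; first lra.
  apply: le_trans n _.
  by move: h4; rewrite ger0_norm ?subr_ge0.
have [|H n] := hC t' t t'0 (ltW tt); first lra.
have [_] := hnmZ (-1) H; rewrite normrN normr1 mul1r.
rewrite (_ : (fun x => -1 * _) = (fun x => W t' x - W t x)) => [->|]; last by apply/funext => x; ring.
by apply: le_trans n _; move: h4; rewrite ltr0_norm ?subr_lt0 // opprB.
Qed.

(** Below a frequency y the H^s norm is bounded by a multiple of the L^2 norm,
    above it by y^(s-m) times the H^m norm. *)
Lemma interpolation s m C e : s < m -> 0 <= s -> 0 <= C -> 0 < e -> exists2 d, 0 < d &
  forall f, HsR m f -> hnm m f <= C -> nm f <= d -> hnm s f <= e.
Proof.
move=> sm s0 C0 e0.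
pose th := (m - s) / 2; have th0 : 0 < th by rewrite divr_gt0 // subr_gt0.
(* The cutoff frequency, chosen such that y^(- th) = e / (2 (C + 1)). *)
pose y := (e / (2 * (C + 1))) `^ (- th^-1).
have C1 : 0 < C + 1 by rewrite ltr_wpDl.
have z0 : 0 < e / (2 * (C + 1)) by rewrite divr_gt0 // mulr_gt0.
have y0 : 0 < y by exact: powR_gt0.
have hy : jw (- th) y <= e / (2 * (C + 1)).
  have -> : e / (2 * (C + 1)) = y `^ (- th).
    by rewrite /y -powRrM mulrNN mulVf ?gt_eqF // powRr1 // ltW.
  rewrite /jw !powRN lef_pV2 ?posrE ?powR_gt0 ?oneDsq_gt0 //.
  apply: ge0_ler_powR; rewrite ?nnegrE ?(ltW th0) ?(ltW y0) ?(ltW (oneDsq_gt0 y)) //.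
  have := sqr_ge0 (y - 1); nra.
exists (e / (2 * jw (s / 2) y)); first by rewrite divr_gt0 // mulr_gt0 // jw_gt0.
move=> f [Lf Lm] nf nd.
have Lh := hart_L2 Lf.
have ms : mfun1 (fun xi => jw (s / 2) xi * hart f xi) by exact: measurable_funM (jw_m _) (L2_m Lh).
have J0 := jw_gt0 (s / 2) y.
have hp xi : `|jw (s / 2) xi * hart f xi| <= 1 * (`|jw (s / 2) y * hart f xi| + `|jw (- th) y * (jw (m / 2) xi * hart f xi)|).
  rewrite mul1r; have [xy|xy] := leP `|xi| y.
    apply: (@le_trans _ _ `|jw (s / 2) y * hart f xi|); last by rewrite lerDl.
    rewrite !normrM; apply: ler_wpM2r => //; rewrite !ger0_norm ?jw_ge0 //.
    apply: ge0_ler_powR; rewrite ?nnegrE ?divr_ge0 ?(ltW (oneDsq_gt0 _)) //.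
    by rewrite lerD2l -(@real_normK _ xi) ?num_real // ler_pXn2r ?nnegrE // ltW.
  apply: (@le_trans _ _ `|jw (- th) y * (jw (m / 2) xi * hart f xi)|); last by rewrite lerDr.
  rewrite mulrA !normrM; apply: ler_wpM2r => //; rewrite !ger0_norm ?jw_ge0 //.
  have -> : s / 2 = - th + m / 2 by rewrite /th; field.
  rewrite jwD; apply: ler_wpM2r; first exact: jw_ge0.
  rewrite /jw !powRN lef_pV2 ?posrE ?powR_gt0 ?oneDsq_gt0 //.
  apply: ge0_ler_powR; rewrite ?nnegrE ?(ltW th0) ?(ltW (oneDsq_gt0 _)) //.
  by rewrite lerD2l -(@real_normK _ xi) ?num_real // ler_pXn2r ?nnegrE // ltW.
have [_ n] := nm_dom2 ler01 ms (L2_Z (jw (s / 2) y) Lh) (L2_Z (jw (- th) y) Lm) hp.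
apply: le_trans n _; rewrite mul1r !nmZ // hart_iso // !gtr0_norm ?jw_gt0 //.
have t1 : jw (s / 2) y * nm f <= e / 2.
  move: nd; rewrite ler_pdivlMr ?mulr_gt0 // ler_pdivlMr //.
  by rewrite (_ : nm f * (2 * jw (s / 2) y) = jw (s / 2) y * nm f * 2) //; ring.
have t2 : jw (- th) y * hnm m f <= e / 2.
  apply: le_trans (ler_wpM2r (nm_ge0 _) hy) _.
  apply: le_trans (ler_wpM2l (ltW z0) nf) _.
  rewrite mulrAC ler_pdivrMr ?mulr_gt0 //; move: e0 C0; clear; nra.
rewrite [e]splitr; exact: lerD.
Qed.

End Truncated.

(** * Regularity of the solution *)

Section Component.
Context {R : realType}.
Variables (b : R -> R) (K s : R) (u v w : R -> R -> R).
Hypotheses (Sb : symb b K) (s0 : 0 <= s).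
Let I0 : set R := [set t | 0 <= t].
(** - B^2 w, with the sign placed as the equation for p produces it. *)
Definition accel b w (t : R) : R -> R := Bop b (fun x => - Bop b (w t) x) : R -> R.
Hypotheses (Lu : forall t, L2p (u t)) (Lv : forall t, L2p (v t)) (Lw : forall t, L2p (w t)).
Hypotheses (du : has_deriv nm I0 u v) (dv : has_deriv nm I0 v (accel b w)).
Hypotheses (u0 : HsR s (u 0)) (v0 : HsR s (v 0)).

Let K0 : 0 <= K := symb_K Sb.

(** Two applications of the gain of half a derivative. *)
Lemma BB_hnm sg f : HsR (sg - 1) f -> HsR sg (Bop b (fun x => - Bop b f x)) /\
  hnm sg (Bop b (fun x => - Bop b f x)) <= K * (K * hnm (sg - 1) f).
Proof.
move=> Hf; have [H1 n1] := Bop_hnm Sb Hf.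
have [H2 n2] := hnmZ (-1) H1.
have E : (fun x => -1 * Bop b f x) = (fun x => - Bop b f x) by apply/funext => x; rewrite mulN1r.
rewrite E normrN normr1 mul1r in H2 n2.
have [H3 n3] := Bop_hnm Sb H2.
have es : sg - 1 + 2^-1 + 2^-1 = sg by field.
rewrite es in H3 n3; split => //; apply: le_trans n3 _; apply: ler_wpM2l => //.
by rewrite n2.
Qed.

Lemma accelB t t' : (fun x => accel b w t' x - accel b w t x) = Bop b (fun x => - Bop b (fun y => w t' y - w t y) x).
Proof.
have L1 := Bop_L2 Sb (Lw t'); have L2 := Bop_L2 Sb (Lw t).
apply/funext => x; rewrite /accel -(BopB x Sb (L2_N L1) (L2_N L2)); congr (Bop b _ x).
apply/funext => y; rewrite (BopB y Sb (Lw t') (Lw t)); by rewrite opprB opprK addrC.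
Qed.

Definition bddH (sg T : R) (z : R -> R -> R) := exists2 C, 0 <= C & forall t, 0 <= t <= T -> HsR sg (z t) /\ hnm sg (z t) <= C.

Lemma bddH_primitive sg T (y z : R -> R -> R) : 0 <= sg -> (forall t, L2p (y t)) -> has_deriv nm I0 y z ->
  HsR sg (y 0) -> bddH sg T z -> bddH sg T y.
Proof.
move=> sg0 Ly dy y0 [C C0 hC]; exists (hnm sg (y 0) + C * `|T|); first by rewrite addr_ge0 ?hnm_ge0 ?mulr_ge0.
move=> t /andP[t0 tT].
have [|H n] := Hs_mean_value sg0 t0 C0 (fun t _ => Ly t) (has_deriv_restr (@sub_itv_I0 R 0 t (lexx 0)) dy).
  by move=> t' /andP[a b']; apply: hC; rewrite a (le_trans b').
have [H1 n1] := HsR_lin 1 H y0.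
have E : (fun x => 1 * (y t x - y 0 x) + y 0 x) = y t by apply/funext => x; ring.
rewrite E normr1 mul1r in H1 n1; split => //.
apply: le_trans n1 _; rewrite addrC lerD2l; apply: le_trans n _.
apply: ler_wpM2l => //; rewrite subr0; exact: le_trans tT (ler_norm T).
Qed.

(** The acceleration gains one derivative over [w]; velocity and displacement
    are its successive primitives, and inherit its regularity up to that of
    the initial data. *)
Lemma lift_regularity sg T : 0 <= sg -> sg <= s -> bddH (sg - 1) T w ->
  [/\ bddH sg T u, bddH sg T v & bddH sg T (accel b w)].
Proof.
move=> sg0 sgs [C C0 hC].
have ba : bddH sg T (accel b w).
  exists (K * (K * C)); first by rewrite !mulr_ge0.
  move=> t It; have [H n] := hC t It; have [H1 n1] := BB_hnm H; split => //.
  by apply: le_trans n1 _; do 2 apply: ler_wpM2l => //.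
have bv : bddH sg T v by apply: (bddH_primitive sg0 Lv dv _ ba); have [] := HsR_mono sgs v0.
split=> //; apply: (bddH_primitive sg0 Lu du _ bv); by have [] := HsR_mono sgs u0.
Qed.

(** Continuity comes from a Lipschitz bound, by the mean value inequality. *)
Lemma bddH_contH (y z : R -> R -> R) : (forall t, L2p (y t)) -> has_deriv nm I0 y z ->
  (forall T, bddH s T z) -> contH s I0 y.
Proof.
move=> Ly dy bz; apply: lip_contH => T; have [C C0 hC] := bz T; exists C => // a c a0 ac cT.
apply: (Hs_mean_value s0 ac C0 (fun t _ => Ly t) (has_deriv_restr (@sub_itv_I0 R a c a0) dy)).
by move=> t /andP[t1 t2]; apply: hC; rewrite (le_trans a0 t1) (le_trans t2).
Qed.

Hypothesis bw : forall T, bddH (s - 1) T w.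
Hypothesis cw : contH (s - 1) I0 w.

(** The bounds on w at both times are needed to place the difference in
    H^(s-1). *)
Lemma accel_contH : contH s I0 (accel b w).
Proof.
move=> t t0 e e0; have K1 : 0 < K * K + 1 by rewrite ltr_wpDl // mulr_ge0.
have [d d0 h] := cw t0 (divr_gt0 e0 K1); exists d => // t' t'0 tt.
have [C C0 hC] := bw (Num.max t t').
have It : 0 <= t <= Num.max t t' by rewrite le_max lexx andbT; exact: t0.
have It' : 0 <= t' <= Num.max t t' by rewrite le_max lexx orbT andbT; exact: t'0.
have [H1 _] := hC t It; have [H2 _] := hC t' It'; have [Hd _] := HsR_B H2 H1.
have [_ n] := BB_hnm Hd; rewrite accelB; apply: le_trans n _.
rewrite mulrA; apply: le_trans (ler_wpM2l _ (h t' t'0 tt)) _; first by rewrite mulr_ge0.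
by rewrite mulrCA ger_pMr // ler_pdivrMr // mul1r lerDl.
Qed.

(** Each of u and v is differentiable in L^2 with a derivative that is
    continuous in H^s, so [Hs_derivable] applies. *)
Theorem Hs_solution :
  [/\ forall t, 0 <= t -> [/\ HsR s (u t), HsR s (v t) & HsR s (accel b w t)],
   [/\ contH s I0 u, contH s I0 v & contH s I0 (accel b w)],
   forall t, I0 t -> forall e : R, 0 < e -> exists2 d, 0 < d & forall h, `|h| < d -> I0 (t + h) ->
    HsR s (fun x => u (t + h) x - u t x - h * v t x) /\ hnm s (fun x => u (t + h) x - u t x - h * v t x) <= e * `|h| &
   forall t, I0 t -> forall e : R, 0 < e -> exists2 d, 0 < d & forall h, `|h| < d -> I0 (t + h) ->
    HsR s (fun x => v (t + h) x - v t x - h * accel b w t x) /\ hnm s (fun x => v (t + h) x - v t x - h * accel b w t x) <= e * `|h|].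
Proof.
have L T := lift_regularity s0 (lexx s) (bw T).
have bu T : bddH s T u by have [] := L T.
have bv T : bddH s T v by have [] := L T.
have ba T : bddH s T (accel b w) by have [] := L T.
have pt z : (forall T, bddH s T z) -> forall t, I0 t -> HsR s (z t).
  by move=> bz t t0; have [C _ h] := bz t; have [] := h t; rewrite ?lexx ?andbT.
have cu := bddH_contH Lu du bv; have cv := bddH_contH Lv dv ba.
split.
- by move=> t t0; split; exact: pt.
- by split => //; exact: accel_contH.
- exact: (Hs_derivable s0 Lu du (pt v bv) cv).
- exact: (Hs_derivable s0 Lv dv (pt _ ba) accel_contH).
Qed.

End Component.

Section TwoComponents.
Context {R : realType}.
Variables (b1 b2 : R -> R) (K1 K2 s : R) (g1 g2 : R * R -> R) (u1 u2 v1 v2 : R -> R -> R).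
Hypotheses (Sb1 : symb b1 K1) (Sb2 : symb b2 K2) (hs : 2^-1 < s).
Hypotheses (sg1 : Csmooth g1) (sg2 : Csmooth g2) (g10 : g1 (0, 0) = 0) (g20 : g2 (0, 0) = 0).
Let I0 : set R := [set t | 0 <= t].
Let w1 t x := u1 t x + comp2 g1 (u1 t) (u2 t) x.
Let w2 t x := u2 t x + comp2 g2 (u1 t) (u2 t) x.
Hypotheses (su1 : forall t, spectral (u1 t)) (su2 : forall t, spectral (u2 t)).
Hypotheses (Lv1 : forall t, L2p (v1 t)) (Lv2 : forall t, L2p (v2 t)).
Hypotheses (Lw1 : forall t, L2p (w1 t)) (Lw2 : forall t, L2p (w2 t)).
Hypotheses (du1 : has_deriv nm I0 u1 v1) (dv1 : has_deriv nm I0 v1 (accel b1 w1)).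
Hypotheses (du2 : has_deriv nm I0 u2 v2) (dv2 : has_deriv nm I0 v2 (accel b2 w2)).
Hypotheses (Hu1 : HsR s (u1 0)) (Hv1 : HsR s (v1 0)) (Hu2 : HsR s (u2 0)) (Hv2 : HsR s (v2 0)).
Hypothesis bnd : forall T, exists C, forall t, 0 <= t <= T ->
  [/\ nm (u1 t) <= C, nm (u2 t) <= C, forall x, `|u1 t x| <= C & forall x, `|u2 t x| <= C].

Let Lu1 t : L2p (u1 t). Proof. by have [] := su1 t. Qed.
Let Lu2 t : L2p (u2 t). Proof. by have [] := su2 t. Qed.
Let s0 : 0 <= s. Proof. by have h := hs; lra. Qed.

Lemma bddH_force (j : nat) (g : R * R -> R) T (u : R -> R -> R) : Csmooth g -> g (0, 0) = 0 ->
  bddH j%:R T u1 -> bddH j%:R T u2 -> bddH j%:R T u -> bddH j%:R T (fun t x => u t x + comp2 g (u1 t) (u2 t) x).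
Proof.
move=> sg g0 [C1 C10 h1] [C2 C20 h2] [C3 C30 h3]; have [M hM] := bnd T.
have [K' hK] := comp_boundedP j sg M (Num.max C1 C2).
exists (C3 + `|K'|); first by rewrite addr_ge0.
move=> t It; have [_ _ m1 m2] := hM t It; have [H1 n1] := h1 t It; have [H2 n2] := h2 t It; have [H3 n3] := h3 t It.
have [||H n] := hK (u1 t) (u2 t) (su1 t) (su2 t) m1 m2 H1 H2; try by rewrite le_max ?n1 ?n2 ?orbT.
have [H4 n4] := HsR_lin 1 H3 H.
have E : (fun x => 1 * u t x + (comp2 g (u1 t) (u2 t) x - g (0, 0))) = (fun x => u t x + comp2 g (u1 t) (u2 t) x).
  by apply/funext => x; rewrite g0 mul1r subr0.
rewrite E normr1 mul1r in H4 n4; split => //; apply: le_trans n4 _; apply: lerD => //.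
exact: le_trans n (ler_norm K').
Qed.

(** One derivative is gained at each step, by [bddH_force] and
    [lift_regularity]. *)
Lemma bootstrap (j : nat) : j%:R <= s -> forall T, bddH j%:R T u1 /\ bddH j%:R T u2.
Proof.
elim: j => [_|j IH js] T.
  have [C hC] := bnd T; split; exists `|C| => // t It; have [n1 n2 _ _] := hC t It.
    by have [H ->] := HsR0 (Lu1 t); split => //; exact: le_trans n1 (ler_norm C).
  by have [H ->] := HsR0 (Lu2 t); split => //; exact: le_trans n2 (ler_norm C).
have js' : j%:R <= s by apply: le_trans js; rewrite ler_nat.
have [h1 h2] := IH js' T.
have e : j.+1%:R - 1 = j%:R :> R by rewrite -natr1 addrK.
have j0 : (0 : R) <= j.+1%:R by [].
have f1 := bddH_force sg1 g10 h1 h2 h1; have f2 := bddH_force sg2 g20 h1 h2 h2.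
rewrite -e in f1 f2.
have [k1 _ _] := lift_regularity Sb1 Lu1 Lv1 du1 dv1 Hu1 Hv1 j0 js f1.
by have [k2 _ _] := lift_regularity Sb2 Lu2 Lv2 du2 dv2 Hu2 Hv2 j0 js f2.
Qed.

Let m := Num.truncn s.
Let ms : m%:R <= s < m.+1%:R. Proof. exact: truncn_itv. Qed.

Lemma force_bdd T : bddH m%:R T w1 /\ bddH m%:R T w2.
Proof.
have /andP[m1 _] := ms; have [h1 h2] := bootstrap m1 T.
by split; [exact: (bddH_force sg1 g10 h1 h2 h1)|exact: (bddH_force sg2 g20 h1 h2 h2)].
Qed.

Lemma s_pred_lt : s - 1 < m%:R.
Proof. by have /andP[_] := ms; rewrite -natr1 ltrBlDr. Qed.

Lemma force_bdd_pred T : bddH (s - 1) T w1 /\ bddH (s - 1) T w2.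
Proof.
have [[C1 C10 h1] [C2 C20 h2]] := force_bdd T; have h := ltW s_pred_lt.
split; [exists C1 => // t It; have [H n] := h1 t It|exists C2 => // t It; have [H n] := h2 t It];
  have [H' n'] := HsR_mono h H; split => //; exact: le_trans n' n.
Qed.

Lemma force_cont (g : R * R -> R) (u : R -> R -> R) t : Csmooth g -> (forall t, L2p (u t)) ->
  (forall e, 0 < e -> exists2 d, 0 < d & forall t', I0 t' -> `|t' - t| < d -> nm (u t' - u t) <= e) ->
  I0 t -> forall e, 0 < e -> exists2 d, 0 < d & forall t', I0 t' -> `|t' - t| < d ->
    nm (fun x => (u t' x + comp2 g (u1 t') (u2 t') x) - (u t x + comp2 g (u1 t) (u2 t) x)) <= e.
Proof.
move=> sg Lu cu t0 e e0; have SN := @L2_seminorm R.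
have [M hM] := bnd (t + 1).
have [L L0 hL] := Csmooth_loclip sg M.
have L1 : 0 < 2 * L + 1 by rewrite ltr_wpDl // mulr_ge0.
have e1 : 0 < e / (2 * L + 1) by rewrite divr_gt0.
have [d1 d10 h1] := has_deriv_cont SN du1 t0 (fun t _ => Lu1 t) (Lv1 t) e1.
have [d2 d20 h2] := has_deriv_cont SN du2 t0 (fun t _ => Lu2 t) (Lv2 t) e1.
have [d3 d30 h3] := cu _ e1.
exists (Num.min (Num.min 1 d1) (Num.min d2 d3)); first by rewrite !lt_min ltr01 d10 d20.
move=> t' t'0; rewrite !lt_min => /andP[/andP[a0 a1] /andP[a2 a3]].
have It : 0 <= t <= t + 1 by rewrite t0 lerDl ler01.
have It' : 0 <= t' <= t + 1 by rewrite t'0 /=; move: a0; rewrite ltr_norml => /andP[_]; lra.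
have [_ _ m1 m2] := hM t It; have [_ _ m1' m2'] := hM t' It'.
have [Ld nd] := comp2_lip L0 (Csmooth_cont sg) hL (spectral_nice (su1 t) m1) (spectral_nice (su2 t) m2) (spectral_nice (su1 t') m1') (spectral_nice (su2 t') m2').
have E : (fun x => (u t' x + comp2 g (u1 t') (u2 t') x) - (u t x + comp2 g (u1 t) (u2 t) x)) =
  (fun x => (u t' x - u t x) + (comp2 g (u1 t') (u2 t') x - comp2 g (u1 t) (u2 t) x)).
  by apply/funext => x; ring.
rewrite E; apply: le_trans (nmD (L2_B (Lu t') (Lu t)) Ld) _.
have n1 : nm (fun x => u1 t' x - u1 t x) <= e / (2 * L + 1) := h1 t' t'0 a1.
have n2 : nm (fun x => u2 t' x - u2 t x) <= e / (2 * L + 1) := h2 t' t'0 a2.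
have n3 : nm (fun x => u t' x - u t x) <= e / (2 * L + 1) := h3 t' t'0 a3.
have n4 := le_trans nd (ler_wpM2l L0 (lerD n1 n2)).
apply: le_trans (lerD n3 n4) _.
have -> : e / (2 * L + 1) + L * (e / (2 * L + 1) + e / (2 * L + 1)) = (e / (2 * L + 1)) * (2 * L + 1) by ring.
by rewrite divfK // gt_eqF.
Qed.

(** Interpolation between the bound in H^m and continuity in L^2, since m
    exceeds s - 1; for s at most 1 continuity in L^2 is enough. *)
Lemma L2_contH (w : R -> R -> R) : (forall t, L2p (w t)) -> (forall T, bddH m%:R T w) ->
  (forall t, I0 t -> forall e : R, 0 < e -> exists2 d, 0 < d & forall t', I0 t' -> `|t' - t| < d ->
    nm (fun x => w t' x - w t x) <= e) -> contH (s - 1) I0 w.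
Proof.
move=> Lw bw cw t t0 e e0.
have [C C0 hC] := bw (t + 1).
have It : 0 <= t <= t + 1 by rewrite t0 lerDl ler01.
have [ds d1 hd] : exists2 d : R, 0 < d & forall f, HsR m%:R f -> hnm m%:R f <= C + C -> nm f <= d -> hnm (s - 1) f <= e.
  have [s1|s1] := leP s 1.
    exists e => // f [Lf _] _ nf; have [H e'] := HsR0 Lf.
    have s10 : s - 1 <= 0 by rewrite subr_le0.
    by have [_ n] := HsR_mono s10 H; apply: le_trans n _; rewrite e'.
  have s10 : 0 <= s - 1 by rewrite subr_ge0 ltW.
  exact: (interpolation s_pred_lt s10 (addr_ge0 C0 C0) e0).
have [d d0 h] := cw t t0 _ d1.
exists (Num.min 1 d); first by rewrite lt_min ltr01.
move=> t' t'0; rewrite lt_min => /andP[a0 a1].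
have It' : 0 <= t' <= t + 1 by rewrite t'0 /=; move: a0; rewrite ltr_norml => /andP[_]; lra.
have [H n] := hC t It; have [H' n'] := hC t' It'; have [Hd nd] := HsR_B H' H.
by apply: hd => //; [apply: le_trans nd _; exact: lerD|exact: h].
Qed.

Lemma force_contH : contH (s - 1) I0 w1 /\ contH (s - 1) I0 w2.
Proof.
have SN := @L2_seminorm R.
split; apply: L2_contH => //.
- by move=> T; have [] := force_bdd T.
- move=> t t0; apply: (force_cont sg1 Lu1) => // e e0.
  exact: (has_deriv_cont SN du1 t0 (fun t _ => Lu1 t) (Lv1 t) e0).
- by move=> T; have [] := force_bdd T.
- move=> t t0; apply: (force_cont sg2 Lu2) => // e e0.
  exact: (has_deriv_cont SN du2 t0 (fun t _ => Lu2 t) (Lv2 t) e0).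
Qed.

End TwoComponents.

(** * Convolution and differentiation under the transform *)

Section ConvSpectrum.
Context {R : realType}.
Local Notation mu := (@lebesgue_measure R).
Variables (beta w : R -> R) (M : R).
Hypotheses (ib : intg beta) (beta_even : forall xi, hart1 beta (- xi) = hart1 beta xi).
Hypotheses (Lw : L2p w) (cw : continuous w) (wM : forall x, `|w x| <= M).

Let mw : mfun1 w := L2_m Lw.
Let M0 : 0 <= M := le_trans (normr_ge0 _) (wM 0).
Let en n (xi : R) : R := expR (- (ep n * `|xi|)).

(** If the Hartley transform is even, the sine part vanishes. *)
Lemma beta_cos_sin xi : \int[mu]_y (cos (xi * y) * beta y) = kernel_hat beta xi /\
  \int[mu]_y (sin (xi * y) * beta y) = 0.
Proof.
have i1 := int_cos_on xi ib; have i2 := int_sin_on xi ib.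
set A := \int[mu]_y _; set B := \int[mu]_y _.
have em : \int[mu]_x (cas (- xi * x) * beta x) = A - B.
  by rewrite -I_B //; apply: I_eq => x; rewrite /cas mulNr cosN sinN mulrBl.
have ep_ : \int[mu]_x (cas (xi * x) * beta x) = A + B.
  by rewrite -I_D //; apply: I_eq => x; rewrite /cas mulrDl.
have c0n : (c0 : R) != 0 by rewrite gt_eqF // c0_gt0.
have := beta_even xi; rewrite /hart1 em ep_ => /(mulfI c0n) e.
have B0 : B = 0 by lra.
by split => //; rewrite /kernel_hat /hart1 ep_ B0 addr0 mulrAC divff // mul1r.
Qed.

Lemma en_L2 n : L2p (en n).
Proof.
have [i _] := int_exp_cos 0 (ep_gt0 (R := R) n).
apply: (L2_of_bdd (M := 1)); first exact: (int_exp (ep_gt0 n)).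
by move=> x; exact: (expabs_le1 x (ep_gt0 n)).
Qed.

Let Lh := hart_L2 Lw.
Let ieh n : intg (fun xi => en n xi * hart w xi). Proof. exact: L2_mul (en_L2 n) Lh. Qed.

(** [hart1_abel] for a bounded square-integrable function, by truncation: the
    left side converges since the damping factor is square-integrable, the
    right side by dominated convergence. *)
Lemma abel_L2 n y : hart1 (fun xi => en n xi * hart w xi) y = \int[mu]_z (w z * pois (ep n) (y - z)).
Proof.
have e0 := ep_gt0 (R := R) n.
have [_ ip0 _] := pois_conv y mw wM e0.
have c1 : \int[mu]_z (tr m w z * pois (ep n) (y - z)) @[m --> \oo] --> \int[mu]_z (w z * pois (ep n) (y - z)).
  have E m : (fun z => tr m w z * pois (ep n) (y - z)) = (fun z => box m%:R z * (w z * pois (ep n) (y - z))).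
    by apply/funext => z; rewrite /tr mulrA.
  have [] := @dct R (fun m z => tr m w z * pois (ep n) (y - z)) (fun z => w z * pois (ep n) (y - z)) (fun z => `|w z * pois (ep n) (y - z)|).
  - by move=> m; rewrite E; apply: measurable_funM; [exact: box_m|exact: intg_m].
  - exact: intg_m.
  - by apply: ae_all => z; apply: cvgM; [exact: tr_cvg|exact: cvg_cst].
  - exact: intg_abs.
  - by move=> m z; rewrite (normrM (tr m w z)) (normrM (w z)); apply: ler_wpM2r => //; exact: tr_le.
  by [].
have c2 : \int[mu]_z (tr m w z * pois (ep n) (y - z)) @[m --> \oo] --> hart1 (fun xi => en n xi * hart w xi) y.
  have c : 2 * c0 * (nm (en n) * nm (fun xi => hart1 (tr m w) xi - hart w xi)) @[m --> \oo] --> (2 * c0 * (nm (en n) * 0) : R).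
    by apply: cvgM; [exact: cvg_cst|apply: cvgM; [exact: cvg_cst|exact: hart_cvg]].
  rewrite !mulr0 in c; move/cvgrPdist_le : c => c; apply/cvgrPdist_le => e epos.
  have := c e epos; apply: filterS => m; rewrite sub0r normrN => H; apply: le_trans (le_trans _ (ler_norm _)) H.
  have LH := L2_hart1_tr m Lw; have Ld := L2_B LH Lh.
  rewrite -(hart1_abel y (tr_intg m Lw) e0) -/(en n) distrC.
  rewrite -(hart1B y (L2_mul (en_L2 n) LH) (ieh n)).
  have E : (fun x => en n x * hart1 (tr m w) x - en n x * hart w x) = (fun x => en n x * (hart1 (tr m w) x - hart w x)).
    by apply/funext => x; rewrite mulrBr.
  have i : intg (fun x => en n x * (hart1 (tr m w) x - hart w x)) := L2_mul (en_L2 n) Ld.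
  rewrite E; apply: le_trans (hart1_bd y i) _; apply: ler_wpM2l; first by rewrite mulr_ge0 // ltW // c0_gt0.
  have La := L2_abs (en_L2 n); have Lb := L2_abs Ld.
  have -> : \int[mu]_x `|en n x * (hart1 (tr m w) x - hart w x)| = ip (fun x => `|en n x|) (fun x => `|hart1 (tr m w) x - hart w x|).
    by rewrite ip_def; apply: I_eq => x; rewrite normrM.
  apply: le_trans (ler_norm _) _; apply: le_trans (cauchy_schwarz La Lb) _.
  apply: ler_pM; rewrite ?nm_ge0 //; [apply: nm_dom (L2_m La) (en_L2 n) _|apply: nm_dom (L2_m Lb) Ld _] => x; by rewrite normr_id.
exact: (cvg_unique (@Rhausdorff R) c2 c1).
Qed.

Let J n y := hart1 (fun xi => en n xi * hart w xi) y.

Lemma J_bd n y : `|J n y| <= M.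
Proof. by rewrite /J abel_L2; exact: (pois_conv_bd y mw wM (ep_gt0 n)). Qed.

Lemma J_cvg y : J n y @[n --> \oo] --> w y.
Proof.
rewrite (_ : (fun n => _) = (fun n => \int[mu]_z (w z * pois (ep n) (y - z)))); first exact: pois_conv_cvg.
by apply/funext => n; exact: abel_L2.
Qed.

Lemma conv_J_cvg x : convolution beta (J n) x @[n --> \oo] --> convolution beta w x.
Proof.
have sub_m (f : R -> R) : mfun1 f -> mfun1 (fun y => f (x - y)).
  by move=> mf; apply: (measurableT_comp mf); apply: measurable_funB.
have mb := intg_m ib.
have [] := @dct R (fun n y => beta y * J n (x - y)) (fun y => beta y * w (x - y)) (fun y => M * `|beta y|).
- by move=> n; apply: measurable_funM => //; apply: sub_m; exact: hart1_m.
- by apply: measurable_funM => //; exact: sub_m.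
- by apply: ae_all => y; apply: cvgM; [exact: cvg_cst|exact: J_cvg].
- by apply: intgZ; exact: intg_abs.
- by move=> n y; rewrite normrM mulrC; apply: ler_wpM2r => //; exact: J_bd.
by [].
Qed.

Hypothesis ibw : intg (fun xi => kernel_hat beta xi * hart w xi).

(** For the damped inverse transform [J n] in place of [w], the formula for
    the convolution is Fubini's theorem. *)
Lemma conv_J n x : convolution beta (J n) x = hart1 (fun xi => en n xi * (kernel_hat beta xi * hart w xi)) x.
Proof.
pose h xi := en n xi * hart w xi.
have ih : intg h := ieh n.
have [] := @fubiniR R (fun y xi => cas ((x - y) * xi) * h xi * beta y) (fun y => `|beta y|) (fun xi => 2 * `|h xi|).
- apply: measurable_funM; last exact: (measurableT_comp (intg_m ib) measurable_fst).
  apply: measurable_funM; last exact: (measurableT_comp (intg_m ih) measurable_snd).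
  apply: (measurableT_comp measurable_cas); apply: measurable_funM; last exact: measurable_snd.
  by apply: measurable_funB => //; exact: measurable_fst.
- exact: intg_abs.
- exact/intgZ/intg_abs.
- by move=> y; exact: normr_ge0.
- by move=> y; rewrite mulr_ge0.
- by move=> y xi; rewrite !normrM mulrC ler_wpM2l // ler_wpM2r // cas_le2.
move=> _ _ i1 i2 E.
have -> : convolution beta (J n) x = c0 * \int[mu]_y \int[mu]_xi (cas ((x - y) * xi) * h xi * beta y).
  rewrite -I_Z //; apply: I_eq => y; rewrite /J /hart1 mulrCA; congr (_ * _).
  rewrite -I_Z; last exact: int_cas.
  by apply: I_eq => xi; rewrite mulrC.
rewrite E /hart1; congr (_ * _); apply: I_eq => xi.
have j1 := int_cos_on xi ib; have j2 := int_sin_on xi ib.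
have k1 := intgZ (cas (xi * x) * h xi) j1; have k2 := intgZ (cas (- (xi * x)) * h xi) j2.
rewrite (@I_eq R _ (fun y => (cas (xi * x) * h xi) * (cos (xi * y) * beta y) - (cas (- (xi * x)) * h xi) * (sin (xi * y) * beta y))); last first.
  by move=> y; rewrite mulrBl casB (mulrC x) (mulrC y); ring.
have [bc bs] := beta_cos_sin xi.
rewrite I_B // !I_Z // bc bs mulr0 subr0 (mulrC xi) /h.
move: (cas (x * xi)) (en n xi) (hart w xi) (kernel_hat beta xi) => *; ring.
Qed.

(** Both sides of [conv_J] converge as the damping is removed: [J n] tends to
    [w] at every point, boundedly, because [w] is continuous. *)
Lemma conv_spectrum x : convolution beta w x = hart1 (fun xi => kernel_hat beta xi * hart w xi) x.
Proof.
have c1 := @conv_J_cvg x.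
have c2 : convolution beta (J n) x @[n --> \oo] --> hart1 (fun xi => kernel_hat beta xi * hart w xi) x.
  rewrite (_ : (fun n => _) = (fun n => hart1 (fun xi => en n xi * (kernel_hat beta xi * hart w xi)) x)); last first.
    by apply/funext => n; exact: conv_J.
  have mb := intg_m ibw.
  have men n : mfun1 (en n) := L2_m (en_L2 n).
  apply: cvgM; first exact: cvg_cst.
  have [] := @dct R (fun n xi => cas (x * xi) * (en n xi * (kernel_hat beta xi * hart w xi))) (fun xi => cas (x * xi) * (kernel_hat beta xi * hart w xi)) (fun xi => 2 * `|kernel_hat beta xi * hart w xi|).
  - by move=> n; apply: measurable_funM; [exact: mcasM|exact: (measurable_funM (men n) mb)].
  - by apply: measurable_funM; [exact: mcasM|].
  - apply: ae_all => xi; apply: cvgM; first exact: cvg_cst.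
    rewrite -[X in _ --> X]mul1r; apply: cvgM; last exact: cvg_cst.
    have c : - (ep n * `|xi|) @[n --> \oo] --> (- (0 * `|xi|) : R).
      by apply: cvgN; apply: cvgM; [exact: ep_cvg|exact: cvg_cst].
    rewrite mul0r oppr0 in c; rewrite -(@expR0 R).
    exact: (cvg_comp _ _ c (@continuous_expR R 0)).
  - by apply: intgZ; exact: intg_abs.
  - move=> n xi; rewrite normrM; apply: ler_pM => //; first exact: cas_le2.
    rewrite normrM -[leRHS]mul1r; apply: ler_wpM2r => //; exact: (expabs_le1 xi (ep_gt0 n)).
  by [].
exact: (cvg_unique (@Rhausdorff R) c1 c2).
Qed.

End ConvSpectrum.

Section Differentiate.
Context {R : realType}.
Local Notation mu := (@lebesgue_measure R).
Implicit Types (f : R -> R).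

Lemma is_derive_cas (x : R) : is_derive x 1 (@cas R) (cas (- x)).
Proof.
have -> : cas (- x) = - sin x + cos x by rewrite /cas cosN sinN addrC.
exact: (is_deriveD (is_derive_cos x) (is_derive_sin x)).
Qed.

Lemma is_derive_casM (a x : R) : is_derive x 1 (fun y : R => cas (y * a)) (cas (- (x * a)) * a).
Proof.
have D1 : is_derive x 1 (fun y : R => y * a) a.
  have := is_deriveM (is_derive_id x (1 : R)) (is_derive_cst a x (1 : R)).
  by rewrite scaler0 add0r /GRing.scale /= mulr1.
exact: (@is_derive1_comp R cas (fun y => y * a) x _ _ (is_derive_cas (x * a)) D1).
Qed.

(** Differentiation under the integral; the reflection is that of cas' (x) =
    cas (- x). *)
Lemma hart1_deriv f (a : R) : intg f -> intg (fun xi => xi * f xi) ->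
  is_derive a 1 (hart1 f) (hart1 (fun xi => xi * f xi) (- a)).
Proof.
move=> i0 i1.
have dF (x xi : R) : is_derive x 1 (fun y : R => cas (y * xi) * f xi) (cas (- (x * xi)) * (xi * f xi)).
  have := is_deriveM (is_derive_casM xi x) (is_derive_cst (f xi) x (1 : R)).
  by rewrite scaler0 add0r /GRing.scale /= => D; apply: (is_derive_eq D); rewrite mulrC mulrA.
have Ia : `]a - 1, a + 1[%classic a by rewrite /= in_itv /= ltrBlDr !ltrDl !ltr01.
have P1 x y : partial1of2 (fun y xi : R => cas (y * xi) * f xi) x y = cas (- (x * y)) * (y * f y).
  by rewrite partial1of2E; have [_ ->] := dF x y.
have H1 (x : R) : `]a - 1, a + 1[%classic x -> mu.-integrable setT (EFin \o (fun xi => cas (x * xi) * f xi)) by move=> _; exact: int_cas.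
have H2 (x y : R) : `]a - 1, a + 1[%classic x -> setT y -> derivable (fun z : R => cas (z * y) * f y) x 1 by move=> _ _; have [] := dF x y.
have G0 (y : R) : 0 <= 2 * `|y * f y| by rewrite mulr_ge0.
have iG : mu.-integrable setT (EFin \o (fun y => 2 * `|y * f y|)) by apply: intgZ; exact: intg_abs.
have Gub (x y : R) : `]a - 1, a + 1[%classic x -> setT y -> `|partial1of2 (fun y xi : R => cas (y * xi) * f xi) x y| <= 2 * `|y * f y|.
  by move=> _ _; rewrite P1 normrM; apply: ler_wpM2r => //; exact: cas_le2.
have D := derivable_under_integral measurableT Ia H1 H2 G0 iG Gub.
have V := differentiation_under_integral measurableT Ia H1 H2 G0 iG Gub.
have D0 : is_derive a 1 (fun x => \int[mu]_xi (cas (x * xi) * f xi)) (\int[mu]_xi (cas (- a * xi) * (xi * f xi))).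
  split => //; rewrite -derive1E V; apply: I_eq => xi; by rewrite P1 mulNr.
have := is_deriveZ (c0 : R) D0.
by [].
Qed.

Lemma hart1_derive2 f : intg f -> intg (fun xi => xi * f xi) -> intg (fun xi => xi ^+ 2 * f xi) ->
  derivable2 (hart1 f) /\ forall x, derive1n 2 (hart1 f) x = - hart1 (fun xi => xi ^+ 2 * f xi) x.
Proof.
move=> i0 i1 i2.
have i2' : intg (fun xi => xi * (xi * f xi)).
  by under eq_fun do rewrite mulrA -expr2.
have d1 x := hart1_deriv x i0 i1.
have E1 : derive1 (hart1 f) = (fun x => hart1 (fun xi => xi * f xi) (- x)).
  by apply/funext => x; rewrite derive1E; have [_ ->] := d1 x.
have d2 (x : R) : is_derive x 1 (derive1 (hart1 f)) (- hart1 (fun xi => xi ^+ 2 * f xi) x).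
  rewrite E1; have D := hart1_deriv (- x) i1 i2'.
  have D1 := is_deriveN (is_derive_id x (1 : R)).
  have := @is_derive1_comp R (hart1 (fun xi => xi * f xi)) (fun y => - y) x _ _ D D1.
  rewrite opprK mulrN1 => D3; apply: (is_derive_eq D3).
  by congr (- hart1 _ x); apply/funext => xi; rewrite mulrA -expr2.
split; first by move=> x; split; [have [] := d1 x|have [] := d2 x].
by move=> x; rewrite [LHS]derive1E; have [_ e] := d2 x.
Qed.

End Differentiate.

(** * Solution of the Cauchy problem *)

Section ToSobolev.
Context {R : realType}.
Local Notation mu := (@lebesgue_measure R).
Let I0 : set R := [set t | 0 <= t].

Lemma sobolev_cvg0 (s : R) (F : set_system R) (FF : Filter F) (X : R -> R -> R) :
  (forall e : R, 0 < e -> \forall h \near F, HsR s (X h) /\ hnm s (X h) <= e) ->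
  sobolev_norm s (X h) @[h --> F] --> 0%E.
Proof.
move=> H; have c0p : 0 < (c0 : R) := c0_gt0.
have E : \forall h \near F, (hnm s (X h) / c0)%:E = sobolev_norm s (X h).
  by apply: filterS (H 1 ltr01) => h [Hh _]; rewrite sobolev_normE.
apply: (cvg_trans (near_eq_cvg E)); apply: cvg_EFin; first exact: nearW.
apply/cvgrPdist_le => e e0.
apply: filterS (H (e * c0) (mulr_gt0 e0 c0p)) => h [_ n] /=.
have n0 : 0 <= hnm s (X h) / c0 := divr_ge0 (hnm_ge0 _ _) (ltW c0p).
by rewrite sub0r normrN ger0_norm // ler_pdivrMr.
Qed.

Lemma to_continuous_Hs (s : R) (u : R -> R -> R) : (forall t, 0 <= t -> HsR s (u t)) -> contH s I0 u -> continuous_Hs s u.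
Proof.
move=> Hu cu; split=> t t0; first by apply/HsE; exact: Hu.
apply: sobolev_cvg0 => e e0; have [d d0 h] := cu t t0 e e0.
have N : \forall t' \near t, `|t' - t| < d.
  by apply/nbhs_ballP; exists d => // t' /=; rewrite /ball /= distrC.
rewrite /within /=; apply: filterS N => t' tt t'0.
by split; [exact: (HsR_B (Hu t' t'0) (Hu t t0)).1|exact: h].
Qed.

Lemma to_is_derive_Hs (s : R) (u v : R -> R -> R) :
  (forall t, I0 t -> forall e : R, 0 < e -> exists2 d, 0 < d & forall h, `|h| < d -> I0 (t + h) ->
    HsR s (fun x => u (t + h) x - u t x - h * v t x) /\ hnm s (fun x => u (t + h) x - u t x - h * v t x) <= e * `|h|) ->
  is_derive_Hs s u v.
Proof.
move=> H t t0; apply: sobolev_cvg0 => e e0; have [d d0 h1] := H t t0 e e0.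
have N : \forall h \near (0 : R), `|h| < d.
  by apply/nbhs_ballP; exists d => // h /=; rewrite /ball /= sub0r normrN.
rewrite /within /dnbhs /within /=; apply: filterS N => h hd hn th.
have [H1 n1] := h1 h hd th; have [H2 n2] := hnmZ h^-1 H1.
have E : (fun x => h^-1 * (u (t + h) x - u t x - h * v t x)) = (fun x => h^-1 * (u (t + h) x - u t x) - v t x).
  by apply/funext => x; rewrite mulrBr mulKf.
rewrite E in H2 n2; split => //; rewrite n2 normfV ler_pdivrMl ?normr_gt0 //.
by rewrite mulrC.
Qed.

End ToSobolev.

Section WaveEquation.
Context {R : realType}.
Local Notation mu := (@lebesgue_measure R).
Variables (beta : R -> R) (C r : R).
Hypothesis beta_int : mu.-integrable setT (EFin \o beta).
Hypothesis hr : 3 < r.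
Hypothesis hC : 0 < C.
Hypothesis beta_hat : forall xi : R, 0 <= fourier beta xi <= (C * (1 + xi ^+ 2) `^ (- r / 2))%:C.

Lemma kernel_hat_L2 : L2p (kernel_hat beta).
Proof.
have ha : - r / 2 < - (2^-1 / 2) by have h := hr; lra.
apply: (L2_dom (kernel_hat_m beta_int) (L2_Z C (jw_L2 ha))) => xi.
have b0 := kernel_hat_ge0 beta_int beta_hat xi.
by rewrite ger0_norm // (le_trans (kernel_hat_le beta_int beta_hat xi)) // ler_norm.
Qed.

(** The spectrum of beta * w is hat beta times that of w; two differentiations
    multiply it by - xi^2, and xi^2 hat beta is the square of the wave symbol. *)
Lemma conv_derive2 w M : L2p w -> continuous w -> (forall x, `|w x| <= M) ->
  derivable2 (convolution beta w) /\
  forall x, derive1n 2 (convolution beta w) x = Bop (wave_symb beta) (fun y => - Bop (wave_symb beta) w y) x.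
Proof.
move=> Lw cw wM; have Lh := hart_L2 Lw.
have Sb := wave_symb_symb beta_int hr hC beta_hat.
pose F xi := kernel_hat beta xi * hart w xi.
have iF : intg F := L2_mul kernel_hat_L2 Lh.
have ev xi : hart1 beta (- xi) = hart1 beta xi := (kernel_hat_fourier beta_int beta_hat xi).2.
have E : convolution beta w = hart1 F by apply/funext => x; exact: (conv_spectrum beta_int ev Lw cw wM iF).
have Lb := bq_L2 Sb Lw.
have e2 xi : xi ^+ 2 * F xi = wave_symb beta xi * (wave_symb beta xi * hart w xi).
  by rewrite /F mulrA -(wave_symb_sq beta_int beta_hat) expr2 mulrA.
have i2 : intg (fun xi => xi ^+ 2 * F xi) by rewrite (funext e2); exact: L2_mul (symb_L2 Sb) Lb.
have i1 : intg (fun xi => xi * F xi).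
  apply: (intg_dom _ (intgD (intg_abs iF) (intg_abs i2))).
    by apply: measurable_funM; [exact: measurable_id|exact: intg_m].
  move=> xi; rewrite !normrM -[X in _ <= X + _]mul1r -mulrDl; apply: ler_wpM2r => //.
  by have := sqr_ge0 (`|xi| - 1); have := normr_ge0 xi; nra.
have [d1 d2] := hart1_derive2 iF i1 i2; rewrite E; split => // x; rewrite d2.
have LB := Bop_L2 Sb Lw; have LN := L2_N LB.
have mN : mfun1 (fun xi => -1 * (xi ^+ 2 * F xi)) by apply: intg_m; exact: intgZ.
rewrite /Bop -mulN1r -hart1Z //; apply: hart1_ae => //; first exact: L2_m (bq_L2 Sb LN).
have hN : aeq (hart (fun y => - Bop (wave_symb beta) w y)) (fun xi => -1 * hart (Bop (wave_symb beta) w) xi).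
  have <- : (fun y => -1 * Bop (wave_symb beta) w y) = (fun y => - Bop (wave_symb beta) w y) by apply/funext => y; rewrite mulN1r.
  exact: hartZ.
by apply: (ae_imp2 _ hN (Bop_hart Sb Lw)) => xi -> ->; rewrite e2; ring.
Qed.

End WaveEquation.

Section Constants.
Context {R : realType}.
Local Notation mu := (@lebesgue_measure R).

(** The integral of |c| is invariant under dilation by 2 and hence 0. *)
Lemma intg_cst0 (c : R) : intg (fun=> c) -> c = 0.
Proof.
move=> i; have ia := intg_abs i.
have [_ e] := I_dilate (ltr0n R 2) ia.
have z : \int[mu]_x `|c| = 0 by lra.
have := I_eq0 ia (fun=> normr_ge0 c) z => ae0.
have m : mfun1 (fun x => `|c| * pois1 x) by apply: intg_m; apply: intgZ; exact: intg_pois1.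
have : \int[mu]_x (`|c| * pois1 x) = \int[mu]_x (0 : R).
  apply: (I_ae m (measurable_cst (0 : R))).
  by apply: (@ae_imp R (fun x => `|c| = 0) _ _ ae0) => x ->; rewrite mul0r.
rewrite I_Z ?I_pois1 ?mulr1 ?I_0; last exact: intg_pois1.
by move/eqP; rewrite normr_eq0 => /eqP.
Qed.

(** Both G (u1, u2) and G (u1, u2) - G (0, 0) are integrable, so the constant
    G (0, 0) is integrable on the line. *)
Lemma potential_eq0 (G g1 g2 : R * R -> R) (M : R) u1 u2 : grad G g1 g2 -> loclip g1 -> loclip g2 ->
  continuous g1 -> continuous g2 -> g1 (0, 0) = 0 -> g2 (0, 0) = 0 ->
  nice M u1 -> nice M u2 -> intg (comp2 G u1 u2) -> G (0, 0) = 0.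
Proof.
move=> gG l1 l2 c1 c2 g10 g20 n1 n2 i.
have cG := loclip_cont (grad_loclip gG c1 c2).
apply: intg_cst0; have := intgB i (potential_intg gG l1 l2 cG g10 g20 n1 n2).
by under eq_fun do rewrite opprB addrC subrK.
Qed.

End Constants.

Section Main.
Context {R : realType}.
Local Notation mu := (@lebesgue_measure R).

Lemma spectral_displ b K (f q : R -> R) : symb b K -> intg f -> L2p f -> L2p q -> spectral (displ b f q).
Proof.
move=> Sb i Lf Lq; have i' := bq_int Sb Lq; have L' := bq_L2 Sb Lq.
have -> : displ b f q = hart1 (fun xi => f xi + b xi * hart q xi).
  by apply/funext => x; rewrite hart1D.
by apply: spectral_hart1; [exact: intgD|exact: L2_D].
Qed.

Lemma displ0 b K (f : R -> R) : symb b K -> displ b f (fun=> 0) = hart1 f.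
Proof.
move=> Sb; apply/funext => x; have L0 : L2p (fun=> 0 : R) by exact: L2_0.
have := BopB x Sb L0 L0; under eq_fun do rewrite subrr.
by rewrite subrr /displ => ->; rewrite addr0.
Qed.

Lemma Bop_deriv b K (I : set R) (q p : R -> R -> R) : symb b K -> (forall t, L2p (q t)) -> (forall t, L2p (p t)) ->
  has_deriv nm I q p -> has_deriv nm I (fun t => Bop b (q t)) (fun t => Bop b (p t)).
Proof.
move=> Sb Lq Lp dq; have := displ_deriv (fun=> 0) Sb Lq Lp dq.
have -> : (fun t => displ b (fun=> 0) (q t)) = (fun t => Bop b (q t)) => //.
apply/funext => t; apply/funext => x; rewrite /displ.
by have := hart1Z 0 x (intg0 (R := R)); rewrite !mul0r => ->; rewrite add0r.
Qed.

Lemma nm_displ b K (f q : R -> R) : symb b K -> intg f -> L2p f -> L2p q -> nm (displ b f q) <= nm f + K * nm q.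
Proof.
move=> Sb i Lf Lq; have [Lh _ e] := synth i Lf.
by apply: le_trans (nmD Lh (Bop_L2 Sb Lq)) _; rewrite e lerD2l; exact: (Bop_nm Sb).
Qed.

End Main.

Theorem theorem5p1 (R : realType) (s r1 r2 : R)
    (hs : 2^-1 < s) (hr1 : 3 < r1) (hr2 : 3 < r2)
    (beta1 beta2 : R -> R)
    (beta1_int : (@lebesgue_measure R).-integrable setT (EFin \o beta1))
    (beta2_int : (@lebesgue_measure R).-integrable setT (EFin \o beta2))
    (C1 C2 : R) (hC1 : 0 < C1) (hC2 : 0 < C2)
    (beta1_hat : forall xi : R,
       0 <= fourier beta1 xi <= (C1 * (1 + xi ^+ 2) `^ (- r1 / 2))%:C)
    (beta2_hat : forall xi : R,
       0 <= fourier beta2 xi <= (C2 * (1 + xi ^+ 2) `^ (- r2 / 2))%:C)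
    (beta1_zeros : isolated_zeros (fourier beta1))
    (beta2_zeros : isolated_zeros (fourier beta2))
    (g1 g2 G : R * R -> R)
    (g1_smooth : Csmooth g1) (g2_smooth : Csmooth g2)
    (g1_0 : g1 (0, 0) = 0) (g2_0 : g2 (0, 0) = 0)
    (G_g1 : forall p : R * R, is_derive p (1, 0) G (g1 p))
    (G_g2 : forall p : R * R, is_derive p (0, 1) G (g2 p))
    (phi1 phi2 psi1 psi2 : R -> R)
    (phi1_Hs : Hs s phi1) (phi2_Hs : Hs s phi2)
    (psi1_Hs : Hs s psi1) (psi2_Hs : Hs s psi2)
    (P1_psi1 : P_in_L2 beta1 psi1) (P2_psi2 : P_in_L2 beta2 psi2)
    (G_int : (@lebesgue_measure R).-integrable setT
               (fun x => (G (phi1 x, phi2 x))%:E))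
    (k : R) (hk : 0 < k)
    (G_lb : forall a b : R, - k * (a ^+ 2 + b ^+ 2) <= G (a, b)) :
  exists u1 u2 : R -> R -> R,
    global_solution s beta1 beta2 g1 g2 phi1 phi2 psi1 psi2 u1 u2.
Proof.
have [s0 c0p] : 0 <= s /\ 0 < (c0 : R) by split; [lra|exact: c0_gt0].
have Hp1 : HsR s phi1 by apply/HsE. have Hp2 : HsR s phi2 by apply/HsE.
have Hq1 : HsR s psi1 by apply/HsE. have Hq2 : HsR s psi2 by apply/HsE.
have Sb1 := wave_symb_symb beta1_int hr1 hC1 beta1_hat; have Sb2 := wave_symb_symb beta2_int hr2 hC2 beta2_hat.
set b1 := wave_symb beta1 in Sb1; set b2 := wave_symb beta2 in Sb2.
have [Lp1 _] := Hp1; have [Lp2 _] := Hp2; have [Lq1 _] := Hq1; have [Lq2 _] := Hq2.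
have lift beta C r psi (hi : (@lebesgue_measure R).-integrable setT (EFin \o beta)) (hr : 3 < r) (hC : 0 < C)
   (hh : forall xi : R, 0 <= fourier beta xi <= (C * (1 + xi ^+ 2) `^ (- r / 2))%:C) :
   isolated_zeros (fourier beta) -> L2p psi -> P_in_L2 beta psi -> exists2 p0, L2p p0 & aeq (Bop (wave_symb beta) p0) psi.
  by move=> hz Lpsi hP; apply: (psi_lift hi hr hC hh hz _ hP); apply/HsE; have [] := HsR0 Lpsi.
have [p01 Lp01 ep1] := lift _ _ _ _ beta1_int hr1 hC1 beta1_hat beta1_zeros Lq1 P1_psi1.
have [p02 Lp02 ep2] := lift _ _ _ _ beta2_int hr2 hC2 beta2_hat beta2_zeros Lq2 P2_psi2.
pose f1 := hart phi1; pose f2 := hart phi2.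
have [if1 _] : intg f1 /\ _ := hs_int hs Hp1; have [if2 _] : intg f2 /\ _ := hs_int hs Hp2.
have Lf1 : L2p f1 := hart_L2 Lp1; have Lf2 : L2p f2 := hart_L2 Lp2.
have cg1 := Csmooth_cont g1_smooth; have cg2 := Csmooth_cont g2_smooth.
have lg1 := Csmooth_loclip g1_smooth; have lg2 := Csmooth_loclip g2_smooth.
have gG : grad G g1 g2 by move=> p; split; [exact: G_g1|exact: G_g2].
have cG : continuous G := loclip_cont (grad_loclip gG cg1 cg2).
have [e1 k1 Lg1 bg1] := cont_repr_spec hs Hp1; have [e2 k2 Lg2 bg2] := cont_repr_spec hs Hp2.
(* The continuous representatives of the data have the same integrable
   potential. *)
have G0 : G (0, 0) = 0.
  pose M := Num.max (2 * c0 * (nm (jw (- (s / 2))) * hnm s phi1)) (2 * c0 * (nm (jw (- (s / 2))) * hnm s phi2)).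
  have n1 : nice M (cont_repr phi1) by split => // x; rewrite le_max bg1.
  have n2 : nice M (cont_repr phi2) by split => // x; rewrite le_max bg2 orbT.
  apply: (potential_eq0 gG lg1 lg2 cg1 cg2 g1_0 g2_0 n1 n2).
  apply: (intg_ae G_int); first by apply: continuous_measurable_fun; exact: comp2_cont.
  by apply: (ae_imp2 _ e1 e2) => x E1 E2; rewrite /comp2 E1 E2.
have glb (p : R * R) : - k * (p.1 ^+ 2 + p.2 ^+ 2) <= G p by case: p => a b; exact: G_lb.
have [q1 [q2 [c1 [c2 [[q10 q20] [c10 c20] Lqc qb [dq1 dq2 dc1 dc2]]]]]] :=
  wave_ode Sb1 Sb2 if1 Lf1 if2 Lf2 cg1 cg2 lg1 lg2 g1_0 g2_0 gG G0 (ltW hk) glb Lp01 Lp02.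
have Lq1' t : L2p (q1 t) by have [] := Lqc t. have Lq2' t : L2p (q2 t) by have [] := Lqc t.
have Lc1 t : L2p (c1 t) by have [] := Lqc t. have Lc2 t : L2p (c2 t) by have [] := Lqc t.
pose u1 t := displ b1 f1 (q1 t); pose u2 t := displ b2 f2 (q2 t).
pose v1 t := Bop b1 (c1 t); pose v2 t := Bop b2 (c2 t).
pose w1 t x := u1 t x + comp2 g1 (u1 t) (u2 t) x; pose w2 t x := u2 t x + comp2 g2 (u1 t) (u2 t) x.
have su1 t : spectral (u1 t) := spectral_displ Sb1 if1 Lf1 (Lq1' t).
have su2 t : spectral (u2 t) := spectral_displ Sb2 if2 Lf2 (Lq2' t).
have Lu1 t : L2p (u1 t) by have [] := su1 t. have Lu2 t : L2p (u2 t) by have [] := su2 t.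
have Lv1 t : L2p (v1 t) := Bop_L2 Sb1 (Lc1 t). have Lv2 t : L2p (v2 t) := Bop_L2 Sb2 (Lc2 t).
have Lw1 t : L2p (w1 t) := force1_L2 Sb1 Sb2 if1 Lf1 if2 Lf2 cg1 lg1 g1_0 (Lq1' t) (Lq2' t).
have Lw2 t : L2p (w2 t) := force2_L2 Sb1 Sb2 if1 Lf1 if2 Lf2 cg2 lg2 g2_0 (Lq1' t) (Lq2' t).
have du1 : has_deriv nm [set t | 0 <= t] u1 v1 := displ_deriv f1 Sb1 Lq1' Lc1 dq1.
have du2 : has_deriv nm [set t | 0 <= t] u2 v2 := displ_deriv f2 Sb2 Lq2' Lc2 dq2.
have dv1 : has_deriv nm [set t | 0 <= t] v1 (accel b1 w1) := Bop_deriv Sb1 Lc1 (fun t => L2_N (Bop_L2 Sb1 (Lw1 t))) dc1.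
have dv2 : has_deriv nm [set t | 0 <= t] v2 (accel b2 w2) := Bop_deriv Sb2 Lc2 (fun t => L2_N (Bop_L2 Sb2 (Lw2 t))) dc2.
have u10 : u1 0 = cont_repr phi1 by rewrite /u1 q10 (displ0 f1 Sb1).
have u20 : u2 0 = cont_repr phi2 by rewrite /u2 q20 (displ0 f2 Sb2).
have Hu1 : HsR s (u1 0) by rewrite u10; have [] := HsR_ae Hp1 Lg1 (aeq_sym e1).
have Hu2 : HsR s (u2 0) by rewrite u20; have [] := HsR_ae Hp2 Lg2 (aeq_sym e2).
have ev1 : aeq (v1 0) psi1 by rewrite /v1 c10.
have ev2 : aeq (v2 0) psi2 by rewrite /v2 c20.
have Hv1 : HsR s (v1 0) by have [] := HsR_ae Hq1 (Lv1 0) (aeq_sym ev1).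
have Hv2 : HsR s (v2 0) by have [] := HsR_ae Hq2 (Lv2 0) (aeq_sym ev2).
(* Bounds in L^2 and in the sup norm, the input of the regularity theory. *)
have bnd T : exists C, forall t, 0 <= t <= T ->
  [/\ nm (u1 t) <= C, nm (u2 t) <= C, forall x, `|u1 t x| <= C & forall x, `|u2 t x| <= C].
  have [C hC] := qb T.
  exists (Num.max (displ_sup2 b1 b2 f1 f2 C) (Num.max (nm f1 + Num.sqrt C1 * C) (nm f2 + Num.sqrt C2 * C))) => t It.
  have [n1 n2] := hC t It.
  have [_ _ m1] := u1_nice b2 f2 Sb1 if1 Lf1 (Lq1' t) n1.
  have [_ _ m2] := u2_nice b1 f1 Sb2 if2 Lf2 (Lq2' t) n2.
  have n1' : nm (u1 t) <= nm f1 + Num.sqrt C1 * C.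
    by apply: le_trans (nm_displ Sb1 if1 Lf1 (Lq1' t)) _; rewrite lerD2l ler_wpM2l // sqrtr_ge0.
  have n2' : nm (u2 t) <= nm f2 + Num.sqrt C2 * C.
    by apply: le_trans (nm_displ Sb2 if2 Lf2 (Lq2' t)) _; rewrite lerD2l ler_wpM2l // sqrtr_ge0.
  split; rewrite ?le_max ?n1' ?n2' ?orbT //.
    by move=> x; rewrite le_max m1.
  by move=> x; rewrite le_max m2.
have fb T := force_bdd_pred Sb1 Sb2 hs g1_smooth g2_smooth g1_0 g2_0 su1 su2 Lv1 Lv2 du1 dv1 du2 dv2 Hu1 Hv1 Hu2 Hv2 bnd T.
have [fc1 fc2] := force_contH Sb1 Sb2 hs g1_smooth g2_smooth g1_0 g2_0 su1 su2 Lv1 Lv2 Lw1 Lw2 du1 dv1 du2 dv2 Hu1 Hv1 Hu2 Hv2 bnd.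
have [P1 [cu1 cv1 ca1] D1 D1'] := Hs_solution Sb1 s0 Lu1 Lv1 Lw1 du1 dv1 Hu1 Hv1 (fun T => (fb T).1) fc1.
have [P2 [cu2 cv2 ca2] D2 D2'] := Hs_solution Sb2 s0 Lu2 Lv2 Lw2 du2 dv2 Hu2 Hv2 (fun T => (fb T).2) fc2.
have wave beta C r g t (u : R -> R) (hi : (@lebesgue_measure R).-integrable setT (EFin \o beta)) (hr : 3 < r) (hC : 0 < C)
   (hh : forall xi : R, 0 <= fourier beta xi <= (C * (1 + xi ^+ 2) `^ (- r / 2))%:C) :
  0 < t -> continuous g -> spectral u -> (exists M, forall x, `|u x| <= M) -> L2p (fun x => u x + comp2 g (u1 t) (u2 t) x) ->
  derivable2 (convolution beta (fun x => u x + g (u1 t x, u2 t x))) /\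
  {ae lebesgue_measure, forall x, Bop (wave_symb beta) (fun y => - Bop (wave_symb beta) (fun x => u x + comp2 g (u1 t) (u2 t) x) y) x =
     derive1n 2 (convolution beta (fun x => u x + g (u1 t x, u2 t x))) x}.
  move=> t0 cg su [Mu hMu] Lw.
  have [C' hC'] := bnd t; have [|_ _ m1 m2] := hC' t; first by rewrite ltW ?lexx.
  have [B B0 hB] := cont_bd C' cg.
  have cw : continuous (fun x => u x + comp2 g (u1 t) (u2 t) x).
    by move=> x; apply: cvgD; [exact: spectral_cont|apply: comp2_cont => //; exact: spectral_cont].
  have wM x : `|u x + comp2 g (u1 t) (u2 t) x| <= Mu + B.
    apply: le_trans (ler_normD _ _) _; apply: lerD => //; apply: hB.
    by split; [exact: m1|exact: m2].
  have [d E] := conv_derive2 hi hr hC hh Lw cw wM.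
  by split => //; apply: ae_all => x; rewrite E.
have bM t : 0 < t -> (exists M, forall x, `|u1 t x| <= M) /\ (exists M, forall x, `|u2 t x| <= M).
  move=> t0; have [C' hC'] := bnd t; have [|_ _ m1 m2] := hC' t; first by rewrite ltW ?lexx.
  by split; exists C'.
exists u1, u2; exists v1, v2, (accel b1 w1), (accel b2 w2); split.
- split; split.
  + by apply: to_continuous_Hs => // t /P1[].
  + by apply: to_continuous_Hs => // t /P1[].
  + by apply: to_continuous_Hs => // t /P1[].
  + exact: to_is_derive_Hs.
  + exact: to_is_derive_Hs.
  + by apply: to_continuous_Hs => // t /P2[].
  + by apply: to_continuous_Hs => // t /P2[].
  + by apply: to_continuous_Hs => // t /P2[].
  + exact: to_is_derive_Hs.
  + exact: to_is_derive_Hs.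
- by move=> t t0; apply: (wave _ _ _ g1 t (u1 t) beta1_int hr1 hC1 beta1_hat t0 cg1 (su1 t) (bM t t0).1 (Lw1 t)).
- by move=> t t0; apply: (wave _ _ _ g2 t (u2 t) beta2_int hr2 hC2 beta2_hat t0 cg2 (su2 t) (bM t t0).2 (Lw2 t)).
- by rewrite u10 u20.
- by split.
Qed.
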